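(* Let $R>0$, let $b$ satisfy $bR^2\in(0,4-2\sqrt3)$, and let $p>p_\star(bR^2)$. Then there exists $r_\star=r_\star(b,p,R)\in(0,R)$, depending only on $b,p,R$, such that the following holds. Let $\Omega\subset\mathbb R^2$ be a bounded $C^\infty$-smooth domain, star-shaped with respect to the origin, given in polar coordinates by $\Omega=\{(r,\theta):r<\rho(\theta)\}$ with a $C^\infty$-smooth $2\pi$-periodic function $\rho:\mathbb R\to(0,\infty)$. If $\mathcal I_p(\Omega^{\mathrm{ext}})=\mathcal I_p(\mathcal B_R^{\mathrm{ext}})$ and $R-r_\star\le\rho\le R+r_\star$, then $$\lambda_1(b,\Omega^{\mathrm{ext}})\le\lambda_1(b,\mathcal B_R^{\mathrm{ext}}).$$
   Context: $p_\star(b):=2+\dfrac{16b-4b^2}{4-8b+b^2}$. $\mathcal B_R=\{x\in\mathbb R^2:|x|<R\}$ and $\Omega^{\mathrm{ext}}=\mathbb R^2\setminus\overline\Omega$. For $p>2$ and $0\in\Omega$, the $p$-th moment is $\mathcal I_p(\Omega^{\mathrm{ext}})=\int_{\Omega^{\mathrm{ext}}}|x|^{-p}\,\mathrm dx$. Let $\mathbf A(x)=\frac12(-x_2,x_1)^\top$ and, for $b>0$, $H^1_{\mathbf A}(\Omega^{\mathrm{ext}})=\{u\in L^2(\Omega^{\mathrm{ext}}):(-\mathrm i\nabla-b\mathbf A)u\in [L^2(\Omega^{\mathrm{ext}})]^2\}$. The lowest eigenvalue of the magnetic Neumann Laplacian $(-\mathrm i\nabla-b\mathbf A)^2$ in $L^2(\Omega^{\mathrm{ext}})$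 is $\lambda_1(b,\Omega^{\mathrm{ext}})=\inf_{u\in H^1_{\mathbf A}(\Omega^{\mathrm{ext}})\setminus\{0\}}\int_{\Omega^{\mathrm{ext}}}|(-\mathrm i\nabla-b\mathbf A)u|^2\,\mathrm dx\,/\,\|u\|^2_{L^2(\Omega^{\mathrm{ext}})}$. *)

(* Defs.v *)
From HB Require Import structures.
From mathcomp Require Import all_boot all_order all_algebra.
From mathcomp Require Import complex.
From mathcomp Require Import all_classical all_reals all_analysis.

Set Implicit Arguments.
Unset Strict Implicit.
Unset Printing Implicit Defensive.

Import Order.TTheory GRing.Theory Num.Theory.
Import numFieldNormedType.Exports.

Local Open Scope classical_set_scope.
Local Open Scope ring_scope.
Local Open Scope complex_scope.

Section Plane.
Variable R : realType.
Implicit Types (x y : R * R) (U Om : set (R * R)) (phi : R * R -> R).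
Implicit Types (u v : R * R -> R[i]).

(* The library norm on [R * R] is the sup norm; this is the Euclidean one. *)
Definition enorm x : R := Num.sqrt (x.1 ^+ 2 + x.2 ^+ 2).

Definition disk (r : R) : set (R * R) := [set x | enorm x < r].

Definition exterior Om : set (R * R) := ~` closure Om.

Local Notation leb2 := (@lebesgue_measure R \x @lebesgue_measure R)%E.

Definition moment (p : R) U : \bar R :=
  (\int[leb2]_(x in U) ((enorm x) `^ (- p))%:E)%E.

Definition pd1 phi : R * R -> R := fun x => 'D_((1, 0) : R * R) phi x.
Definition pd2 phi : R * R -> R := fun x => 'D_((0, 1) : R * R) phi x.

(* The iterated partial derivative whose successive directions are given by a
   word in the alphabet {false, true} = {x_1, x_2}. *)
Definition pds (w : seq bool) phi : R * R -> R :=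
  foldr (fun (j : bool) g => if j then pd2 g else pd1 g) phi w.

Definition smooth2 phi : Prop := forall w x,
  [/\ {for x, continuous (pds w phi)},
      derivable (pds w phi) x ((1, 0) : R * R) &
      derivable (pds w phi) x ((0, 1) : R * R)].

Definition smooth1 (f : R -> R) : Prop := forall n t, derivable (derive1n n f) t 1.

Definition test_function U phi : Prop :=
  [/\ smooth2 phi, compact (closure [set x | phi x != 0]) &
      closure [set x | phi x != 0] `<=` U].

Definition normsq (z : R[i]) : R := complex.Re z ^+ 2 + complex.Im z ^+ 2.

Definition cintegral U u : R[i] :=
  (\int[leb2]_(x in U) complex.Re (u x))
  +i* (\int[leb2]_(x in U) complex.Im (u x)).

Definition L2 U u : Prop :=
  [/\ measurable_fun U (fun x => complex.Re (u x)),
      measurable_fun U (fun x => complex.Im (u x)) &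
      (\int[leb2]_(x in U) (normsq (u x))%:E < +oo)%E].

Definition A1 x : R := - x.2 / 2.
Definition A2 x : R := x.1 / 2.

(* (v1, v2) = (-i grad - b A) u in the sense of distributions on U, the
   derivatives having been moved to the (real) test function. *)
Definition mag_grad (b : R) U u v1 v2 : Prop :=
  forall phi, test_function U phi ->
    cintegral U (fun x =>
      u x * ('i%C * (pd1 phi x)%:C - (b * A1 x * phi x)%:C))
    = cintegral U (fun x => v1 x * (phi x)%:C)
    /\
    cintegral U (fun x =>
      u x * ('i%C * (pd2 phi x)%:C - (b * A2 x * phi x)%:C))
    = cintegral U (fun x => v2 x * (phi x)%:C).

(* u is in H^1_A(U) and its magnetic gradient is represented by (v1, v2). *)
Definition H1A (b : R) U u v1 v2 : Prop :=
  [/\ L2 U u, L2 U v1, L2 U v2 & mag_grad b U u v1 v2].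

Definition nonzero_on U u : Prop :=
  ~ {ae leb2, forall x, U x -> u x = 0}.

(* The magnetic gradient is unique up to a null set, so the quotient depends
   on u only. *)
Definition lambda1 (b : R) U : \bar R :=
  ereal_inf [set q | exists u v1 v2,
    [/\ H1A b U u v1 v2, nonzero_on U u &
      q = ((\int[leb2]_(x in U) (normsq (v1 x) + normsq (v2 x)))
           / (\int[leb2]_(x in U) normsq (u x)))%:E]].

Definition domain Om : Prop := [/\ open Om, connected Om & Om !=set0].

(* Near each boundary point, Om is the sublevel set of a smooth function with
   nonvanishing gradient. *)
Definition smooth_boundary Om : Prop :=
  forall x, (closure Om `\` interior Om) x ->
    exists (V : set (R * R)) (F : R * R -> R),
      [/\ open V, V x, smooth2 F,
          (forall y, V y -> (Om y <-> F y < 0)) &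
          (pd1 F x, pd2 F x) <> (0, 0)].

Definition star_shaped0 Om : Prop :=
  forall x (t : R), Om x -> 0 <= t <= 1 -> Om (t * x.1, t * x.2).

Definition polar_region (rho : R -> R) : set (R * R) :=
  [set x | exists r t : R,
    [/\ 0 <= r, r < rho t & x = (r * cos t, r * sin t)]].

Definition pstar (b : R) : R :=
  2 + (16 * b - 4 * b ^+ 2) / (4 - 8 * b + b ^+ 2).

End Plane.

(* Main.v *)
Require Import Defs.
From HB Require Import structures.
From mathcomp Require Import all_boot all_order all_algebra.
From mathcomp Require Import complex.
From mathcomp Require Import all_classical all_reals all_analysis.
From mathcomp Require Import measurable_realfun.
From mathcomp Require Import ring lra zify.
Set Implicit Arguments.
Unset Strict Implicit.
Unset Printing Implicit Defensive.
Import Order.TTheory GRing.Theory Num.Theory.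
Import numFieldNormedType.Exports.
Local Open Scope classical_set_scope.
Local Open Scope ring_scope.

(* Let [f(r) e^(i m theta)] be a ground state on the exterior of the disk of radius
   [rad], with eigenvalue [lam] and [f'(rad) = 0]. Used as a trial function on the
   exterior of [Omega], it has energy minus [lam] times mass equal to the integral of
   the radial density [g = f^2 ((f'/f)^2 + V - lam)], with
   [V(r) = (m/r - b r/2)^2]. Over the exterior of the disk this integral vanishes.
   The condition [p > pstar] says that [r^p g(r)] is strictly increasing at [rad];
   hence [g(r) - kappa r^(-p)], with [kappa = rad^p g(rad)], is negative just inside
   and positive just outside the circle of radius [rad], and since both exteriors
   have the same [p]-th moment the integral of [g] over the exterior of [Omega] is
   at most the one over the exterior of the disk.

   That [lam] is a lower bound on the exterior of the disk is proved mode by mode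
   in the angular Fourier expansion: a solution [h] of the Riccati inequality
   [h' + h/r + h^2 <= V_n - lam] with [h(rad) <= 0] allows one to complete the
   square in the one-dimensional energy. *)

(** * Polar coordinates *)

(** The form domain only knows weak magnetic gradients, tested away from the boundary, so no
    boundary condition is prescribed on the disk: each Fourier mode is shown to be absolutely
    continuous up to the boundary, and its boundary term is discarded through the sign of [h rad].
    The radial profile is an integral of Tricomi type, for which the Neumann condition becomes a
    scalar equation in a parameter [a]. The energy is [b (1 - 2 a)], and [a > 0] puts it below [b].
    Little else is known about the minimizing mode m >= 1. With B = b rad^2, the monotonicity of r^p
    g at [rad] reads 2 (m^2 - B^2/4) < p ((m - B/2)^2 - lam rad^2). The case where m is 1 and lam
    rad^2 is replaced by B implies all the others. There the bracket on the right is (4 - 8 B +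
    B^2)/4, which is positive when B is below its smaller root 4 - 2 sqrt 3, and solving for p gives
    exactly p > 2 + (16 B - 4 B^2)/(4 - 8 B + B^2). *)

Section plane_measure.
Context {R : realType}.
Local Notation leb := (@lebesgue_measure R).
Local Notation leb2 := (@lebesgue_measure R \x @lebesgue_measure R)%E.

Lemma ball_prodE (x : R * R) (e : R) :
  ball x e = ball x.1 e `*` ball x.2 e.
Proof. by apply/seteqP; split => y. Qed.

(** The sigma-algebra of [R * R] is the product one, while openness refers to the product topology.
    The two meet because an open set is the union of the countably many balls with rational data
    that it contains, and a sup-norm ball is a product of intervals. *)
Lemma open_measurable2 (A : set (R * R)) : open A -> measurable A.
Proof.
move=> oA.
pose B (q : (rat * rat) * rat) : set (R * R) :=
  let b := ball (ratr q.1.1 : R, ratr q.1.2 : R) (ratr q.2) in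
  if `[< b `<=` A >] then b else set0.
have -> : A = \bigcup_q (B q).
  apply/seteqP; split => [x Ax|x [q _]]; last first.
    by rewrite /B; case: asboolP => //= + Bx => /(_ _ Bx).
  have /nbhs_ballP [e /= e0 eA] := open_nbhs_nbhs (conj oA Ax).
  have e30 : 0 < e / 3 by rewrite divr_gt0.
  (* A radius between e/3 and 2e/3 and a centre within e/3 of x: the ball contains x and stays
     within distance e of it. *)
  have [d] : exists q : rat, ratr q \in `](e / 3), (e / 3 *+ 2)[.
    by apply: rat_in_itvoo; rewrite mulr2n ltrDl.
  rewrite in_itv/= => /andP[d1 d2].
  have [q1] : exists q : rat, ratr q \in `](x.1 - e / 3), (x.1 + e / 3)[.
    by apply: rat_in_itvoo; rewrite ltrD2l gtrN.
  rewrite in_itv/= => /andP[q11 q12].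
  have [q2] : exists q : rat, ratr q \in `](x.2 - e / 3), (x.2 + e / 3)[.
    by apply: rat_in_itvoo; rewrite ltrD2l gtrN.
  rewrite in_itv/= => /andP[q21 q22].
  exists ((q1, q2), d) => //; rewrite /B/=.
  case: asboolP => [_|]; last first.
    case=> y; rewrite ball_prodE => -[/= y1 y2]; apply: eA.
    rewrite ball_prodE; split; rewrite /ball/= in y1 y2 *.
      rewrite ltr_norml in y1; rewrite ltr_norml.
      by move: y1 => /andP[? ?]; apply/andP; split; lra.
    rewrite ltr_norml in y2; rewrite ltr_norml.
    by move: y2 => /andP[? ?]; apply/andP; split; lra.
  by rewrite ball_prodE; split; rewrite /ball/= ltr_norml; apply/andP; split; lra.
apply: countable_bigcupT_measurable => // q; rewrite /B.
case: asboolP => // _; rewrite ball_prodE.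
by apply: measurableX; exact: measurable_ball.
Qed.

Lemma continuous_measurable_fun2 (f : R * R -> R) :
  continuous f -> measurable_fun setT f.
Proof.
move=> /continuousP cf.
apply: (measurability _ (RGenOpens.measurableE R)) => _ [_ [a [b ->] <-]].
by rewrite setTI; apply: open_measurable2; apply: cf; exact: interval_open.
Qed.

Lemma ge0_integral_mrestr (D : set (R * R)) (mD : measurable D)
    (g : R * R -> \bar R) : measurable_fun setT g -> (forall x, 0 <= g x)%E ->
  (\int[mrestr leb2 mD]_x g x = \int[leb2]_(x in D) g x)%E.
Proof.
move=> mg g0; rewrite -(setUv D) ge0_integral_setU//=; last 3 first.
- exact: measurableC.
- by apply: measurable_funTS.
- by apply/disj_setPCl.
rewrite [X in (_ + X)%E](_ : _ = 0%E) ?adde0; last first.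
  apply: null_set_integral => //; [exact: measurableC|by apply: measurable_funTS|].
  by rewrite /= /mrestr setICl measure0.
apply: eq_measure_integral => A mA AD.
by rewrite /mrestr; congr (leb2 _); apply/setIidPl.
Qed.

(* The density [w] is realised as the length of the fibres of the region
   [0 <= y < w x], so that the substitution is a push-forward of the planar
   Lebesgue measure. *)
Lemma ge0_integral_subst (J : set R) (w phi : R -> R) (F : R -> \bar R) :
  measurable J -> measurable_fun J phi -> measurable_fun J w ->
  (forall x, J x -> 0 <= w x) ->
  (forall x1 x2 : R, (x1 < x2)%R ->
    \int[leb]_(x in J `&` phi @^-1` `]x1, x2]) (w x)%:E = (x2 - x1)%:E)%E ->
  measurable_fun setT F -> (forall x, 0 <= F x)%E ->
  (\int[leb]_x F x = \int[leb]_(x in J) (F (phi x) * (w x)%:E))%E.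
Proof.
move=> mJ mphi mw w0 Hw mF F0.
pose w' := w \_ J; pose phi' := phi \_ J.
have mw' : measurable_fun setT w' by apply/(measurable_restrictT _ mJ).
have mphi' : measurable_fun setT phi' by apply/(measurable_restrictT _ mJ).
pose D : set (R * R) := [set z | 0 <= z.2] `&` [set z | z.2 < w' z.1].
have mD : measurable D.
  apply: measurableI.
    have := @measurable_fun_ler _ _ R setT (cst 0) (fun z : R * R => z.2)
      (measurable_cst _) (measurable_snd).
    by move=> /(_ measurableT [set true]); rewrite setTI; exact.
  have := @measurable_fun_ltr _ _ R setT (fun z : R * R => z.2) (w' \o fst)
      (measurable_snd) (measurableT_comp mw' measurable_fst).
  by move=> /(_ measurableT [set true]); rewrite setTI; exact.
pose psi (z : R * R) : measurableTypeR R := phi' z.1.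
have mpsi : measurable_fun setT psi by exact: (measurableT_comp mphi' measurable_fst).
have w'0 x : 0 <= w' x.
  by rewrite /w' patchE; case: ifPn => // xJ; apply: w0; exact: set_mem.
have DE x : leb (xsection D x) = (w' x)%:E.
  have -> : xsection D x = `[0, w' x[%classic.
    apply/seteqP; split=> y; rewrite /xsection/= inE /D/= in_itv/=.
      by move=> [-> ->].
    by move=> /andP[-> ->].
  rewrite lebesgue_measure_itv/= lte_fin sube0; case: ltP => // w0'.
  by apply/eqP; rewrite eqe eq_le w'0 w0'.
have key (G : R -> \bar R) : measurable_fun setT G -> (forall x, 0 <= G x)%E ->
    (\int[leb2]_(z in D) G z.1 = \int[leb]_(x in J) (G x * (w x)%:E))%E.
  move=> mG G0.
  rewrite integral_mkcond fubini_tonelli1; last 2 first.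
  - by apply/(measurable_restrictT _ mD); apply: measurable_funTS;
      apply: measurableT_comp.
  - by move=> z; rewrite patchE; case: ifP.
  rewrite [RHS]integral_mkcond; apply: eq_integral => x _.
  rewrite /fubini_F [LHS](_ : _ = \int[leb]_(y in xsection D x) cst (G x) y)%E.
    rewrite integral_cst; last exact: measurable_xsection.
    by rewrite [X in (_ * X)%E](DE x) /w' !patchE; case: ifPn => // _; rewrite mule0.
  rewrite [RHS]integral_mkcond; apply: eq_integral => y _.
  by rewrite !patchE mem_xsection.
pose nu : {measure set (measurableTypeR R) -> \bar R} :=
  pushforward (mrestr leb2 mD) psi.
(* The push-forward has the right mass on half-open intervals, and this determines Lebesgue
   measure. *)
transitivity (\int[nu mpsi]_x F x)%E.
  apply: (@eq_measure_integral _ (measurableTypeR R) R setT (nu mpsi) leb F).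
  move=> A mA _; apply: lebesgue_measure_unique => // X [[x1 x2]] /= _ <-.
  have m12 : measurable (`]x1, x2] : set R) by exact: measurable_itv.
  have mJ12 : measurable (phi' @^-1` `]x1, x2]).
    by rewrite -[X in measurable X]setTI; exact: mphi'.
  rewrite /nu/= /pushforward/= /mrestr.
  have -> : leb2 (psi @^-1` `]x1, x2] `&` D) =
      (\int[leb2]_(z in D) (\1_(phi' @^-1` `]x1, x2]) z.1)%:E)%E.
    rewrite -[RHS]/(\int[leb2]_(z in D)
      (\1_(psi @^-1` `]x1, x2]) z)%:E)%E integral_indic//.
    by rewrite -[X in measurable X]setTI; exact: mpsi.
  rewrite (key (fun x => (\1_(phi' @^-1` `]x1, x2]) x)%:E)); last 2 first.
  - by apply/measurable_EFinP; exact: measurable_indic.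
  - by move=> x; rewrite lee_fin.
  rewrite lebesgue_measure_itv/= lte_fin; have [x12|x21] := ltP x1 x2.
    rewrite -EFinB -Hw// integral_mkcondr.
    apply: eq_integral => x /set_mem Jx; rewrite patchE.
    have -> : (x \in phi @^-1` `]x1, x2]) = (x \in phi' @^-1` `]x1, x2]).
      have e : phi' x = phi x by rewrite /phi' patchE mem_set.
      by apply/idP/idP => /set_mem H; apply/mem_set; move: H; rewrite /preimage/= e.
    by rewrite indicE; case: (_ \in _); rewrite ?mul1e ?mul0e.
  rewrite [RHS]integral0_eq// => x _.
  by rewrite indicE set_itv_ge ?preimage_set0 ?in_set0 ?mul0e// bnd_simp -leNgt.
transitivity (\int[mrestr leb2 mD]_z (F \o psi) z)%E.
  have := @ge0_integral_pushforward _ _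
    (measurableTypeR R * measurableTypeR R)%type (measurableTypeR R) R psi mpsi
    (mrestr leb2 mD) setT F measurableT mF.
  by rewrite preimage_setT; apply=> x _; exact: F0.
rewrite ge0_integral_mrestr; first last.
- by move=> x; exact: F0.
- exact: (measurableT_comp mF mpsi).
rewrite [LHS](key (F \o phi')); first last.
- by move=> x; exact: F0.
- exact: (measurableT_comp mF mphi').
by apply: eq_integral => x xJ; rewrite /= /phi' patchE xJ.
Qed.

Lemma FTC2_closed (F f : R -> R) (a b : R) : a <= b ->
  (forall x, a <= x <= b -> is_derive x 1 F (f x)) ->
  {within `[a, b], continuous f} ->
  (\int[leb]_(x in `[a, b]) (f x)%:E = (F b - F a)%:E)%E.
Proof.
rewrite le_eqVlt => /predU1P[-> _ _|ab dF cf].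
  by rewrite set_itv1 integral_set1 subrr.
have cF x : a <= x <= b -> {for x, continuous F}.
  move=> /dF [dFx _].
  by apply/differentiable_continuous/derivable1_diffP.
rewrite (@continuous_FTC2 _ f F a b ab cf) ?EFinB//.
  split.
  - move=> x; rewrite in_itv/= => /andP[ax xb].
    by have [] : is_derive x 1 F (f x) by apply: dF; rewrite !ltW.
  - by apply: cvg_at_right_filter; apply: cF; rewrite lexx ltW.
  - by apply: cvg_at_left_filter; apply: cF; rewrite lexx ltW.
move=> x; rewrite in_itv/= => /andP[ax xb].
have dFx : is_derive x 1 F (f x) by apply: dF; rewrite !ltW.
by rewrite derive1E derive_val.
Qed.

Lemma ge0_integral_affine (a c : R) (F : R -> \bar R) : a != 0 ->
  measurable_fun setT F -> (forall x, 0 <= F x)%E ->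
  (\int[leb]_x F x = \int[leb]_x (F (a * x + c)%R * `|a|%R%:E))%E.
Proof.
move=> a0 mF F0.
apply: (@ge0_integral_subst setT (cst `|a|) (fun x => a * x + c)) => //.
- by apply: measurable_funD => //; exact: measurable_funM.
- move=> x1 x2 x12; rewrite setTI.
  pose y1 := (x1 - c) / a; pose y2 := (x2 - c) / a.
  have [a_gt0|a_lt0|/eqP] := ltgtP 0 a; last by rewrite eq_sym (negbTE a0).
  + have -> : (fun x => a * x + c) @^-1` `]x1, x2] = `]y1, y2]%classic.
      apply/seteqP; split => x /=; rewrite !in_itv/= /y1 /y2.
        by rewrite ltr_pdivrMr// ler_pdivlMr// ltrBlDr lerBrDr ![x * a]mulrC.
      by rewrite ltr_pdivrMr// ler_pdivlMr// ltrBlDr lerBrDr ![x * a]mulrC.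
    rewrite (integral_cst _ _ `|a|%:E)//= lebesgue_measure_itv/= lte_fin.
    have y12 : y1 < y2 by rewrite /y1 /y2 ltr_pM2r ?invr_gt0// ltrD2r.
    rewrite y12 -EFinB -EFinM gtr0_norm// /y1 /y2; congr (_%:E).
    by field; rewrite a0.
  + have -> : (fun x => a * x + c) @^-1` `]x1, x2] = `[y2, y1[%classic.
      apply/seteqP; split => x /=; rewrite !in_itv/= /y1 /y2.
        rewrite ltr_ndivlMr// ler_ndivrMr// ltrBlDr lerBrDr ![x * a]mulrC.
        by rewrite andbC.
      rewrite ltr_ndivlMr// ler_ndivrMr// ltrBlDr lerBrDr ![x * a]mulrC.
      by rewrite andbC.
    rewrite (integral_cst _ _ `|a|%:E)//= lebesgue_measure_itv/= lte_fin.
    have y12 : y2 < y1 by rewrite /y1 /y2 ltr_nM2r ?invr_lt0// ltrD2r.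
    rewrite y12 -EFinB -EFinM ltr0_norm// /y1 /y2; congr (_%:E).
    by field; rewrite a0.
Qed.

Lemma cos_neq0_pihalf (x : R) : x \in `](- (pi / 2)), (pi / 2)[ -> cos x != 0.
Proof. by rewrite in_itv/= => /cos_gt0_pihalf c0; rewrite gt_eqF. Qed.

Lemma ge0_integral_tan (F : R -> \bar R) :
  measurable_fun setT F -> (forall x, 0 <= F x)%E ->
  (\int[leb]_x F x =
   \int[leb]_(x in `](- (pi / 2))%R, (pi / 2)%R[)
     (F (tan x) * (cos x ^- 2)%:E))%E.
Proof.
move=> mF F0.
have ctan (x : R) : x \in `](- (pi / 2)), (pi / 2)[ -> {for x, continuous tan}.
  by move=> /cos_neq0_pihalf; exact: continuous_tan.
have cw (x : R) : x \in `](- (pi / 2)), (pi / 2)[ ->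
    {for x, continuous (fun x : R => cos x ^- 2)}.
  move=> /cos_neq0_pihalf c0; apply: cvgV; first by rewrite expf_neq0.
  by apply: cvgM; exact: continuous_cos.
apply: ge0_integral_subst => //.
- apply: open_continuous_measurable_fun; first exact: interval_open.
  by move=> x /set_mem; exact: ctan.
- apply: open_continuous_measurable_fun; first exact: interval_open.
  by move=> x /set_mem; exact: cw.
- by move=> x _; rewrite invr_ge0 sqr_ge0.
move=> x1 x2 x12.
have a12 : atan x1 < atan x2.
  by rewrite -ltr_tan ?atanK// in_itv/= atan_gtNpi2 atan_ltpi2.
have sub (x : R) : atan x1 <= x <= atan x2 -> x \in `](- (pi / 2)), (pi / 2)[.
  move=> /andP[h1 h2]; rewrite in_itv/=.
  by rewrite (lt_le_trans (atan_gtNpi2 _) h1) (le_lt_trans h2 (atan_ltpi2 _)).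
have -> : `](- (pi / 2)), (pi / 2)[ `&` tan @^-1` `]x1, x2] =
    `]atan x1, atan x2]%classic.
  apply/seteqP; split => [x [xJ]|x] /=; rewrite !in_itv/=.
    rewrite -{1}(atanK x1) -{1}(atanK x2) ltr_tan//; last first.
      by rewrite in_itv/= atan_gtNpi2 atan_ltpi2.
    by rewrite !leNgt ltr_tan// in_itv/= atan_gtNpi2 atan_ltpi2.
  move=> /andP[h1 h2].
  have xJ : x \in `](- (pi / 2)), (pi / 2)[ by apply: sub; rewrite ltW.
  split; first by move: xJ; rewrite in_itv.
  rewrite -{1}(atanK x1) -{1}(atanK x2) ltr_tan//; last first.
    by rewrite in_itv/= atan_gtNpi2 atan_ltpi2.
  by rewrite h1 !leNgt ltr_tan -?leNgt// in_itv/= atan_gtNpi2 atan_ltpi2.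
rewrite integral_itv_obnd_cbnd; last first.
  apply/measurable_EFinP; apply: (@measurable_funS _ _ _ _ `](- (pi / 2)), (pi / 2)[) => //.
    by move=> x /=; rewrite in_itv/= => /andP[h1 h2]; apply: sub; rewrite ltW.
  apply: open_continuous_measurable_fun; first exact: interval_open.
  by move=> x /set_mem; exact: cw.
have dtan (x : R) : atan x1 <= x <= atan x2 -> is_derive x 1 tan (cos x ^- 2).
  by move=> /sub /cos_neq0_pihalf c0; exact: is_derive_tan.
rewrite (FTC2_closed (ltW a12) dtan) ?atanK//.
apply: continuous_in_subspaceT => x /set_mem/=; rewrite in_itv/= => xa.
by apply: cw; exact: sub.
Qed.

Definition polar (z : R * R) : R * R := (z.1 * cos z.2, z.1 * sin z.2).

Lemma measurable_polar : measurable_fun setT polar.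
Proof.
apply: measurable_fun_pair; apply: measurable_funM => //.
  by apply: measurableT_comp => //; apply: continuous_measurable_fun; exact: continuous_cos.
by apply: measurableT_comp => //; apply: continuous_measurable_fun; exact: continuous_sin.
Qed.


Lemma tonelli_leb2 (F : R * R -> \bar R) :
  measurable_fun setT F -> (forall x, 0 <= F x)%E ->
  (\int[leb2]_z F z = \int[leb]_x \int[leb]_y F (x, y))%E.
Proof. by move=> mF F0; exact: fubini_tonelli1. Qed.

Lemma tonelli_leb2C (F : R * R -> \bar R) :
  measurable_fun setT F -> (forall x, 0 <= F x)%E ->
  (\int[leb]_x \int[leb]_y F (x, y) = \int[leb]_y \int[leb]_x F (x, y))%E.
Proof. by move=> mF F0; exact: fubini_tonelli. Qed.

Lemma measurable_tonelli1 (F : R * R -> \bar R) :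
  measurable_fun setT F -> (forall x, 0 <= F x)%E ->
  measurable_fun setT (fun x => \int[leb]_y F (x, y))%E.
Proof. by move=> mF F0; exact: (@measurable_fun_fubini_tonelli_F). Qed.

Lemma measurable_tonelli2 (F : R * R -> \bar R) :
  measurable_fun setT F -> (forall x, 0 <= F x)%E ->
  measurable_fun setT (fun y => \int[leb]_x F (x, y))%E.
Proof. by move=> mF F0; exact: (@measurable_fun_fubini_tonelli_G). Qed.

(** Only one-dimensional substitutions are used: y = x s on each vertical line, an exchange of the
    two integrals, s = tan t, and finally x = r cos t. The radius therefore runs over the whole real
    line and the angle over half a turn. *)
Lemma ge0_integral_halfpolar (F : R * R -> \bar R) :
  measurable_fun setT F -> (forall x, 0 <= F x)%E ->
  (\int[leb2]_z F z = \int[leb]_(t in `](- (pi / 2))%R, (pi / 2)%R[)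
     \int[leb]_r (F (polar (r, t)) * `|r|%R%:E))%E.
Proof.
move=> mF F0.
have mF1 x : measurable_fun setT (fun y => F (x, y)).
  exact: measurableT_comp mF (pair1_measurable x).
rewrite (tonelli_leb2 mF F0).
pose G (z : R * R) := (F (z.1, z.1 * z.2)%R * `|z.1|%R%:E)%E.
have mG : measurable_fun setT G.
  apply: emeasurable_funM.
    apply: measurableT_comp => //; apply: measurable_fun_pair => //.
    exact: measurable_funM.
  by apply/measurable_EFinP; apply: measurableT_comp.
have G0 z : (0 <= G z)%E by rewrite mule_ge0// lee_fin.
transitivity (\int[leb]_x \int[leb]_t G (x, t))%E.
  apply: ae_eq_integral => //.
  - exact: measurable_tonelli1.
  - exact: measurable_tonelli1.
  (* The substitution y = x s degenerates on the line x = 0, a null set of abscissas. *)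
  exists [set 0]; split => //; first exact: lebesgue_measure_set1.
  move=> x /= /not_implyP[_ H]; apply/eqP/negPn/negP => x0; apply: H.
  rewrite (ge0_integral_affine 0 x0 (mF1 x))//.
  by apply: eq_integral => t _; rewrite addr0.
rewrite (tonelli_leb2C mG G0).
rewrite (ge0_integral_tan (measurable_tonelli2 mG G0)); last first.
  by move=> x; exact: integral_ge0.
apply: eq_integral => t /set_mem tJ.
have c0 : 0 < cos t by apply: cos_gt0_pihalf; move: tJ; rewrite /= in_itv.
have mGt : measurable_fun setT (fun x => G (x, tan t)).
  exact: measurableT_comp mG (pair2_measurable (tan t)).
rewrite (@ge0_integral_affine (cos t) 0 (fun x => G (x, tan t)) (lt0r_neq0 c0) mGt); last first.
  by move=> x; exact: G0.
rewrite muleC -ge0_integralZl; first last.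
- by rewrite lee_fin invr_ge0 sqr_ge0.
- by move=> x _; apply: mule_ge0; [exact: G0|rewrite lee_fin].
- apply: emeasurable_funM; last exact: measurable_cst.
  apply: (measurableT_comp mGt); apply: measurable_funD => //.
- exact: measurableT.
apply: eq_integral => r _; rewrite /G/polar/= addr0.
rewrite (_ : cos t * r * tan t = r * sin t); last first.
  by rewrite /tan; field; rewrite gt_eqF.
rewrite (mulrC (cos t)) muleC -!muleA; congr (_ * _)%E.
rewrite -!EFinM; congr (_%:E); rewrite normrM (gtr0_norm c0).
by field; rewrite gt_eqF.
Qed.

Lemma measurable_fun_halfpolar (F : R * R -> \bar R) :
  measurable_fun setT F ->
  measurable_fun setT (fun z => F (polar z) * `|z.1|%R%:E)%E.
Proof.
move=> mF; apply: emeasurable_funM.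
  exact: measurableT_comp mF measurable_polar.
by apply/measurable_EFinP; apply: measurableT_comp.
Qed.

(** The half turn on which [tan] is inverted, followed by its translate by pi; half-open, so that
    each direction occurs exactly once. *)
Definition circle : set R := `](- (pi / 2)), (pi / 2 + pi)]%classic.

Lemma measurable_circle : measurable circle. Proof. exact: measurable_itv. Qed.

Lemma measurable_restr (D : set R) (f : R -> \bar R) :
  measurable D -> measurable_fun setT f -> measurable_fun setT (f \_ D).
Proof.
move=> mD mf; apply/(measurable_restrictT f mD).
exact: (measurable_funS measurableT (@subsetT _ D) mf).
Qed.

Lemma ge0_integral_evenodd (K : R -> \bar R) :
  measurable_fun setT K -> (forall x, 0 <= K x)%E ->
  (\int[leb]_r K r = \int[leb]_(r in `]0%R, +oo[) K r +
    \int[leb]_(r in `]0%R, +oo[) K (- r)%R)%E.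
Proof.
move=> mK K0.
transitivity (\int[leb]_(r in `]0%R, +oo[ `|` `]-oo, 0%R]) K r)%E.
  congr (integral _ _ _); apply/seteqP; split => // r _ /=.
  by rewrite !in_itv/= andbT; case: ltP => _; [left|right].
rewrite ge0_integral_setU; first last.
- apply/disj_setPLR => r /=; rewrite !in_itv/= andbT => r0 /(lt_le_trans r0).
  by rewrite ltxx.
- by move=> r _.
- exact: measurable_funTS.
- exact: measurable_itv.
- exact: measurable_itv.
congr (_ + _)%E; rewrite -integral_itv_bndo_bndc; last exact: measurable_funTS.
rewrite integral_mkcond (@ge0_integral_affine (-1) 0); first last.
- by move=> r; rewrite patchE; case: ifP.
- by apply: measurable_restr.
- by rewrite oppr_eq0 oner_eq0.
rewrite [RHS]integral_mkcond; apply: eq_integral => r _.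
rewrite !patchE normrN1 mule1 mulN1r addr0 !mem_setE !in_itv/= andbT.
by rewrite oppr_lt0.
Qed.

(** A negative radius at angle t is a positive radius at angle t + pi; this turns the signed radii
    of [ge0_integral_halfpolar] into a full turn of angles. *)
Lemma ge0_integral_polar (F : R * R -> \bar R) :
  measurable_fun setT F -> (forall x, 0 <= F x)%E ->
  (\int[leb2]_z F z = \int[leb]_(r in `]0%R, +oo[)
     (r%:E * \int[leb]_(t in circle) F (polar (r, t))))%E.
Proof.
move=> mF F0; rewrite ge0_integral_halfpolar//.
pose G z := (F (polar z) * `|z.1|%R%:E)%E.
have mG : measurable_fun setT G by exact: measurable_fun_halfpolar.
have G0 z : (0 <= G z)%E by rewrite mule_ge0// lee_fin.
have mGr (r : R) : measurable_fun setT (fun t => G (r, t)).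
  exact: measurableT_comp mG (pair1_measurable r).
have mGt (t : R) : measurable_fun setT (fun r => G (r, t)).
  exact: measurableT_comp mG (pair2_measurable t).
pose J : set R := `](- (pi / 2)), (pi / 2)[%classic.
have mJ : measurable J by exact: measurable_itv.
pose H (z : R * R) := (G z * (\1_J z.2)%:E)%E.
have mH : measurable_fun setT H.
  apply: emeasurable_funM => //; apply/measurable_EFinP.
  exact: (measurableT_comp (measurable_indic mJ)).
have H0 z : (0 <= H z)%E by rewrite mule_ge0// lee_fin.
transitivity (\int[leb]_t \int[leb]_r H (r, t))%E.
  rewrite integral_mkcond; apply: eq_integral => t _.
  rewrite patchE /H/= indicE; case: ifP => _.
    by apply: eq_integral => r _; rewrite mule1.
  by rewrite integral0_eq// => r _; rewrite mule0.
rewrite -(tonelli_leb2C mH H0).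
pose K r := (\int[leb]_t H (r, t))%E.
have mK : measurable_fun setT K by exact: measurable_tonelli1.
have K0 r : (0 <= K r)%E by exact: integral_ge0.
have KE r : K r = (\int[leb]_(t in J) G (r, t))%E.
  rewrite [RHS]integral_mkcond; apply: eq_integral => t _.
  by rewrite patchE /H/= indicE; case: ifP; rewrite ?mule1 ?mule0.
rewrite -[LHS]/(\int[leb]_r K r)%E.
rewrite (ge0_integral_evenodd mK K0).
have mS (D : set R) (f : R -> \bar R) : measurable_fun setT f -> measurable_fun D f.
  by move=> mf; exact: (measurable_funS measurableT (@subsetT _ D) mf).
rewrite -ge0_integralD; first last.
- apply: mS; exact: (measurableT_comp mK).
- by move=> r _; exact: K0.
- exact: mS.
- by move=> r _; exact: K0.
- exact: measurable_itv.
apply: eq_integral => r /set_mem/=; rewrite in_itv/= andbT => r0.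
rewrite !KE.
have -> : circle = J `|` `[(pi / 2), (pi / 2 + pi)]%classic.
  apply/seteqP; split => t; rewrite /circle /J/= !in_itv/=.
    by case: (ltP t (pi / 2)) => [_ /andP[-> _]|_ /andP[_ ->]]; [left|right].
  have := pihalf_ge1 R; have := pi_gt0 R => p0 p1.
  by move=> [/andP[t1 t2]|/andP[t1 t2]]; apply/andP; split; lra.
have mFr (r' : R) : measurable_fun setT (fun t => F (polar (r', t))).
  exact: measurableT_comp mF (measurableT_comp measurable_polar (pair1_measurable r')).
rewrite ge0_integral_setU; first last.
- apply/disj_setPLR => t; rewrite /J/= !in_itv/= => /andP[_ t2] /andP[t3 _].
  by move: t2; rewrite ltNge t3.
- by move=> t _; exact: F0.
- exact: mS.
- exact: measurable_itv.
- exact: mJ.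
rewrite ge0_muleDr; [|by apply: integral_ge0 => ? _; exact: F0..].
congr (_ + _)%E.
  rewrite -ge0_integralZl; first last.
  - by rewrite lee_fin ltW.
  - by move=> t _; exact: F0.
  - exact: mS.
  - exact: mJ.
  by apply: eq_integral => t _; rewrite /G/= gtr0_norm// muleC.
rewrite [in RHS]integral_itv_bndoo; last exact: mS.
rewrite integral_mkcond [in RHS]integral_mkcond.
rewrite [in RHS](@ge0_integral_affine 1 pi) ?oner_eq0//; last 2 first.
- by apply: measurable_restr.
- by move=> t; rewrite patchE; case: ifP.
rewrite -ge0_integralZl; first last.
- by rewrite lee_fin ltW.
- by move=> t _; apply: mule_ge0; [rewrite patchE; case: ifP|rewrite lee_fin].
- apply: emeasurable_funM; last exact: measurable_cst.
  apply: (measurableT_comp (measurable_restr _ (mFr r))) => //.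
  by apply: measurable_funD => //; exact: measurable_funM.
- exact: measurableT.
apply: eq_integral => t _; rewrite !patchE normr1 mule1 mul1r.
have -> : (t + pi \in `](pi / 2), (pi / 2 + pi)[%classic) = (t \in J).
  rewrite !mem_setE /J !in_itv/= ltrD2r; congr (_ && _).
  by apply/idP/idP; lra.
case: ifPn => [_|_]; last by rewrite mule0.
rewrite /G/= normrN gtr0_norm// muleC /polar/=.
by rewrite [cos (t + pi)]cosDpi [sin (t + pi)]sinDpi !mulrN !mulNr.
Qed.

End plane_measure.

(** * Integrable and absolutely continuous functions *)

Section integrable_functions.
Context d (T : measurableType d) (R : realType) (mu : {measure set T -> \bar R}).
Variable D : set T.
Implicit Types f g h : T -> R.
Hypothesis mD : measurable D.

Definition L1 (f : T -> R) := mu.-integrable D (EFin \o f).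

Lemma L1_meas f : L1 f -> measurable_fun D f.
Proof. by move=> /measurable_int /measurable_EFinP. Qed.

Lemma L1D f g : L1 f -> L1 g -> L1 (fun x => f x + g x).
Proof.
rewrite /L1 => hf hg; have -> : EFin \o (fun x => f x + g x) =
    ((EFin \o f) \+ (EFin \o g))%E by apply/funext => x /=; rewrite EFinD.
exact: integrableD.
Qed.

Lemma L1Z c f : L1 f -> L1 (fun x => c * f x).
Proof.
rewrite /L1 => hf; have -> : EFin \o (fun x => c * f x) =
    (fun x => c%:E * (EFin \o f) x)%E by apply/funext => x /=; rewrite EFinM.
exact: integrableZl.
Qed.

Lemma L1N f : L1 f -> L1 (fun x => - f x).
Proof.
by move=> /(L1Z (-1)); rewrite /L1; under eq_fun do rewrite mulN1r.
Qed.

Lemma L1B f g : L1 f -> L1 g -> L1 (fun x => f x - g x).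
Proof. by move=> hf hg; apply: L1D => //; exact: L1N. Qed.

Lemma L1_le f g : measurable_fun D f -> (forall x, D x -> `|f x| <= g x) ->
  L1 g -> L1 f.
Proof.
move=> mf fg; apply: le_integrable => //; first exact/measurable_EFinP.
move=> x Dx /=; rewrite lee_fin (le_trans (fg _ Dx))//.
by rewrite ler_norm.
Qed.

Lemma L1_Mbnd h f M : measurable_fun D h -> (forall x, D x -> `|h x| <= M) ->
  L1 f -> L1 (fun x => h x * f x).
Proof.
move=> mh hM Lf; apply: (@L1_le _ (fun x => M * `|f x|)).
- by apply: measurable_funM => //; exact: L1_meas.
- by move=> x Dx; rewrite normrM ler_wpM2r// hM.
- apply: L1Z; have := integrable_abse Lf.
  by apply: eq_integrable.
Qed.

Lemma L1_eq f g : (forall x, D x -> f x = g x) -> L1 f -> L1 g.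
Proof.
move=> fg; apply: eq_integrable => // x /set_mem Dx /=.
by rewrite fg.
Qed.

Lemma Rint_eq f g : (forall x, D x -> f x = g x) ->
  \int[mu]_(x in D) f x = \int[mu]_(x in D) g x.
Proof. by move=> fg; apply: eq_Rintegral => x /set_mem; exact: fg. Qed.

Lemma EFin_Rint f : L1 f ->
  (\int[mu]_(x in D) f x)%:E = (\int[mu]_(x in D) (f x)%:E)%E.
Proof. by move=> Lf; rewrite fineK//; exact: integrable_fin_num. Qed.

Lemma L1_ge0P f : measurable_fun D f -> (forall x, D x -> 0 <= f x) ->
  L1 f <-> (\int[mu]_(x in D) (f x)%:E < +oo)%E.
Proof.
move=> mf f0; have e : (\int[mu]_(x in D) `|(f x)%:E| =
    \int[mu]_(x in D) (f x)%:E)%E.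
  by apply: eq_integral => x /set_mem Dx /=; rewrite ger0_norm// f0.
split; first by case/integrableP => _ /=; rewrite e.
by move=> h; apply/integrableP; split; [exact/measurable_EFinP|rewrite /= e].
Qed.

End integrable_functions.

Lemma L1S d (T : measurableType d) (R : realType) (mu : {measure set T -> \bar R})
    (D E : set T) (f : T -> R) : measurable D -> measurable E -> E `<=` D ->
  L1 mu D f -> L1 mu E f.
Proof. by move=> mD mE ED; exact: integrableS. Qed.

(** * Absolutely continuous functions and integration by parts *)

Section abs_continuous.
Context {R : realType}.
Local Notation leb := (@lebesgue_measure R).
Local Notation leb2 := (@lebesgue_measure R \x @lebesgue_measure R)%E.
Implicit Types (f g F G : R -> R) (a b c x : R).

Lemma le_abs_fine (x : \bar R) : (`|fine x|%:E <= `|x|)%E.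
Proof. by case: x => [r| |] /=; rewrite ?normr0 ?leey. Qed.

(** The inner real integral takes a finite value even on slices that are not integrable; these form
    a null set, so the outer integral does not see them. *)
Lemma Rfubini (h : R * R -> R) : L1 leb2 setT h ->
  \int[leb2]_z h z = \int[leb]_x \int[leb]_y h (x, y) /\
  L1 leb setT (fun x => \int[leb]_y h (x, y)).
Proof.
move=> Lh; have iF := integrable_fubini_F Lh.
have mF := measurable_int _ iF.
have Lr : L1 leb setT (fun x => \int[leb]_y h (x, y)).
  apply: le_integrable iF => //.
    by apply/measurable_EFinP; apply: measurableT_comp mF.
  by move=> x _; exact: le_abs_fine.
split => //; rewrite {1}/Rintegral -(integral12_prod_meas1 Lh) /Rintegral.
congr fine; apply: ae_eq_integral => //; first by have /measurable_int := Lr.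
apply: filterS (ae_integrable1 Lh) => x Lx _.
by rewrite fineK//; exact: integrable_fin_num.
Qed.

Lemma Rfubini_sym (h : R * R -> R) : L1 leb2 setT h ->
  \int[leb2]_z h z = \int[leb]_y \int[leb]_x h (x, y) /\
  L1 leb setT (fun y => \int[leb]_x h (x, y)).
Proof.
move=> Lh; pose k (z : R * R) := h (z.2, z.1).
have mh := L1_meas Lh.
have mk : measurable_fun setT k.
  by apply: (measurableT_comp mh); exact: measurable_fun_pair.
have Lk : L1 leb2 setT k.
  apply/integrable12ltyP; first exact/measurable_EFinP.
  exact: (integrable21ltyP leb leb ((measurable_EFinP _ _).2 mh)).1 Lh.
have [kE Lk1] := Rfubini Lk; split; last exact: Lk1.
rewrite -[RHS]kE /Rintegral; congr fine.
by rewrite -(integral21_prod_meas1 Lh) -(integral12_prod_meas1 Lk).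
Qed.

Lemma L1_restrict (D : set R) f : measurable D -> L1 leb D f <-> L1 leb setT (f \_ D).
Proof.
move=> mD; rewrite /L1; split.
  move=> h; rewrite -restrict_EFin.
  by apply/integrable_restrict => //; rewrite setTI.
by rewrite -restrict_EFin => /integrable_restrict; rewrite setTI; exact.
Qed.

Lemma L1T_restrict (D : set R) f : measurable D -> L1 leb setT f ->
  L1 leb setT (f \_ D).
Proof. by move=> mD Lf; apply/(L1_restrict f mD); apply: (L1S _ _ _ Lf). Qed.

Lemma L1_continuous f a b : {within `[a, b], continuous f} -> L1 leb `[a, b] f.
Proof.
by move=> cf; apply: continuous_compact_integrable => //; exact: segment_compact.
Qed.

(* Fubini on the two triangles below and above the diagonal. *)
Lemma Rintegral_triangles f g : L1 leb setT f -> L1 leb setT g ->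
  \int[leb]_x (f x * \int[leb]_(y in `]-oo, x]) g y) +
  \int[leb]_y (g y * \int[leb]_(x in `]-oo, y]) f x) =
  (\int[leb]_x f x) * (\int[leb]_y g y).
Proof.
move=> Lf Lg.
pose h (z : R * R) := f z.1 * g z.2.
pose A : set (R * R) := [set z | z.2 <= z.1].
have mA : measurable A.
  have := @measurable_fun_ler _ _ R setT snd fst (@measurable_snd _ _ R R) measurable_fst.
  by move=> /(_ measurableT [set true]); rewrite setTI; exact.
have mf := L1_meas Lf; have mg := L1_meas Lg.
have mh : measurable_fun setT h.
  by apply: measurable_funM;
    [exact: (measurableT_comp mf measurable_fst)|exact: (measurableT_comp mg measurable_snd)].
have Lh : L1 leb2 setT h.
  apply/integrable12ltyP; first exact/measurable_EFinP.
  apply: (@le_lt_trans _ _ (\int[leb]_x (`|f x|%:E * \int[leb]_y `|(g y)%:E|))%E).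
    rewrite le_eqVlt; apply/orP; left; apply/eqP.
    apply: eq_integral => x _; rewrite -ge0_integralZl//; last first.
      by apply/measurable_EFinP; exact: measurableT_comp.
    by apply: eq_integral => y _; rewrite /h/= normrM EFinM.
  have /integrableP[_ Lf'] := Lf; have /integrableP[_ Lg'] := Lg.
  rewrite ge0_integralZr//.
  - by rewrite lte_mul_pinfty// ?ge0_fin_numE// integral_ge0.
  - by apply/measurable_EFinP; exact: measurableT_comp.
  - exact: integral_ge0.
pose h1 := fun z => \1_A z * h z; pose h2 := fun z => \1_(~` A) z * h z.
have i1 (B : set (R * R)) z : `|\1_B z : R| <= 1.
  by rewrite indicE; case: (_ \in _); rewrite ?normr1 ?normr0.
have L1h : L1 leb2 setT h1 by apply: L1_Mbnd Lh => //; exact: measurable_indic.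
have L2h : L1 leb2 setT h2.
  by apply: L1_Mbnd Lh => //; apply: measurable_indic; exact: measurableC.
have -> : (\int[leb]_x f x) * (\int[leb]_y g y) = \int[leb2]_z h z.
  rewrite (Rfubini Lh).1 -RintegralZr//.
  by apply: Rint_eq => x _; rewrite -RintegralZl.
have -> : \int[leb2]_z h z = \int[leb2]_z h1 z + \int[leb2]_z h2 z.
  rewrite -RintegralD//; apply: Rint_eq => z _; rewrite /h1 /h2 !indicE in_setC.
  by case: (_ \in _); rewrite ?mul1r ?mul0r ?addr0 ?add0r.
rewrite (Rfubini L1h).1 (Rfubini_sym L2h).1; congr (_ + _).
  apply: Rint_eq => x _; rewrite Rintegral_mkcond -RintegralZl//; last first.
    exact: L1T_restrict.
  apply: Rint_eq => y _; rewrite patchE /h1 indicE /h mem_setE in_itv/=.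
  have -> : ((x, y) \in A) = (y <= x) by apply/idP/idP => [/set_mem|?]//; apply/mem_set.
  by case: (y <= x); rewrite ?mul1r ?mul0r ?mulr0.
apply: Rint_eq => y _.
rewrite -Rintegral_itv_bndo_bndc; last exact: (L1S _ _ _ Lf).
rewrite Rintegral_mkcond -RintegralZl//; last first.
  exact: L1T_restrict.
apply: Rint_eq => x _; rewrite patchE /h2 indicE /h mem_setE in_itv/= in_setC.
have -> : ((x, y) \in A) = (y <= x) by apply/idP/idP => [/set_mem|?]//; apply/mem_set.
by case: ltP; rewrite ?mul1r ?mul0r ?mulr0 ?[g _ * _]mulrC.
Qed.

(** Absolute continuity is encoded by the integral formula: this is what a weak derivative yields
    and what integration by parts consumes. The derivative [f] is meaningful only up to a null
    set. *)
Definition AC a b F f := L1 leb `[a, b] f /\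
  forall x, a <= x <= b -> F x = F a + \int[leb]_(t in `[a, x]) f t.

Lemma AC_sub a b c F f : c <= b -> AC a b F f -> AC a c F f.
Proof.
move=> cb [Lf FE]; split; last first.
  by move=> x /andP[ax xc]; apply: FE; rewrite ax (le_trans xc).
apply: L1S Lf; [exact: measurable_itv|exact: measurable_itv|].
by apply: subset_itvl; rewrite bnd_simp.
Qed.

Lemma AC_continuous a b F f : a <= b -> AC a b F f ->
  {within `[a, b], continuous F}.
Proof.
move=> ab [Lf FE].
apply: (@subspace_eq_continuous _ `[a, b] _
  (fun x => F a + parameterized_integral leb a x f)).
  by move=> x /set_mem/=; rewrite in_itv/= => /FE /esym.
have := parameterized_integral_continuous ab Lf.
move=> h x; apply: cvgD; first exact: cvg_cst.
exact: h.
Qed.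

Lemma AC_bounded a b F f : a <= b -> AC a b F f ->
  exists M : R, forall x, a <= x <= b -> `|F x| <= M.
Proof.
move=> ab ACF; have cF := AC_continuous ab ACF.
have [M [_ HM]] := compact_bounded (continuous_compact cF (@segment_compact _ a b)).
exists (M + 1) => x xab; apply: (HM (M + 1)); first by rewrite ltrDl.
by exists x => //=; rewrite in_itv.
Qed.

Lemma AC_meas a b F f : a <= b -> AC a b F f -> measurable_fun `[a, b] F.
Proof.
move=> ab ACF; apply: subspace_continuous_measurable_fun => //.
exact: AC_continuous ACF.
Qed.

Lemma AC_end a b F f : a <= b -> AC a b F f ->
  \int[leb]_(t in `[a, b]) f t = F b - F a.
Proof. by move=> ab [_ /(_ b)]; rewrite ab lexx => -> //; rewrite addrC addKr. Qed.

(** The product rule without pointwise derivatives: the square with side [a, c] is cut along its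
    diagonal by [Rintegral_triangles], applied to [f] and [g] cut off to [a, c]. *)
Lemma AC_mul a b F G f g : a <= b -> AC a b F f -> AC a b G g ->
  AC a b (fun x => F x * G x) (fun x => f x * G x + F x * g x).
Proof.
move=> ab ACF ACG.
have [MF HF] := AC_bounded ab ACF; have [MG HG] := AC_bounded ab ACG.
have mF := AC_meas ab ACF; have mG := AC_meas ab ACG.
case: (ACF) => Lf FE; case: (ACG) => Lg GE.
have L1fG : L1 leb `[a, b] (fun x => f x * G x).
  have : L1 leb `[a, b] (fun x => G x * f x).
    by apply: (@L1_Mbnd _ (measurableTypeR R) R leb `[a, b] (measurable_itv _) G f MG) => // x /=; rewrite in_itv/=; exact: HG.
  by apply: L1_eq => // x _; rewrite mulrC.
have L1Fg : L1 leb `[a, b] (fun x => F x * g x).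
  by apply: (@L1_Mbnd _ (measurableTypeR R) R leb `[a, b] (measurable_itv _) F g MF) => // x /=; rewrite in_itv/=; exact: HF.
split; first exact: L1D.
move=> c /andP[ac cb].
have sub : `[a, c] `<=` `[a, b] by apply: subset_itvl; rewrite bnd_simp.
have Lfc : L1 leb `[a, c] f by apply: L1S Lf.
have Lgc : L1 leb `[a, c] g by apply: L1S Lg.
pose f' := f \_ `[a, c]; pose g' := g \_ `[a, c].
have Lf' : L1 leb setT f' by apply/(L1_restrict f (measurable_itv _)).
have Lg' : L1 leb setT g' by apply/(L1_restrict g (measurable_itv _)).
have := Rintegral_triangles Lf' Lg'.
have int' k x : a <= x <= c ->
    \int[leb]_(y in `]-oo, x]) (k \_ `[a, c]) y = \int[leb]_(y in `[a, x]) k y.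
  move=> /andP[ax xc]; rewrite Rintegral_mkcond [RHS]Rintegral_mkcond.
  apply: Rint_eq => y _; rewrite !patchE !mem_setE !in_itv/=.
  case: (leP y x) => yx; rewrite ?andbF ?andbT//.
  by rewrite (le_trans yx xc) andbT.
have e1 : \int[leb]_x (f' x * \int[leb]_(y in `]-oo, x]) g' y) =
    \int[leb]_(x in `[a, c]) (f x * (G x - G a)).
  rewrite [RHS]Rintegral_mkcond; apply: Rint_eq => x _.
  rewrite /f' !patchE; case: ifPn => [/set_mem/=|_]; last by rewrite mul0r.
  rewrite in_itv/= => xac; rewrite int'// GE; last first.
    by case/andP: xac => -> /le_trans ->.
  by congr (_ * _); ring.
have e2 : \int[leb]_x (g' x * \int[leb]_(y in `]-oo, x]) f' y) =
    \int[leb]_(x in `[a, c]) (g x * (F x - F a)).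
  rewrite [RHS]Rintegral_mkcond; apply: Rint_eq => x _.
  rewrite /g' !patchE; case: ifPn => [/set_mem/=|_]; last by rewrite mul0r.
  rewrite in_itv/= => xac; rewrite int'// FE; last first.
    by case/andP: xac => -> /le_trans ->.
  by congr (_ * _); ring.
rewrite e1 e2 /f' /g' -!Rintegral_mkcond.
have Fc := AC_end ac (AC_sub cb ACF); have Gc := AC_end ac (AC_sub cb ACG).
rewrite Fc Gc.
have -> : \int[leb]_(x in `[a, c]) (f x * (G x - G a)) =
    \int[leb]_(x in `[a, c]) (f x * G x) - G a * \int[leb]_(x in `[a, c]) f x.
  rewrite -RintegralZl// -RintegralB//; last 2 first.
  - by apply: L1S L1fG.
  - exact: L1Z.
  by apply: Rint_eq => x _; ring.
have -> : \int[leb]_(x in `[a, c]) (g x * (F x - F a)) =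
    \int[leb]_(x in `[a, c]) (F x * g x) - F a * \int[leb]_(x in `[a, c]) g x.
  rewrite -RintegralZl// -RintegralB//; last 2 first.
  - by apply: L1S L1Fg.
  - exact: L1Z.
  by apply: Rint_eq => x _; ring.
rewrite Fc Gc RintegralD//; last 2 first.
- by apply: L1S L1fG.
- by apply: L1S L1Fg.
set A := \int[_]_(_ in _) _; set B := \int[_]_(_ in _) _ => h.
have -> : A + B = (A - G a * (F c - F a) + (B - F a * (G c - G a))) +
  (G a * (F c - F a) + F a * (G c - G a)) by ring.
by rewrite h; ring.
Qed.

Lemma AC_derive a b F f : (forall x, a <= x <= b -> is_derive x 1 F (f x)) ->
  {within `[a, b], continuous f} -> AC a b F f.
Proof.
move=> dF cf; split; first exact: L1_continuous.
move=> x /andP[ax xb].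
have dF' y : a <= y <= x -> is_derive y 1 F (f y).
  by move=> /andP[ay yx]; apply: dF; rewrite ay (le_trans yx).
rewrite /Rintegral (FTC2_closed ax dF')/=; first by ring.
by apply: continuous_subspaceW cf; apply: subset_itvl; rewrite bnd_simp.
Qed.
End abs_continuous.

Section derivation_rules.
Context {R : realType}.
Implicit Types (f g : R -> R) (x df dg : R).

Lemma is_deriveM1 f g x df dg : is_derive x 1 f df -> is_derive x 1 g dg ->
  is_derive x 1 (fun y => f y * g y) (df * g x + f x * dg).
Proof.
move=> hf hg; apply: is_derive_eq.
by rewrite /GRing.scale/= addrC (mulrC (g x)).
Qed.

Lemma is_deriveD1 f g x df dg : is_derive x 1 f df -> is_derive x 1 g dg ->
  is_derive x 1 (fun y => f y + g y) (df + dg).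
Proof. by move=> hf hg; apply: is_derive_eq. Qed.

Lemma is_deriveB1 f g x df dg : is_derive x 1 f df -> is_derive x 1 g dg ->
  is_derive x 1 (fun y => f y - g y) (df - dg).
Proof. by move=> hf hg; apply: is_derive_eq. Qed.

Lemma is_derive_comp1 f g x df dg : is_derive x 1 g dg ->
  is_derive (g x) 1 f df -> is_derive x 1 (fun y => f (g y)) (df * dg).
Proof.
move=> hg hf; have := is_derive1_comp hf hg.
by move=> h; apply: (is_derive_eq h).
Qed.

Lemma is_deriveX1 f x df n : is_derive x 1 f df ->
  is_derive x 1 (fun y => f y ^+ n) (n%:R * f x ^+ n.-1 * df).
Proof.
move=> hf; elim: n => [|n IH].
  have -> : (fun y => f y ^+ 0) = cst 1 by apply/funext => y; rewrite expr0.
  by rewrite !mul0r; exact: is_derive_cst.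
have h := is_deriveM1 hf IH.
have -> : (fun y => f y ^+ n.+1) = (fun y => f y * f y ^+ n).
  by apply/funext => y; rewrite exprS.
apply: (is_derive_eq h); case: n {IH h} => [|n] /=.
  by rewrite !expr0; ring.
by rewrite -!natr1 !exprS; ring.
Qed.

Lemma is_deriveV1 f x df : f x != 0 -> is_derive x 1 f df ->
  is_derive x 1 (fun y => (f y)^-1) (- df / f x ^+ 2).
Proof.
move=> fx0 hf; have h := is_deriveV fx0 hf.
apply: (is_derive_eq h).
by rewrite /GRing.scale/= mulNr mulrC mulNr.
Qed.

Lemma is_derive_idX1 x n : is_derive x 1 (fun y => y ^+ n) (n%:R * x ^+ n.-1).
Proof.
by have := is_deriveX1 n (is_derive_id x (1 : R)); rewrite mulr1.
Qed.

Lemma is_derive_continuous1 f x df : is_derive x 1 f df -> {for x, continuous f}.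
Proof. by move=> [hf _]; exact/differentiable_continuous/derivable1_diffP. Qed.

End derivation_rules.

(** * Integrals over a half-line and the energy of one radial mode *)

Section half_line.
Context {R : realType}.
Local Notation leb := (@lebesgue_measure R).
Local Notation RT := (measurableTypeR R).
Implicit Types (f g F G : R -> R) (a b c x : R).

Lemma integral_tail_cvg f a : L1 leb `[a, +oo[ f ->
  \int[leb]_(x in `[a, T]) f x @[T --> +oo] --> \int[leb]_(x in `[a, +oo[) f x.
Proof.
move=> Lf; apply/cvg_pinftyP => u u_oo.
have mD : @measurable _ RT `[a, +oo[ by exact: measurable_itv.
pose fn n x := f x * \1_(`[a, u n] : set R) x.
have i1 n x : \1_(`[a, u n] : set R) x <= 1 :> R.
  by rewrite indicE; case: (_ \in _).
have mfn n : measurable_fun `[a, +oo[ (EFin \o fn n).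
  apply/measurable_EFinP; apply: measurable_funM; first exact: (L1_meas Lf).
  by apply: measurable_indic; exact: measurable_itv.
have fnf x : (x \in `[a, +oo[) -> (EFin \o fn n) x @[n --> \oo] --> (EFin \o f) x.
  rewrite in_itv/= andbT => ax; apply: cvg_near_cst.
  move/cvgryPge : u_oo => /(_ x) [N _ HN]; exists N => // n /= /HN /= xu.
  by rewrite /fn indicE mem_set ?mulr1//= in_itv/= ax.
have := @dominated_convergence _ RT R leb _ mD (fun n => EFin \o fn n) (EFin \o f)
  (fun x => `|(f x)%:E|%E) mfn (measurable_int _ Lf) _ _ _.
case.
- by apply: aeW => x /= xD; apply: fnf.
- by apply: integrable_abse.
- apply: aeW => x n _ /=; rewrite lee_fin /fn normrM ler_piMr//.
  by rewrite ger0_norm ?i1// indicE; case: (_ \in _).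
move=> _ _ H; rewrite /Rintegral; apply: fine_cvg.
rewrite fineK; last exact: integrable_fin_num.
have -> : (fun n => \int[leb]_(x in `[a, u n]) (f x)%:E)%E =
    (fun n => \int[leb]_(x in `[a, +oo[) (fn n x)%:E)%E; last exact: H.
apply/funext => n; rewrite integral_mkcond [RHS]integral_mkcond.
apply: eq_integral => x _; rewrite !patchE /fn indicE.
case: ifPn => xn; last by rewrite mulr0; case: ifP.
rewrite mulr1 ifT//; apply/mem_set => /=; rewrite in_itv/= andbT.
by move/set_mem: xn => /=; rewrite in_itv/= => /andP[].
Qed.

(** A function that stays above d > 0 on a half-line is not integrable there. Only arbitrarily large
    points with a small value are obtained, not a limit at infinity; they suffice to control a
    boundary term. *)
Lemma L1_tail_small f a : L1 leb `[a, +oo[ f -> forall d M, 0 < d ->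
  exists2 T, M <= T & f T < d.
Proof.
move=> Lf d M d0; apply: contrapT => H.
have fd T : M <= T -> d <= f T.
  by move=> MT; rewrite leNgt; apply/negP => fT; apply: H; exists T.
pose m := Num.max a M.
have Lm : L1 leb `[m, +oo[ f.
  apply: (@L1S _ RT _ _ `[a, +oo[) Lf => //.
  by apply: subset_itvr; rewrite bnd_simp le_max lexx.
have : L1 leb `[m, +oo[ (cst d).
  apply: (@L1_le _ RT _ _ _ _ (cst d) f) Lm => // x /=; rewrite in_itv/= andbT.
  rewrite ge_max => /andP[_ Mx]; rewrite gtr0_norm//; exact: fd.
move=> /integrableP[_]; under eq_integral do rewrite /= gtr0_norm//.
rewrite (integral_cst _ _ d%:E)//= lebesgue_measure_itv/= ltry.
by rewrite gt0_muley.
Qed.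

Lemma FTC2_infty F f a l : (forall x, a <= x -> is_derive x 1 F (f x)) ->
  {within `[a, +oo[, continuous f} -> L1 leb `[a, +oo[ f ->
  F x @[x --> +oo] --> l -> \int[leb]_(x in `[a, +oo[) f x = l - F a.
Proof.
move=> dF cf Lf Fl.
have h : F T - F a @[T --> +oo] --> l - F a by apply: cvgB => //; exact: cvg_cst.
apply: (@cvg_unique _ _ _ _ _ _ (integral_tail_cvg Lf)).
  exact: Rhausdorff.
apply: cvg_trans h; apply: near_eq_cvg; near=> T.
have aT : a <= T by near: T; apply: nbhs_pinfty_ge; exact: num_real.
have dF' x : a <= x <= T -> is_derive x 1 F (f x) by move=> /andP[/dF].
rewrite /Rintegral (FTC2_closed aT dF')//.
by apply: continuous_subspaceW cf; apply: subset_itvl.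
Unshelve. all: end_near. Qed.

Lemma integral_sym_cvg f : L1 leb setT f ->
  \int[leb]_(x in `[- n%:R, n%:R]) f x @[n --> \oo] --> \int[leb]_x f x.
Proof.
move=> Lf.
pose fn (n : nat) x := f x * \1_(`[- n%:R, n%:R] : set R) x.
have i1 n x : \1_(`[- n%:R, n%:R] : set R) x <= 1 :> R.
  by rewrite indicE; case: (_ \in _).
have mfn n : measurable_fun setT (EFin \o fn n).
  apply/measurable_EFinP; apply: measurable_funM; first exact: (L1_meas Lf).
  by apply: measurable_indic; exact: measurable_itv.
have fnf x : (EFin \o fn n) x @[n --> \oo] --> (EFin \o f) x.
  apply: cvg_near_cst.
  have [N HN] : exists N : nat, `|x| < N%:R.
    by exists (Num.bound `|x|); exact: archi_boundP.
  exists N => // n /= Nn; rewrite /fn indicE mem_set ?mulr1//= in_itv/=.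
  by rewrite -ler_norml (le_trans (ltW HN))// ler_nat.
have := @dominated_convergence _ RT R leb _ measurableT (fun n => EFin \o fn n) (EFin \o f)
  (fun x => `|(f x)%:E|%E) mfn (measurable_int _ Lf) _ _ _.
case.
- by apply: aeW => x /= xD; apply: fnf.
- by apply: integrable_abse.
- apply: aeW => x n _ /=; rewrite lee_fin /fn normrM ler_piMr//.
  by rewrite ger0_norm ?i1// indicE; case: (_ \in _).
move=> _ _ H; rewrite /Rintegral; apply: fine_cvg.
rewrite fineK; last exact: integrable_fin_num.
have -> : (fun n : nat => \int[leb]_(x in `[(- n%:R)%R, n%:R]) (f x)%:E)%E =
    (fun n => \int[leb]_x (fn n x)%:E)%E; last exact: H.
apply/funext => n; rewrite integral_mkcond.
apply: eq_integral => x _; rewrite patchE /fn indicE.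
by case: ifPn; rewrite ?mulr1 ?mulr0.
Qed.

Lemma FTC2_real F f : (forall x, is_derive x 1 F (f x)) -> continuous f ->
  L1 leb setT f -> F n%:R @[n --> \oo] --> (0 : R) ->
  F (- n%:R) @[n --> \oo] --> (0 : R) -> \int[leb]_x f x = 0.
Proof.
move=> dF cf Lf Fp Fn.
have h : F n%:R - F (- n%:R) @[n --> \oo] --> (0 : R).
  by rewrite -[0 in X in _ --> X]subr0; apply: cvgB.
apply: (@cvg_unique _ _ _ _ _ _ (integral_sym_cvg Lf)); first exact: Rhausdorff.
apply: cvg_trans h; apply: near_eq_cvg; near=> n.
have nn : - n%:R <= n%:R :> R by rewrite lerNl opprK lerN10 || rewrite (@le_trans _ _ 0)// oppr_le0.
rewrite /Rintegral (FTC2_closed nn (fun x _ => dF x))//.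
exact: continuous_subspaceT.
Unshelve. all: end_near. Qed.

Lemma Rintegral_gt0 f : L1 leb setT f -> continuous f -> (forall x, 0 < f x) ->
  0 < \int[leb]_x f x.
Proof.
move=> Lf cf f0.
have cf01 : {within `[0, 1], continuous f} by exact: continuous_subspaceT.
have [c _ Hc] := EVT_min ler01 cf01.
have L01 : L1 leb `[0, 1] f by exact: (L1S _ _ _ Lf).
apply: (@lt_le_trans _ _ (\int[leb]_(x in `[0, 1]) f c)).
  have e : leb `[0, 1] = 1%E.
    by rewrite lebesgue_measure_itv/= lte_fin ltr01 oppr0 addr0.
  by rewrite Rintegral_cst// [X in fine X]e mulr1.
apply: (@le_trans _ _ (\int[leb]_(x in `[0, 1]) f x)).
  apply: le_Rintegral => //.
  by apply: L1_continuous; apply: continuous_subspaceT => x; exact: cvg_cst.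
rewrite Rintegral_mkcond; apply: le_Rintegral => //; first exact: L1T_restrict.
by move=> x _; rewrite patchE; case: ifP => // _; exact: ltW.
Qed.

Lemma ae_imp (P Q : R -> Prop) : (forall x, P x -> Q x) ->
  {ae leb, forall x, P x} -> {ae leb, forall x, Q x}.
Proof.
move=> PQ [N [mN N0 sub]]; exists N; split => //.
by apply: subset_trans sub => x /= nQ Px; apply: nQ; exact: PQ.
Qed.

Lemma AC_ae a b F f g : measurable_fun `[a, b] g ->
  {ae leb, forall x, `[a, b]%classic x -> f x = g x} -> AC a b F f -> AC a b F g.
Proof.
move=> mg fg [Lf FE]; split.
  have mf := measurable_int _ Lf.
  have mge : measurable_fun `[a, b] (EFin \o g) by exact/measurable_EFinP.
  case/integrableP: Lf => _ h; apply/integrableP; split => //.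
  apply: le_lt_trans h; rewrite le_eqVlt; apply/orP; left; apply/eqP.
  apply: ae_eq_integral => //.
  - exact: measurableT_comp.
  - exact: measurableT_comp.
  - by apply: ae_imp fg => x fgx xab /=; rewrite fgx.
move=> x /andP[ax xb]; rewrite FE ?ax//; congr (_ + fine _).
have sub : `[a, x] `<=` `[a, b] by apply: subset_itvl; rewrite bnd_simp.
apply: ae_eq_integral => //.
- apply/measurable_EFinP; have := L1_meas Lf; apply: measurable_funS => //.
- by apply/measurable_EFinP; apply: measurable_funS mg.
- by apply: ae_imp fg => y fgy yax /=; rewrite fgy//; exact: sub.
Qed.

(* With [alpha = beta / r^k] one has
   [e >= (pi_ - h alpha)^2 r + d/dr (h alpha^2 r)]; the boundary term at [r0] is
   nonnegative because [h r0 <= 0], and the one at infinity is controlled by the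
   integrability of [r^3 alpha^2]. *)
Lemma weighted_energy_ge0 (r0 C : R) (k : nat) (e h h' U pi_ beta gamma : R -> R) :
  0 < r0 -> 0 < C ->
  (forall T, r0 <= T -> AC r0 T beta gamma) ->
  (forall r, r0 <= r -> gamma r = r ^+ k * pi_ r + k%:R * beta r / r) ->
  (forall r, r0 <= r -> is_derive r 1 h (h' r)) ->
  {within `[r0, +oo[, continuous h'} ->
  (forall r, r0 <= r -> h' r + h r / r + h r ^+ 2 <= U r) ->
  h r0 <= 0 -> (forall r, r0 <= r -> `|h r| <= C * r) ->
  (forall r, r0 <= r -> e r = (pi_ r ^+ 2 + U r * (beta r / r ^+ k) ^+ 2) * r) ->
  L1 leb `[r0, +oo[ e ->
  L1 leb `[r0, +oo[ (fun r => r ^+ 3 * (beta r / r ^+ k) ^+ 2) ->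
  0 <= \int[leb]_(r in `[r0, +oo[) e r.
Proof.
move=> r00 C0 ACb gE dh ch' ric h0 hC eE Le L3.
rewrite leNgt; apply/negP => I0.
set I := \int[leb]_(r in _) _ in I0.
have lower T : r0 <= T ->
    - (C * T ^+ 2 * (beta T / T ^+ k) ^+ 2) <= \int[leb]_(r in `[r0, T]) e r.
  move=> r0T.
  (* Chosen so that [W beta^2] is h alpha^2 r, written through [beta] because it is [beta] that is
     known to be absolutely continuous. *)
  pose W r := h r * (r * (r ^+ k ^+ 2)^-1).
  pose W' r := h' r * (r * (r ^+ k ^+ 2)^-1) +
     h r * (1 - 2 * k%:R) * (r ^+ k ^+ 2)^-1.
  have dW r : r0 <= r -> is_derive r 1 W (W' r).
    move=> r0r; have r_gt0 : 0 < r by exact: lt_le_trans r0r.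
    have rn0 : r ^+ k ^+ 2 != 0 by rewrite !expf_neq0// gt_eqF.
    have ? := dh _ r0r.
    have dp : is_derive r 1 (fun r : R => r * (r ^+ k ^+ 2)^-1)
        ((1 - 2 * k%:R) * (r ^+ k ^+ 2)^-1).
      have h1 := is_deriveX1 2 (is_derive_idX1 r k).
      have h2 := is_deriveM1 (is_derive_id r (1 : R)) (is_deriveV1 (f := fun r => r ^+ k ^+ 2) rn0 h1).
      apply: (is_derive_eq h2).
      have rk0 : r ^+ k != 0 by rewrite expf_neq0// gt_eqF.
      case: (k) rk0 => [|k'] rk0 /=; first by rewrite !expr0; field.
      rewrite exprS in rk0 *; rewrite mulf_eq0 negb_or in rk0.
      by case/andP: rk0 => r1 r2; field; rewrite r1 r2.
    apply: (is_derive_eq (is_deriveM1 (dh _ r0r) dp)).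
    by rewrite /W'; ring.
  have cT : {within `[r0, T], continuous h'}.
    by apply: continuous_subspaceW ch'; apply: subset_itvl.
  have pos (x : R) : x \in `[r0, T]%classic -> 0 < x /\ r0 <= x.
    move=> /set_mem/=; rewrite in_itv/= => /andP[r0x _].
    by split=> //; exact: lt_le_trans r0x.
  have cP : {within `[r0, T], continuous (fun r => r * (r ^+ k ^+ 2)^-1)}.
    apply: continuous_in_subspaceT => x /pos[x0 _].
    apply: cvgM; first exact: cvg_id.
    apply: cvgV; first by rewrite !expf_neq0// gt_eqF.
    by apply: (is_derive_continuous1 (is_deriveX1 2 (is_derive_idX1 x k))).
  have cQ : {within `[r0, T], continuous (fun r => h r * (1 - 2 * k%:R) * (r ^+ k ^+ 2)^-1)}.
    apply: continuous_in_subspaceT => x /pos[x0 r0x].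
    apply: cvgM.
      by apply: cvgM; [exact: (is_derive_continuous1 (dh _ r0x))|exact: cvg_cst].
    apply: cvgV; first by rewrite !expf_neq0// gt_eqF.
    by apply: (is_derive_continuous1 (is_deriveX1 2 (is_derive_idX1 x k))).
  have cW' : {within `[r0, T], continuous W'}.
    move=> x; apply: cvgD; last exact: cQ.
    by apply: cvgM; [exact: cT|exact: cP].
  have ACW : AC r0 T W W'.
    by apply: AC_derive => // r /andP[/dW].
  have ACbb := AC_mul r0T (ACb _ r0T) (ACb _ r0T).
  have ACq := AC_mul r0T ACW ACbb.
  have := AC_end r0T ACq.
  set q := (fun x => W' x * _ + _) => qE.
  have Lq : L1 leb `[r0, T] q by case: ACq.
  have LeT : L1 leb `[r0, T] e.
    by apply: (@L1S _ RT _ _ `[r0, +oo[) Le => //; apply: subset_itvl.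
  apply: (@le_trans _ _ (\int[leb]_(r in `[r0, T]) q r)).
    rewrite qE.
    have W0 : W r0 <= 0.
      rewrite /W mulr_le0_ge0// mulr_ge0 ?(ltW r00)// invr_ge0 sqr_ge0//.
    have -> : W T * (beta T * beta T) = h T * T * (beta T / T ^+ k) ^+ 2.
      rewrite /W; field; rewrite expf_neq0// gt_eqF//.
      exact: lt_le_trans r0T.
    have : 0 <= - (W r0 * (beta r0 * beta r0)).
      by rewrite oppr_ge0 mulr_le0_ge0// -expr2 sqr_ge0.
    have T0 : 0 < T by exact: lt_le_trans r0T.
    have : - (C * T ^+ 2) * (beta T / T ^+ k) ^+ 2 <= h T * T * (beta T / T ^+ k) ^+ 2.
      rewrite ler_wpM2r ?sqr_ge0// expr2 mulrA -mulNr ler_pM2r//.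
      by have := hC _ r0T; rewrite ler_norml => /andP[].
    by rewrite mulNr => H1 H2; apply: le_trans H1 _; rewrite lerDl.
  apply: le_Rintegral => // r; rewrite /= in_itv/= => /andP[r0r _].
  have r_gt0 : 0 < r by exact: lt_le_trans r0r.
  rewrite eE// /q /W /W' gE//.
  set al := beta r / r ^+ k.
  have -> : beta r = r ^+ k * al.
    by rewrite /al; field; rewrite expf_neq0// gt_eqF.
  have := ric _ r0r; rewrite -(ler_pM2r r_gt0) -subr_ge0 => rr.
  have rk0 : r ^+ k != 0 by rewrite expf_neq0// gt_eqF.
  rewrite -subr_ge0.
  have -> : (pi_ r ^+ 2 + U r * al ^+ 2) * r -
    ((h' r * (r * (r ^+ k ^+ 2)^-1) + h r * (1 - 2 * k%:R) * (r ^+ k ^+ 2)^-1) *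
     (r ^+ k * al * (r ^+ k * al)) +
     h r * (r * (r ^+ k ^+ 2)^-1) *
     ((r ^+ k * pi_ r + k%:R * (r ^+ k * al) / r) * (r ^+ k * al) +
      r ^+ k * al * (r ^+ k * pi_ r + k%:R * (r ^+ k * al) / r))) =
    r * (pi_ r - h r * al) ^+ 2 +
    (U r * r - (h' r + h r / r + h r ^+ 2) * r) * al ^+ 2.
    by field; rewrite rk0 gt_eqF.
  by rewrite addr_ge0// mulr_ge0 ?sqr_ge0// ltW.
(* If I < 0, then for large T the integral up to T is below I/2. A point T >= 1 with T^3 alpha(T)^2
   < -I/(2C) makes the lower bound -C T^2 alpha(T)^2 exceed I/2, a contradiction. *)
have /cvgrPdist_lt/(_ (- I / 2)) := integral_tail_cvg Le.
rewrite -/I divr_gt0 ?oppr_gt0// => /(_ isT) [M [_ HM]].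
pose m := Num.max (Num.max (M + 1) 1) r0.
have d0 : 0 < - I / 2 / C by rewrite !divr_gt0// oppr_gt0.
have [T mT] := L1_tail_small L3 m d0.
have [MT T1 r0T] : [/\ M < T, 1 <= T & r0 <= T].
  move: mT; rewrite /m !ge_max => /andP[/andP[h1 h2] h3]; split => //.
  by apply: lt_le_trans h1; rewrite ltrDl.
rewrite ltr_pdivlMr// => small.
have := HM _ MT; rewrite ltr_norml => /andP[h1 _].
have := lower _ r0T.
move: small; set Y := (_ / _) ^+ 2 => small h2.
have h3 : C * T ^+ 2 * Y <= T ^+ 3 * Y * C.
  have -> : T ^+ 3 * Y * C = T * (C * T ^+ 2 * Y) by ring.
  rewrite ler_peMl//; apply: mulr_ge0; last exact: sqr_ge0.
  by apply: mulr_ge0; [exact: ltW|exact: sqr_ge0].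
move: h1 h2 h3 small; set A := \int[_]_(_ in _) _.
set B := C * _ * _; set D := _ * C; clear => h1 h2 h3 small; lra.
Qed.
End half_line.

(** * The confluent hypergeometric integral *)

Section under_integral.
Context {R : realType}.
Local Notation leb := (@lebesgue_measure R).

Lemma is_derive_under_integral (f df : R -> R -> R) (a u v : R) (G : R -> R) :
  u < a < v -> (forall x, u < x < v -> L1 leb setT (f x)) ->
  (forall x y, u < x < v -> is_derive x 1 (f ^~ y) (df x y)) ->
  (forall y, 0 <= G y) -> L1 leb setT G ->
  (forall x y, u < x < v -> `|df x y| <= G y) ->
  is_derive a 1 (fun x => \int[leb]_y f x y) (\int[leb]_y df a y).
Proof.
move=> uav Lf fdf G0 LG dfG.
have Ia : `]u, v[%classic a by rewrite /= in_itv.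
have H1 x : `]u, v[%classic x -> leb.-integrable setT (EFin \o f x).
  by rewrite /= in_itv/=; exact: Lf.
have H2 x y : `]u, v[%classic x -> setT y -> derivable (f ^~ y) x 1.
  by rewrite /= in_itv/= => /(fdf x y) [].
have E x y : u < x < v -> partial1of2 f x y = df x y.
  by move=> uxv; rewrite partial1of2E; case: (fdf _ y uxv).
have H3 x y : `]u, v[%classic x -> setT y -> `|partial1of2 f x y| <= G y.
  by rewrite /= in_itv/= => uxv _; rewrite E//; exact: dfG.
apply: DeriveDef.
  exact: (derivable_under_integral measurableT Ia H1 H2 G0 LG H3).
rewrite -derive1E (differentiation_under_integral measurableT Ia H1 H2 G0 LG H3).
by apply: Rint_eq => y _; rewrite E.
Qed.

End under_integral.

Section confluent.
Context {R : realType}.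
Local Notation leb := (@lebesgue_measure R).
Local Notation RT := (measurableTypeR R).
Implicit Types (a z x c : R) (j m : nat).

Lemma cvg_expN c : 0 < c -> expR (- (c * x)) @[x --> +oo] --> (0 : R).
Proof.
move=> c0; have := @cvgr_expR R.
apply: (@cvg_comp _ _ _ (fun x : R => c * x) (fun x : R => expR (- x))).
by apply: gt0_cvgMry => //; exact: cvg_id.
Qed.

Lemma cvg0_le (f g : nat -> R) : (forall n, `|f n| <= g n) ->
  g n @[n --> \oo] --> (0 : R) -> f n @[n --> \oo] --> (0 : R).
Proof.
move=> fg g0; apply: norm_cvg0; apply: (@squeeze_cvgr _ _ _ _ (cst 0) _ _ _ _ _ g0); last exact: cvg_cst.
by apply: nearW => n; rewrite normr_ge0/=.
Qed.

Lemma L1_exp_abs c : 0 < c -> L1 leb setT (fun x => expR (- (c * `|x|))).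
Proof.
move=> c0.
have cont : continuous (fun x : R => expR (- (c * `|x|))).
  move=> x; apply: (@continuous_comp _ _ _ (fun x : R => - (c * `|x|)) expR).
    apply: cvgN; apply: cvgM; first exact: cvg_cst.
    exact: norm_continuous.
  exact: continuous_expR.
have mk : measurable_fun (setT : set R) (fun x : R => expR (- (c * `|x|))).
  exact: continuous_measurable_fun.
have k0 x : setT x -> 0 <= expR (- (c * `|x|)) by move=> _; exact: expR_ge0.
have [_ H] := L1_ge0P leb mk k0; apply: H => {k0 mk}.
rewrite ge0_symfun_integralT//; last first.
  by move=> x /=; rewrite normrN.
have -> : [set x : R | 0 <= x] = `[0, +oo[%classic.
  by apply/seteqP; split => x /=; rewrite in_itv/= andbT.
have dF x : is_derive x 1 (fun x => - c^-1 * expR (- c * x)) (expR (- c * x)).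
  have h1 := is_deriveM1 (is_derive_cst (- c : R) x 1) (is_derive_id x (1 : R)).
  have h2 := is_derive_comp1 h1 (is_derive_expR _).
  have h3 := is_deriveM1 (is_derive_cst (- c^-1 : R) x 1) h2.
  by apply: (is_derive_eq h3); rewrite /=; field; rewrite gt_eqF.
rewrite (@ge0_continuous_FTC2y _ _ (fun x => - c^-1 * expR (- c * x)) 0 0).
- by rewrite -EFinB -EFinM ltry.
- by move=> x _; exact: expR_ge0.
- exact: continuous_subspaceT.
- rewrite -(mulr0 (- c^-1)); apply: cvgM; first exact: cvg_cst.
  by apply: cvg_trans (cvg_expN c0); apply: near_eq_cvg; near=> x; rewrite mulNr.
- by move=> x _; have [] := dF x.
- apply: cvg_at_right_filter; exact: (is_derive_continuous1 (dF 0)).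
- move=> x; rewrite in_itv/= andbT => x0; have [_] := dF x.
  by rewrite derive1E => ->; rewrite ger0_norm ?ltW// mulNr.
Unshelve. all: end_near. Qed.

(* With [t = e^x], [kint m j a z] is the integral of
   [e^(-z t) t^(a+j-1) (1+t)^(m-a)] over [t > 0]; for [j = 0] it is
   [Gamma(a) U(a, m+1, z)] with Tricomi's function [U]. *)
Definition kap m a z x := expR (a * x + (m%:R - a) * ln (1 + expR x) - z * expR x).

Definition kint m j a z := \int[leb]_x (expR x ^+ j * kap m a z x).

Lemma kap_gt0 m a z x : 0 < kap m a z x. Proof. exact: expR_gt0. Qed.

Lemma expR_X_kap m j a z x : expR x ^+ j * kap m a z x =
  expR ((a + j%:R) * x + (m%:R - a) * ln (1 + expR x) - z * expR x).
Proof. by rewrite -expRM_natl -expRD; congr expR; ring. Qed.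

Lemma oneDexp_gt0 x : 0 < 1 + expR x :> R.
Proof. by rewrite addr_gt0// expR_gt0. Qed.

Lemma ln1Dexp_ge0 x : 0 <= ln (1 + expR x).
Proof. by rewrite ln_ge0// lerDl expR_ge0. Qed.

Definition kdom m j c z := expR (m%:R * ln 2 + (2 * m%:R + 1 + j%:R + c) ^+ 2 / (2 * z)).

(** For x <= 0 the factor e^((a+j)x) decays at rate at least c. For x > 0 the term z e^x >= z x^2/2
    beats the linear ones, and completing the square in B x - z x^2/2 with B = 2m + 1 + j + c gives
    the constant in [kdom]. The bound is uniform in z >= z0 and in the admissible a, so it serves
    both for derivatives in z and for continuity in a. *)
Lemma kap_le_dom m j a c z0 z x : 0 < c -> c <= a + j%:R -> 0 <= a -> a <= m%:R + 1 ->
  0 < z0 -> z0 <= z ->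
  expR x ^+ j * kap m a z x <= kdom m j c z0 * expR (- (c * `|x|)).
Proof.
move=> c0 caj a0 am z00 z0z; rewrite expR_X_kap /kdom -expRD ler_expR.
have ex0 := expR_gt0 x.
have z0ex : z0 * expR x <= z * expR x by rewrite ler_wpM2r// ltW.
have l2 : 0 <= ln 2 :> R by rewrite ln_ge0// ler1n.
have L0 := ln1Dexp_ge0 x.
set L := ln (1 + expR x) in L0 *.
have mL : (m%:R - a) * L <= m%:R * L by rewrite ler_wpM2r// gerBl.
have m0 : 0 <= m%:R :> R by rewrite ler0n.
have j0 : 0 <= j%:R :> R by rewrite ler0n.
set K := (_ ^+ 2) / _.
have K0 : 0 <= K by rewrite /K divr_ge0 ?sqr_ge0// mulr_ge0// ltW.
have [x0|x0] := leP x 0.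
  rewrite ler0_norm//.
  have LL : L <= ln 2.
    rewrite ler_ln ?posrE ?oneDexp_gt0// -(natr1 1) addrC lerD2r.
    by rewrite -(expR0 R) ler_expR.
  have h1 : m%:R * L <= m%:R * ln 2 by rewrite ler_wpM2l.
  have h2 : (a + j%:R) * x <= c * x by rewrite ler_wnM2r.
  have h3 : 0 <= z0 * expR x by rewrite mulr_ge0// ltW.
  by rewrite mulrN opprK; lra.
rewrite gtr0_norm//.
have LL : L <= ln 2 + x.
  rewrite -[x in leRHS]expRK -lnM ?posrE// ler_ln ?posrE ?oneDexp_gt0 ?mulr_gt0//.
  by rewrite mulr_natl mulr2n lerD2r -(expR0 R) ler_expR ltW.
have h1 : m%:R * L <= m%:R * ln 2 + m%:R * x by rewrite -mulrDr ler_wpM2l.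
have h2 : (a + j%:R) * x <= (m%:R + 1 + j%:R) * x.
  by rewrite ler_wpM2r ?(ltW x0)// lerD2r.
have h3 : z0 * (x ^+ 2 / 2) <= z0 * expR x.
  rewrite ler_wpM2l ?(ltW z00)//.
  have := @expR_ge1Dxn R x 1 (ltW x0); rewrite /= => h.
  by apply: le_trans h; rewrite lerDr.
have h4 : (2 * m%:R + 1 + j%:R + c) * x - z0 * (x ^+ 2 / 2) <= K.
  rewrite -subr_ge0 /K.
  set B := _ + c.
  have -> : B ^+ 2 / (2 * z0) - (B * x - z0 * (x ^+ 2 / 2)) = (B - z0 * x) ^+ 2 / (2 * z0).
    by field; rewrite gt_eqF.
  by rewrite divr_ge0 ?sqr_ge0// mulr_ge0// ltW.
have : (2 * m%:R + 1 + j%:R + c) * x = m%:R * x + (m%:R + 1 + j%:R) * x + c * x by ring.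
by lra.
Qed.

Definition kexp_der m a z x := a + (m%:R - a) * (expR x / (1 + expR x)) - z * expR x.

Lemma is_derive_kap m a z x :
  is_derive x 1 (kap m a z) (kap m a z x * kexp_der m a z x).
Proof.
have h1 := is_deriveM1 (is_derive_cst (a : R) x 1) (is_derive_id x (1 : R)).
have hl := is_deriveD1 (is_derive_cst (1 : R) x 1) (is_derive_expR x).
have hl2 := is_derive_comp1 hl (is_derive1_ln (oneDexp_gt0 x)).
have h2 := is_deriveM1 (is_derive_cst (m%:R - a : R) x 1) hl2.
have h3 := is_deriveM1 (is_derive_cst (z : R) x 1) (is_derive_expR x).
have h := is_derive_comp1 (is_deriveB1 (is_deriveD1 h1 h2) h3) (is_derive_expR _).
apply: (is_derive_eq h); rewrite /= /kexp_der.
by rewrite !mul0r !add0r mulr1 (mulrC (1 + expR x)^-1).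
Qed.

Lemma continuous_expRX_kap m j a z : continuous (fun x => expR x ^+ j * kap m a z x).
Proof.
move=> x; apply: (is_derive_continuous1 (is_deriveM1 (is_deriveX1 j (is_derive_expR x)) (is_derive_kap m a z x))).
Qed.

Lemma L1_kap m j a z : 0 < a -> a <= m%:R + 1 -> 0 < z ->
  L1 leb setT (fun x => expR x ^+ j * kap m a z x).
Proof.
move=> a0 am z0.
apply: (@L1_le _ RT _ _ _ measurableT _ (fun x => kdom m j a z * expR (- (a * `|x|)))).
- have mk : measurable_fun (setT : set R) (fun x => expR x ^+ j * kap m a z x).
    by apply: continuous_measurable_fun; exact: continuous_expRX_kap.
  exact: mk.
- move=> x _; rewrite gtr0_norm ?mulr_gt0 ?exprn_gt0 ?expR_gt0//.
  by apply: kap_le_dom => //; rewrite ?lerDl ?ler0n ?ltW.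
- by apply: L1Z => //; exact: L1_exp_abs.
Qed.

Lemma kint_gt0 m j a z : 0 < a -> a <= m%:R + 1 -> 0 < z -> 0 < kint m j a z.
Proof.
move=> a0 am z0; apply: Rintegral_gt0; first exact: L1_kap.
  exact: continuous_expRX_kap.
by move=> x; rewrite mulr_gt0 ?exprn_gt0 ?expR_gt0.
Qed.

Lemma is_derive_kint m j a z : 0 < a -> a <= m%:R + 1 -> 0 < z ->
  is_derive z 1 (kint m j a) (- kint m j.+1 a z).
Proof.
move=> a0 am z0.
have zv : z / 2 < z < z + 1 by apply/andP; split; lra.
have pos z' : z / 2 < z' < z + 1 -> 0 < z' by move=> /andP[h _]; lra.
have Lk := L1_kap j.+1 a0 am z0.
have -> : - kint m j.+1 a z = \int[leb]_x (- (expR x ^+ j.+1 * kap m a z x)).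
  rewrite /kint -mulN1r -RintegralZl//.
  by apply: Rint_eq => x _; rewrite mulN1r.
apply: (@is_derive_under_integral _ (fun z x => expR x ^+ j * kap m a z x)
  (fun z x => - (expR x ^+ j.+1 * kap m a z x)) z (z / 2) (z + 1)
  (fun x => kdom m j.+1 a (z / 2) * expR (- (a * `|x|)))) => //.
- by move=> z' /pos z'0; exact: L1_kap.
- move=> z' x _.
  have h3 := is_deriveM1 (is_derive_id z' (1 : R)) (is_derive_cst (expR x : R) z' 1).
  have h4 := is_deriveB1 (is_derive_cst (a * x + (m%:R - a) * ln (1 + expR x) : R) z' 1) h3.
  have h := is_derive_comp1 h4 (is_derive_expR _).
  apply: (is_derive_eq (is_deriveM1 (is_derive_cst (expR x ^+ j : R) z' 1) h)).
  by rewrite /= -/(kap m a z' x) exprS; ring.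
- by move=> x; rewrite mulr_ge0// expR_ge0.
- by apply: L1Z => //; exact: L1_exp_abs.
- move=> z' x zz'; rewrite normrN gtr0_norm ?mulr_gt0 ?exprn_gt0 ?expR_gt0//.
  apply: kap_le_dom => //; rewrite ?lerDl ?ler0n ?(ltW a0) ?divr_gt0//.
  by case/andP: zz' => /ltW.
Qed.

(* Kummer's equation for the decaying solution, obtained by integrating a total
   derivative. *)
Lemma kint_ode m a z : 0 < a -> a <= m%:R + 1 -> 0 < z ->
  z * kint m 2 a z + (z - m%:R - 1) * kint m 1 a z - a * kint m 0 a z = 0.
Proof.
move=> a0 am z0.
have L j := L1_kap j a0 am z0.
pose f x := a * (expR x ^+ 0 * kap m a z x) + (m%:R + 1 - z) * (expR x ^+ 1 * kap m a z x)
  - z * (expR x ^+ 2 * kap m a z x).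
(* The factor 1 + e^x clears the denominator of the logarithmic derivative [kexp_der], so that F' is
   the combination [f] of integrands. *)
pose F x := (1 + expR x) * kap m a z x.
have Lf : L1 leb setT f by apply: L1B => //; [apply: L1D => //|]; exact: L1Z.
have If : \int[leb]_x f x = a * kint m 0 a z + (m%:R + 1 - z) * kint m 1 a z - z * kint m 2 a z.
  rewrite RintegralB//; last 2 first.
  - by apply: L1D => //; exact: L1Z.
  - exact: L1Z.
  rewrite RintegralD//; [|exact: L1Z..].
  by rewrite (RintegralZl _ _ (L 0)) ?(RintegralZl _ _ (L 1)) ?(RintegralZl _ _ (L 2)).
have FE x : F x = expR x ^+ 0 * kap m a z x + expR x ^+ 1 * kap m a z x.
  by rewrite /F expr0 expr1; ring.
pose M := kdom m 0 a z + kdom m 1 a z.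
have FM x : `|F x| <= M * expR (- (a * `|x|)).
  rewrite gtr0_norm ?mulr_gt0 ?oneDexp_gt0 ?kap_gt0// FE mulrDl.
  by rewrite lerD// kap_le_dom// ?lerDl ?ler0n ?addr0// ltW.
have lim0 : (M * expR (- (a * n%:R)) @[n --> \oo] --> (0 : R)).
  rewrite -[0 in X in _ --> X](mulr0 M); apply: cvgM; first exact: cvg_cst.
  apply: (@cvg_comp _ _ _ (fun n : nat => n%:R : R) (fun x : R => expR (- (a * x)))).
    exact: cvgr_idn.
  exact: cvg_expN.
suff : \int[leb]_x f x = 0 by rewrite If => h; rewrite -oppr0 -h; ring.
apply: (@FTC2_real _ F f).
- move=> x; apply: (is_derive_eq (is_deriveM1 (is_deriveD1 (is_derive_cst (1 : R) x 1) (is_derive_expR x)) (is_derive_kap m a z x))).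
  rewrite /f /kexp_der expr0 expr1 /cst /= add0r.
  by field; rewrite gt_eqF// oneDexp_gt0.
- move=> x; apply: cvgB; last by apply: cvgM; [exact: cvg_cst|exact: continuous_expRX_kap].
  by apply: cvgD; (apply: cvgM; [exact: cvg_cst|exact: continuous_expRX_kap]).
- exact: Lf.
- by apply: (cvg0_le _ lim0) => n; rewrite (le_trans (FM _))// ger0_norm.
- by apply: (cvg0_le _ lim0) => n; rewrite (le_trans (FM _))// normrN ger0_norm.
Qed.

Lemma kint_le_dom m j a c z : 0 < c -> c <= a + j%:R -> 0 < a -> a <= m%:R + 1 ->
  0 < z -> kint m j a z <= kdom m j c z * \int[leb]_x expR (- (c * `|x|)).
Proof.
move=> c0 caj a0 am z0; rewrite /kint -RintegralZl//; last exact: L1_exp_abs.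
apply: le_Rintegral => //.
- exact: L1_kap.
- by apply: L1Z => //; exact: L1_exp_abs.
- by move=> x _; apply: kap_le_dom => //; exact: ltW.
Qed.

Lemma kint_decr m j a z0 z : 0 < a -> a <= m%:R + 1 -> 0 < z0 -> z0 <= z ->
  kint m j a z <= kint m j a z0.
Proof.
move=> a0 am z00 z0z; have zp : 0 < z by exact: lt_le_trans z0z.
apply: le_Rintegral => //; [exact: L1_kap|exact: L1_kap|].
move=> x _; rewrite ler_wpM2l ?exprn_ge0 ?expR_ge0// /kap ler_expR lerD2l lerN2.
by rewrite ler_wpM2r ?expR_ge0.
Qed.

(** On the interval [-1/a, 0] of length 1/a the factor e^(a x) is at least 1/e. Hence [kint m 0 a z]
    blows up as a tends to 0, whereas [kint m 1 a z] stays bounded; [exists_neumann] rests on this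
    contrast. *)
Lemma kint0_lower m a z : (0 < m)%N -> 0 < a -> a <= 1 -> 0 < z ->
  expR (- 1 - z) / a <= kint m 0 a z.
Proof.
move=> m0 a0 a1 z0.
have am : a <= m%:R + 1 by rewrite (le_trans a1)// lerDr.
have m1 : 1 <= m%:R :> R by rewrite ler1n.
have L01 := L1_kap 0 a0 am z0.
have e : leb `[(- a^-1), 0] = (a^-1)%:E.
  by rewrite lebesgue_measure_itv/= lte_fin oppr_lt0 invr_gt0 a0 opprK add0e.
apply: (@le_trans _ _ (\int[leb]_(x in `[(- a^-1), 0]) expR (- 1 - z))).
  by rewrite Rintegral_cst// [X in fine X]e.
apply: (@le_trans _ _ (\int[leb]_(x in `[(- a^-1), 0]) (expR x ^+ 0 * kap m a z x))).
  apply: le_Rintegral => //.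
  - by apply: L1_continuous; apply: continuous_subspaceT => x; exact: cvg_cst.
  - exact: (L1S _ _ _ L01).
  - move=> x; rewrite /= in_itv/= => /andP[x1 x2].
    rewrite expr0 mul1r /kap ler_expR.
    have h1 : -1 <= a * x.
      by rewrite -(ler_pM2l a0) mulrN divff ?gt_eqF// in x1.
    have h2 : 0 <= (m%:R - a) * ln (1 + expR x).
      by rewrite mulr_ge0 ?ln1Dexp_ge0// subr_ge0 (le_trans a1).
    have h3 : z * expR x <= z.
      by rewrite ler_piMr ?(ltW z0)// -(expR0 R) ler_expR.
    by lra.
rewrite Rintegral_mkcond; apply: le_Rintegral => //; first exact: L1T_restrict.
by move=> x _; rewrite patchE; case: ifP => // _; rewrite mulr_ge0// ?exprn_ge0 ?expR_ge0.
Qed.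

Lemma continuous_kint m j z a1 a : 0 < a1 -> a1 < a -> a < m%:R + 1 -> 0 < z ->
  {for a, continuous (fun a => kint m j a z)}.
Proof.
move=> a10 a1a am z0.
have aI : a \in `]a1, (m%:R + 1)[%classic by apply/mem_set; rewrite /= in_itv/= a1a.
have itvE a' : `]a1, (m%:R + 1)[%classic a' -> 0 < a' /\ a1 <= a' <= m%:R + 1.
  rewrite /= in_itv/= => /andP[h1 h2]; split; first exact: lt_trans h1.
  by rewrite !ltW.
have H1 a' : `]a1, (m%:R + 1)[%classic a' ->
    leb.-integrable setT (EFin \o (fun x => expR x ^+ j * kap m a' z x)).
  by move=> /itvE[a'0 /andP[_ h]]; exact: L1_kap.
have H2 : {ae leb, forall y, setT y -> {in `]a1, (m%:R + 1)[%classic,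
    continuous (fun a' => expR y ^+ j * kap m a' z y)}}.
  apply: aeW => y _ a' _.
  have h1 := is_deriveM1 (is_derive_id a' (1 : R)) (is_derive_cst (y : R) a' 1).
  have h2 := is_deriveB1 (is_derive_cst (m%:R : R) a' 1) (is_derive_id a' (1 : R)).
  have h3 := is_deriveM1 h2 (is_derive_cst (ln (1 + expR y) : R) a' 1).
  have h4 := is_deriveB1 (is_deriveD1 h1 h3) (is_derive_cst (z * expR y : R) a' 1).
  have h5 := is_derive_comp1 h4 (is_derive_expR _).
  apply: (is_derive_continuous1 (is_deriveM1 (is_derive_cst (expR y ^+ j : R) a' 1) h5)).
have H3 : leb.-integrable setT (EFin \o (fun x => kdom m j a1 z * expR (- (a1 * `|x|)))).
  by apply: L1Z => //; exact: L1_exp_abs.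
have H4 a' : `]a1, (m%:R + 1)[%classic a' -> {ae leb, forall y, setT y ->
    `|expR y ^+ j * kap m a' z y| <= kdom m j a1 z * expR (- (a1 * `|y|))}.
  move=> /itvE[a'0 /andP[h1 h2]]; apply: aeW => y _.
  rewrite gtr0_norm ?mulr_gt0 ?exprn_gt0 ?expR_gt0//.
  by apply: kap_le_dom => //; [rewrite (le_trans h1)// lerDl|exact: ltW].
exact: (continuity_under_integral measurableT H1 H2 H3 H4 aI).
Qed.

(* [a = m] gives the decaying solution [r^-m exp(-b r^2/4)]. *)
Lemma kint_top m z : (0 < m)%N -> 0 < z ->
  m%:R * kint m 0 m%:R z = z * kint m 1 m%:R z.
Proof.
move=> m0 z0.
have a0 : 0 < m%:R :> R by rewrite ltr0n.
have am : m%:R <= m%:R + 1 :> R by rewrite lerDl.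
have L j := L1_kap j a0 am z0.
pose f x := m%:R * (expR x ^+ 0 * kap m m%:R z x) - z * (expR x ^+ 1 * kap m m%:R z x).
have If : \int[leb]_x f x = m%:R * kint m 0 m%:R z - z * kint m 1 m%:R z.
  rewrite RintegralB//; [|exact: L1Z..].
  by rewrite (RintegralZl _ _ (L 0)) ?(RintegralZl _ _ (L 1)).
pose M := kdom m 0 m%:R z.
have FM x : `|kap m m%:R z x| <= M * expR (- (m%:R * `|x|)).
  rewrite gtr0_norm ?kap_gt0// -[leLHS]mul1r -(expr0 (expR x)).
  by rewrite kap_le_dom// ?addr0// ltW.
have lim0 : (M * expR (- (m%:R * n%:R)) @[n --> \oo] --> (0 : R)).
  rewrite -[0 in X in _ --> X](mulr0 M); apply: cvgM; first exact: cvg_cst.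
  apply: (@cvg_comp _ _ _ (fun n : nat => n%:R : R) (fun x : R => expR (- (m%:R * x)))).
    exact: cvgr_idn.
  exact: cvg_expN.
suff : \int[leb]_x f x = 0 by rewrite If => /eqP; rewrite subr_eq0 => /eqP.
apply: (@FTC2_real _ (kap m m%:R z) f).
- move=> x; apply: (is_derive_eq (is_derive_kap m m%:R z x)).
  by rewrite /f /kexp_der expr0 expr1; ring.
- by move=> x; apply: cvgB; (apply: cvgM; [exact: cvg_cst|exact: continuous_expRX_kap]).
- by apply: L1B => //; exact: L1Z.
- by apply: (cvg0_le _ lim0) => n; rewrite (le_trans (FM _))// ger0_norm.
- by apply: (cvg0_le _ lim0) => n; rewrite (le_trans (FM _))// normrN ger0_norm.
Qed.

(** With z = b r^2/2 the equation expresses that [radh] vanishes at r. The intermediate value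
    theorem applies between a small [a], where [kint m 0] dominates, and a = m, where [kint_top]
    gives the opposite sign. *)
Lemma exists_neumann m z : (0 < m)%N -> 0 < z -> z < m%:R ->
  exists a, [/\ 0 < a, a < m%:R + 1 &
    (m%:R - z) * kint m 0 a z = 2 * z * kint m 1 a z].
Proof.
move=> m0 z0 zm.
have m1 : 1 <= m%:R :> R by rewrite ler1n.
pose g a := (m%:R - z) * kint m 0 a z - 2 * z * kint m 1 a z.
pose C := kdom m 1 1 z * \int[leb]_x expR (- (1 * `|x|)).
have C0 : 0 < C.
  by apply: lt_le_trans (kint_le_dom (a := 1) _ _ _ _ _) ;
    rewrite ?kint_gt0// ?lerDl ?lerDr ?ler0n// (le_trans m1)// lerDl.
(* With E = (m - z) e^(-1-z), the inequality 2 z C <= E/d is needed; d = E/(2 z C + E) satisfies it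
   and is below 1, as [kint0_lower] requires. *)
pose d := (m%:R - z) * expR (- 1 - z) / (2 * z * C + (m%:R - z) * expR (- 1 - z)).
have e0 : 0 < (m%:R - z) * expR (- 1 - z) by rewrite mulr_gt0 ?subr_gt0 ?expR_gt0.
have zC : 0 < 2 * z * C by rewrite mulr_gt0// mulr_gt0.
have d0 : 0 < d by rewrite divr_gt0// addr_gt0.
have d1 : d < 1 by rewrite ltr_pdivrMr ?addr_gt0// mul1r ltrDr.
have dm : d <= m%:R + 1 by rewrite (le_trans (ltW d1))// lerDr.
have gd : 0 <= g d.
  rewrite subr_ge0.
  have h1 : kint m 1 d z <= C by apply: kint_le_dom => //; rewrite lerDr ltW.
  have h2 := kint0_lower m0 d0 (ltW d1) z0.
  apply: (@le_trans _ _ (2 * z * C)); first by rewrite ler_wpM2l// mulr_ge0// ltW.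
  apply: (@le_trans _ _ ((m%:R - z) * (expR (- 1 - z) / d))); last first.
    by rewrite ler_wpM2l// subr_ge0 ltW.
  rewrite [leRHS]mulrA ler_pdivlMr// /d mulrA ler_pdivrMr ?addr_gt0// mulrC.
  by rewrite ler_pM2l// lerDl ltW.
have gm : g m%:R <= 0.
  rewrite /g mulrBl kint_top//.
  have k1 : 0 < kint m 1 m%:R z by rewrite kint_gt0// ?lerDl// ltr0n.
  have k0 : 0 < kint m 0 m%:R z by rewrite kint_gt0// ?lerDl// ltr0n.
  have : 0 < z * kint m 0 m%:R z by rewrite mulr_gt0.
  have : 0 < z * kint m 1 m%:R z by rewrite mulr_gt0.
  by rewrite -mulrA; lra.
have dmm : d <= m%:R by rewrite (le_trans (ltW d1)).
have cg : {within `[d, m%:R], continuous g}.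
  apply: continuous_in_subspaceT => a /set_mem/=; rewrite in_itv/= => /andP[da am].
  have h : d / 2 < a by apply: lt_le_trans da; rewrite ltr_pdivrMr// ltr_pMr// ltr1n.
  have d20 : 0 < d / 2 by rewrite divr_gt0.
  have am1 : a < m%:R + 1 by rewrite (le_lt_trans am)// ltrDl.
  by apply: cvgB; (apply: cvgM; [exact: cvg_cst|exact: (continuous_kint d20 h am1 z0)]).
have mm : Num.min (g d) (g m%:R) <= 0 <= Num.max (g d) (g m%:R).
  by apply/andP; split; [rewrite ge_min; apply/orP; right; exact: gm|rewrite le_max; apply/orP; left; exact: gd].
have [a] := IVT dmm cg mm.
rewrite in_itv/= => /andP[da am] ga; exists a; split.
- exact: lt_le_trans da.
- by rewrite (le_lt_trans am)// ltrDl.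
- by apply/eqP; rewrite -subr_eq0; apply/eqP.
Qed.
End confluent.

(** * Radial eigenfunctions and supersolutions *)

Ltac pos := solve [repeat first
  [ done | assumption | apply: normr_ge0 | apply: expR_gt0 | apply: expR_ge0 | apply: ltr01 | apply: ler01
  | apply: ler0n | apply: ltr0Sn | apply: sqr_ge0
  | apply: mulr_gt0 | apply: exprn_gt0 | rewrite invr_gt0 | apply: addr_gt0
  | match goal with |- is_true (0 <= _ * _)%R => apply: mulr_ge0 end
  | apply: exprn_ge0 | rewrite invr_ge0
  | match goal with |- is_true (0 <= _ + _)%R => apply: addr_ge0 end
  | match goal with |- is_true (0 <= _)%R => apply: ltW end ]].

Section radial.
Context {R : realType}.
Local Notation leb := (@lebesgue_measure R).
Local Notation RT := (measurableTypeR R).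
Implicit Types (a b r : R) (m : nat).

(* Radial part of the eigenfunction [f(r) e^(i m theta)] with eigenvalue
   [b (1 - 2 a)], and its logarithmic derivative. *)
Definition rad0 m a b r := r ^+ m * expR (- (b * r ^+ 2 / 4)) * kint m 0 a (b * r ^+ 2 / 2).

Definition radh m a b r := m%:R / r - b * r / 2
  - b * r * (kint m 1 a (b * r ^+ 2 / 2) / kint m 0 a (b * r ^+ 2 / 2)).

Definition pot (n : int) b r := (n%:~R / r - b * r / 2) ^+ 2.

(** The radial equation f'' + f'/r = (V - lam) f, solved for h' after the substitution h = f'/f. *)
Definition radh' m a b r :=
  pot m b r - b * (1 - 2 * a) - radh m a b r / r - radh m a b r ^+ 2.

Section eigen.
Variables (m : nat) (a b : R).
Hypotheses (a0 : 0 < a) (am : a <= m%:R + 1) (b0 : 0 < b).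

Let z_gt0 r : 0 < r -> 0 < b * r ^+ 2 / 2.
Proof. by move=> r0; rewrite divr_gt0// mulr_gt0// exprn_gt0. Qed.

Let is_derive_kintr j r : 0 < r ->
  is_derive r 1 (fun r => kint m j a (b * r ^+ 2 / 2)) (- (b * r * kint m j.+1 a (b * r ^+ 2 / 2))).
Proof.
move=> r0.
have h1 := is_deriveM1 (is_derive_cst (b : R) r 1) (is_derive_idX1 r 2).
have h2 := is_deriveM1 h1 (is_derive_cst (2^-1 : R) r 1).
have h := is_derive_comp1 h2 (is_derive_kint j a0 am (z_gt0 r0)).
by apply: (is_derive_eq h); rewrite /= /cst expr1; field.
Qed.

Lemma rad0_gt0 r : 0 < r -> 0 < rad0 m a b r.
Proof. by move=> r0; rewrite !mulr_gt0 ?exprn_gt0 ?expR_gt0// kint_gt0// z_gt0. Qed.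

Lemma is_derive_rad0 r : 0 < r ->
  is_derive r 1 (rad0 m a b) (rad0 m a b r * radh m a b r).
Proof.
move=> r0.
have k0 := kint_gt0 0 a0 am (z_gt0 r0).
have h1 := is_deriveM1 (is_derive_cst (b : R) r 1) (is_derive_idX1 r 2).
have h2 := is_deriveM1 h1 (is_derive_cst (4^-1 : R) r 1).
have h2' := is_deriveB1 (is_derive_cst (0 : R) r 1) h2.
have h3 := is_derive_comp1 h2' (is_derive_expR _).
have h := is_deriveM1 (is_deriveM1 (is_derive_idX1 r m) h3) (is_derive_kintr 0 r0).
have -> : rad0 m a b = (fun r => r ^+ m * expR (0 - b * r ^+ 2 / 4) * kint m 0 a (b * r ^+ 2 / 2)).
  by apply/funext => x; rewrite sub0r.
apply: (is_derive_eq h); rewrite /= /cst /rad0 /radh sub0r expr1.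
have -> : m%:R * r ^+ m.-1 = r ^+ m * (m%:R / r).
  by case: m => [|k] /=; [rewrite !mul0r mulr0|rewrite exprS; field; rewrite gt_eqF].
move: k0; set K0 := kint m 0 a _; set K1 := kint m 1 a _ => k0.
by field; rewrite !gt_eqF.
Qed.

(** The quotient rule brings in [kint m 2]; Kummer's equation eliminates it, and what remains is the
    Riccati equation. *)
Lemma is_derive_radh r : 0 < r -> is_derive r 1 (radh m a b) (radh' m a b r).
Proof.
move=> r0.
have k0 := kint_gt0 0 a0 am (z_gt0 r0).
have k0' : kint m 0 a (b * r ^+ 2 / 2) != 0 by rewrite gt_eqF.
have r0' : r != 0 by rewrite gt_eqF.
have ode := kint_ode a0 am (z_gt0 r0).
have d1 := is_deriveM1 (is_derive_cst (m%:R : R) r 1) (is_deriveV1 r0' (is_derive_id r (1 : R))).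
have d2 := is_deriveM1 (is_deriveM1 (is_derive_cst (b : R) r 1) (is_derive_id r (1 : R))) (is_derive_cst (2^-1 : R) r 1).
have d3 := is_deriveM1 (is_derive_kintr 1 r0) (is_deriveV1 (f := fun r => kint m 0 a (b * r ^+ 2 / 2)) k0' (is_derive_kintr 0 r0)).
have d4 := is_deriveM1 (is_deriveM1 (is_derive_cst (b : R) r 1) (is_derive_id r (1 : R))) d3.
have d := is_deriveB1 (is_deriveB1 d1 d2) d4.
apply: (is_derive_eq d); rewrite /= /cst /radh' /radh /pot.
move: k0' ode; set K0 := kint m 0 a _; set K1 := kint m 1 a _; set K2 := kint m 2 a _ => k0' ode.
have -> : K2 = (a * K0 - (b * r ^+ 2 / 2 - m%:R - 1) * K1) / (b * r ^+ 2 / 2).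
  apply/eqP; rewrite eq_sym -subr_eq0 -[X in _ == X](mulr0 (- (b * r ^+ 2 / 2)^-1)) -ode; apply/eqP.
  by field; rewrite r0' gt_eqF.
by rewrite -pmulrn; field; rewrite r0' k0' gt_eqF.
Qed.

Lemma continuous_radh' r : 0 < r -> {for r, continuous (radh' m a b)}.
Proof.
move=> r0.
have r0' : r != 0 by rewrite gt_eqF.
have dh := is_derive_radh r0.
have di := is_deriveV1 r0' (is_derive_id r (1 : R)).
have d1 := is_deriveM1 (is_derive_cst (m%:~R : R) r 1) di.
have d2 := is_deriveM1 (is_deriveM1 (is_derive_cst (b : R) r 1) (is_derive_id r (1 : R))) (is_derive_cst (2^-1 : R) r 1).
have d3 := is_deriveX1 2 (is_deriveB1 d1 d2).
have d4 := is_deriveB1 d3 (is_derive_cst (b * (1 - 2 * a) : R) r 1).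
exact: (is_derive_continuous1 (is_deriveB1 (is_deriveB1 d4 (is_deriveM1 dh di)) (is_deriveX1 2 dh))).
Qed.

(** Up to [r1] the bound is continuity on a compact interval. Beyond [r1] one has z = b r^2/2 >= m +
    2, and Kummer's equation with [kint m 2] > 0 gives [kint m 1] <= a [kint m 0], which makes the
    last term of [radh] at most a b r. *)
Lemma radh_le r0 : 0 < r0 -> exists2 C, 0 < C & forall r, r0 <= r -> `|radh m a b r| <= C * r.
Proof.
move=> r00.
pose r1 := Num.max r0 (Num.max 1 (2 * (m%:R + 2) / b)).
have r01 : r0 <= r1 by rewrite le_max lexx.
have ch : {within `[r0, r1], continuous (fun r => `|radh m a b r|)}.
  apply: continuous_in_subspaceT => r /set_mem/=; rewrite in_itv/= => /andP[h _].
  have rp : 0 < r by exact: lt_le_trans h.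
  exact: (continuous_comp (is_derive_continuous1 (is_derive_radh rp)) (@norm_continuous _ _ _)).
have [c _ cM] := EVT_max r01 ch.
pose M := `|radh m a b c|.
pose C := M / r0 + m%:R / r0 ^+ 2 + b / 2 + b * a + 1.
have M0 : 0 <= M by exact: normr_ge0.
have t1 : 0 <= M / r0 by pos.
have t2 : 0 <= m%:R / r0 ^+ 2 by rewrite divr_ge0// exprn_ge0// ltW.
have t3 : 0 <= b / 2 by rewrite divr_ge0// ltW.
have t4 : 0 <= b * a by rewrite mulr_ge0// ltW.
exists C => [|r r0r]; first by rewrite ltr_wpDl// !addr_ge0.
have rp : 0 < r by exact: lt_le_trans r0r.
have [rr1|rr1] := leP r r1.
  apply: (@le_trans _ _ M); first by apply: cM; rewrite in_itv/= r0r.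
  apply: (@le_trans _ _ (M / r0 * r)).
    by rewrite mulrAC ler_pdivlMr// ler_wpM2l.
  by rewrite ler_wpM2r// ?(ltW rp)// /C; lra.
have r_ge1 : 1 <= r by rewrite (le_trans _ (ltW rr1))// /r1 !le_max lexx orbT.
have rz : m%:R + 2 <= b * r ^+ 2 / 2.
  have h : 2 * (m%:R + 2) / b <= r by rewrite (le_trans _ (ltW rr1))// /r1 !le_max lexx !orbT.
  have h2 : r <= r ^+ 2 by rewrite expr2 ler_peMl// ltW.
  rewrite ler_pdivrMr// in h; rewrite ler_pdivlMr// [leLHS]mulrC (le_trans h)// mulrC.
  by rewrite ler_wpM2l// ltW.
have k0 := kint_gt0 0 a0 am (z_gt0 rp).
have k1 := kint_gt0 1 a0 am (z_gt0 rp).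
have k2 := kint_gt0 2 a0 am (z_gt0 rp).
have ode := kint_ode a0 am (z_gt0 rp).
rewrite /radh; move: (z_gt0 rp) k0 k1 k2 ode rz.
set z := b * r ^+ 2 / 2.
set K0 := kint m 0 a _; set K1 := kint m 1 a _; set K2 := kint m 2 a _ => z0 k0 k1 k2 ode rz.
have qa : K1 / K0 <= a.
  rewrite ler_pdivrMr//.
  have h1 : 0 < z * K2 by rewrite mulr_gt0.
  have h2 : K1 <= (z - m%:R - 1) * K1 by rewrite ler_peMl ?(ltW k1)//; lra.
  by lra.
have q0 : 0 < K1 / K0 by rewrite divr_gt0.
have bq : b * r * (K1 / K0) <= b * a * r.
  by rewrite mulrAC ler_wpM2r ?(ltW rp)// ler_wpM2l// ltW.
have bq0 : 0 <= b * r * (K1 / K0) by rewrite !mulr_ge0 ?invr_ge0 ?ltW.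
have mr : m%:R / r <= m%:R / r0 ^+ 2 * r.
  rewrite ler_pdivrMr// -[leRHS]mulrA -expr2 [leRHS]mulrAC ler_pdivlMr ?exprn_gt0//.
  by rewrite ler_wpM2l// lerXn2r// nnegrE ltW.
have mr0 : 0 <= m%:R / r by rewrite divr_ge0// ltW.
have br0 : 0 <= b * r by rewrite mulr_ge0 ?ltW.
have Mr : 0 <= M / r0 * r by rewrite mulr_ge0// ltW.
rewrite /C ler_norml; apply/andP; split; last first.
  by rewrite !mulrDl mulrAC; lra.
by rewrite !mulrDl (mulrAC b); lra.
Qed.

(** With n = m + 3, the Taylor bound x^n/n! <= e^x turns the Gaussian into a constant times r^(-2n).
    This outweighs the growth r^n, and the remaining factor [kint] decreases in r. *)
Lemma rad0_decay r0 : 0 < r0 -> exists2 K, 0 <= K & forall r, r0 <= r -> rad0 m a b r * r ^+ 3 <= K.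
Proof.
move=> r00.
pose I0 := kint m 0 a (b * r0 ^+ 2 / 2).
have I00 : 0 < I0 by rewrite kint_gt0// z_gt0.
pose n := (m + 3)%N.
pose K := n`!%:R * (4 / b) ^+ n / r0 ^+ n * I0.
exists K => [|r r0r].
  by rewrite !mulr_ge0 ?invr_ge0 ?exprn_ge0 ?divr_ge0 ?ler0n// ltW.
have rp : 0 < r by exact: lt_le_trans r0r.
have kI : kint m 0 a (b * r ^+ 2 / 2) <= I0.
  apply: kint_decr => //; first exact: z_gt0.
  rewrite ler_pM2r ?invr_gt0// ler_wpM2l ?(ltW b0)//.
  by rewrite lerXn2r// nnegrE ltW.
have x0 : 0 < b * r ^+ 2 / 4 by rewrite divr_gt0// mulr_gt0// exprn_gt0.
have ex : expR (- (b * r ^+ 2 / 4)) <= n`!%:R * (4 / b) ^+ n / r ^+ n / r ^+ n.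
  rewrite expRN -[leRHS]invrK lef_pV2 ?posrE ?expR_gt0//; last first.
    by rewrite !invr_gt0 !mulr_gt0 ?invr_gt0 ?exprn_gt0 ?divr_gt0 ?ltr0n ?fact_gt0.
  have h : (b * r ^+ 2 / 4) ^+ n / n`!%:R <= expR (b * r ^+ 2 / 4).
    by rewrite (le_trans _ (expR_ge1Dxn n.-1 (ltW x0)))// /n addn3/= lerDr.
  apply: le_trans h; rewrite le_eqVlt; apply/orP; left; apply/eqP.
  rewrite !invfM !invrK !expr_div_n exprMn -exprM mulnC exprM expr2.
  by field; rewrite !expf_neq0 ?gt_eqF ?ltr0n ?fact_gt0.
have step : rad0 m a b r * r ^+ 3 <= r ^+ n * (n`!%:R * (4 / b) ^+ n / r ^+ n / r ^+ n) * I0.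
  rewrite /rad0 mulrAC [X in X * _]mulrAC -exprD.
  have r1 : 0 <= r ^+ n by pos.
  have k1 := ltW (kint_gt0 0 a0 am (z_gt0 rp)).
  apply: ler_pM => //; first by rewrite mulr_ge0// expR_ge0.
  by rewrite -/n; exact: (ler_wpM2l r1 ex).
apply: (le_trans step); rewrite /K ler_wpM2r ?(ltW I00)//.
rewrite mulrC mulrVK ?unitfE ?expf_neq0 ?gt_eqF//.
apply: ler_wpM2l; first by pos.
by rewrite lef_pV2 ?posrE ?exprn_gt0// lerXn2r// nnegrE ltW.
Qed.

End eigen.

(* For a positive solution [f] of the radial equation with energy [lam] in the
   mode [n], [h = f' / f] satisfies the Riccati inequality with equality. *)
Definition supersolution (n : int) b lam r0 (h h' : R -> R) :=
  [/\ forall r, r0 <= r -> is_derive r 1 h (h' r),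
      {within `[r0, +oo[, continuous h'},
      forall r, r0 <= r -> h' r + h r / r + h r ^+ 2 <= pot n b r - lam,
      h r0 <= 0 &
      exists2 C, 0 < C & forall r, r0 <= r -> `|h r| <= C * r].

Lemma within_rightray (f : R -> R) r0 : (forall r, r0 <= r -> {for r, continuous f}) ->
  {within `[r0, +oo[, continuous f}.
Proof.
move=> H; apply: continuous_in_subspaceT => r /set_mem/=; rewrite in_itv/= andbT; exact: H.
Qed.

Lemma supersolution_le n b lam lam' r0 h h' : lam <= lam' ->
  supersolution n b lam' r0 h h' -> supersolution n b lam r0 h h'.
Proof.
move=> ll [H1 H2 H3 H4 H5]; split=> // r r0r.
by rewrite (le_trans (H3 r r0r))// lerD2l lerN2.
Qed.

Lemma supersolution_radh m a b r0 : 0 < a -> a <= m%:R + 1 -> 0 < b -> 0 < r0 ->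
  radh m a b r0 = 0 ->
  supersolution m b (b * (1 - 2 * a)) r0 (radh m a b) (radh' m a b).
Proof.
move=> a0 am b0 r00 h0.
have rp r : r0 <= r -> 0 < r by exact: lt_le_trans.
split.
- by move=> r /rp; exact: is_derive_radh.
- by apply: within_rightray => r /rp; exact: continuous_radh'.
- by move=> r _; rewrite le_eqVlt /radh'; apply/orP; left; apply/eqP; ring.
- by rewrite h0.
- exact: radh_le.
Qed.

Let is_derive_lin (c b r : R) : 0 < r ->
  is_derive r 1 (fun r => c / r - b * r / 2) (- c / r ^+ 2 - b / 2).
Proof.
move=> r0; have r0' : r != 0 by rewrite gt_eqF.
have d1 := is_deriveM1 (is_derive_cst (c : R) r 1) (is_deriveV1 r0' (is_derive_id r (1 : R))).
have d2 := is_deriveM1 (is_deriveM1 (is_derive_cst (b : R) r 1) (is_derive_id r (1 : R))) (is_derive_cst (2^-1 : R) r 1).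
by apply: (is_derive_eq (is_deriveB1 d1 d2)); rewrite /= /cst; field.
Qed.

Lemma lin_le (c b r0 r : R) : 0 < b -> 0 < r0 -> r0 <= r ->
  `|c / r - b * r / 2| <= (`|c| / r0 ^+ 2 + b) * r.
Proof.
move=> b0 r00 r0r; have rp : 0 < r by exact: lt_le_trans r0r.
apply: (le_trans (ler_normB _ _)); rewrite mulrDl; apply: lerD.
  rewrite normrM normfV (gtr0_norm rp) ler_pdivrMr// -[leRHS]mulrA -expr2 [leRHS]mulrAC ler_pdivlMr ?exprn_gt0//.
  by rewrite ler_wpM2l// lerXn2r// nnegrE ltW.
have br : 0 <= b * r by rewrite mulr_ge0 ?ltW.
by rewrite ger0_norm ?divr_ge0// ler_pdivrMr// ler_peMr// ler1n.
Qed.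

(** The logarithmic derivative of r^n e^(-b r^2/4), a lowest Landau level function: it solves the
    Riccati equation exactly with energy [b], and it is negative when n <= 0. *)
Lemma supersolution_neg (n : int) b lam r0 : n <= 0 -> 0 < b -> lam <= b -> 0 < r0 ->
  supersolution n b lam r0 (fun r => n%:~R / r - b * r / 2) (fun r => - n%:~R / r ^+ 2 - b / 2).
Proof.
move=> n0 b0 lb r00.
have rp r : r0 <= r -> 0 < r by exact: lt_le_trans.
split.
- by move=> r /rp; exact: is_derive_lin.
- apply: within_rightray => r /rp rp'; have r20 : r ^+ 2 != 0 by rewrite expf_neq0// gt_eqF.
  have d1 := is_deriveV1 (f := fun x => x ^+ 2) r20 (is_derive_idX1 r 2).
  exact: (is_derive_continuous1 (is_deriveB1 (is_deriveM1 (is_derive_cst (- n%:~R : R) r 1) d1) (is_derive_cst (b / 2 : R) r 1))).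
- move=> r /rp rp'; rewrite /pot.
  have -> : - n%:~R / r ^+ 2 - b / 2 + (n%:~R / r - b * r / 2) / r + (n%:~R / r - b * r / 2) ^+ 2
    = (n%:~R / r - b * r / 2) ^+ 2 - b by field; rewrite gt_eqF.
  by rewrite lerD2l lerN2.
- rewrite subr_le0 (@le_trans _ _ 0)//; last by rewrite divr_ge0// mulr_ge0// ltW.
  by rewrite ler_pdivrMr// mul0r lerz0.
- exists (`|n%:~R| / r0 ^+ 2 + b) => [|r]; last exact: lin_le.
  by rewrite ltr_wpDl// divr_ge0// exprn_ge0// ltW.
Qed.

(** For n > 0 the Landau slope n/r - b r/2 may be positive at [r0]; the factor 1 - r0^2/r^2 makes it
    vanish there. The hypothesis is the price of this factor in the Riccati inequality. *)
Lemma supersolution_large (n : int) b lam r0 : 0 < b -> 0 < r0 -> 0 <= b - lam ->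
  (forall r, r0 <= r ->
    b + (r ^+ 2)^-1 <= ((n%:~R - 1) / r - b * r / 2) ^+ 2 + (b - lam) * r ^+ 2 / r0 ^+ 2) ->
  exists h h', supersolution n b lam r0 h h'.
Proof.
move=> b0 r00 bl H.
have rp r : r0 <= r -> 0 < r by exact: lt_le_trans.
pose g r : R := n%:~R / r - b * r / 2.
pose g' r : R := - n%:~R / r ^+ 2 - b / 2.
pose ph r : R := 1 - r0 ^+ 2 * (r ^+ 2)^-1.
pose ph' r : R := 2 * r0 ^+ 2 / r ^+ 3.
have dV r : 0 < r -> is_derive r 1 (fun r => (r ^+ 2)^-1) (- (2 / r ^+ 3)).
  move=> r0'; have r20 : r ^+ 2 != 0 by rewrite expf_neq0// gt_eqF.
  apply: (is_derive_eq (is_deriveV1 (f := fun x => x ^+ 2) r20 (is_derive_idX1 r 2))).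
  by rewrite expr1; field; rewrite gt_eqF.
have dph r : 0 < r -> is_derive r 1 ph (ph' r).
  move=> r0'.
  apply: (is_derive_eq (is_deriveB1 (is_derive_cst (1 : R) r 1) (is_deriveM1 (is_derive_cst (r0 ^+ 2 : R) r 1) (dV r r0')))).
  by rewrite /ph' /cst /=; ring.
exists (fun r => ph r * g r), (fun r => ph' r * g r + ph r * g' r); split.
- move=> r /rp r0'; apply: (is_derive_eq (is_deriveM1 (dph r r0') (is_derive_lin _ b r0'))).
  by rewrite /g /g'.
- apply: within_rightray => r /rp r0'.
  have r30 : r ^+ 3 != 0 by rewrite expf_neq0// gt_eqF.
  have d3 := is_deriveV1 (f := fun x => x ^+ 3) r30 (is_derive_idX1 r 3).
  have dg' := is_deriveB1 (is_deriveM1 (is_derive_cst (- n%:~R : R) r 1) (dV r r0')) (is_derive_cst (b / 2 : R) r 1).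
  exact: (is_derive_continuous1 (is_deriveD1 (is_deriveM1 (is_deriveM1 (is_derive_cst (2 * r0 ^+ 2 : R) r 1) d3) (is_derive_lin _ b r0')) (is_deriveM1 (dph r r0') dg'))).
- move=> r r0r; have r0' := rp _ r0r.
  have s0 : 0 < r0 ^+ 2 / r ^+ 2 by rewrite divr_gt0 ?exprn_gt0.
  have s1 : r0 ^+ 2 / r ^+ 2 <= 1.
    by rewrite ler_pdivrMr ?exprn_gt0// mul1r lerXn2r// nnegrE ltW.
  have := H r r0r; rewrite -subr_ge0 => Hr.
  rewrite -subr_ge0 /pot.
  (* With s = r0^2/r^2 and g the Landau slope, the Riccati defect is s times the difference of the
     two sides of the hypothesis, plus s (1 - s) g^2. *)
  have -> : (n%:~R / r - b * r / 2) ^+ 2 - lam - (ph' r * g r + ph r * g' r + ph r * g r / r + (ph r * g r) ^+ 2)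
    = r0 ^+ 2 / r ^+ 2 * (((n%:~R - 1) / r - b * r / 2) ^+ 2 + (b - lam) * r ^+ 2 / r0 ^+ 2 - (b + (r ^+ 2)^-1))
      + (r0 ^+ 2 / r ^+ 2 * (1 - r0 ^+ 2 / r ^+ 2)) * g r ^+ 2.
    by rewrite /ph' /ph /g' /g; field; rewrite !gt_eqF.
  have s2 : 0 <= 1 - r0 ^+ 2 / r ^+ 2 by rewrite subr_ge0.
  have s0' := ltW s0.
  apply: addr_ge0; first exact: mulr_ge0.
  by apply: mulr_ge0; [exact: mulr_ge0|exact: sqr_ge0].
- by rewrite /ph divff ?expf_neq0 ?gt_eqF// subrr mul0r.
- exists (`|n%:~R| / r0 ^+ 2 + b) => [|r r0r].
    by rewrite ltr_wpDl// divr_ge0// exprn_ge0// ltW.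
  rewrite normrM (le_trans _ (lin_le _ b0 r00 r0r))// ler_piMl// /ph.
  have s1 : r0 ^+ 2 / r ^+ 2 <= 1.
    by rewrite ler_pdivrMr ?exprn_gt0 ?rp// mul1r lerXn2r// nnegrE ltW ?rp.
  rewrite ger0_norm ?subr_ge0// gerBl divr_ge0// exprn_ge0// ltW// rp//.
Qed.

Lemma neumann_mode m b r0 : (0 < m)%N -> 0 < b -> 0 < r0 -> b * r0 ^+ 2 < 2 ->
  exists a, [/\ 0 < a, a <= m%:R + 1 & radh m a b r0 = 0].
Proof.
move=> m0 b0 r00 br.
have z0 : 0 < b * r0 ^+ 2 / 2 by rewrite divr_gt0// mulr_gt0// exprn_gt0.
have zm : b * r0 ^+ 2 / 2 < m%:R.
  by apply: (@lt_le_trans _ _ 1); rewrite ?ler1n// ltr_pdivrMr// mul1r.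
have [a [a0 am aE]] := exists_neumann m0 z0 zm.
exists a; split => //; first exact: ltW.
have k0 := kint_gt0 0 a0 (ltW am) z0.
rewrite /radh; move: k0 aE; set K0 := kint m 0 _ _; set K1 := kint m 1 _ _ => k0 aE.
have r0n : r0 != 0 by rewrite gt_eqF.
have k0n : K0 != 0 by rewrite gt_eqF.
have -> : m%:R / r0 - b * r0 / 2 - b * r0 * (K1 / K0) =
  ((m%:R - b * r0 ^+ 2 / 2) * K0 - 2 * (b * r0 ^+ 2 / 2) * K1) / (r0 * K0).
  by field; rewrite r0n k0n.
by rewrite aE subrr mul0r.
Qed.

(* The minimizing angular mode need not be identified: the modes [n <= 0] and
   the large modes have the explicit supersolution
   [(1 - c r0^2 / r^2) (n / r - b r / 2)] with [c = 0] or [1], and the minimum is taken over the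
   finitely many remaining ones. *)
Lemma spectral_gap b r0 : 0 < b -> 0 < r0 -> b * r0 ^+ 2 < 2 ->
  exists m a, [/\ (0 < m)%N, 0 < a, a <= m%:R + 1, radh m a b r0 = 0 &
    forall n : int, exists h h', supersolution n b (b * (1 - 2 * a)) r0 h h'].
Proof.
move=> b0 r00 br.
have [aa Haa] : exists aa : nat -> R, forall m, (0 < m)%N ->
    [/\ 0 < aa m, aa m <= m%:R + 1 & radh m (aa m) b r0 = 0].
  have /choice[aa H] : forall m, exists a, (0 < m)%N -> [/\ 0 < a, a <= m%:R + 1 & radh m a b r0 = 0].
    move=> m; have [m0|m0] := boolP (0 < m)%N; last by exists 0.
    by have [a Ha] := neumann_mode m0 b0 r00 br; exists a.
  by exists aa.
have [a10 a11 _] := Haa 1%N isT.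
pose d := 2 * aa 1%N * b.
have d0 : 0 < d by rewrite !mulr_gt0.
pose K := 1 + b + (r0 ^+ 2)^-1.
have i0 : 0 < (r0 ^+ 2)^-1 by rewrite invr_gt0 exprn_gt0.
have K1 : 1 <= K by rewrite /K; lra.
(* [K] bounds the left-hand side of the hypothesis of [supersolution_large]. Beyond [r1] the
   quadratic term with coefficient [d] alone exceeds [K]; below [r1] the square does so as soon as
   the mode is larger than [N]. *)
pose r1 := Num.max 1 (K * r0 ^+ 2 / d).
have r1_gt0 : 0 < r1 by rewrite lt_max ltr01.
pose N := Num.Def.archi_bound (1 + r1 * (K + b * r1 / 2)).
have Nbig : 1 + r1 * (K + b * r1 / 2) < N%:R.
  have K0 : 0 <= K by exact: le_trans K1.
  by apply: archi_boundP; pos.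
pose i0' : 'I_N.+1 := ord0.
(* The largest [a] among the modes 1 to N + 1, hence the least energy b (1 - 2 a). *)
pose mm := [arg max_(i > i0') aa (val i).+1]%O.
have mmax : forall i : 'I_N.+1, aa (val i).+1 <= aa (val mm).+1.
  by move=> i; rewrite /mm; case: arg_maxP => //= j _; apply.
have [am0 am1 amh] := Haa (val mm).+1 isT.
exists (val mm).+1, (aa (val mm).+1); split=> // n.
have lle a' : a' <= aa (val mm).+1 -> b * (1 - 2 * aa (val mm).+1) <= b * (1 - 2 * a').
  by move=> h; rewrite ler_pM2l// lerD2l lerN2 ler_pM2l.
have [n0|n0] := leP n 0.
  exists (fun r => n%:~R / r - b * r / 2), (fun r => - n%:~R / r ^+ 2 - b / 2).
  apply: supersolution_neg => //.
  by rewrite -[leRHS]mulr1 ler_pM2l// gerBl mulr_ge0// ltW.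
case: n n0 => // -[//|k] _.
have [kN|kN] := leqP k N.
  have [ak0 ak1 akh] := Haa k.+1 isT.
  exists (radh k.+1 (aa k.+1) b), (radh' k.+1 (aa k.+1) b).
  apply: (supersolution_le _ (supersolution_radh ak0 ak1 b0 r00 akh)).
  have kN1 : (k < N.+1)%N by [].
  exact: lle (mmax (Ordinal kN1)).
(* The energy of the mode 1 is enough for the large modes, since it is at least the minimum. *)
suff [h [h' S]] : exists h h', supersolution k.+1 b (b * (1 - 2 * aa 1%N)) r0 h h'.
  by exists h, h'; apply: (supersolution_le _ S); exact: lle (mmax ord0).
have dE : b - b * (1 - 2 * aa 1%N) = d by rewrite /d; ring.
apply: supersolution_large => //; rewrite dE; first exact: ltW.
move=> r r0r; have rp : 0 < r by exact: lt_le_trans r0r.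
have irr : (r ^+ 2)^-1 <= (r0 ^+ 2)^-1.
  by rewrite lef_pV2 ?posrE ?exprn_gt0// lerXn2r// nnegrE ltW.
have dr0 : 0 <= d * r ^+ 2 / r0 ^+ 2.
  by rewrite !mulr_ge0 ?invr_ge0 ?exprn_ge0 ?ltW.
apply: (@le_trans _ _ K); first by rewrite /K; lra.
have [r1r|rr1] := leP r1 r.
  apply: (@le_trans _ _ (d * r ^+ 2 / r0 ^+ 2)); last by rewrite lerDr sqr_ge0.
  rewrite ler_pdivlMr ?exprn_gt0//.
  have h : K * r0 ^+ 2 / d <= r by rewrite (le_trans _ r1r)// le_max lexx orbT.
  have h1 : 1 <= r by rewrite (le_trans _ r1r)// le_max lexx.
  rewrite ler_pdivrMr// in h; rewrite (le_trans h)// [leLHS]mulrC ler_wpM2l ?(ltW d0)//.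
  by rewrite expr2 ler_peMl// ltW.
apply: (@le_trans _ _ (((k.+1%:Z%:~R - 1) / r - b * r / 2) ^+ 2)); last by rewrite lerDl.
have hg : K <= (k.+1%:Z%:~R - 1) / r - b * r / 2.
  rewrite lerBrDr ler_pdivlMr//.
  have -> : k.+1%:Z%:~R - 1 = k%:R :> R by rewrite -pmulrn -natr1 addrK.
  have kk : N%:R + 1 <= k%:R :> R by rewrite natr1 ler_nat.
  have h1 : (K + b * r / 2) * r <= r1 * (K + b * r1 / 2).
    rewrite [leRHS]mulrC ler_pM// ?(ltW rp) ?(ltW rr1)//.
      by rewrite addr_ge0 ?(le_trans ler01 K1)// divr_ge0// mulr_ge0// ltW.
    by rewrite lerD2l ler_pM2r ?invr_gt0// ler_pM2l// ltW.
  by apply: (le_trans h1); lra.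
by rewrite (le_trans hg)// expr2 ler_peMl ?(le_trans K1 hg)// (le_trans _ hg)// (le_trans ler01).
Qed.

(* Energy density minus [b (1 - 2 a)] times mass density of the trial
   function. *)
Definition excess m a b r :=
  rad0 m a b r ^+ 2 * (radh m a b r ^+ 2 + pot m b r - b * (1 - 2 * a)).

(** * Decay, total integral and sign change of the excess density *)

Section bathtub.
Variables (m : nat) (a b r0 : R).
Hypotheses (a0 : 0 < a) (am : a <= m%:R + 1) (b0 : 0 < b) (r00 : 0 < r0).
Hypothesis h0 : radh m a b r0 = 0.

Lemma continuous_excess r : 0 < r -> {for r, continuous (excess m a b)}.
Proof.
move=> rp; have r0' : r != 0 by rewrite gt_eqF.
have dh := is_derive_radh a0 am b0 rp.
have d0 := is_derive_rad0 a0 am b0 rp.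
have dg := is_derive_lin m%:~R b rp.
exact: (is_derive_continuous1 (is_deriveM1 (is_deriveX1 2 d0) (is_deriveB1 (is_deriveD1 (is_deriveX1 2 dh) (is_deriveX1 2 dg)) (is_derive_cst (b * (1 - 2 * a) : R) r 1)))).
Qed.

(** Both [radh^2] and [pot] are O(r^2), so the product is at most a constant times the square of the
    bounded quantity [rad0] r^3. The power r^4 makes every density below O(r^(-3)) after
    multiplication by r. *)
Lemma excess_decay r1 : 0 < r1 -> exists2 K, 0 <= K & forall r, r1 <= r ->
  rad0 m a b r ^+ 2 * (1 + r ^+ 2 + radh m a b r ^+ 2 + pot m b r) * r ^+ 4 <= K.
Proof.
move=> r10.
have [K K0 HK] := rad0_decay a0 am b0 r10.
have [C C0 HC] := radh_le a0 am b0 r10.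
pose C2 := `|m%:~R : R| / r1 ^+ 2 + b.
have C20 : 0 < C2.
  by rewrite /C2 ltr_wpDl// divr_ge0// exprn_ge0// ltW.
pose D := (r1 ^+ 2)^-1 + 1 + C ^+ 2 + C2 ^+ 2.
exists (K ^+ 2 * D) => [|r r1r]; first by rewrite /D; pos.
have rp : 0 < r by exact: lt_le_trans r1r.
have e1 : radh m a b r ^+ 2 <= C ^+ 2 * r ^+ 2.
  rewrite -exprMn -[leLHS]real_normK ?num_real// lerXn2r// ?nnegrE ?normr_ge0 ?HC//.
  by apply: mulr_ge0; exact: ltW.
have e2 : pot m b r <= C2 ^+ 2 * r ^+ 2.
  rewrite -exprMn /pot -[leLHS]real_normK ?num_real// lerXn2r// ?nnegrE ?normr_ge0 ?lin_le//.
  by apply: mulr_ge0; exact: ltW.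
have e3 : 1 <= (r1 ^+ 2)^-1 * r ^+ 2.
  rewrite mulrC ler_pdivlMr ?exprn_gt0// mul1r lerXn2r// nnegrE ltW//.
have e4 : 1 + r ^+ 2 + radh m a b r ^+ 2 + pot m b r <= D * r ^+ 2.
  by rewrite /D !mulrDl mul1r; move: e1 e2 e3; lra.
have f0 := ltW (rad0_gt0 a0 am b0 rp).
have r20 : 0 <= r ^+ 2 by exact: sqr_ge0.
have e5 : (rad0 m a b r * r ^+ 3) ^+ 2 <= K ^+ 2.
  by rewrite lerXn2r ?HK// nnegrE// mulr_ge0// exprn_ge0// ltW.
have D0 : 0 <= D by rewrite /D; pos.
apply: (@le_trans _ _ ((rad0 m a b r * r ^+ 3) ^+ 2 * D)); last exact: ler_wpM2r.
have -> : (rad0 m a b r * r ^+ 3) ^+ 2 * D = rad0 m a b r ^+ 2 * (D * r ^+ 2) * r ^+ 4 by ring.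
apply: ler_wpM2r; first by rewrite exprn_ge0// ltW.
by apply: ler_wpM2l; first exact: sqr_ge0.
Qed.

Lemma L1_inv_exp3 r1 K : 0 < r1 -> L1 leb `[r1, +oo[ (fun r => K * (r ^+ 3)^-1).
Proof.
move=> r10; apply: L1Z => //.
have rp r : r1 <= r -> 0 < r by exact: lt_le_trans.
have cf : {within `[r1, +oo[, continuous (fun r : R => (r ^+ 3)^-1)}.
  apply: within_rightray => r /rp rp'; have r30 : r ^+ 3 != 0 by rewrite expf_neq0// gt_eqF.
  exact: (is_derive_continuous1 (is_deriveV1 (f := fun x => x ^+ 3) r30 (is_derive_idX1 r 3))).
have mf : measurable_fun (`[r1, +oo[ : set R) (fun r : R => (r ^+ 3)^-1).
  by apply: subspace_continuous_measurable_fun.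
have f0 r : `[r1, +oo[%classic r -> 0 <= (r ^+ 3)^-1.
  by rewrite /= in_itv/= andbT => /rp rp'; rewrite invr_ge0 exprn_ge0// ltW.
have [_ H] := L1_ge0P leb mf f0; apply: H => {mf}.
pose F (r : R) := - 2^-1 * (r ^+ 2)^-1.
have dF r : 0 < r -> is_derive r 1 F ((r ^+ 3)^-1).
  move=> rp'; have r20 : r ^+ 2 != 0 by rewrite expf_neq0// gt_eqF.
  apply: (is_derive_eq (is_deriveM1 (is_derive_cst (- 2^-1 : R) r 1) (is_deriveV1 (f := fun x => x ^+ 2) r20 (is_derive_idX1 r 2)))).
  by rewrite expr1 /cst; field; rewrite gt_eqF.
have f0' r : r1 <= r -> 0 <= (r ^+ 3)^-1.
  by move=> /rp rp'; rewrite invr_ge0 exprn_ge0// ltW.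
have Fl : F x @[x --> +oo] --> (0 : R).
  rewrite /F -(mulr0 (- 2^-1)); apply: cvgM; first exact: cvg_cst.
  apply: (@squeeze_cvgr _ _ _ _ (cst 0) (fun x : R => x^-1)); last 2 first.
  - exact: cvg_cst.
  - by apply/gtr0_cvgV0; [exact: nbhs_pinfty_gt|exact: cvg_id].
  near=> x.
  have x1 : 1 <= x by near: x; apply: nbhs_pinfty_ge; exact: num_real.
  have x0 : 0 < x by exact: lt_le_trans x1.
  rewrite invr_ge0 sqr_ge0/= lef_pV2 ?posrE ?exprn_gt0// expr2.
  by rewrite ler_peMl// ltW.
rewrite (@ge0_continuous_FTC2y _ _ F r1 0 f0' cf Fl).
- by rewrite -EFinB ltry.
- by move=> x /ltW/rp/dF[].
- by apply: cvg_at_right_filter; exact: (is_derive_continuous1 (dF _ r10)).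
- move=> x; rewrite in_itv/= andbT => /ltW/rp/dF[_].
  by rewrite derive1E.
Unshelve. all: end_near. Qed.

Lemma L1_excess r1 : 0 < r1 -> L1 leb `[r1, +oo[ (fun r => r * excess m a b r).
Proof.
move=> r10; have [K K0 HK] := excess_decay r10.
have rp r : r1 <= r -> 0 < r by exact: lt_le_trans.
pose c := 1 + `|b * (1 - 2 * a)|.
have mf : measurable_fun (`[r1, +oo[ : set R) (fun r : R => r * excess m a b r).
  apply: subspace_continuous_measurable_fun => //.
  apply: within_rightray => r /rp rp'; apply: cvgM; first exact: cvg_id.
  exact: continuous_excess.
apply: (@L1_le _ RT _ _ _ (measurable_itv _) _ (fun r => (c * K) * (r ^+ 3)^-1)).
- exact: mf.
- move=> r; rewrite /= in_itv/= andbT => r1r; have rp' := rp _ r1r.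
  rewrite ler_pdivlMr ?exprn_gt0// normrM (gtr0_norm rp') mulrAC -exprS mulrC.
  apply: le_trans (ler_wpM2l _ (HK r r1r)); last by rewrite /c addr_ge0.
  rewrite [leRHS]mulrA; apply: ler_wpM2r; first by rewrite exprn_ge0// ltW.
  rewrite /excess normrM ger0_norm ?sqr_ge0// mulrCA; apply: ler_wpM2l; first exact: sqr_ge0.
  apply: (le_trans (ler_normB _ _)).
  have p0 : 0 <= pot m b r by exact: sqr_ge0.
  have p1 : 0 <= radh m a b r ^+ 2 by exact: sqr_ge0.
  have p2 : 0 <= r ^+ 2 by exact: sqr_ge0.
  have s0 : 0 <= r ^+ 2 + radh m a b r ^+ 2 + pot m b r by rewrite !addr_ge0.
  have q0 : 0 <= `|b * (1 - 2 * a)| * (r ^+ 2 + radh m a b r ^+ 2 + pot m b r) by rewrite mulr_ge0.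
  rewrite ger0_norm ?addr_ge0// /c.
  rewrite -subr_ge0; set N := `|_| in q0 *.
  have -> : (1 + N) * (1 + r ^+ 2 + radh m a b r ^+ 2 + pot m b r) - (radh m a b r ^+ 2 + pot m b r + N)
    = 1 + r ^+ 2 + N * (r ^+ 2 + radh m a b r ^+ 2 + pot m b r) by ring.
  by rewrite !addr_ge0.
- exact: L1_inv_exp3.
Qed.

(** By the Riccati equation, r times the excess is the derivative of r f f', which vanishes at [r0]
    by the Neumann condition and at infinity by decay. *)
Lemma integral_excess : \int[leb]_(r in `[r0, +oo[) (r * excess m a b r) = 0.
Proof.
pose F r := r * radh m a b r * rad0 m a b r ^+ 2.
have rp r : r0 <= r -> 0 < r by exact: lt_le_trans.
have dF r : r0 <= r -> is_derive r 1 F (r * excess m a b r).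
  move=> /rp rp'.
  have dh := is_derive_radh a0 am b0 rp'.
  have d0 := is_derive_rad0 a0 am b0 rp'.
  apply: (is_derive_eq (is_deriveM1 (is_deriveM1 (is_derive_id r (1 : R)) dh) (is_deriveX1 2 d0))).
  by rewrite /excess /radh' /= expr1; field; rewrite gt_eqF.
have cF : {within `[r0, +oo[, continuous (fun r => r * excess m a b r)}.
  apply: within_rightray => r /rp rp'; apply: cvgM; first exact: cvg_id.
  exact: continuous_excess.
have Fl : F x @[x --> +oo] --> (0 : R).
  have [K K0 HK] := excess_decay r00.
  apply: norm_cvg0; apply: (@squeeze_cvgr _ _ _ _ (cst 0) (fun x : R => K * x^-1)); last 2 first.
  - exact: cvg_cst.
  - rewrite -[0 in X in _ --> X](mulr0 K); apply: cvgM; first exact: cvg_cst.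
    by apply/gtr0_cvgV0; [exact: nbhs_pinfty_gt|exact: cvg_id].
  near=> x.
  have x1 : 1 <= x by near: x; apply: nbhs_pinfty_ge; exact: num_real.
  have x0 : r0 <= x by near: x; apply: nbhs_pinfty_ge; exact: num_real.
  have xp := rp _ x0.
  rewrite normr_ge0/= ler_pdivlMr// /F 2!normrM (gtr0_norm xp).
  apply: le_trans (HK x x0).
  have -> : `|rad0 m a b x ^+ 2| = rad0 m a b x ^+ 2 by rewrite ger0_norm ?sqr_ge0.
  set f2 := rad0 m a b x ^+ 2; set h := radh m a b x.
  have f20 : 0 <= f2 by exact: sqr_ge0.
  have -> : x * `|h| * f2 * x = f2 * (`|h| * x ^+ 2) by ring.
  rewrite -[leRHS]mulrA; apply: ler_wpM2l => //.
  have p0 : 0 <= pot m b x by exact: sqr_ge0.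
  have x20 : 0 <= x ^+ 2 by exact: sqr_ge0.
  have x24 : x ^+ 2 <= x ^+ 4 by rewrite ler_eXn2l.
  have hh : `|h| <= 1 + h ^+ 2.
    have : 0 <= (`|h| - 1) ^+ 2 by exact: sqr_ge0.
    have : 0 <= `|h| by [].
    by rewrite -(real_normK (num_real h)); set y := `|h|; nra.
  apply: ler_pM => //.
  by apply: (le_trans hh); lra.
rewrite (FTC2_infty dF cF (L1_excess r00) Fl) /F h0 mulr0 mul0r subr0 //.
Unshelve. all: end_near. Qed.

(** A derivative that is positive at a single point compares nearby values with the value at that
    point, without any monotonicity between other points. The bathtub argument uses only such
    comparisons. *)
Lemma sign_near (k : R -> R) (x c : R) : is_derive x 1 k c -> 0 < c ->
  exists2 d, 0 < d & forall y, `|y - x| < d ->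
    (y <= x -> k y <= k x) /\ (x <= y -> k x <= k y).
Proof.
move=> [dk ek] c0.
have H : h^-1 *: (k (h *: (1 : R) + x) - k x) @[h --> 0^'] --> c.
  by rewrite -ek; exact: dk.
have : \forall h \near 0^', 0 < h^-1 *: (k (h *: (1 : R) + x) - k x).
  by apply: cvgr_gt H _ c0.
rewrite near_withinE => /nbhs_ballP[d /= d0 Hd].
exists d => // y yd.
have [->|yx] := eqVneq y x; first by [].
have yx0 : y - x != 0 by rewrite subr_eq0.
have := Hd (y - x); rewrite /ball/= sub0r normrN => /(_ yd yx0).
have -> : (y - x) *: (1 : R) + x = y by rewrite /GRing.scale/= mulr1 subrK.
rewrite /GRing.scale/= => Hy; split => xy.
  have yl : y - x < 0 by rewrite lt_neqAle yx0 subr_le0.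
  move: yl; rewrite -invr_lt0 => yl.
  by move: Hy; rewrite (nmulr_rgt0 _ yl) subr_lt0; exact: ltW.
have yl : 0 < y - x by rewrite lt_neqAle eq_sym yx0 subr_ge0.
move: yl; rewrite -invr_gt0 => yl.
by move: Hy; rewrite (pmulr_rgt0 _ yl) subr_gt0; exact: ltW.
Qed.

(** At [r0], where f' = 0, the only contributions to the derivative of y^p [excess] come from y^p
    and from the potential. Their sum is a positive multiple of the difference of the two sides of
    the hypothesis. *)
Lemma bathtub_sign p : 2 * (m%:R ^+ 2 - (b * r0 ^+ 2) ^+ 2 / 4) <
    p * ((m%:R - b * r0 ^+ 2 / 2) ^+ 2 - b * (1 - 2 * a) * r0 ^+ 2) ->
  exists2 d, 0 < d & forall y, 0 < y -> `|y - r0| < d ->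
    (y <= r0 -> excess m a b y <= excess m a b r0 * r0 `^ p * y `^ (- p)) /\
    (r0 <= y -> excess m a b r0 * r0 `^ p * y `^ (- p) <= excess m a b y).
Proof.
move=> Hp.
pose k y := y `^ p * excess m a b y.
have dh := is_derive_radh a0 am b0 r00.
have d0 := is_derive_rad0 a0 am b0 r00.
have dg := is_derive_lin m%:~R b r00.
have dp : is_derive r0 1 (fun y => y `^ p) (p * r0 `^ (p - 1)).
  exact: is_derive1_powR.
have de := is_deriveM1 (is_deriveX1 2 d0) (is_deriveB1 (is_deriveD1 (is_deriveX1 2 dh) (is_deriveX1 2 dg)) (is_derive_cst (b * (1 - 2 * a) : R) r0 1)).
have dk := is_deriveM1 dp de.
have [|d dp0 Hd] := sign_near dk.
  rewrite /cst /= !expr1 /excess /pot h0.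
  have -> : r0 `^ p = r0 `^ (p - 1) * r0.
    by rewrite -{3}(powRr1 (ltW r00)) -powRD ?subrK// (gt_eqF r00) implybT.
  have f0 := rad0_gt0 a0 am b0 r00.
  have P0 : 0 < r0 `^ (p - 1) by rewrite powR_gt0.
  rewrite -pmulrn.
  set P := r0 `^ (p - 1) in P0 *; set f := rad0 m a b r0 in f0 *.
  have -> : p * P * (f ^+ 2 * (0 ^+ 2 + (m%:R / r0 - b * r0 / 2) ^+ 2 - b * (1 - 2 * a))) +
   P * r0 * (2%:R * f * (f * 0) * (0 ^+ 2 + (m%:R / r0 - b * r0 / 2) ^+ 2 - b * (1 - 2 * a)) +
     f ^+ 2 * (2%:R * 0 * radh' m a b r0 + 2%:R * (m%:R / r0 - b * r0 / 2) * (- m%:R / r0 ^+ 2 - b / 2) - 0))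
   = P * f ^+ 2 / r0 ^+ 2 * (p * ((m%:R - b * r0 ^+ 2 / 2) ^+ 2 - b * (1 - 2 * a) * r0 ^+ 2) -
      2 * (m%:R ^+ 2 - (b * r0 ^+ 2) ^+ 2 / 4)) by field; rewrite gt_eqF.
  apply: mulr_gt0; last by rewrite subr_gt0.
  by apply: divr_gt0; [apply: mulr_gt0 => //|]; exact: exprn_gt0.
exists d => // y y0 yd; have [H1 H2] := Hd y yd.
have yp : 0 < y `^ p by rewrite powR_gt0.
rewrite powRN [_ * r0 `^ p]mulrC; split => yr.
  by rewrite ler_pdivlMr// [leLHS]mulrC; exact: H1.
by rewrite ler_pdivrMr// [leRHS]mulrC; exact: H2.
Qed.
End bathtub.

(** For M = 1 and lam = B the inequality is the bound [pstar B < p] cleared of its denominator. A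
    larger M adds (M - 1) ((p - 2)(M + 1) - p B), whose second factor is at least 2 (p - 2) - p B >=
    0, and a smaller [lam] only helps. Here M is the angular mode, and [B] and [lam] are the field
    and the energy multiplied by the squared radius. *)
Lemma pstar_slope (B p M lam : R) : 0 < B -> B < 1 -> 0 < 4 - 8 * B + B ^+ 2 -> pstar B < p ->
  1 <= M -> lam < B -> 2 < p /\ 2 * (M ^+ 2 - B ^+ 2 / 4) < p * ((M - B / 2) ^+ 2 - lam).
Proof.
move=> B0 B1 D0; rewrite /pstar -ltrBrDl ltr_pdivrMr// => Hp M1 lB.
have p2 : 2 < p.
  have : 0 < (p - 2) * (4 - 8 * B + B ^+ 2) by apply: lt_trans Hp; nra.
  by rewrite pmulr_lgt0// subr_gt0.
split => //.
have p0 : 0 < p by lra.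
have h1 : 2 * (M ^+ 2 - B ^+ 2 / 4) < p * ((M - B / 2) ^+ 2 - B).
  have e : p * ((M - B / 2) ^+ 2 - B) - 2 * (M ^+ 2 - B ^+ 2 / 4) =
    ((p - 2) * (4 - 8 * B + B ^+ 2) - (16 * B - 4 * B ^+ 2)) / 4
     + (M - 1) * ((p - 2) * (M + 1) - p * B) by field.
  rewrite -subr_gt0 e ltr_wpDr//; last by rewrite divr_gt0// subr_gt0.
  apply: mulr_ge0; first by rewrite subr_ge0.
  have : 2 * (p - 2) <= (p - 2) * (M + 1) by rewrite mulrC ler_pM2l ?subr_gt0//; lra.
  by nra.
by apply: (lt_trans h1); rewrite ltr_pM2l// ltrD2l ltrN2.
Qed.
End radial.

(** * Fourier series on the circle *)

Section circle_integral.
Context {R : realType}.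
Local Notation leb := (@lebesgue_measure R).
Local Notation RT := (measurableTypeR R).
Implicit Types (f g w : R -> R) (m : int) (n : nat) (c : R).

Definition Lc f : Prop := L1 leb circle f.
Definition ic f : R := \int[leb]_(t in circle) f t.

Let mc := @measurable_circle R.

Lemma Lc_eq f g : (forall t, circle t -> f t = g t) -> Lc f -> Lc g.
Proof. exact: (@L1_eq _ RT R leb circle mc f g). Qed.
Lemma LcD f g : Lc f -> Lc g -> Lc (fun t => f t + g t).
Proof. exact: (@L1D _ RT R leb circle mc f g). Qed.
Lemma LcZ c f : Lc f -> Lc (fun t => c * f t).
Proof. exact: (@L1Z _ RT R leb circle mc c f). Qed.
Lemma LcB f g : Lc f -> Lc g -> Lc (fun t => f t - g t).
Proof. exact: (@L1B _ RT R leb circle mc f g). Qed.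
Lemma icD f g : Lc f -> Lc g -> ic (fun t => f t + g t) = ic f + ic g.
Proof. by move=> Lf Lg; rewrite /ic RintegralD. Qed.
Lemma icB f g : Lc f -> Lc g -> ic (fun t => f t - g t) = ic f - ic g.
Proof. by move=> Lf Lg; rewrite /ic RintegralB. Qed.
Lemma icZ c f : Lc f -> ic (fun t => c * f t) = c * ic f.
Proof. by move=> Lf; rewrite /ic RintegralZl. Qed.
Lemma ic_eq f g : (forall t, circle t -> f t = g t) -> ic f = ic g.
Proof. exact: (@Rint_eq _ RT R leb circle f g). Qed.
Lemma Lc_le f g : measurable_fun (circle : set RT) f -> (forall t, circle t -> `|f t| <= g t) ->
  Lc g -> Lc f.
Proof. exact: (@L1_le _ RT R leb circle mc f g). Qed.
Lemma le_ic f g : Lc f -> Lc g -> (forall t, circle t -> f t <= g t) -> ic f <= ic g.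
Proof. by move=> Lf Lg H; apply: le_Rintegral. Qed.
Lemma ic_ge0 f : (forall t, circle t -> 0 <= f t) -> 0 <= ic f.
Proof. by move=> H; exact: Rintegral_ge0. Qed.

Lemma LcS (F : nat -> R -> R) N : (forall k, Lc (F k)) -> Lc (fun t => \sum_(k < N) F k t).
Proof.
move=> LF; elim: N => [|N IH].
  apply: (@Lc_eq (fun t => 0 * F 0%N t)); last exact: LcZ.
  by move=> t _; rewrite big_ord0 mul0r.
apply: (@Lc_eq (fun t => (\sum_(k < N) F k t) + F N t)); last exact: LcD.
by move=> t _; rewrite big_ord_recr.
Qed.

Lemma icS (F : nat -> R -> R) N : (forall k, Lc (F k)) ->
  ic (fun t => \sum_(k < N) F k t) = \sum_(k < N) ic (F k).
Proof.
move=> LF; elim: N => [|N IH].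
  rewrite big_ord0 (@ic_eq _ (fun t => 0 * F 0%N t)) ?icZ ?mul0r//.
  by move=> t _; rewrite big_ord0 mul0r.
rewrite big_ord_recr /= -IH -icD//; last exact: LcS.
by apply: ic_eq => t _; rewrite big_ord_recr.
Qed.

Lemma circle_itv (t : R) : circle t -> - (pi / 2) < t <= pi / 2 + pi.
Proof. by rewrite /circle /= in_itv/=. Qed.

Lemma cont_meas_circle f : continuous f -> measurable_fun (circle : set RT) f.
Proof.
move=> cf; have mf : measurable_fun (setT : set R) f by exact: continuous_measurable_fun.
exact: (measurable_funS measurableT (@subsetT _ _) mf).
Qed.

Lemma circ_ends : - (pi / 2) <= pi / 2 + pi :> R.
Proof. by have := pi_gt0 R; lra. Qed.

Lemma Lc_cont f : continuous f -> Lc f.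
Proof.
move=> cf; have := @L1_continuous R f (- (pi / 2)) (pi / 2 + pi) (continuous_subspaceT cf).
apply: L1S; [exact: measurable_itv|exact: mc|].
by move=> t /circle_itv/andP[h1 h2]; rewrite /= in_itv/= h2 ltW.
Qed.

Lemma ic_cont_FTC (F f : R -> R) : (forall x : R, is_derive x 1 F (f x)) -> continuous f ->
  ic f = F (pi / 2 + pi) - F (- (pi / 2)).
Proof.
move=> dF cf; rewrite /ic /circle Rintegral_itv_obnd_cbnd; last exact: Lc_cont.
by rewrite /Rintegral (FTC2_closed circ_ends (fun x _ => dF x))//; exact: continuous_subspaceT.
Qed.

Lemma Lc_bnd (h f : R -> R) (M : R) : measurable_fun (circle : set RT) h -> (forall t, `|h t| <= M) ->
  Lc f -> Lc (fun t => h t * f t).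
Proof. by move=> mh hM Lf; apply: (@L1_Mbnd _ RT R leb circle mc h f M mh) => // t _; exact: hM. Qed.

Lemma is_derive_sinZ (c d x : R) : is_derive x 1 (fun t => sin (c * t + d)) (c * cos (c * x + d)).
Proof.
have h1 := is_deriveD1 (is_deriveM1 (is_derive_cst (c : R) x 1) (is_derive_id x (1 : R))) (is_derive_cst (d : R) x 1).
by apply: (is_derive_eq (is_derive_comp1 h1 (is_derive_sin _))); rewrite /cst; ring.
Qed.

Lemma is_derive_cosZ (c d x : R) : is_derive x 1 (fun t => cos (c * t + d)) (- (c * sin (c * x + d))).
Proof.
have h1 := is_deriveD1 (is_deriveM1 (is_derive_cst (c : R) x 1) (is_derive_id x (1 : R))) (is_derive_cst (d : R) x 1).
by apply: (is_derive_eq (is_derive_comp1 h1 (is_derive_cos _))); rewrite /cst; ring.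
Qed.

Lemma cont_cosZ (c d : R) : continuous (fun t => cos (c * t + d)).
Proof. by move=> x; exact: (is_derive_continuous1 (is_derive_cosZ c d x)). Qed.

Lemma cont_sinZ (c d : R) : continuous (fun t => sin (c * t + d)).
Proof. by move=> x; exact: (is_derive_continuous1 (is_derive_sinZ c d x)). Qed.

Lemma cont_cosm (c : R) : continuous (fun t => cos (c * t)).
Proof. by move=> x; have := @cont_cosZ c 0 x; under eq_fun do rewrite addr0. Qed.
Lemma cont_sinm (c : R) : continuous (fun t => sin (c * t)).
Proof. by move=> x; have := @cont_sinZ c 0 x; under eq_fun do rewrite addr0. Qed.

Lemma abs_cos_le1 (x : R) : `|cos x| <= 1.
Proof. by rewrite ler_norml cos_geN1 cos_le1. Qed.
Lemma abs_sin_le1 (x : R) : `|sin x| <= 1.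
Proof. by rewrite ler_norml sin_geN1 sin_le1. Qed.

Lemma sin_periodz m (x : R) : sin (x + m%:~R * (2 * pi)) = sin x.
Proof.
have P n y : sin (y + n%:R * (2 * pi)) = sin y :> R.
  by rewrite -[RHS](periodicn (@sinD2pi R) n) -[pi *+ 2 *+ n]mulr_natl -[pi *+ 2]mulr_natl.
case: m => n; first by rewrite -pmulrn P.
by rewrite NegzE -(P n.+1 (x + _)); congr sin; rewrite mulrNz -pmulrn; ring.
Qed.

Lemma ic_cos m (d : R) : ic (fun t => cos (m%:~R * t + d)) = if m == 0 then 2 * pi * cos d else 0.
Proof.
case: eqP => [->|/eqP m0].
  have dF (x : R) : is_derive x 1 (fun t => cos d * t) (cos (0%:~R * x + d)).
    apply: (is_derive_eq (is_deriveM1 (is_derive_cst (cos d : R) x 1) (is_derive_id x (1 : R)))).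
    by rewrite /cst mulr0z !mul0r !add0r mulr1.
  by rewrite (ic_cont_FTC dF); [field|exact: cont_cosZ].
have mR : m%:~R != 0 :> R by rewrite intr_eq0.
have dF (x : R) : is_derive x 1 (fun t => m%:~R^-1 * sin (m%:~R * t + d)) (cos (m%:~R * x + d)).
  apply: (is_derive_eq (is_deriveM1 (is_derive_cst (m%:~R^-1 : R) x 1) (is_derive_sinZ _ _ x))).
  by rewrite /cst mul0r add0r mulKf.
rewrite (ic_cont_FTC dF); last exact: cont_cosZ.
rewrite -mulrBr.
have -> : m%:~R * (pi / 2 + pi) + d = (m%:~R * (- (pi / 2)) + d) + m%:~R * (2 * pi) by field.
by rewrite sin_periodz subrr mulr0.
Qed.

Lemma ic_sin m : ic (fun t => sin (m%:~R * t)) = 0.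
Proof.
rewrite (@ic_eq _ (fun t => cos (m%:~R * t + - (pi / 2)))); last by move=> t _; rewrite cosBpihalf.
by rewrite ic_cos cosN cos_pihalf mulr0 if_same.
Qed.

Lemma Lc1 c : Lc (fun=> c).
Proof. by apply: Lc_cont => x; exact: cvg_cst. Qed.

Lemma ic1 c : ic (fun=> c) = 2 * pi * c.
Proof.
rewrite (@ic_eq _ (fun t => c * cos (0%:~R * t + 0))); last by move=> t _; rewrite mul0r addr0 cos0 mulr1.
rewrite icZ; last by apply: Lc_cont; exact: cont_cosZ.
by rewrite ic_cos eqxx cos0 mulr1 mulrC.
Qed.

Definition L2c w : Prop := measurable_fun (circle : set RT) w /\ Lc (fun t => w t ^+ 2).

Lemma L2c_Lc w : L2c w -> Lc w.
Proof.
move=> [mw L]; apply: (Lc_le mw _ (LcD (Lc1 1) L)) => t _.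
have : 0 <= (`|w t| - 1) ^+ 2 by exact: sqr_ge0.
have : 0 <= `|w t| by [].
by rewrite -(real_normK (num_real (w t))); set y := `|_|; nra.
Qed.

Lemma L2c_mul f g : L2c f -> L2c g -> Lc (fun t => f t * g t).
Proof.
move=> [mf Lf] [mg Lg].
apply: (Lc_le (measurable_funM mf mg) _ (LcD Lf Lg)) => t _.
rewrite normrM -(real_normK (num_real (f t))) -(real_normK (num_real (g t))).
have : 0 <= (`|f t| - `|g t|) ^+ 2 by exact: sqr_ge0.
have : 0 <= (`|f t| + `|g t|) ^+ 2 by exact: sqr_ge0.
by set x := `|f t|; set y := `|g t|; nra.
Qed.

Lemma L2cN w : L2c w -> L2c (fun t => - w t).
Proof.
move=> [mw Lw]; split; first exact: measurable_oppr || exact: (measurableT_comp (@oppr_measurable R setT)).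
by apply: (Lc_eq _ Lw) => t _; rewrite sqrrN.
Qed.

Lemma L2cB f g : L2c f -> L2c g -> L2c (fun t => f t - g t).
Proof.
move=> hf hg; split; first exact: (measurable_funB hf.1 hg.1).
apply: (@Lc_eq (fun t => (f t ^+ 2 + g t ^+ 2) - 2 * (f t * g t))); first by move=> t _; ring.
by apply: LcB; [exact: (LcD hf.2 hg.2)|apply: LcZ; exact: L2c_mul].
Qed.

Lemma Lc_cosM c w : Lc w -> Lc (fun t => cos (c * t) * w t).
Proof. by move=> Lw; apply: (@Lc_bnd _ _ 1 _ _ Lw); [apply: cont_meas_circle; exact: cont_cosm|move=> t; exact: abs_cos_le1]. Qed.
Lemma Lc_sinM c w : Lc w -> Lc (fun t => sin (c * t) * w t).
Proof. by move=> Lw; apply: (@Lc_bnd _ _ 1 _ _ Lw); [apply: cont_meas_circle; exact: cont_sinm|move=> t; exact: abs_sin_le1]. Qed.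

(* [fc m w1 w2] and [fc m w2 (- w1)] are the real and the imaginary part of the
   [m]-th Fourier coefficient of [w1 + i w2]. *)
Definition fc m (w1 w2 : R -> R) : R := ic (fun t => cos (m%:~R * t) * w1 t + sin (m%:~R * t) * w2 t).

Definition fc2 m w1 w2 : R := fc m w1 w2 ^+ 2 + fc m w2 (fun t => - w1 t) ^+ 2.

Lemma Lc_fc m w1 w2 : Lc w1 -> Lc w2 -> Lc (fun t => cos (m%:~R * t) * w1 t + sin (m%:~R * t) * w2 t).
Proof. by move=> L1 L2; apply: LcD; [exact: Lc_cosM|exact: Lc_sinM]. Qed.

Lemma LcN w : Lc w -> Lc (fun t => - w t).
Proof. by move=> L; apply: (Lc_eq _ (LcZ (-1) L)) => t _; rewrite mulN1r. Qed.

Lemma fcB m v1 v2 w1 w2 : Lc v1 -> Lc v2 -> Lc w1 -> Lc w2 ->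
  fc m (fun t => v1 t - w1 t) (fun t => v2 t - w2 t) = fc m v1 v2 - fc m w1 w2.
Proof.
move=> h1 h2 h3 h4; rewrite /fc -icB; [|exact: Lc_fc|exact: Lc_fc].
by apply: ic_eq => t _; ring.
Qed.

Lemma fc_ext m v1 v2 w1 w2 : (forall t, circle t -> v1 t = w1 t) -> (forall t, circle t -> v2 t = w2 t) ->
  fc m v1 v2 = fc m w1 w2.
Proof. by move=> h1 h2; apply: ic_eq => t ct; rewrite h1// h2. Qed.

Lemma fcZ m c w1 w2 : Lc w1 -> Lc w2 ->
  fc m (fun t => c * w1 t) (fun t => c * w2 t) = c * fc m w1 w2.
Proof.
move=> h1 h2; rewrite /fc -icZ; last exact: Lc_fc.
by apply: ic_eq => t _; ring.
Qed.

Lemma LcSs (I : eqType) (s : seq I) (F : I -> R -> R) : (forall k, Lc (F k)) ->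
  Lc (fun t => \sum_(k <- s) F k t).
Proof.
move=> LF; elim: s => [|i s IH].
  by apply: (Lc_eq _ (Lc1 0)) => t _; rewrite big_nil.
by apply: (Lc_eq _ (LcD (LF i) IH)) => t _; rewrite big_cons.
Qed.

Lemma icSs (I : eqType) (s : seq I) (F : I -> R -> R) : (forall k, Lc (F k)) ->
  ic (fun t => \sum_(k <- s) F k t) = \sum_(k <- s) ic (F k).
Proof.
move=> LF; elim: s => [|i s IH].
  rewrite big_nil -[RHS](mulr0 (2 * pi)) -ic1.
  by apply: ic_eq => t _; rewrite big_nil.
rewrite big_cons -IH -icD//; last exact: LcSs.
by apply: ic_eq => t _; rewrite big_cons.
Qed.

(** The squared distance from w1 + i w2 to its Fourier sum over [s] is nonnegative; expanding it
    with orthogonality leaves the inequality. Complex exponentials are written out in real and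
    imaginary parts. *)
Lemma bessel (s : seq int) w1 w2 : uniq s -> L2c w1 -> L2c w2 ->
  \sum_(m <- s) fc2 m w1 w2 <= 2 * pi * ic (fun t => w1 t ^+ 2 + w2 t ^+ 2).
Proof.
move=> us h1 h2.
have L1 := L2c_Lc h1; have L2 := L2c_Lc h2; have LN1 := LcN L1.
pose a m := fc m w1 w2 / (2 * pi).
pose a' m := fc m w2 (fun t => - w1 t) / (2 * pi).
(* [T1] and [T2] are the real and imaginary parts of (a + i a') e^(i m t). *)
pose T1 m t := a m * cos (m%:~R * t) - a' m * sin (m%:~R * t).
pose T2 m t := a m * sin (m%:~R * t) + a' m * cos (m%:~R * t).
pose S1 t := \sum_(m <- s) T1 m t.
pose S2 t := \sum_(m <- s) T2 m t.
have pi0 := pi_gt0 R.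
have pi20 : 2 * pi != 0 :> R by rewrite mulf_neq0// gt_eqF.
pose X m t := a m * (cos (m%:~R * t) * w1 t + sin (m%:~R * t) * w2 t)
   + a' m * (cos (m%:~R * t) * w2 t + sin (m%:~R * t) * - w1 t).
have LX m : Lc (X m) by apply: LcD; apply: LcZ; exact: Lc_fc.
have iX m : ic (X m) = fc2 m w1 w2 / (2 * pi).
  rewrite icD; [|apply: LcZ; exact: Lc_fc..].
  rewrite !icZ; [|exact: Lc_fc..]; rewrite -!/(fc _ _ _).
  by rewrite /a /a' /fc2; set i := (2 * pi)^-1; ring.
pose Y (m n : int) t := (a m * a n + a' m * a' n) * cos ((m - n)%:~R * t)
   + (a m * a' n - a' m * a n) * sin ((m - n)%:~R * t).
have LY (m n : int) : Lc (Y m n).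
  by apply: LcD; apply: LcZ; apply: Lc_cont; [exact: cont_cosm|exact: cont_sinm].
have iY (m n : int) : ic (Y m n) = if m == n then (a m ^+ 2 + a' m ^+ 2) * (2 * pi) else 0.
  rewrite icD; [|apply: LcZ; apply: Lc_cont; [exact: cont_cosm || exact: cont_sinm]..].
  rewrite !icZ; [|apply: Lc_cont; [exact: cont_cosm || exact: cont_sinm]..].
  rewrite ic_sin mulr0 addr0.
  rewrite (@ic_eq _ (fun t => cos ((m - n)%:~R * t + 0))); last by move=> t _; rewrite addr0.
  rewrite ic_cos cos0 mulr1 subr_eq0; case: eqP => [->|_]; last by rewrite mulr0.
  by rewrite !expr2.
have SS t : S1 t ^+ 2 + S2 t ^+ 2 = \sum_(m <- s) \sum_(n <- s) Y m n t.
  rewrite !expr2 /S1 /S2 !mulr_suml -big_split/=; apply: eq_bigr => m _.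
  rewrite !mulr_sumr -big_split/=; apply: eq_bigr => n _.
  have e : (m - n)%:~R * t = m%:~R * t - n%:~R * t by rewrite intrB mulrBl.
  rewrite /T1 /T2 /Y e cosB sinB; ring.
have SW t : S1 t * w1 t + S2 t * w2 t = \sum_(m <- s) X m t.
  rewrite /S1 /S2 !mulr_suml -big_split/=; apply: eq_bigr => m _.
  rewrite /T1 /T2 /X; ring.
pose E t := (w1 t ^+ 2 + w2 t ^+ 2) - 2 * (\sum_(m <- s) X m t) + \sum_(m <- s) \sum_(n <- s) Y m n t.
have E0 t : 0 <= E t.
  have -> : E t = (w1 t - S1 t) ^+ 2 + (w2 t - S2 t) ^+ 2 by rewrite /E -SS -SW; ring.
  by rewrite addr_ge0 ?sqr_ge0.
have := ic_ge0 (fun t _ => E0 t).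
have LXs : Lc (fun t => \sum_(m <- s) X m t) by exact: LcSs.
have LYs m : Lc (fun t => \sum_(n <- s) Y m n t) by exact: LcSs.
have LYss : Lc (fun t => \sum_(m <- s) \sum_(n <- s) Y m n t) by exact: (LcSs s LYs).
have Lw := LcD h1.2 h2.2.
rewrite icD//; last by apply: LcB => //; exact: LcZ.
rewrite icB//; last exact: LcZ.
rewrite icZ// icSs// (icSs s LYs).
set Q := \sum_(m <- s) fc2 m w1 w2.
have -> : \sum_(m <- s) ic (X m) = Q / (2 * pi).
  by rewrite /Q mulr_suml; apply: eq_bigr => m _; rewrite iX.
have -> : \sum_(m <- s) ic (fun t => \sum_(n <- s) Y m n t) = Q / (2 * pi).
  rewrite /Q mulr_suml [LHS]big_seq [RHS]big_seq; apply: eq_bigr => m ms.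
  rewrite icSs// (bigD1_seq m)//= big1 ?addr0; last first.
    by move=> n /negbTE nm; rewrite iY eq_sym nm.
  rewrite iY eqxx /fc2 /a /a'; set P := 2 * pi in pi20 *; field.
  exact: pi20.
have -> : forall J : R, J - 2 * (Q / (2 * pi)) + Q / (2 * pi) = J - Q / (2 * pi) by move=> J; ring.
by rewrite subr_ge0 ler_pdivrMr ?mulr_gt0// mulrC.
Qed.

(** The real part of the binomial expansion of (e^(ix) + e^(-ix))^N e^(iy). The free phase [y]
    yields the sine identities from the same formula, by the choice y = -pi/2. *)
Lemma cos_binomial N (x y : R) :
  (2 * cos x) ^+ N * cos y = \sum_(k < N.+1) 'C(N, k)%:R * cos (y + (N%:R - 2 * k%:R) * x).
Proof.
elim: N y => [|N IH] y.
  by rewrite big_ord_recl big_ord0 expr0 bin0 !mul1r addr0 mulr0 subr0 mul0r addr0.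
have e z : 2 * cos x * cos z = cos (z + x) + cos (z - x) by rewrite cosD cosB; ring.
rewrite exprSr -mulrA e mulrDr !IH.
rewrite [X in X + _]big_ord_recl [X in _ + X]big_ord_recr /=.
rewrite [RHS]big_ord_recl [X in _ = _ + X]big_ord_recr /=.
rewrite !bin0 !binn /bump /=.
under [X in _ = _ + (X + _)]eq_bigr => k _.
  rewrite add1n binS natrD mulrDl; over.
rewrite big_split/=.
set A := \sum_(i < N) _; set B := \sum_(i < N) _; set A' := \sum_(i < N) _; set B' := \sum_(i < N) _.
have -> : A = A'.
  apply: eq_bigr => k _; congr (_ * cos _); rewrite -natr1 -[in RHS]natr1 ?add1n -?natr1; ring.
have -> : B = B'.
  apply: eq_bigr => k _; congr (_ * cos _); rewrite -natr1 -[in RHS]natr1 ?add1n -?natr1; ring.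
have -> : y + x + (N%:R - 2 * 0%:R) * x = y + (N.+1%:R - 2 * 0%:R) * x by rewrite -natr1; ring.
have -> : y - x + (N%:R - 2 * N%:R) * x = y + (N.+1%:R - 2 * N.+1%:R) * x by rewrite -natr1; ring.
rewrite add1n; ring.
Qed.

Definition frq n (k : nat) : int := n%:Z - k%:Z.

Lemma kernel_cos n (x y : R) :
  (1 + cos x) ^+ n * cos y = \sum_(k < (2 * n).+1) 'C(2 * n, k)%:R / 2 ^+ n * cos (y + (frq n k)%:~R * x).
Proof.
have e : 1 + cos x = (2 * cos (x / 2)) ^+ 2 / 2.
  have {1}-> : x = x / 2 + x / 2 by field.
  by rewrite cosD; have := cos2Dsin2 (x / 2); lra.
rewrite e expr_div_n -exprM mulrAC cos_binomial mulr_suml; apply: eq_bigr => k _.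
rewrite mulrAC; congr (_ * cos _); congr (y + _).
by rewrite /frq intrB -!pmulrn natrM; field.
Qed.

Definition knorm n : R := ic (fun t => (1 + cos t) ^+ n).

Definition kcoef n k : R := 'C(2 * n, k)%:R / 2 ^+ n / knorm n.

(* The de la Vallee-Poussin kernel: its Fourier coefficients [2 pi kcoef n k]
   lie in [0, 1], so smoothing by it bounds partial sums of Parseval's series
   from below. *)
Definition Jk n (t : R) : R := (1 + cos t) ^+ n / knorm n.

Lemma frq_eq0 n k : (frq n k == 0) = (k == n).
Proof. by rewrite subr_eq0 eqz_nat eq_sym. Qed.

Lemma cont_1Dcos n : continuous (fun t : R => (1 + cos t) ^+ n).
Proof. by move=> x; exact: (is_derive_continuous1 (is_deriveX1 n (is_deriveD1 (is_derive_cst (1 : R) x 1) (is_derive_cos x)))). Qed.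

Lemma oneDcos_ge0 (t : R) : 0 <= 1 + cos t.
Proof. by have := cos_geN1 t; lra. Qed.

Lemma Rint_subset (A B : set R) f : measurable A -> measurable B -> A `<=` B ->
  (forall t, B t -> 0 <= f t) -> L1 leb B f ->
  \int[leb]_(t in A) f t <= \int[leb]_(t in B) f t.
Proof.
move=> mA mB AB f0 LB.
have LA : L1 leb A f by exact: (@L1S _ RT R leb B A f mB mA AB LB).
rewrite -lee_fin !EFin_Rint//; apply: ge0_subset_integral => //.
by apply/measurable_EFinP; exact: (L1_meas LB).
Qed.

(** Since sin <= 1, the mass is at least the integral over [0, pi] of (1 + cos t)^n sin t, which is
    explicit. This keeps the normalized kernel below (n + 1) q^n where (1 + cos)/2 <= q. *)
Lemma knorm_ge n : 2 ^+ n.+1 / n.+1%:R <= knorm n.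
Proof.
have pi0 := pi_gt0 R.
pose F (x : R) := - (n.+1%:R)^-1 * (1 + cos x) ^+ n.+1.
pose f (x : R) := (1 + cos x) ^+ n * sin x.
have n0 : n.+1%:R != 0 :> R by rewrite pnatr_eq0.
have dF (x : R) : is_derive x 1 F (f x).
  have d := is_deriveX1 n.+1 (is_deriveD1 (is_derive_cst (1 : R) x 1) (is_derive_cos x)).
  apply: (is_derive_eq (is_deriveM1 (is_derive_cst (- (n.+1%:R)^-1 : R) x 1) d)).
  by rewrite /f /cst /=; field.
have cf : continuous f.
  by move=> x; apply: cvgM; [exact: cont_1Dcos|exact: continuous_sin].
have -> : 2 ^+ n.+1 / n.+1%:R = \int[leb]_(t in `[0, pi]) f t.
  rewrite /Rintegral (FTC2_closed (ltW pi0) (fun x _ => dF x))/=; last exact: continuous_subspaceT.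
  by rewrite /F cos0 cospi subrr expr0n/=; ring.
have Lf : L1 leb (`[0, pi] : set R) f by apply: L1_continuous; exact: continuous_subspaceT.
apply: (@le_trans _ _ (\int[leb]_(t in `[0, pi]) ((1 + cos t) ^+ n))).
  apply: le_Rintegral => //.
    by apply: L1_continuous; apply: continuous_subspaceT; exact: cont_1Dcos.
  by move=> t _; rewrite ler_piMr ?sin_le1// exprn_ge0// oneDcos_ge0.
have Lg := Lc_cont (@cont_1Dcos n).
apply: (@Rint_subset `[0, pi]%classic circle) => //.
by move=> t; rewrite /= /circle /= !in_itv/= => /andP[h1 h2]; apply/andP; split; lra.
Qed.

Lemma bin_mid n k : ('C(2 * n, k) <= 'C(2 * n, n))%N.
Proof.
have H d : (d <= n)%N -> ('C(2 * n, n - d) <= 'C(2 * n, n))%N.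
  elim: d => [|d IH] dn; first by rewrite subn0.
  apply: leq_trans (IH (ltnW dn)).
  have e : (n - d = (n - d.+1).+1)%N by rewrite -subSn.
  rewrite e -(leq_pmul2l (ltn0Sn (n - d.+1))) mul_bin_left leq_mul2r; apply/orP; right.
  by rewrite -e mul2n -addnn -addnBA ?leq_subr// subKn ?(leq_trans (leq_subr _ _))// leq_addr || lia.
have [kn|nk] := leqP k n; first by rewrite -(subKn kn); apply: H; exact: leq_subr.
have [k2|k2] := leqP k (2 * n); last by rewrite bin_small.
rewrite -bin_sub//; have -> : (2 * n - k = n - (k - n))%N by lia.
by apply: H; lia.
Qed.

Lemma knormE n : knorm n = 2 * pi * ('C(2 * n, n)%:R / 2 ^+ n).
Proof.
pose F k t : R := 'C(2 * n, k)%:R / 2 ^+ n * cos ((frq n k)%:~R * t + 0).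
have LF k : Lc (F k) by apply: LcZ; apply: Lc_cont; exact: cont_cosZ.
rewrite /knorm (@ic_eq _ (fun t => \sum_(k < (2 * n).+1) F k t)); last first.
  move=> t _; have := kernel_cos n t 0; rewrite cos0 mulr1 => ->.
  by apply: eq_bigr => k _; rewrite /F addrC.
rewrite icS//.
have nn : (n < (2 * n).+1)%N by lia.
rewrite (bigD1 (Ordinal nn))//= big1 ?addr0.
  by rewrite /F icZ ?ic_cos ?frq_eq0 ?eqxx ?cos0 ?mulr1 1?mulrC//; apply: Lc_cont; exact: cont_cosZ.
move=> k /negbTE kn; rewrite /F icZ; last by apply: Lc_cont; exact: cont_cosZ.
by rewrite ic_cos frq_eq0; move: kn; rewrite -val_eqE/= => ->; rewrite mulr0.
Qed.

Lemma knorm_gt0 n : 0 < knorm n.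
Proof. by apply: lt_le_trans (knorm_ge n); rewrite divr_gt0// ?exprn_gt0// ltr0Sn. Qed.

Lemma kcoef_ge0 n k : 0 <= kcoef n k.
Proof. by rewrite /kcoef !divr_ge0// ?exprn_ge0// ltW// knorm_gt0. Qed.

Lemma kcoef_le n k : kcoef n k <= (2 * pi)^-1.
Proof.
have pi0 := pi_gt0 R.
have p2 : 0 < 2 * pi :> R by rewrite mulr_gt0.
rewrite /kcoef ler_pdivrMr ?knorm_gt0// knormE mulrA mulVf ?gt_eqF// mul1r.
by rewrite ler_pM2r ?invr_gt0 ?exprn_gt0// ler_nat bin_mid.
Qed.

Lemma kcoef_mid n : kcoef n n = (2 * pi)^-1.
Proof.
have pi0 := pi_gt0 R; have := knorm_gt0 n; rewrite /kcoef knormE.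
set y := _ / 2 ^+ n => /lt0r_neq0; rewrite mulf_eq0 negb_or => /andP[_ y0].
by rewrite invfM mulrCA mulfV// mulr1.
Qed.

Lemma Jk_cos n (x y : R) : Jk n (x - y) = \sum_(k < (2 * n).+1) kcoef n k * cos ((frq n k)%:~R * (x - y)).
Proof.
have := kernel_cos n (x - y) 0; rewrite cos0 mulr1 /Jk => ->; rewrite mulr_suml.
by apply: eq_bigr => k _; rewrite add0r mulrAC.
Qed.

(** The phase -pi/2 in [kernel_cos] replaces cosines by sines. The sum vanishes because the kernel
    is even, so that its cosine sum is its full exponential sum. *)
Lemma Jk_sin n (x y : R) : \sum_(k < (2 * n).+1) kcoef n k * sin ((frq n k)%:~R * (x - y)) = 0.
Proof.
have := kernel_cos n (x - y) (- (pi / 2)); rewrite cosN cos_pihalf mulr0 => /(congr1 ( *%R^~ (knorm n)^-1)).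
rewrite mul0r mulr_suml => e; rewrite [RHS]e.
by apply: eq_bigr => k _; rewrite [- (pi / 2) + _]addrC cosBpihalf mulrAC.
Qed.

Lemma cont_sum N (F : nat -> R -> R) : (forall k, continuous (F k)) ->
  continuous (fun x => \sum_(k < N) F k x).
Proof.
move=> cF; elim: N => [|N IH] x.
  by under eq_fun do rewrite big_ord0; exact: cvg_cst.
by under eq_fun do rewrite big_ord_recr/=; apply: cvgD; [exact: IH|exact: cF].
Qed.

Lemma Jk_ge0 n (x : R) : 0 <= Jk n x.
Proof. by rewrite divr_ge0 ?exprn_ge0 ?oneDcos_ge0// ltW// knorm_gt0. Qed.

Lemma Jk_le n (x q : R) : (1 + cos x) / 2 <= q -> Jk n x <= n.+1%:R * q ^+ n.
Proof.
move=> xq; rewrite /Jk ler_pdivrMr ?knorm_gt0//.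
have c0 := oneDcos_ge0 x.
have h0 : 0 <= (1 + cos x) / 2 by rewrite divr_ge0.
have q0 : 0 <= q by exact: le_trans xq.
apply: (@le_trans _ _ (n.+1%:R * q ^+ n * (2 ^+ n.+1 / n.+1%:R))); last first.
  by apply: ler_wpM2l; [rewrite mulr_ge0 ?exprn_ge0|exact: knorm_ge].
have -> : n.+1%:R * q ^+ n * (2 ^+ n.+1 / n.+1%:R) = 2 * (2 * q) ^+ n.
  by rewrite exprMn exprS; field.
have h : (1 + cos x) ^+ n <= (2 * q) ^+ n.
  by rewrite lerXn2r// ?nnegrE// ?mulr_ge0//; move: xq; rewrite ler_pdivrMr// mulrC.
apply: (le_trans h); rewrite ler_peMl// ?exprn_ge0// ?mulr_ge0//.
by rewrite ler1n.
Qed.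

Definition Kc n w (x : R) : R := ic (fun t => Jk n (x - t) * w t).

Lemma cont_Jk n (x : R) : continuous (fun t => Jk n (x - t)).
Proof.
move=> t; apply: cvgM; last exact: cvg_cst.
have d1 := is_deriveB1 (is_derive_cst (x : R) t 1) (is_derive_id t (1 : R)).
exact: (is_derive_continuous1 (is_deriveX1 n (is_deriveD1 (is_derive_cst (1 : R) t 1) (is_derive_comp1 d1 (is_derive_cos _))))).
Qed.

Lemma ic_Jk n (x : R) : ic (fun t => Jk n (x - t)) = 1.
Proof.
pose F k t : R := kcoef n k * cos ((- frq n k)%:~R * t + (frq n k)%:~R * x).
have LF k : Lc (F k) by apply: LcZ; apply: Lc_cont; exact: cont_cosZ.
rewrite (@ic_eq _ (fun t => \sum_(k < (2 * n).+1) F k t)); last first.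
  move=> t _; rewrite Jk_cos; apply: eq_bigr => k _; rewrite /F mulrNz mulrBr; congr (_ * cos _); ring.
rewrite icS//.
have nn : (n < (2 * n).+1)%N by lia.
rewrite (bigD1 (Ordinal nn))//= big1 ?addr0.
  rewrite /F icZ; last by apply: Lc_cont; exact: cont_cosZ.
  have /eqP f0 : frq n n == 0 by rewrite frq_eq0.
  rewrite ic_cos oppr_eq0 f0 eqxx mulr0z mul0r cos0 mulr1 kcoef_mid mulVf//.
  by rewrite mulf_neq0// lt0r_neq0// pi_gt0.
move=> k /negbTE kn; rewrite /F icZ; last by apply: Lc_cont; exact: cont_cosZ.
by rewrite ic_cos oppr_eq0 frq_eq0; move: kn; rewrite -val_eqE/= => ->; rewrite mulr0.
Qed.

(** Convolution multiplies the Fourier coefficients by those of the kernel. The left side depends on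
    [w1] alone: adding the null sum [Jk_sin] times [w2] completes the real coefficients to those of
    w1 + i w2. *)
Lemma Kc_E n w1 w2 (x : R) : Lc w1 -> Lc w2 ->
  Kc n w1 x = \sum_(k < (2 * n).+1) kcoef n k * (cos ((frq n k)%:~R * x) * fc (frq n k) w1 w2
    - sin ((frq n k)%:~R * x) * fc (frq n k) w2 (fun t => - w1 t)).
Proof.
move=> L1 L2; have LN := LcN L1.
pose F k t : R := kcoef n k * (cos ((frq n k)%:~R * x) * (cos ((frq n k)%:~R * t) * w1 t + sin ((frq n k)%:~R * t) * w2 t)
    - sin ((frq n k)%:~R * x) * (cos ((frq n k)%:~R * t) * w2 t + sin ((frq n k)%:~R * t) * - w1 t)).
have LF k : Lc (F k) by apply: LcZ; apply: LcB; apply: LcZ; exact: Lc_fc.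
rewrite /Kc (@ic_eq _ (fun t => \sum_(k < (2 * n).+1) F k t)); last first.
  move=> t _; rewrite -[LHS]subr0 -[X in _ - X](mul0r (w2 t)).
  rewrite -[X in _ - X * _](Jk_sin n x t) Jk_cos !mulr_suml -sumrB.
  apply: eq_bigr => k _; rewrite /F mulrBr cosB sinB; ring.
rewrite icS//; apply: eq_bigr => k _.
rewrite /F icZ; last by apply: LcB; apply: LcZ; exact: Lc_fc.
by rewrite icB ?icZ//; [exact: Lc_fc|exact: Lc_fc|apply: LcZ; exact: Lc_fc|apply: LcZ; exact: Lc_fc].
Qed.

Lemma cont_Kc n w : Lc w -> continuous (Kc n w).
Proof.
move=> Lw; have L0 : Lc (fun=> 0) by exact: Lc1.
have -> : Kc n w = fun x => \sum_(k < (2 * n).+1) kcoef n k * (cos ((frq n k)%:~R * x) * fc (frq n k) w (fun=> 0)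
    - sin ((frq n k)%:~R * x) * fc (frq n k) (fun=> 0) (fun t => - w t)).
  by apply/funext => x; exact: Kc_E.
apply: (cont_sum (F := fun k x => kcoef n k * (cos ((frq n k)%:~R * x) * fc (frq n k) w (fun=> 0)
    - sin ((frq n k)%:~R * x) * fc (frq n k) (fun=> 0) (fun t => - w t)))) => k x.
apply: cvgM; first exact: cvg_cst.
by apply: cvgB; (apply: cvgM; [|exact: cvg_cst]); [exact: cont_cosm|exact: cont_sinm].
Qed.

Definition psum n w1 w2 : R := \sum_(k < (2 * n).+1) kcoef n k * fc2 (frq n k) w1 w2.

Lemma psumE n w1 w2 : L2c w1 -> L2c w2 ->
  psum n w1 w2 = ic (fun t => w1 t * Kc n w1 t + w2 t * Kc n w2 t).
Proof.
move=> h1 h2; have L1 := L2c_Lc h1; have L2 := L2c_Lc h2; have LN := LcN L1.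
pose F k t : R := kcoef n k * (
    fc (frq n k) w1 w2 * (cos ((frq n k)%:~R * t) * w1 t + sin ((frq n k)%:~R * t) * w2 t)
  + fc (frq n k) w2 (fun t => - w1 t) * (cos ((frq n k)%:~R * t) * w2 t + sin ((frq n k)%:~R * t) * - w1 t)).
have LF k : Lc (F k) by apply: LcZ; apply: LcD; apply: LcZ; exact: Lc_fc.
have fcN m : fc m (fun t => - w1 t) (fun t => - w2 t) = - fc m w1 w2.
  rewrite -mulN1r -fcZ//; apply: fc_ext => t _; by rewrite mulN1r.
rewrite [RHS](@ic_eq _ (fun t => \sum_(k < (2 * n).+1) F k t)); last first.
  move=> t _; rewrite (Kc_E n t L1 L2) (Kc_E n t L2 LN) !mulr_sumr -big_split/=.
  by apply: eq_bigr => k _; rewrite /F fcN; ring.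
rewrite icS//; apply: eq_bigr => k _.
rewrite /F icZ; last by apply: LcD; apply: LcZ; exact: Lc_fc.
by rewrite icD ?icZ /fc2 ?expr2//; [exact: Lc_fc|exact: Lc_fc|apply: LcZ; exact: Lc_fc|apply: LcZ; exact: Lc_fc].
Qed.

Lemma sqD_ge0 w1 w2 (t : R) : 0 <= w1 t ^+ 2 + w2 t ^+ 2.
Proof. by rewrite addr_ge0 ?sqr_ge0. Qed.

Definition energy w1 w2 : R := ic (fun t => w1 t ^+ 2 + w2 t ^+ 2).

Lemma psum_ge0 n w1 w2 : 0 <= psum n w1 w2.
Proof.
by apply: sumr_ge0 => k _; apply: mulr_ge0; [exact: kcoef_ge0|rewrite /fc2 addr_ge0 ?sqr_ge0].
Qed.

Definition freqs n : seq int := [seq frq n k | k <- iota 0 (2 * n).+1].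

Lemma freqs_uniq n : uniq (freqs n).
Proof. by rewrite map_inj_uniq ?iota_uniq// => x y; rewrite /frq; lia. Qed.

Lemma sum_freqs n (F : int -> R) : \sum_(m <- freqs n) F m = \sum_(k < (2 * n).+1) F (frq n k).
Proof. by rewrite /freqs big_map -[iota 0 _]/(index_iota 0 (2 * n).+1) big_mkord. Qed.

Lemma psum_le_freqs n w1 w2 : 2 * pi * psum n w1 w2 <= \sum_(m <- freqs n) fc2 m w1 w2.
Proof.
have p2 : 0 < 2 * pi :> R by rewrite mulr_gt0// pi_gt0.
rewrite sum_freqs /psum mulr_sumr; apply: ler_sum => k _; rewrite mulrA ler_piMl//.
  by rewrite /fc2 addr_ge0 ?sqr_ge0.
by rewrite -ler_pdivlMl// mulr1; exact: kcoef_le.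
Qed.

Lemma psum_le n w1 w2 : L2c w1 -> L2c w2 -> psum n w1 w2 <= energy w1 w2.
Proof.
move=> h1 h2; have p2 : 0 < 2 * pi :> R by rewrite mulr_gt0// pi_gt0.
rewrite -(ler_pM2l p2); apply: (le_trans (psum_le_freqs n w1 w2)).
exact: bessel (freqs_uniq n) h1 h2.
Qed.

Lemma fcD m v1 v2 w1 w2 : Lc v1 -> Lc v2 -> Lc w1 -> Lc w2 ->
  fc m (fun t => v1 t + w1 t) (fun t => v2 t + w2 t) = fc m v1 v2 + fc m w1 w2.
Proof.
move=> h1 h2 h3 h4; rewrite /fc -icD; [|exact: Lc_fc|exact: Lc_fc].
by apply: ic_eq => t _; ring.
Qed.

Lemma L2cD f g : L2c f -> L2c g -> L2c (fun t => f t + g t).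
Proof.
move=> hf hg; split; first exact: (measurable_funD hf.1 hg.1).
apply: (@Lc_eq (fun t => (f t ^+ 2 + g t ^+ 2) + 2 * (f t * g t))); first by move=> t _; ring.
by apply: LcD; [exact: (LcD hf.2 hg.2)|apply: LcZ; exact: L2c_mul].
Qed.

Lemma parallelogram n v1 v2 w1 w2 : L2c v1 -> L2c v2 -> L2c w1 -> L2c w2 ->
  psum n (fun t => v1 t + w1 t) (fun t => v2 t + w2 t)
  + psum n (fun t => v1 t - w1 t) (fun t => v2 t - w2 t) = 2 * (psum n v1 v2 + psum n w1 w2).
Proof.
move=> h1 h2 h3 h4; rewrite /psum -!big_split/= mulr_sumr; apply: eq_bigr => k _.
have a1 := L2c_Lc h1; have a2 := L2c_Lc h2; have a3 := L2c_Lc h3; have a4 := L2c_Lc h4.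
have n1 := LcN a1; have n3 := LcN a3.
rewrite /fc2 !(fcD _ a1 a2 a3 a4) !(fcB _ a1 a2 a3 a4).
rewrite (@fc_ext _ _ (fun t => - (v1 t + w1 t)) (fun t => v2 t + w2 t) (fun t => - v1 t + - w1 t))//; last by move=> t _; rewrite opprD.
rewrite (@fc_ext _ _ (fun t => - (v1 t - w1 t)) (fun t => v2 t - w2 t) (fun t => - v1 t - - w1 t))//; last by move=> t _; rewrite opprB opprK addrC.
rewrite fcD// fcB//; ring.
Qed.

Lemma energy_parallelogram v1 v2 w1 w2 : L2c v1 -> L2c v2 -> L2c w1 -> L2c w2 ->
  energy (fun t => v1 t + w1 t) (fun t => v2 t + w2 t)
  + energy (fun t => v1 t - w1 t) (fun t => v2 t - w2 t) = 2 * (energy v1 v2 + energy w1 w2).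
Proof.
move=> h1 h2 h3 h4.
have LE f g : L2c f -> L2c g -> Lc (fun t => f t ^+ 2 + g t ^+ 2) by move=> hf hg; apply: LcD; [exact: hf.2|exact: hg.2].
rewrite /energy -!icD; [|exact: LE|exact: LE|by apply: LE; exact: L2cD|by apply: LE; exact: L2cB].
rewrite -icZ; last by apply: LcD; exact: LE.
by apply: ic_eq => t _; ring.
Qed.

Lemma cvg_nexp (q : R) : q < 1 -> 0 <= q -> n.+1%:R * q ^+ n @[n --> \oo] --> (0 : R).
Proof.
move=> q1 q0.
have [e e0 qE] : exists2 e, 0 < e & q = 1 - e by exists (1 - q); [rewrite subr_gt0|rewrite subKr].
have en := lt0r_neq0 e0.
pose C := 2 * expR e / e ^+ 2.
apply: (@cvg0_le _ _ (fun n => C * harmonic n)); last first.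
  by rewrite -(mulr0 C); apply: cvgM; [exact: cvg_cst|exact: cvg_harmonic].
move=> n; rewrite ger0_norm ?mulr_ge0 ?exprn_ge0// /harmonic/=.
have n0 : 0 < n.+1%:R :> R by rewrite ltr0Sn.
have qe : q <= expR (- e) by rewrite qE; exact: expR_ge1Dx.
have h1 : q ^+ n <= expR e / expR (e * n.+1%:R).
  apply: (@le_trans _ _ (expR (- e) ^+ n)); first by rewrite lerXn2r// nnegrE// expR_ge0.
  by rewrite -expRM_natl -expRN -expRD ler_expR -natr1; lra.
have h2 : (e * n.+1%:R) ^+ 2 / 2 <= expR (e * n.+1%:R).
  have ex : 0 <= e * n.+1%:R by rewrite mulr_ge0// ltW.
  by apply: le_trans (expR_ge1Dxn 1 ex); rewrite lerDr.
have p2 : 0 < (e * n.+1%:R) ^+ 2 / 2 by rewrite divr_gt0// exprn_gt0// mulr_gt0.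
have h3 : expR e / expR (e * n.+1%:R) <= expR e / ((e * n.+1%:R) ^+ 2 / 2).
  by rewrite ler_pM2l ?expR_gt0// lef_pV2 ?posrE ?expR_gt0.
apply: (le_trans (ler_wpM2l (ltW n0) (le_trans h1 h3))).
rewrite le_eqVlt; apply/orP; left; apply/eqP; rewrite /C exprMn.
field.
by rewrite en andbT addrC natr1 lt0r_neq0.
Qed.

Lemma cos_away (d x : R) : 0 < d -> d <= pi -> d <= `|x| -> `|x| <= 2 * pi - d -> cos x <= cos d.
Proof.
move=> d0 dp dx xd.
have -> : cos x = cos `|x| by case: ger0P => // _; rewrite cosN.
move: dx xd; set y := `|x| => dy yd.
have pi0 := pi_gt0 R.
have I z : 0 <= z <= pi -> z \in `[0, pi] by rewrite in_itv.
have [yp|yp] := leP y pi.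
  by rewrite leNgt; apply/negP; rewrite ltr_cos ?I//; lra.
have -> : cos y = cos (2 * pi - y).
  by rewrite mulr_natl cosB cos2pi sin2pi mul1r mul0r addr0.
by rewrite leNgt; apply/negP; rewrite ltr_cos ?I//; lra.
Qed.

(** An approximate identity argument. No periodicity of [w] is assumed, so the point is interior:
    [e] is at most its distance to both ends of the interval, which keeps |x - t| away from 2 pi,
    where the kernel concentrates as well. *)
Lemma Kc_cvg w M (x : R) : continuous w -> (forall t, `|w t| <= M) -> - (pi / 2) < x < pi / 2 + pi ->
  Kc n w x @[n --> \oo] --> w x.
Proof.
move=> cw wM /andP[xl xr]; have pi0 := pi_gt0 R.
have Lw : Lc w by exact: Lc_cont.
have M0 : 0 <= M by exact: le_trans (wM x).
apply/cvgrPdist_le => eps eps0.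
have [d /= d0 Hd] : exists2 d : R, 0 < d & forall t, `|x - t| < d -> `|w x - w t| <= eps / 2.
  have /cvgrPdist_le/(_ (eps / 2)) := cw x; rewrite divr_gt0// => /(_ isT) /nbhs_ballP[d /= d0 H].
  by exists d => // t xt; apply: H.
pose e := Num.min d (Num.min (x + pi / 2) (pi / 2 + pi - x)).
have e0 : 0 < e by rewrite /e !lt_min d0/=; apply/andP; split; lra.
have ed : e <= d by rewrite /e ge_min lexx.
have e1 : e <= x + pi / 2 by rewrite /e !ge_min lexx orbT.
have e2 : e <= pi / 2 + pi - x by rewrite /e !ge_min lexx !orbT.
have ep : e <= pi by lra.
pose q := (1 + cos e) / 2.
have q1 : q < 1.
  rewrite /q ltr_pdivrMr// mul1r -[2]/(1 + 1) ltrD2l -(cos0 R) ltr_cos ?in_itv/= ?lexx ?(ltW e0) ?(ltW pi0)//.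
have q0 : 0 <= q by rewrite divr_ge0// oneDcos_ge0.
have far n t : circle t -> Jk n (x - t) * `|w t - w x| <= eps / 2 * Jk n (x - t) + 2 * M * (n.+1%:R * q ^+ n).
  move=> /circle_itv/andP[tl tr].
  have J0 := Jk_ge0 n (x - t).
  have nq : 0 <= n.+1%:R * q ^+ n by rewrite mulr_ge0// exprn_ge0.
  have [xt|xt] := ltP `|x - t| e.
    have h : `|w t - w x| <= eps / 2 by rewrite distrC; apply: Hd; exact: lt_le_trans ed.
    rewrite mulrC (le_trans (ler_wpM2r J0 h))// lerDl mulr_ge0// mulr_ge0//.
  have h : `|w t - w x| <= 2 * M.
    by rewrite (le_trans (ler_normB _ _))// mulr_natl mulr2n lerD.
  have hJ : Jk n (x - t) <= n.+1%:R * q ^+ n.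
    apply: Jk_le; rewrite ler_pM2r ?invr_gt0// lerD2l; apply: cos_away => //.
    by rewrite ler_norml; apply/andP; split; lra.
  apply: (@le_trans _ _ (2 * M * (n.+1%:R * q ^+ n))); last by rewrite lerDr mulr_ge0// divr_ge0// ltW.
  by rewrite mulrC ler_pM.
have LJ n : Lc (fun t => Jk n (x - t)) by apply: Lc_cont; exact: cont_Jk.
have Lww : Lc (fun t => `|w t - w x|).
  apply: Lc_cont => t; apply: (@continuous_comp _ _ _ (fun t => w t - w x)); last exact: norm_continuous.
  by apply: cvgB; [exact: cw|exact: cvg_cst].
have cJw n (v : R -> R) : continuous v -> Lc (fun t => Jk n (x - t) * v t).
  by move=> cv; apply: Lc_cont => t; apply: cvgM; [exact: cont_Jk|exact: cv].
have bound n : `|w x - Kc n w x| <= eps / 2 + 2 * pi * (2 * M) * (n.+1%:R * q ^+ n).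
  have -> : w x - Kc n w x = ic (fun t => Jk n (x - t) * (w x - w t)).
    rewrite -[w x in LHS]mulr1 -(ic_Jk n x) -icZ// -icB//; [|exact: LcZ|exact: cJw].
    by apply: ic_eq => t _; ring.
  have cd : continuous (fun t => w x - w t) by move=> t; apply: cvgB; [exact: cvg_cst|exact: cw].
  have ca : continuous (fun t => `|w t - w x|).
    move=> t; apply: (@continuous_comp _ _ _ (fun t => w t - w x)); last exact: norm_continuous.
    by apply: cvgB; [exact: cw|exact: cvg_cst].
  apply: (@le_trans _ _ (ic (fun t => Jk n (x - t) * `|w t - w x|))).
    rewrite ler_norml -[X in X <= _]mulN1r -icZ; last exact: cJw.
    apply/andP; split; apply: le_ic; try exact: cJw.
    - by apply: LcZ; exact: cJw.
    - move=> t _; rewrite mulN1r -mulrN; apply: ler_wpM2l; first exact: Jk_ge0.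
      by rewrite lerNl opprB ler_norm.
    - move=> t _; apply: ler_wpM2l; first exact: Jk_ge0.
      by rewrite distrC ler_norm.
  apply: (@le_trans _ _ (ic (fun t => eps / 2 * Jk n (x - t) + 2 * M * (n.+1%:R * q ^+ n)))).
    apply: le_ic; [exact: cJw| |exact: far].
    by apply: LcD; [exact: LcZ|exact: Lc1].
  rewrite icD; [|exact: LcZ|exact: Lc1].
  by rewrite icZ// ic_Jk mulr1 ic1 le_eqVlt; apply/orP; left; apply/eqP; ring.
have lim : 2 * pi * (2 * M) * (n.+1%:R * q ^+ n) @[n --> \oo] --> (0 : R).
  rewrite -[0 in X in _ --> X](mulr0 (2 * pi * (2 * M))); apply: cvgM; first exact: cvg_cst.
  exact: cvg_nexp.
have : \forall n \near \oo, `|0 - 2 * pi * (2 * M) * (n.+1%:R * q ^+ n)| <= eps / 2.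
  by have /cvgrPdist_le/(_ (eps / 2)) := lim; apply; rewrite divr_gt0.
apply: filterS => n hn; apply: (le_trans (bound n)).
have : 2 * pi * (2 * M) * (n.+1%:R * q ^+ n) <= eps / 2.
  by apply: le_trans hn; rewrite sub0r normrN ler_norm.
by lra.
Qed.

Lemma ae_neq (c : R) : {ae leb, forall t, t != c}.
Proof.
exists [set c]; split; [exact: measurable_set1|exact: lebesgue_measure_set1|].
by move=> t /=; case: (eqVneq t c) => // _ H; exfalso; exact: H.
Qed.

Lemma ic_dct (F : nat -> R -> R) f g : (forall n, measurable_fun (circle : set RT) (F n)) ->
  measurable_fun (circle : set RT) f ->
  (forall t, - (pi / 2) < t < pi / 2 + pi -> F n t @[n --> \oo] --> f t) ->
  Lc g -> (forall n t, circle t -> `|F n t| <= g t) ->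
  ic (F n) @[n --> \oo] --> ic f.
Proof.
move=> mF mf Ff Lg Fg.
have H1 n : measurable_fun (circle : set RT) (EFin \o F n) by apply/measurable_EFinP.
have H2 : measurable_fun (circle : set RT) (EFin \o f) by apply/measurable_EFinP.
have H3 : {ae leb, forall t, circle t -> (EFin \o F n) t @[n --> \oo] --> (EFin \o f) t}.
  apply: ae_imp (ae_neq (pi / 2 + pi)) => t tn /circle_itv/andP[tl tr].
  apply: cvg_EFin; first exact: nearW.
  by apply: Ff; rewrite tl lt_neqAle tn.
have H4 : {ae leb, forall t n, circle t -> (`|(EFin \o F n) t| <= (EFin \o g) t)%E}.
  by apply: aeW => t n ct; rewrite /= lee_fin; exact: Fg.
have [Lf _ H] := @dominated_convergence _ RT R leb circle mc _ _ _ H1 H2 H3 Lg H4.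
have e2 : (\int[leb]_(x in circle) (EFin \o f) x)%E = (ic f)%:E by rewrite /ic EFin_Rint.
rewrite e2 in H.
exact: (fine_cvg H).
Qed.

Lemma psum_cvg_cont w1 w2 M : continuous w1 -> continuous w2 ->
  (forall t, `|w1 t| <= M) -> (forall t, `|w2 t| <= M) ->
  psum n w1 w2 @[n --> \oo] --> energy w1 w2.
Proof.
move=> c1 c2 b1 b2.
have cl w : continuous w -> L2c w.
  move=> cw; split; first exact: cont_meas_circle.
  by apply: Lc_cont => t; apply: cvgM; exact: cw.
have h1 := cl _ c1; have h2 := cl _ c2.
have L1 := L2c_Lc h1; have L2 := L2c_Lc h2.
have M0 : 0 <= M by exact: le_trans (b1 0).
have Kb n w : continuous w -> (forall t, `|w t| <= M) -> forall t, `|Kc n w t| <= M.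
  move=> cw bw t.
  have LJ (v : R -> R) : continuous v -> Lc (fun s => Jk n (t - s) * v s).
    by move=> cv; apply: Lc_cont => s; apply: cvgM; [exact: cont_Jk|exact: cv].
  have LM : Lc (fun s => M * Jk n (t - s)) by apply: LcZ; apply: Lc_cont; exact: cont_Jk.
  have iM : ic (fun s => M * Jk n (t - s)) = M.
    by rewrite icZ ?ic_Jk ?mulr1//; apply: Lc_cont; exact: cont_Jk.
  rewrite ler_norml -[X in X <= _]mulN1r -{1 2}iM -icZ//; apply/andP; split; apply: le_ic; try exact: LJ.
  - exact: LcZ.
  - move=> s _; rewrite mulN1r [M * _]mulrC -mulrN; apply: ler_wpM2l; first exact: Jk_ge0.
    by rewrite lerNl (le_trans (ler_norm _))// normrN.
  - exact: LM.
  - move=> s _; rewrite [M * _]mulrC; apply: ler_wpM2l; first exact: Jk_ge0.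
    by rewrite (le_trans (ler_norm _)).
under eq_cvg do rewrite (psumE _ h1 h2).
apply: (@ic_dct _ _ (fun=> M * M + M * M)); last 2 first.
- exact: Lc1.
- move=> n t _; apply: (le_trans (ler_normD _ _)); rewrite !normrM.
  by apply: lerD; apply: ler_pM => //; exact: Kb.
- move=> n; apply: cont_meas_circle => t.
  by apply: cvgD; apply: cvgM; [exact: c1|exact: cont_Kc|exact: c2|exact: cont_Kc].
- apply: cont_meas_circle => t.
  by apply: cvgD; apply: cvgM; [exact: c1|exact: c1|exact: c2|exact: c2].
- move=> t tc; rewrite !expr2; apply: cvgD; (apply: cvgM; first exact: cvg_cst).
    exact: (Kc_cvg c1 b1).
  exact: (Kc_cvg c2 b2).
Qed.

Definition clip (M x : R) : R := Num.max (- M) (Num.min M x).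

Lemma clip_le M x : 0 <= M -> `|clip M x| <= M.
Proof.
move=> M0; rewrite /clip ler_norml le_max lexx/= ge_max ge_min lexx andbT.
by rewrite (@le_trans _ _ 0)// oppr_le0.
Qed.

Lemma clip_id M x : `|x| <= M -> clip M x = x.
Proof.
rewrite ler_norml => /andP[h1 h2]; rewrite /clip.
by rewrite (min_idPr h2) (max_idPr h1).
Qed.

Lemma clipE M x : 0 <= M -> clip M x = if x <= - M then - M else if M <= x then M else x.
Proof.
move=> M0; have MM : - M <= M by rewrite (@le_trans _ _ 0)// oppr_le0.
rewrite /clip; case: (leP x (- M)) => h1.
  by apply/max_idPl; rewrite ge_min h1 orbT.
have [h2|h2] := lerP M x; first by apply/max_idPr.
by apply/max_idPr; exact: ltW.
Qed.

Lemma clip_lip M x y : 0 <= M -> `|clip M x - clip M y| <= `|x - y|.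
Proof.
move=> M0; wlog yx : x y / y <= x => [H|].
  by have [/H//|/ltW/H] := leP y x; rewrite distrC [X in _ <= X -> _]distrC.
rewrite [leRHS]ger0_norm ?subr_ge0// ler_norml !clipE//.
by case: (leP x (- M)) => h1; case: (leP y (- M)) => h2; case: (leP M x) => h3; case: (leP M y) => h4;
  apply/andP; split; lra.
Qed.

Lemma clip_diff M x : 0 <= M -> `|x - clip M x| <= `|x|.
Proof.
move=> M0; rewrite clipE//.
case: (leP x (- M)) => h1; first by rewrite !ler0_norm; lra.
by case: (leP M x) => h2; [rewrite !ger0_norm; lra|rewrite subrr normr0].
Qed.

Lemma cont_clip M : continuous (clip M).
Proof.
move=> x; apply/cvgrPdist_le => e e0.
have [M0|M0] := leP 0 M.
  near=> y; apply: (le_trans (clip_lip x y M0)).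
  near: y; apply/nbhs_ballP; exists e => //= y; rewrite /ball/= => h; exact: ltW.
have h y : clip M y = - M.
  rewrite /clip; apply/max_idPl; rewrite ge_min; apply/orP; left.
  by rewrite (@le_trans _ _ 0) ?oppr_ge0// ltW.
by near=> y; rewrite !h subrr normr0 ltW.
Unshelve. all: end_near. Qed.

(** The function is truncated at height n by dominated convergence, the truncation is approximated
    in L^1 by a continuous function, and this one is clipped again. Between functions bounded by n,
    the squared L^2 distance is at most 2 n times the L^1 distance. *)
Lemma dense w (e : R) : L2c w -> 0 < e ->
  exists (c : R -> R) (M : R), [/\ continuous c, 0 <= M, (forall t, `|c t| <= M) & ic (fun t => (w t - c t) ^+ 2) <= e].
Proof.
move=> h e0.
have mcl M : measurable_fun (circle : set RT) (fun t => clip M (w t)).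
  have mc1 : measurable_fun (setT : set R) (clip M).
    by apply: continuous_measurable_fun; exact: cont_clip.
  exact: (measurableT_comp mc1 h.1).
have lim1 : ic (fun t => (w t - clip n%:R (w t)) ^+ 2) @[n --> \oo] --> ic (fun=> 0).
  apply: (@ic_dct _ _ (fun t => w t ^+ 2)).
  - move=> n; apply: measurable_funX; exact: (measurable_funB h.1 (mcl _)).
  - exact: measurable_cst.
  - move=> t _; apply/cvgrPdist_le => d d0; near=> n.
    have wn : `|w t| < n%:R by near: n; exact: nbhs_infty_gtr.
    by rewrite clip_id ?subrr ?expr0n/= ?normr0 ?subrr ?normr0 ?ltW.
  - exact: h.2.
  - move=> n t _; rewrite normrX -(real_normK (num_real (w t))) lerXn2r ?nnegrE// clip_diff//.
have [n hn] : exists n, ic (fun t => (w t - clip n%:R (w t)) ^+ 2) <= e / 4.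
  have e4 : 0 < e / 4 by rewrite divr_gt0.
  have /cvgrPdist_le/(_ _ e4)[n _ /(_ n (leqnn n))] := lim1.
  rewrite ic1 mulr0 sub0r normrN => H; exists n; exact: le_trans (ler_norm _) H.
pose wn t := clip n%:R (w t).
have Lwn : Lc wn.
  apply: (Lc_le (mcl n%:R) _ (Lc1 n%:R)) => t _; exact: clip_le.
have mcirc : (leb circle < +oo)%E.
  by rewrite /circle lebesgue_measure_itv/= lte_fin; case: ifP => _; rewrite -?EFinB ltry.
have [g [gc gi gl]] := approximation_continuous_integrable mc mcirc Lwn.
have Lgw k : Lc (fun t => `|wn t - g k t|).
  have LD : Lc (fun t => wn t - g k t) by apply: LcB => //; exact: gi.
  have mD : measurable_fun (circle : set RT) (fun t => wn t - g k t) by exact: (L1_meas LD).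
  exact: (integrable_norm LD).
have lim2 : ic (fun t => `|wn t - g k t|) @[k --> \oo] --> (0 : R).
  apply: (@fine_cvg _ _ _ _ (fun k => \int[leb]_(z in circle) `|(wn z - g k z)%:E|)%E).
  exact: gl.
(* The summand 1 keeps the denominator positive when n = 0. *)
have p0 : 0 < 4 * (2 * n%:R) + 1 :> R by rewrite ltr_wpDl// !mulr_ge0.
have [k hk] : exists k, ic (fun t => `|wn t - g k t|) <= e / (4 * (2 * n%:R) + 1).
  have e4 : 0 < e / (4 * (2 * n%:R) + 1) by rewrite divr_gt0.
  have /cvgrPdist_le/(_ _ e4)[k _ /(_ k (leqnn k))] := lim2.
  rewrite sub0r normrN => H; exists k; exact: le_trans (ler_norm _) H.
pose c t := clip n%:R (g k t).
have cc : continuous c.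
  by move=> t; apply: (@continuous_comp _ _ _ (g k) (clip n%:R)); [exact: gc|exact: cont_clip].
exists c, n%:R; split=> //; first by move=> t; exact: clip_le.
have L2w : L2c wn.
  split; first exact: mcl.
  apply: (Lc_le (measurable_funX 2 (mcl _)) _ (Lc1 (n%:R ^+ 2))) => t _.
  by rewrite normrX lerXn2r ?nnegrE// clip_le.
have L2cc : L2c c.
  split; first exact: cont_meas_circle.
  by apply: Lc_cont => t; apply: cvgM; exact: cc.
have B1 := L2cB h L2w; have B2 := L2cB L2w L2cc; have B3 := L2cB h L2cc.
have s1 : ic (fun t => (w t - c t) ^+ 2) <= ic (fun t => 2 * (w t - wn t) ^+ 2 + 2 * (wn t - c t) ^+ 2).
  apply: le_ic; [exact: B3.2|by apply: LcD; apply: LcZ; [exact: B1.2|exact: B2.2]|].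
  move=> t _; rewrite -subr_ge0.
  have -> : 2 * (w t - wn t) ^+ 2 + 2 * (wn t - c t) ^+ 2 - (w t - c t) ^+ 2 = (w t - wn t - (wn t - c t)) ^+ 2 by ring.
  exact: sqr_ge0.
apply: (le_trans s1); rewrite icD; [|by apply: LcZ; [exact: B1.2 || exact: B2.2]..].
rewrite !icZ; [|exact: B2.2|exact: B1.2].
have s2 : ic (fun t => (wn t - c t) ^+ 2) <= 2 * n%:R * ic (fun t => `|wn t - g k t|).
  rewrite -icZ//; apply: le_ic; [exact: B2.2|exact: LcZ|].
  move=> t _; rewrite -(real_normK (num_real _)) expr2; apply: ler_pM => //.
    by rewrite (le_trans (ler_normB _ _))// mulr_natl mulr2n lerD// clip_le.
  (* [wn] is its own truncation and [clip] is 1-Lipschitz, so clipping [g k] does not increase its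
     distance to [wn]. *)
  have wc : clip n%:R (wn t) = wn t by apply: clip_id; exact: clip_le.
  by rewrite -{1}wc; exact: clip_lip.
have s3 : 2 * n%:R * ic (fun t => `|wn t - g k t|) <= e / 4.
  apply: (le_trans (ler_wpM2l _ hk)); first by rewrite mulr_ge0.
  rewrite [leLHS]mulrA ler_pdivrMr//; set y := 2 * n%:R; have y0 : 0 <= y by rewrite mulr_ge0.
  by have -> : e / 4 * (4 * y + 1) = y * e + e / 4; [by field|rewrite lerDl ltW// divr_gt0].
by lra.
Unshelve. all: end_near. Qed.

(** The defect [energy] - [psum] is nonnegative and obeys the parallelogram law. Writing w = c + v
    with c continuous, the defect of w is at most twice the defect of c plus twice the energy of v;
    the first tends to 0 by [psum_cvg_cont], the second is small by density. *)
Lemma parseval w1 w2 : L2c w1 -> L2c w2 -> psum n w1 w2 @[n --> \oo] --> energy w1 w2.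
Proof.
move=> h1 h2; apply/cvgrPdist_le => e e0.
have e8 : 0 < e / 8 by rewrite divr_gt0.
have [c1 [M1 [cc1 M10 cM1 H1]]] := dense h1 e8.
have [c2 [M2 [cc2 M20 cM2 H2]]] := dense h2 e8.
have cl w : continuous w -> L2c w.
  move=> cw; split; first exact: cont_meas_circle.
  by apply: Lc_cont => t; apply: cvgM; exact: cw.
have k1 := cl _ cc1; have k2 := cl _ cc2.
pose v1 t := w1 t - c1 t; pose v2 t := w2 t - c2 t.
have hv1 : L2c v1 := L2cB h1 k1.
have hv2 : L2c v2 := L2cB h2 k2.
have Ev : energy v1 v2 <= e / 4.
  by rewrite /energy icD; [|exact: hv1.2|exact: hv2.2]; move: H1 H2; rewrite -/(v1) /v1 /v2; lra.
have b1 t : `|c1 t| <= Num.max M1 M2 by rewrite le_max cM1.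
have b2 t : `|c2 t| <= Num.max M1 M2 by rewrite le_max cM2 orbT.
have e4 : 0 < e / 4 by rewrite divr_gt0.
have /cvgrPdist_le/(_ _ e4) := psum_cvg_cont cc1 cc2 b1 b2.
apply: filterS => n hn.
have P := parallelogram n k1 k2 hv1 hv2.
have EP := energy_parallelogram k1 k2 hv1 hv2.
have w1E : (fun t => c1 t + v1 t) = w1 by apply/funext => t; rewrite /v1 addrC subrK.
have w2E : (fun t => c2 t + v2 t) = w2 by apply/funext => t; rewrite /v2 addrC subrK.
rewrite w1E w2E in P EP.
have D1 := psum_le n (L2cB k1 hv1) (L2cB k2 hv2).
have D2 := psum_le n h1 h2.
have D3 := psum_ge0 n v1 v2.
rewrite ger0_norm ?subr_ge0//.
have D4 : energy c1 c2 - psum n c1 c2 <= e / 4 by apply: le_trans hn; rewrite ler_norm.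
by lra.
Qed.

Lemma parseval_freqs w1 w2 : L2c w1 -> L2c w2 ->
  \sum_(m <- freqs n) fc2 m w1 w2 @[n --> \oo] --> 2 * pi * energy w1 w2.
Proof.
move=> h1 h2; apply: (@squeeze_cvgr _ _ _ _ (fun n => 2 * pi * psum n w1 w2) (fun=> 2 * pi * energy w1 w2)).
- by apply: nearW => n; rewrite psum_le_freqs (bessel (freqs_uniq n) h1 h2).
- by apply: cvgM; [exact: cvg_cst|exact: parseval].
- exact: cvg_cst.
Qed.
End circle_integral.

(** * Polar integration of integrable functions *)

Section polar_fubini.
Context {R : realType}.
Local Notation leb := (@lebesgue_measure R).
Local Notation RT := (measurableTypeR R).
Local Notation leb2 := (@lebesgue_measure R \x @lebesgue_measure R)%E.
Implicit Types (F : R * R -> R).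

Lemma ae_and (P Q : R -> Prop) : {ae leb, forall r, P r} -> {ae leb, forall r, Q r} ->
  {ae leb, forall r, P r /\ Q r}.
Proof.
move=> [A [mA A0 PA]] [B [mB B0 QB]]; exists (A `|` B); split.
- exact: measurableU.
- apply/eqP; rewrite -measure_le0 -[0%E]adde0 -{1}A0 -B0; exact: measureU2.
- move=> r /= PQ; have [p|/PA] := pselect (P r); last by left.
  by right; apply: QB => /= q; apply: PQ.
Qed.

Definition arc F (r : R) : R -> R := fun t => F (polar (r, t)).

Lemma measurable_slice F : measurable_fun (setT : set (RT * RT)) F ->
  measurable_fun (setT : set RT) (fun r => ic (fun t => F (r, t))).
Proof.
move=> mF.
pose G (z : RT * RT) : R := F z * \1_circle z.2.
have mG : measurable_fun setT G.
  apply: measurable_funM => //.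
  exact: (measurableT_comp (measurable_indic (@measurable_circle R)) measurable_snd).
have mE : measurable_fun setT (EFin \o G) by apply/measurable_EFinP.
have mp : measurable_fun setT (EFin \o G)^\+%E by exact: measurable_funepos.
have mn : measurable_fun setT (EFin \o G)^\-%E by exact: measurable_funeneg.
have m1 := measurable_tonelli1 mp (fun z => funepos_ge0 _ z).
have m2 := measurable_tonelli1 mn (fun z => funeneg_ge0 _ z).
have m3 : measurable_fun (setT : set RT) (fun r => fine (\int[leb]_t (EFin \o G)^\+ (r, t) - \int[leb]_t (EFin \o G)^\- (r, t))%E).
  exact: (measurableT_comp (fine_measurable measurableT) (emeasurable_funB m1 m2)).
apply: eq_measurable_fun m3 => r _.
rewrite /ic Rintegral_mkcond.
have -> : (fun t => F (r, t)) \_ circle = (fun t => G (r, t)).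
  by apply/funext => t; rewrite patchE /G /= indicE; case: ifP; rewrite ?mulr1 ?mulr0.
rewrite /Rintegral integralE; congr (fine (_ - _)%E); apply: eq_integral => t _.
  by rewrite !funeposE.
by rewrite !funenegE.
Qed.

Lemma measurable_arc F : measurable_fun (setT : set (RT * RT)) F ->
  measurable_fun (setT : set (RT * RT)) (fun z => F (polar z)).
Proof. by move=> mF; exact: (measurableT_comp mF (@measurable_polar R)). Qed.

Lemma measurable_arc1 F (r : R) : measurable_fun (setT : set (RT * RT)) F ->
  measurable_fun (circle : set RT) (arc F r).
Proof.
move=> mF; apply: (measurable_funS measurableT (@subsetT _ _)).
exact: (measurableT_comp (measurable_arc mF) (pair1_measurable r)).
Qed.

Let rpos : set R := `]0, +oo[%classic.
Let mrpos : measurable rpos. Proof. exact: measurable_itv. Qed.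

Lemma measurable_ic_arc F : measurable_fun (setT : set (RT * RT)) F ->
  measurable_fun (rpos : set RT) (fun r => r * ic (arc F r)).
Proof.
move=> mF; apply: (measurable_funS measurableT (@subsetT _ _)).
apply: measurable_funM => //; exact: (measurable_slice (measurable_arc mF)).
Qed.

Let absE F (z : R * R) : \bar R := (`|F z|)%:E.

Let mabs F : measurable_fun (setT : set (RT * RT)) F -> measurable_fun (setT : set (RT * RT)) (absE F).
Proof. by move=> mF; apply/measurable_EFinP; exact: measurableT_comp. Qed.

Lemma polar_L1 F : L1 leb2 setT F ->
  leb.-integrable rpos (fun r => r%:E * \int[leb]_(t in circle) (`|arc F r t|)%:E)%E.
Proof.
move=> LF; have mF : measurable_fun (setT : set (RT * RT)) F by exact: (L1_meas LF).
have mA := mabs mF.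
have A0 z : (0 <= absE F z)%E by rewrite lee_fin.
have e := ge0_integral_polar mA A0.
have mI : measurable_fun (setT : set RT) (fun r => \int[leb]_(t in circle) (`|arc F r t|)%:E)%E.
  have mG : measurable_fun (setT : set (RT * RT)) (fun z => absE F (polar z) * (\1_circle z.2)%:E)%E.
    apply: emeasurable_funM; first exact: (measurableT_comp mA (@measurable_polar R)).
    apply/measurable_EFinP.
    exact: (measurableT_comp (measurable_indic (@measurable_circle R)) measurable_snd).
  have := measurable_tonelli1 mG (fun z => mule_ge0 (A0 _) (_ : (0 <= (\1_circle z.2)%:E)%E)).
  move=> /(_ (fun z => _)) H.
  have {}H : measurable_fun (setT : set RT) (fun r => \int[leb]_t (absE F (polar (r, t)) * (\1_circle t)%:E))%E.
    by apply: H => z; rewrite lee_fin indicE.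
  apply: eq_measurable_fun H => r _; rewrite [RHS]integral_mkcond; apply: eq_integral => t _.
  by rewrite patchE indicE; case: ifP => _; rewrite ?mule1 ?mule0.
apply/integrableP; split.
  apply: emeasurable_funM; last exact: (measurable_funS measurableT (@subsetT _ _) mI).
  by apply/measurable_EFinP; exact: measurable_id.
rewrite (@eq_integral _ RT R leb rpos (fun r => r%:E * \int[leb]_(t in circle) absE F (polar (r, t)))%E).
  rewrite -e; have /integrableP[_] := LF; exact.
move=> r /set_mem; rewrite /rpos /= in_itv/= andbT => r0.
by rewrite gee0_abs// mule_ge0 ?lee_fin ?(ltW r0)// integral_ge0.
Qed.

Lemma polar_arc_Lc F : L1 leb2 setT F -> {ae leb, forall r, 0 < r -> Lc (arc F r)}.
Proof.
move=> LF; have mF : measurable_fun (setT : set (RT * RT)) F by exact: (L1_meas LF).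
have := @integrable_ae _ RT R leb rpos mrpos _ (polar_L1 LF).
apply: ae_imp => r H r0.
have r0' : rpos r by rewrite /rpos/= in_itv/= r0.
have {}H := H r0'.
apply/integrableP; split; first by apply/measurable_EFinP; exact: measurable_arc1.
have I0 : (0 <= \int[leb]_(t in circle) (`|arc F r t|)%:E)%E by apply: integral_ge0 => t _; rewrite lee_fin.
rewrite ltey_eq; apply/orP; left.
move: H; rewrite fin_numE => /andP[_ H]; rewrite fin_numElt (lt_le_trans _ I0)//=.
move: I0 H; case: (\int[leb]_(t in circle) (`|arc F r t|)%:E)%E => [x|//|//]; rewrite ?ltry//.
by move=> _; rewrite gt0_muley ?lte_fin// eqxx.
Qed.

Lemma polar_L1r F : L1 leb2 setT F -> L1 leb rpos (fun r => r * ic (arc F r)).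
Proof.
move=> LF; have mF : measurable_fun (setT : set (RT * RT)) F by exact: (L1_meas LF).
apply: (@le_integrable _ RT R leb rpos mrpos _ _ _ _ (polar_L1 LF)).
  by apply/measurable_EFinP; exact: measurable_ic_arc.
move=> r; rewrite /rpos/= in_itv/= andbT => r0.
rewrite [leRHS]gee0_abs; last first.
  by rewrite mule_ge0 ?lee_fin ?(ltW r0)//; apply: integral_ge0 => t _; rewrite lee_fin.
rewrite normrM (gtr0_norm r0) EFinM; apply: lee_wpmul2l; first by rewrite lee_fin ltW.
apply: (le_trans (le_abs_fine _)); apply: le_abse_integral; first exact: measurable_circle.
by apply/measurable_EFinP; exact: measurable_arc1.
Qed.

Lemma Rpolar_ge0 F : L1 leb2 setT F -> (forall z, 0 <= F z) ->
  \int[leb2]_z F z = \int[leb]_(r in rpos) (r * ic (arc F r)).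
Proof.
move=> LF F0; have mF : measurable_fun (setT : set (RT * RT)) F by exact: (L1_meas LF).
have mE : measurable_fun (setT : set (RT * RT)) (EFin \o F) by apply/measurable_EFinP.
rewrite /Rintegral (ge0_integral_polar mE (fun z => _))//; congr fine.
have LP := polar_L1 LF; have LR := polar_L1r LF.
have E r : (r%:E * \int[leb]_(t in circle) (`|arc F r t|)%:E = r%:E * \int[leb]_(t in circle) (EFin \o F) (polar (r, t)))%E.
  by congr (_ * _)%E; apply: eq_integral => t _; rewrite /arc ger0_norm.
transitivity (\int[leb]_(r in rpos) (r%:E * \int[leb]_(t in circle) (`|arc F r t|)%:E))%E.
  by apply: eq_integral => r _; rewrite E.
apply: ae_eq_integral => //; [exact: (measurable_int _ LP)|exact: (measurable_int _ LR)|].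
apply: ae_imp (polar_arc_Lc LF) => r H; rewrite /rpos /= in_itv/= andbT => r0.
rewrite EFinM; congr (_ * _)%E; rewrite /ic EFin_Rint; last exact: (H r0).
  by apply: eq_integral => t _; rewrite /arc ger0_norm.
exact: measurable_circle.
Qed.

Lemma Rpolar F : L1 leb2 setT F -> \int[leb2]_z F z = \int[leb]_(r in rpos) (r * ic (arc F r)).
Proof.
move=> LF; have mF : measurable_fun (setT : set (RT * RT)) F by exact: (L1_meas LF).
pose P z := Num.max (F z) 0; pose N z := Num.max (- F z) 0.
have FE z : F z = P z - N z by rewrite /P /N; case: (lerP (F z) 0); case: (lerP (- F z) 0); lra.
have Labs : L1 leb2 setT (fun z => `|F z|) by exact: (integrable_norm LF).
have LP : L1 leb2 setT P.
  apply: (L1_le measurableT _ _ Labs).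
    by apply: measurable_maxr => //; exact: measurable_cst.
  by move=> z _; rewrite ger0_norm ?le_max ?lexx ?orbT// ge_max ler_norm normr_ge0.
have LN : L1 leb2 setT N.
  apply: (L1_le measurableT _ _ Labs).
    by apply: measurable_maxr; [exact: measurableT_comp|exact: measurable_cst].
  by move=> z _; rewrite ger0_norm ?le_max ?lexx ?orbT// ge_max -normrN ler_norm normr_ge0.
have P0 z : 0 <= P z by rewrite le_max lexx orbT.
have N0 z : 0 <= N z by rewrite le_max lexx orbT.
transitivity (\int[leb2]_z P z - \int[leb2]_z N z).
  by rewrite -RintegralB//; apply: Rint_eq => z _.
rewrite (Rpolar_ge0 LP P0) (Rpolar_ge0 LN N0) -RintegralB//; [|exact: polar_L1r|exact: polar_L1r].
have L1P := polar_L1r LP; have L1N := polar_L1r LN; have L1F := polar_L1r LF.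
rewrite /Rintegral; congr fine; apply: ae_eq_integral => //.
- by have /integrableP[] := @L1B _ RT R leb rpos mrpos _ _ L1P L1N.
- by have /integrableP[] := L1F.
have aP := polar_arc_Lc LP; have aN := polar_arc_Lc LN.
have : {ae leb, forall r, (0 < r -> Lc (arc P r)) /\ (0 < r -> Lc (arc N r))} by exact: ae_and.
apply: ae_imp => r [H1 H2]; rewrite /rpos /= in_itv/= andbT => r0.
rewrite -mulrBr -icB; [|exact: H1|exact: H2]; congr (_ * _)%:E.
by apply: ic_eq => t _; rewrite /arc FE.
Qed.
End polar_fubini.

(** * Smooth radial cut-offs and the du Bois-Reymond lemma *)

Section smooth_class.
Context {R : realType}.
Local Notation leb := (@lebesgue_measure R).

(** The negative powers of x make the family stable under derivation, up to linear combinations. *)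
Definition flat (n : nat) (x : R) : R := if 0 < x then x ^- n * expR (- x^-1) else 0.

Lemma flat_ge0 n x : 0 <= flat n x.
Proof. by rewrite /flat; case: ifP => // x0; rewrite mulr_ge0 ?expR_ge0// invr_ge0 exprn_ge0// ltW. Qed.

(** The Taylor term of order n + 2 of e^(1/x). The quadratic bound makes the difference quotient at
    the origin tend to 0. *)
Lemma flat_le n x : 0 < x -> flat n x <= (n + 2)`!%:R * x ^+ 2.
Proof.
move=> x0; rewrite /flat x0.
have xi : 0 <= x^-1 by rewrite invr_ge0 ltW.
have h : x^-1 ^+ (n + 2) / (n + 2)`!%:R <= expR (x^-1).
  by rewrite (le_trans _ (expR_ge1Dxn (n + 1) xi))// addn1 addn2 lerDr.
have f0 : 0 < (n + 2)`!%:R :> R by rewrite ltr0n fact_gt0.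
rewrite expRN mulrC ler_pdivrMl ?exprn_gt0// ?expR_gt0// -?ler_pdivlMr.
have h2 : 1 <= expR x^-1 * (n + 2)`!%:R * x ^+ (n + 2).
  rewrite -ler_pdivrMr ?exprn_gt0// div1r -exprVn.
  by move: h; rewrite ler_pdivrMr.
have xn : 0 < x ^- n by rewrite invr_gt0 exprn_gt0.
rewrite -[leLHS]mulr1 (le_trans (ler_wpM2l (ltW xn) h2))// le_eqVlt; apply/orP; left; apply/eqP.
by rewrite exprD; field; rewrite expf_neq0// gt_eqF.
Qed.

Lemma is_derive_flat n (x : R) : is_derive x 1 (flat n) (- n%:R * flat n.+1 x + flat n.+2 x).
Proof.
have [x0|x0|->] := ltrgt0P x.
- have xn0 : x != 0 by rewrite gt_eqF.
  have xn : x ^+ n != 0 by rewrite expf_neq0.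
  have d1 := is_deriveV1 (f := fun y => y ^+ n) xn (is_derive_idX1 x n).
  have di := is_deriveV1 xn0 (is_derive_id x (1 : R)).
  have d2 := is_derive_comp1 (is_deriveB1 (is_derive_cst (0 : R) x 1) di) (is_derive_expR _).
  have d := is_deriveM1 d1 d2.
  have e : {near x, (fun y => y ^- n * expR (0 - y^-1)) =1 flat n}.
    near=> y; have y0 : 0 < y by near: y; exact: lt_nbhsr.
    by rewrite /flat y0 sub0r.
  apply: (is_derive_eq (near_eq_is_derive e d)).
  rewrite /flat x0 sub0r /cst.
  case: n xn d1 d e => [|n] xn d1 d e /=; last by rewrite !exprS; field; rewrite xn0 expf_neq0.
  by rewrite !exprS expr0; field.
- have e : {near x, cst 0 =1 flat n}.
    near=> y; have y0 : y < 0 by near: y; exact: lt_nbhsl.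
    by rewrite /flat ltNge (ltW y0).
  apply: (is_derive_eq (near_eq_is_derive e (is_derive_cst (0 : R) x 1))).
  by rewrite /flat ltNge (ltW x0)/= mulr0 addr0.
have f0 k : flat k 0 = 0 by rewrite /flat ltxx.
rewrite !f0 mulr0 addr0.
have H : h^-1 *: (flat n (h *: (1 : R) + 0) - flat n 0) @[h --> 0^'] --> (0 : R).
  apply/cvgrPdist_le => e e0; near=> h.
  have hn0 : h != 0 by near: h; exact: nbhs_dnbhs_neq.
  rewrite sub0r normrN f0 subr0 addr0 /GRing.scale/= mulr1.
  have [h0|h0] := ltP 0 h; last by rewrite /flat ltNge h0/= mulr0 normr0 ltW.
  rewrite ger0_norm ?mulr_ge0 ?flat_ge0 ?invr_ge0 ?(ltW h0)//.
  rewrite ler_pdivrMl// (le_trans (flat_le _ h0))// expr2 mulrA mulrC ler_pM2l//.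
  rewrite -ler_pdivlMl ?ltr0n ?fact_gt0//.
  apply: (le_trans (ler_norm _)); near: h.
  apply: dnbhs0_le; rewrite mulr_gt0// invr_gt0 ltr0n fact_gt0//.
by apply: DeriveDef; [apply/cvg_ex; exists 0|apply: cvg_lim => //; exact: Rhausdorff].
Unshelve. all: end_near. Qed.

(* [SM] and [C2] are closed under derivation by construction, which makes all
   their members smooth test functions; [flat] supplies the cut-offs. *)
Inductive SM : (R -> R) -> Prop :=
| SM_flat n c d : SM (fun s => flat n (c * s + d))
| SM_cst c : SM (fun=> c)
| SM_add f g : SM f -> SM g -> SM (fun s => f s + g s)
| SM_mul f g : SM f -> SM g -> SM (fun s => f s * g s)
| SM_prim f g : SM g -> (forall s : R, is_derive s 1 f (g s)) -> SM f.

Lemma SM_derive f : SM f -> exists2 g, SM g & forall s : R, is_derive s 1 f (g s).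
Proof.
elim=> [n c d|c|f1 f2 _ [g1 S1 D1] _ [g2 S2 D2]|f1 f2 S1' [g1 S1 D1] S2' [g2 S2 D2]|f1 g1 S1 _ D1].
- exists (fun s => c * (- n%:R * flat n.+1 (c * s + d) + flat n.+2 (c * s + d))).
    apply: (SM_mul (SM_cst _)); apply: SM_add; last exact: SM_flat.
    by apply: (SM_mul (SM_cst _)); exact: SM_flat.
  move=> s; have d1 := is_deriveD1 (is_deriveM1 (is_derive_cst (c : R) s 1) (is_derive_id s (1 : R))) (is_derive_cst (d : R) s 1).
  by apply: (is_derive_eq (is_derive_comp1 d1 (is_derive_flat n _))); rewrite /cst; ring.
- by exists (fun=> 0); [exact: SM_cst|move=> s; exact: is_derive_cst].
- exists (fun s => g1 s + g2 s); first exact: SM_add.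
  by move=> s; exact: is_deriveD1.
- exists (fun s => g1 s * f2 s + f1 s * g2 s).
    by apply: SM_add; apply: SM_mul.
  by move=> s; exact: is_deriveM1.
- by exists g1.
Qed.

Lemma SM_cont f : SM f -> continuous f.
Proof. by move=> /SM_derive[g _ D] s; exact: (is_derive_continuous1 (D s)). Qed.

(** Partial derivatives taken along coordinate lines, so that the one-variable rules apply; [D12_pd]
    and [pd_D12] translate to and from [pd1] and [pd2]. *)
Definition D12 (f d1 d2 : R * R -> R) := forall x : R * R,
  is_derive x.1 1 (fun t => f (t, x.2)) (d1 x) /\ is_derive x.2 1 (fun t => f (x.1, t)) (d2 x).

Definition nsq (x : R * R) : R := x.1 ^+ 2 + x.2 ^+ 2.

(** The 2 is the number of variables, not an order of differentiability. Radial members are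
    functions of the squared norm, so that no singularity appears at the origin. *)
Inductive C2 : (R * R -> R) -> Prop :=
| C2_cst c : C2 (fun=> c)
| C2_fst : C2 (fun x => x.1)
| C2_snd : C2 (fun x => x.2)
| C2_add f g : C2 f -> C2 g -> C2 (fun x => f x + g x)
| C2_mul f g : C2 f -> C2 g -> C2 (fun x => f x * g x)
| C2_rad f : SM f -> C2 (fun x => f (nsq x)).

Lemma D12_cst c : D12 (fun=> c) (fun=> 0) (fun=> 0).
Proof. by move=> x; split; exact: is_derive_cst. Qed.
Lemma D12_fst : D12 (fun x => x.1) (fun=> 1) (fun=> 0).
Proof. by move=> x; split; [exact: is_derive_id|exact: is_derive_cst]. Qed.
Lemma D12_snd : D12 (fun x => x.2) (fun=> 0) (fun=> 1).
Proof. by move=> x; split; [exact: is_derive_cst|exact: is_derive_id]. Qed.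
Lemma D12_add f g f1 f2 g1 g2 : D12 f f1 f2 -> D12 g g1 g2 ->
  D12 (fun x => f x + g x) (fun x => f1 x + g1 x) (fun x => f2 x + g2 x).
Proof. by move=> F G x; have [? ?] := F x; have [? ?] := G x; split; exact: is_deriveD1. Qed.
Lemma D12_mul f g f1 f2 g1 g2 : D12 f f1 f2 -> D12 g g1 g2 ->
  D12 (fun x => f x * g x) (fun x => f1 x * g x + f x * g1 x) (fun x => f2 x * g x + f x * g2 x).
Proof.
move=> F G x; have [F1 F2] := F x; have [G1 G2] := G x; split.
  by apply: (is_derive_eq (is_deriveM1 F1 G1)) => /=; rewrite -!surjective_pairing.
by apply: (is_derive_eq (is_deriveM1 F2 G2)) => /=; rewrite -!surjective_pairing.
Qed.
Lemma D12_rad (f g : R -> R) : (forall s : R, is_derive s 1 f (g s)) ->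
  D12 (fun x => f (nsq x)) (fun x => 2 * x.1 * g (nsq x)) (fun x => 2 * x.2 * g (nsq x)).
Proof.
move=> D [a b]; split; rewrite /nsq /=.
  have d1 := is_deriveD1 (is_derive_idX1 a 2) (is_derive_cst (b ^+ 2 : R) a 1).
  by apply: (is_derive_eq (is_derive_comp1 d1 (D _))); rewrite /= expr1; ring.
have d1 := is_deriveD1 (is_derive_cst (a ^+ 2 : R) b 1) (is_derive_idX1 b 2).
by apply: (is_derive_eq (is_derive_comp1 d1 (D _))); rewrite /= expr1; ring.
Qed.
Lemma D12_ext f f1 f2 g1 g2 : D12 f f1 f2 -> (forall x, f1 x = g1 x) -> (forall x, f2 x = g2 x) ->
  D12 f g1 g2.
Proof. by move=> F e1 e2 x; rewrite -e1 -e2; exact: F. Qed.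

Lemma C2_D12 f : C2 f -> exists f1 f2, [/\ C2 f1, C2 f2 & D12 f f1 f2].
Proof.
elim=> [c|||f1 f2 S1 [a1 [a2 [A1 A2 DA]]] S2 [b1 [b2 [B1 B2 DB]]]|f1 f2 S1 [a1 [a2 [A1 A2 DA]]] S2 [b1 [b2 [B1 B2 DB]]]|f1 S].
- by exists (fun=> 0), (fun=> 0); split; [exact: C2_cst..|exact: D12_cst].
- by exists (fun=> 1), (fun=> 0); split; [exact: C2_cst..|exact: D12_fst].
- by exists (fun=> 0), (fun=> 1); split; [exact: C2_cst..|exact: D12_snd].
- by do 2 eexists; split; last exact: (D12_add DA DB); exact: C2_add.
- do 2 eexists; split; last exact: (D12_mul DA DB).
    by apply: C2_add; apply: C2_mul.
  by apply: C2_add; apply: C2_mul.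
- have [g Sg Dg] := SM_derive S.
  do 2 eexists; split; last exact: (D12_rad Dg).
    by apply: C2_mul; [apply: C2_mul; [exact: C2_cst|exact: C2_fst]|exact: C2_rad].
  by apply: C2_mul; [apply: C2_mul; [exact: C2_cst|exact: C2_snd]|exact: C2_rad].
Qed.

Lemma continuous_nsq : continuous nsq.
Proof.
move=> x; apply: cvgD; rewrite /= ?expr2.
  by apply: cvgM; exact: cvg_fst.
by apply: cvgM; exact: cvg_snd.
Qed.

Lemma C2_cont f : C2 f -> continuous f.
Proof.
elim=> [c|||f1 f2 _ H1 _ H2|f1 f2 _ H1 _ H2|f1 S] x.
- exact: cvg_cst.
- exact: cvg_fst.
- exact: cvg_snd.
- by apply: cvgD; [exact: H1|exact: H2].
- by apply: cvgM; [exact: H1|exact: H2].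
- by apply: (@continuous_comp _ _ _ nsq f1); [exact: continuous_nsq|exact: SM_cont].
Qed.

Lemma quotient1 (f : R * R -> R) (x : R * R) :
  (fun h : R => h^-1 *: (f (h *: ((1, 0) : R * R) + x) - f x)) =
  (fun h : R => h^-1 *: (f (h *: (1 : R) + x.1, x.2) - f (x.1, x.2))).
Proof.
apply/funext => h; case: x => a b /=.
have -> : h *: ((1, 0) : R * R) + (a, b) = (h *: (1 : R) + a, h * 0 + b) by [].
by rewrite mulr0 add0r.
Qed.

Lemma quotient2 (f : R * R -> R) (x : R * R) :
  (fun h : R => h^-1 *: (f (h *: ((0, 1) : R * R) + x) - f x)) =
  (fun h : R => h^-1 *: (f (x.1, h *: (1 : R) + x.2) - f (x.1, x.2))).
Proof.
apply/funext => h; case: x => a b /=.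
have -> : h *: ((0, 1) : R * R) + (a, b) = (h * 0 + a, h *: (1 : R) + b) by [].
by rewrite mulr0 add0r.
Qed.

Lemma partialE (f : R * R -> R) (x : R * R) :
  (forall d, is_derive x.1 1 (fun t => f (t, x.2)) d -> derivable f x ((1, 0) : R * R) /\ pd1 f x = d) /\
  (forall d, is_derive x.2 1 (fun t => f (x.1, t)) d -> derivable f x ((0, 1) : R * R) /\ pd2 f x = d).
Proof.
split=> d []; first by rewrite /pd1 /derivable /derive quotient1.
by rewrite /pd2 /derivable /derive quotient2.
Qed.

Lemma pd_D12 (f : R * R -> R) : (forall x, derivable f x ((1, 0) : R * R)) -> (forall x, derivable f x ((0, 1) : R * R)) ->
  D12 f (pd1 f) (pd2 f).
Proof.
move=> h1 h2 x; split; apply: DeriveDef.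
- by have := h1 x; rewrite /derivable quotient1.
- by rewrite /pd1 /derive quotient1.
- by have := h2 x; rewrite /derivable quotient2.
- by rewrite /pd2 /derive quotient2.
Qed.

Lemma D12_pd f f1 f2 : D12 f f1 f2 -> pd1 f = f1 /\ pd2 f = f2.
Proof.
move=> F; split; apply/funext => x; have [F1 F2] := F x.
  by have [] := (partialE f x).1 _ F1.
by have [] := (partialE f x).2 _ F2.
Qed.

Lemma C2_smooth2 f : C2 f -> smooth2 f.
Proof.
move=> S w.
have Sw : C2 (pds w f).
  elim: w => [//|j w IH]; rewrite /pds /= -/(pds w f).
  have [f1 [f2 [S1 S2 /D12_pd[e1 e2]]]] := C2_D12 IH.
  by case: j; [rewrite e2|rewrite e1].
move=> x; have [f1 [f2 [S1 S2 D]]] := C2_D12 Sw.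
have [D1 D2] := D x.
split; first exact: C2_cont.
  by have [] := (partialE (pds w f) x).1 _ D1.
by have [] := (partialE (pds w f) x).2 _ D2.
Qed.

Definition supp_in (c d : R) (f : R -> R) := forall s : R, ~~ (c < s < d) -> f s = 0.

(** Bounded by 1 and convergent to the indicator of the open interval from c to d as n grows,
    because e^(-1/((n+1) x)) tends to 1 for x > 0. *)
Definition bump (c d : R) (n : nat) (s : R) :=
  flat 0 (n.+1%:R * s + - (n.+1%:R * c)) * flat 0 (- n.+1%:R * s + n.+1%:R * d).

Lemma SM_bump c d n : SM (bump c d n).
Proof. by apply: SM_mul; exact: SM_flat. Qed.

Lemma flat0_le1 (x : R) : flat 0 x <= 1.
Proof.
rewrite /flat; case: ifP => // x0; rewrite expr0 invr1 mul1r -expR0 ler_expR.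
by rewrite oppr_le0 invr_ge0 ltW.
Qed.

Lemma bump_ge0 c d n s : 0 <= bump c d n s.
Proof. by rewrite mulr_ge0// flat_ge0. Qed.

Lemma bump_le1 c d n s : bump c d n s <= 1.
Proof. by rewrite mulr_ile1 ?flat_ge0 ?flat0_le1. Qed.

Lemma supp_bump c d n : supp_in c d (bump c d n).
Proof.
move=> s; rewrite negb_and -!leNgt /bump /flat.
have n0 : 0 < n.+1%:R :> R by rewrite ltr0Sn.
have -> : n.+1%:R * s + - (n.+1%:R * c) = n.+1%:R * (s - c) by ring.
have -> : - n.+1%:R * s + n.+1%:R * d = n.+1%:R * (d - s) by ring.
rewrite !pmulr_rgt0// !subr_gt0 => /orP[] h.
  by rewrite [c < s]ltNge h /= mul0r.
by rewrite [s < d]ltNge h /= mulr0.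
Qed.

Lemma bump_cvg c d s : c < s < d -> bump c d n s @[n --> \oo] --> (1 : R).
Proof.
move=> /andP[cs sd].
have key (x : R) : 0 < x -> flat 0 (n.+1%:R * x) @[n --> \oo] --> (1 : R).
  move=> x0.
  have h : expR (- (x^-1 * harmonic n)) @[n --> \oo] --> (1 : R).
    have h0 : - (x^-1 * harmonic n) @[n --> \oo] --> (0 : R).
      have h1 : x^-1 * harmonic n @[n --> \oo] --> x^-1 * 0.
        by apply: cvgM; [exact: cvg_cst|exact: cvg_harmonic].
      have h2 : - (x^-1 * harmonic n) @[n --> \oo] --> - (x^-1 * 0) := cvgN h1.
      by rewrite mulr0 oppr0 in h2; exact: h2.
    by rewrite -(expR0 R); apply: (@cvg_comp _ _ _ (fun n => - (x^-1 * harmonic n)) expR _ _ _ h0); exact: continuous_expR.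
  apply: cvg_trans h; apply: near_eq_cvg; apply: nearW => n.
  by rewrite /flat pmulr_rgt0// x0 expr0 invr1 mul1r /harmonic/= invfM mulrC.
rewrite -[1 in X in _ --> X](mulr1 1); apply: cvgM.
  have := key (s - c); rewrite subr_gt0 => /(_ cs).
  by under eq_fun do rewrite mulrBr.
have := key (d - s); rewrite subr_gt0 => /(_ sd).
by under eq_fun do rewrite mulrBr addrC -mulNr.
Qed.

Lemma L1_supp c d f : continuous f -> supp_in c d f -> L1 leb setT f.
Proof.
move=> cf sf.
have L : L1 leb `[c, d] f by apply: L1_continuous; exact: continuous_subspaceT.
have := (L1_restrict f (measurable_itv `[c, d])).1 L.
have -> // : f \_ `[c, d] = f.
apply/funext => s; rewrite patchE; case: ifPn => // h; rewrite sf//.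
apply: contra h => /andP[h1 h2]; apply/mem_set; rewrite /= in_itv/= !ltW//.
Qed.

Definition prim (f : R -> R) (s : R) := \int[leb]_(t in `]-oo, s]) f t.

Lemma is_derive_prim f : continuous f -> L1 leb setT f -> forall s : R, is_derive s 1 (prim f) (f s).
Proof.
move=> cf Lf s.
have L u : leb.-integrable [set` Interval -oo%O (BRight u)] (EFin \o f).
  by apply: L1S Lf => //; exact: measurable_itv.
have s1 : s < s + 1 by rewrite ltrDl.
have [d e] : derivable (prim f) s 1 /\ derive1 (prim f) s = f s.
  apply: (continuous_FTC1 s1 (L (s + 1)) _ (cf s)).
  exact: ltNyr.
by apply: DeriveDef; [exact: d|rewrite -derive1E; exact: e].
Qed.

Lemma prim_lo c d f s : supp_in c d f -> s <= c -> prim f s = 0.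
Proof.
move=> sf sc; rewrite /prim (@Rint_eq _ (measurableTypeR R) R leb _ f (fun=> 0)).
  by rewrite /Rintegral integral0.
by move=> t; rewrite /= in_itv/= => ts; rewrite sf// negb_and -!leNgt (le_trans ts sc).
Qed.

Lemma prim_hi c d f s : c <= d -> continuous f -> supp_in c d f -> d <= s -> prim f s = \int[leb]_t f t.
Proof.
move=> cd cf sf ds; rewrite /prim Rintegral_mkcond; congr (fine (integral _ _ (EFin \o _))).
apply/funext => t; rewrite patchE; case: ifPn => // h; rewrite sf//.
rewrite negb_and -!leNgt; apply/orP; right; apply: (le_trans ds).
by rewrite leNgt; apply: contra h => h; apply/mem_set; rewrite /= in_itv/= ltW.
Qed.

Lemma supp_prim c d f : c <= d -> continuous f -> supp_in c d f -> \int[leb]_t f t = 0 ->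
  supp_in c d (prim f).
Proof.
move=> cd cf sf f0 s; rewrite negb_and -!leNgt => /orP[h|h].
  exact: prim_lo sf h.
by rewrite (prim_hi cd cf sf h).
Qed.

Lemma integral_sq (r0 T c d : R) (f : R -> R) : 0 < r0 -> r0 <= T -> r0 ^+ 2 <= c -> c <= d -> d <= T ^+ 2 ->
  continuous f -> supp_in c d f ->
  \int[leb]_(r in `[r0, T]) (2 * r * f (r ^+ 2)) = \int[leb]_t f t.
Proof.
move=> r00 rT rc cd dT cf sf; have Lf := L1_supp cf sf.
have dF (r : R) : r0 <= r <= T -> is_derive r 1 (fun r => prim f (r ^+ 2)) (2 * r * f (r ^+ 2)).
  move=> _; apply: (is_derive_eq (is_derive_comp1 (is_derive_idX1 r 2) (is_derive_prim cf Lf _))).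
  by rewrite expr1; ring.
rewrite /Rintegral (FTC2_closed rT dF)/=.
  by rewrite (prim_hi cd cf sf dT) (prim_lo sf rc) subr0.
apply: continuous_subspaceT => r; apply: cvgM; first by apply: cvgM; [exact: cvg_cst|exact: cvg_id].
apply: (@continuous_comp _ _ _ (fun r : R => r ^+ 2) f); last exact: cf.
exact: (is_derive_continuous1 (is_derive_idX1 r 2)).
Qed.

(** The primitive of [f] is constant between a and b, and by Lebesgue differentiation its derivative
    is [f] almost everywhere. *)
Lemma L1_ball_zero (f : R -> R) (a b : R) : L1 leb setT f ->
  (forall x y, a < x -> x < y -> y < b -> \int[leb]_(t in `]x, y[) f t = 0) ->
  {ae leb, forall t, a < t < b -> f t = 0}.
Proof.
move=> Lf H.
have L u : leb.-integrable [set` Interval -oo%O (BRight u)] (EFin \o f).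
  by apply: L1S Lf => //; exact: measurable_itv.
have lf : locally_integrable setT f by apply: open_integrable_locally => //; exact: openT.
have := FTC1Ny L lf; apply: ae_imp => t [df ft] /andP[at_ tb].
rewrite -ft.
set G := fun x : R => _ in df ft *.
have GE x y : a < x -> x < y -> y < b -> G x = G y.
  move=> ax xy yb.
  have := @Rintegral_itvB R f -oo%O (BRight y) x (L y) isT; rewrite bnd_simp => /(_ (ltW xy)) e.
  have Lxy : leb.-integrable [set` `]x, y[] (EFin \o f) by apply: L1S Lf => //; exact: measurable_itv.
  have := Rintegral_itv_bndo_bndc Lxy; rewrite (H x y ax xy yb) -e => /eqP.
  by rewrite eq_sym subr_eq0 => /eqP.
have e : {near t, cst (G t) =1 G}.
  near=> y; have ay : a < y by near: y; exact: lt_nbhsr.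
  have yb : y < b by near: y; exact: lt_nbhsl.
  rewrite /cst; have [ty|yt|->//] := ltgtP t y; first exact: GE.
  by apply/esym; exact: GE.
have d := near_eq_is_derive e (is_derive_cst (G t) t (1 : R)).
by rewrite derive1E; case: d.
Unshelve. all: end_near. Qed.

(** Bumps in the variable r^2 converge boundedly to indicators of intervals, so the integral of [D]
    over every interior interval vanishes. *)
Lemma weak_zero (r0 T : R) (D : R -> R) : 0 < r0 -> L1 leb `[r0, T] D ->
  (forall c d f, r0 ^+ 2 < c -> c < d -> d < T ^+ 2 -> SM f -> supp_in c d f ->
    \int[leb]_(r in `[r0, T]) (D r * f (r ^+ 2)) = 0) ->
  {ae leb, forall r, r0 <= r <= T -> D r = 0}.
Proof.
move=> r00 LD H.
have mI : measurable (`[r0, T]%classic : set (measurableTypeR R)) by exact: measurable_itv.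
suff K : {ae leb, forall r, r0 < r < T -> (D \_ `[r0, T]) r = 0}.
  have := ae_and K (ae_and (ae_neq r0) (ae_neq T)); apply: ae_imp => r [h [n1 n2]] /andP[h1 h2].
  have := h _; rewrite !lt_neqAle eq_sym n1 n2 h1 h2 => /(_ isT); rewrite patchE.
  by have -> : r \in `[r0, T]%classic by apply/mem_set; rewrite /= in_itv/= h1.
apply: L1_ball_zero; first exact: (L1_restrict D (measurable_itv _)).1.
move=> x y rx xy yT.
have x0 : 0 < x by exact: lt_trans rx.
have y0 : 0 < y by exact: lt_trans xy.
have sq (u v : R) : 0 < u -> 0 < v -> (u ^+ 2 < v ^+ 2) = (u < v).
  by move=> u0 v0; rewrite ltr_pXn2r// nnegrE ltW.
pose F n r := D r * bump (x ^+ 2) (y ^+ 2) n (r ^+ 2).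
pose f r := D r * \1_(`]x, y[%classic : set R) r.
have sb n : supp_in (x ^+ 2) (y ^+ 2) (bump (x ^+ 2) (y ^+ 2) n) by exact: supp_bump.
have mD := L1_meas LD.
have mb n : measurable_fun (`[r0, T]%classic : set (measurableTypeR R)) (fun r => bump (x ^+ 2) (y ^+ 2) n (r ^+ 2)).
  have cb : continuous (fun r : R => bump (x ^+ 2) (y ^+ 2) n (r ^+ 2)).
    move=> r; apply: (@continuous_comp _ _ _ (fun r : R => r ^+ 2)).
      exact: (is_derive_continuous1 (is_derive_idX1 r 2)).
    exact: (SM_cont (SM_bump _ _ _)).
  have mc : measurable_fun (setT : set R) (fun r : R => bump (x ^+ 2) (y ^+ 2) n (r ^+ 2)) by exact: continuous_measurable_fun.
  exact: (measurable_funS measurableT (@subsetT _ _) mc).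
have H1 n : measurable_fun (`[r0, T]%classic : set (measurableTypeR R)) (EFin \o F n).
  by apply/measurable_EFinP; apply: measurable_funM.
have H2 : measurable_fun (`[r0, T]%classic : set (measurableTypeR R)) (EFin \o f).
  apply/measurable_EFinP; apply: measurable_funM; first exact: mD.
  have mxy : measurable (`]x, y[%classic : set (measurableTypeR R)) by exact: measurable_itv.
  by apply: measurable_funTS; exact: measurable_indic.
have H3 : {ae leb, forall r, `[r0, T]%classic r -> (EFin \o F n) r @[n --> \oo] --> (EFin \o f) r}.
  apply: aeW => r; rewrite /= in_itv/= => /andP[rr _].
  have rp : 0 < r by exact: lt_le_trans rr.
  apply: cvg_EFin; first exact: nearW.
  apply: cvgM; first exact: cvg_cst.
  rewrite indicE; have -> : (r \in `]x, y[%classic) = (x < r < y).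
    by apply/idP/idP => [/set_mem|h]; [|apply/mem_set]; rewrite /= in_itv.
  have [h|h] := boolP (x < r < y).
    by apply: bump_cvg; rewrite !sq.
  have -> : (fun n => bump (x ^+ 2) (y ^+ 2) n (r ^+ 2)) = (fun=> 0).
    by apply/funext => n; apply: sb; rewrite !sq.
  exact: cvg_cst.
have H4 : {ae leb, forall r n, `[r0, T]%classic r -> (`|(EFin \o F n) r| <= (EFin \o (fun r => `|D r|%R)) r)%E}.
  apply: aeW => r n _; rewrite /= lee_fin normrM ler_piMr// ger0_norm ?bump_ge0//.
  exact: bump_le1.
have LN : L1 leb `[r0, T] (fun r => `|D r|) by exact: (integrable_norm LD).
have [Lf _ C] := @dominated_convergence _ (measurableTypeR R) R leb _ mI _ _ _ H1 H2 H3 LN H4.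
have e2 : (\int[leb]_(r in `[r0, T]) (EFin \o f) r)%E = (\int[leb]_(r in `[r0, T]) f r)%:E by rewrite EFin_Rint.
rewrite e2 in C.
have C1 : \int[leb]_(r in `[r0, T]) F n r @[n --> \oo] --> \int[leb]_(r in `[r0, T]) f r by exact: (fine_cvg C).
have F0 n : \int[leb]_(r in `[r0, T]) F n r = 0.
  by apply: (H (x ^+ 2) (y ^+ 2)); rewrite ?sq//; [exact: lt_trans yT|exact: SM_bump].
have I0 : \int[leb]_(r in `[r0, T]) f r = 0.
  have F0' : (fun n => \int[leb]_(r in `[r0, T]) F n r) = (fun=> 0) by apply/funext => n; exact: F0.
  rewrite F0' in C1; apply/esym.
  by rewrite -(cvg_lim (@Rhausdorff R) C1) lim_cst//; exact: Rhausdorff.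
rewrite -[RHS]I0 Rintegral_mkcond [RHS]Rintegral_mkcond; congr (fine (integral _ _ (EFin \o _))).
apply/funext => r; rewrite !patchE /f indicE.
have [/set_mem|_] := boolP (r \in `]x, y[%classic); last by rewrite mulr0 if_same.
rewrite /= in_itv/= => /andP[h1 h2].
have -> : r \in `[r0, T]%classic by apply/mem_set; rewrite /= in_itv/= (ltW (lt_trans rx h1)) (ltW (lt_trans h2 yT)).
by rewrite mulr1.
Qed.

Lemma bump_int_gt0 c d : c < d -> 0 < \int[leb]_t bump c d 0 t.
Proof.
move=> cd; have cb : continuous (bump c d 0) by exact: SM_cont (SM_bump _ _ _).
have Lb : L1 leb setT (bump c d 0) by apply: L1_supp cb _; exact: supp_bump.
rewrite lt_neqAle; apply/andP; split; last by apply: Rintegral_ge0 => t _; exact: bump_ge0.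
apply/negP => /eqP I0.
have z x y : c < x -> x < y -> y < d -> \int[leb]_(t in `]x, y[) bump c d 0 t = 0.
  move=> cx xy yd; apply/eqP; rewrite eq_le; apply/andP; split; last by apply: Rintegral_ge0 => t _; exact: bump_ge0.
  rewrite [leRHS]I0; apply: Rint_subset => //; first [exact: measurable_itv|by move=> t _; exact: bump_ge0].
have dP := is_derive_prim cb Lb.
pose m := (c + d) / 2.
have cm : c < m < d by rewrite /m; apply/andP; split; lra.
have bm : 0 < bump c d 0 m.
  have /andP[h1 h2] := cm.
  have e1 : 1%:R * m + - (1%:R * c) = m - c by ring.
  have e2 : - 1%:R * m + 1%:R * d = d - m by ring.
  by rewrite /bump /flat e1 e2 !subr_gt0 h1 h2 !expr0 !invr1 !mul1r mulr_gt0// expR_gt0.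
have GE x y : c < x -> x < y -> y < d -> prim (bump c d 0) x = prim (bump c d 0) y.
  move=> cx xy yd.
  have L : leb.-integrable [set` Interval -oo%O (BRight y)] (EFin \o bump c d 0).
    by apply: L1S Lb => //; exact: measurable_itv.
  have := @Rintegral_itvB R _ -oo%O (BRight y) x L isT; rewrite bnd_simp => /(_ (ltW xy)) e.
  have Lxy : leb.-integrable [set` `]x, y[] (EFin \o bump c d 0) by apply: L1S Lb => //; exact: measurable_itv.
  have := Rintegral_itv_bndo_bndc Lxy; rewrite (z x y cx xy yd) -e => /eqP.
  by rewrite eq_sym subr_eq0 => /eqP.
have /andP[h1 h2] := cm.
have e : {near m, cst (prim (bump c d 0) m) =1 prim (bump c d 0)}.
  near=> y; have ay : c < y by near: y; exact: lt_nbhsr.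
  have yb : y < d by near: y; exact: lt_nbhsl.
  rewrite /cst; have [ty|yt|->//] := ltgtP m y; first exact: GE.
  by apply/esym; exact: GE.
have d0 := near_eq_is_derive e (is_derive_cst (prim (bump c d 0) m) m (1 : R)).
have := dP m => -[_ E1]; have := d0 => -[_ E2].
by move: bm; rewrite -E1 E2 ltxx.
Unshelve. all: end_near. Qed.

(** The du Bois-Reymond lemma in the variable s = r^2, whence the factor 2 r. The constant is the
    pairing of [D] with a fixed bump [p] of mass one, so that it is the same for all T. *)
Lemma weak_const (r0 : R) (D : R -> R) : 0 < r0 ->
  (forall T, r0 <= T -> L1 leb `[r0, T] D) ->
  (forall c d f g T, r0 ^+ 2 < c -> c < d -> r0 <= T -> d < T ^+ 2 -> SM f -> SM g -> supp_in c d f ->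
    supp_in c d g -> (forall s : R, is_derive s 1 f (g s)) ->
    \int[leb]_(r in `[r0, T]) (D r * (2 * r * g (r ^+ 2))) = 0) ->
  exists C, forall T, r0 <= T -> {ae leb, forall r, r0 <= r <= T -> D r = C}.
Proof.
move=> r00 LD H.
pose c0 := r0 ^+ 2 + 1; pose d0 := r0 ^+ 2 + 2.
have cd0 : c0 < d0 by rewrite /c0 /d0 ltrD2l ltr1n.
have rc0 : r0 ^+ 2 < c0 by rewrite /c0 ltrDl.
have I0 := bump_int_gt0 cd0; set J := \int[leb]_t _ in I0.
pose p s := J^-1 * bump c0 d0 0 s.
have Sp : SM p by apply: (SM_mul (SM_cst _)); exact: SM_bump.
have sp : supp_in c0 d0 p by move=> s h; rewrite /p (supp_bump _ h) mulr0.
have Lb : L1 leb setT (bump c0 d0 0) by apply: L1_supp; [exact: SM_cont (SM_bump _ _ _)|exact: supp_bump].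
have Ip : \int[leb]_t p t = 1.
  by rewrite /p RintegralZl// -/J mulVf// gt_eqF.
have cp := SM_cont Sp.
have Lp := L1_supp cp sp.
pose T0 := r0 + 2.
have T0d : d0 < T0 ^+ 2 by rewrite /d0 /T0; have := r00; nra.
have rT0 : r0 <= T0 by rewrite lerDl.
have mI T : measurable (`[r0, T]%classic : set (measurableTypeR R)) by exact: measurable_itv.
have LDg T f : r0 <= T -> SM f -> L1 leb `[r0, T] (fun r => D r * (2 * r * f (r ^+ 2))).
  move=> rT Sf.
  have cg : continuous (fun r : R => 2 * r * f (r ^+ 2)).
    move=> r; apply: cvgM; first by apply: cvgM; [exact: cvg_cst|exact: cvg_id].
    apply: (@continuous_comp _ _ _ (fun r : R => r ^+ 2) f); last exact: SM_cont.
    exact: (is_derive_continuous1 (is_derive_idX1 r 2)).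
  have cn : {within `[r0, T], continuous (fun r => `|2 * r * f (r ^+ 2)|)}.
    apply: continuous_subspaceT => r.
    exact: (continuous_comp (cg r) (@norm_continuous _ _ _)).
  have [m _ mM] := EVT_max rT cn.
  have mg : measurable_fun (setT : set R) (fun r : R => 2 * r * f (r ^+ 2)) by exact: continuous_measurable_fun.
  apply: (@L1_eq _ (measurableTypeR R) R leb _ (mI T) (fun r => (2 * r * f (r ^+ 2)) * D r)).
    by move=> r _; rewrite mulrC.
  apply: (@L1_Mbnd _ (measurableTypeR R) R leb _ (mI T) _ _ _ (measurable_funS measurableT (@subsetT _ _) mg) _ (LD T rT)).
  by move=> r rr; apply: mM; exact: rr.
pose C := \int[leb]_(r in `[r0, T0]) (D r * (2 * r * p (r ^+ 2))).
exists C => T rT.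
pose T1 := Num.max T T0 + 1.
have TT1 : T <= T1 by rewrite /T1 (@le_trans _ _ (Num.max T T0)) ?le_max ?lexx// lerDl.
have T0T1 : T0 <= T1 by rewrite /T1 (@le_trans _ _ (Num.max T T0)) ?le_max ?lexx ?orbT// lerDl.
have rT1 : r0 <= T1 by exact: le_trans rT TT1.
(* [p] is supported in radii below [T0], so the endpoint of the interval does not affect [C]. *)
have Cind : C = \int[leb]_(r in `[r0, T1]) (D r * (2 * r * p (r ^+ 2))).
  rewrite /C Rintegral_mkcond [RHS]Rintegral_mkcond; congr (fine (integral _ _ (EFin \o _))).
  apply/funext => r; rewrite !patchE.
  have [/set_mem|n0] := boolP (r \in `[r0, T0]%classic).
    rewrite /= in_itv/= => /andP[h1 h2].
    by have -> : r \in `[r0, T1]%classic by apply/mem_set; rewrite /= in_itv/= h1 (le_trans h2).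
  case: ifPn => // /set_mem; rewrite /= in_itv/= => /andP[h1 h2].
  rewrite sp ?mulr0//; apply/negP => /andP[_ h3]; move/negP: n0; apply; apply/mem_set.
  rewrite /= in_itv/= h1/= leNgt; apply/negP => h4.
  have : T0 ^+ 2 < r ^+ 2 by rewrite ltr_pXn2r// nnegrE; [exact: le_trans (ltW r00) rT0|exact: le_trans (ltW r00) h1].
  by move: T0d h3; lra.
pose E r := (D r - C) * (2 * r).
have LE : L1 leb `[r0, T1] E.
  apply: (@L1_eq _ (measurableTypeR R) R leb _ (mI T1) (fun r => D r * (2 * r * 1) - C * (2 * r))).
    by move=> r _; rewrite /E; ring.
  apply: (@L1B _ (measurableTypeR R) R leb _ (mI T1)).
    exact: (LDg T1 (fun=> 1) rT1 (SM_cst _)).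
  apply: L1_continuous; apply: continuous_subspaceT => r; apply: cvgM; first exact: cvg_cst.
  by apply: cvgM; [exact: cvg_cst|exact: cvg_id].
have Z : {ae leb, forall r, r0 <= r <= T1 -> E r = 0}.
  apply: weak_zero => // c d f rc cd dT Sf sf.
  have cf := SM_cont Sf; have Lf := L1_supp cf sf.
  pose If := \int[leb]_t f t.
  (* Removing the mean makes the primitive of [g] compactly supported, so that it may be used as a
     test function. *)
  pose g s := f s - If * p s.
  have Sg : SM g.
    have -> : g = (fun s => f s + (- If) * p s) by apply/funext => s; rewrite /g mulNr.
    by apply: SM_add => //; apply: SM_mul => //; exact: SM_cst.
  pose c' := Num.min c c0; pose d' := Num.max d d0.
  have sg : supp_in c' d' g.
    move=> s h; rewrite /g sf ?sp ?mulr0 ?subr0//; apply: contra h => /andP[h1 h2].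
      by rewrite /c' /d' gt_min lt_max h1 h2 !orbT.
    by rewrite /c' /d' gt_min lt_max h1 h2.
  have cd' : c' < d' by rewrite /c' /d' gt_min lt_max cd.
  have cg := SM_cont Sg; have Lg := L1_supp cg sg.
  have Ig : \int[leb]_t g t = 0.
    rewrite /g RintegralB//; last by apply: (@L1Z _ (measurableTypeR R) R leb setT measurableT).
    by rewrite RintegralZl// Ip mulr1 subrr.
  have dP := is_derive_prim cg Lg.
  have := H c' d' (prim g) g T1.
  rewrite lt_min rc rc0 => /(_ isT cd' rT1); rewrite gt_max dT (lt_le_trans T0d); last first.
    by rewrite lerXn2r// nnegrE; [exact: le_trans (ltW r00) rT0|exact: le_trans (ltW r00) rT1].
  move=> /(_ isT (SM_prim Sg dP) Sg (supp_prim (ltW cd') cg sg Ig) sg dP) K.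
  have e1 : \int[leb]_(r in `[r0, T1]) (D r * (2 * r * g (r ^+ 2))) =
    \int[leb]_(r in `[r0, T1]) (D r * (2 * r * f (r ^+ 2))) - If * C.
    rewrite Cind -RintegralZl//; last exact: LDg.
    rewrite -RintegralB//; last 2 first.
    - exact: LDg.
    - by apply: (@L1Z _ (measurableTypeR R) R leb _ (mI T1)); exact: LDg.
    by apply: Rint_eq => r _; rewrite /g; ring.
  have e2 : \int[leb]_(r in `[r0, T1]) (E r * f (r ^+ 2)) =
    \int[leb]_(r in `[r0, T1]) (D r * (2 * r * f (r ^+ 2))) - C * If.
    have <- : \int[leb]_(r in `[r0, T1]) (2 * r * f (r ^+ 2)) = If.
      by apply: (@integral_sq r0 T1 c d) => //; exact: ltW.
    have L2 : L1 leb `[r0, T1] (fun r => 2 * r * f (r ^+ 2)).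
      apply: L1_continuous; apply: continuous_subspaceT => r.
      apply: cvgM; first by apply: cvgM; [exact: cvg_cst|exact: cvg_id].
      apply: (@continuous_comp _ _ _ (fun r : R => r ^+ 2) f); last exact: cf.
      exact: (is_derive_continuous1 (is_derive_idX1 r 2)).
    rewrite -RintegralZl// -RintegralB//; last 2 first.
    - exact: LDg.
    - by apply: (@L1Z _ (measurableTypeR R) R leb _ (mI T1)).
    by apply: Rint_eq => r _; rewrite /E; ring.
  by rewrite e2 mulrC -e1.
apply: ae_imp Z => r h /andP[h1 h2].
have /eqP : E r = 0 by apply: h; rewrite h1 (le_trans h2).
rewrite /E mulf_eq0 mulf_eq0.
have rp : 0 < r by exact: lt_le_trans h1.
by rewrite (gt_eqF rp) pnatr_eq0/= orbF subr_eq0 => /eqP.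
Qed.
End smooth_class.

(** * Fourier modes of a weak magnetic gradient *)

Section ae_tools.
Context {R : realType}.
Local Notation leb := (@lebesgue_measure R).
Local Notation RT := (measurableTypeR R).
Implicit Types (D : set RT) (f g : R -> R).

Lemma L1_le_ae D f g : measurable D -> measurable_fun D f ->
  {ae leb, forall r, D r -> `|f r| <= g r} -> L1 leb D g -> L1 leb D f.
Proof.
move=> mD mf H Lg.
have Lg' : L1 leb D (fun r => `|g r|) by exact: (integrable_norm Lg).
apply/integrableP; split; first by apply/measurable_EFinP.
have /integrableP[_] := Lg; apply: le_lt_trans.
apply: (@ae_ge0_le_integral _ RT R leb D mD) => //.
- by apply: measurableT_comp => //; apply/measurable_EFinP.
- by apply: measurableT_comp => //; exact: (measurable_int _ Lg).
- apply: ae_imp H => r h /h {}h; rewrite /= lee_fin (le_trans h)// ler_norm//.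
Qed.

Lemma Rint_ae D f g : measurable D -> measurable_fun D f -> measurable_fun D g ->
  {ae leb, forall r, D r -> f r = g r} -> \int[leb]_(r in D) f r = \int[leb]_(r in D) g r.
Proof.
move=> mD mf mg H; rewrite /Rintegral; congr fine; apply: ae_eq_integral => //.
- by apply/measurable_EFinP.
- by apply/measurable_EFinP.
- by apply: ae_imp H => r h Dr; rewrite h.
Qed.

Lemma L1_ae D f g : measurable D -> measurable_fun D g ->
  {ae leb, forall r, D r -> f r = g r} -> L1 leb D f -> L1 leb D g.
Proof.
move=> mD mg H Lf; apply: (@L1_le_ae D g (fun r => `|f r|)) => //; last exact: (integrable_norm Lf).
by apply: ae_imp H => r h Dr; rewrite h.
Qed.

Lemma L1_contM (a b : R) f g : continuous g -> L1 leb `[a, b] f -> L1 leb `[a, b] (fun r => g r * f r).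
Proof.
move=> cg Lf; have mI : measurable (`[a, b]%classic : set RT) by exact: measurable_itv.
have [ab|ba] := leP a b; last first.
  apply: (@L1_eq _ RT R leb _ mI (fun r => 0 * f r)); last exact: (@L1Z _ RT R leb _ mI).
  by move=> r; rewrite /= in_itv/= => /andP[h1 h2]; move: (le_trans h1 h2); rewrite leNgt ba.
have cn : {within `[a, b], continuous (fun r => `|g r|)}.
  apply: continuous_subspaceT => r.
  exact: (continuous_comp (cg r) (@norm_continuous _ _ _)).
have [m _ mM] := EVT_max ab cn.
have mg : measurable_fun (setT : set R) g by exact: continuous_measurable_fun.
apply: (@L1_Mbnd _ RT R leb _ mI _ _ _ (measurable_funS measurableT (@subsetT _ _) mg) _ Lf).
by move=> r rr; apply: mM; exact: rr.
Qed.
End ae_tools.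

(** * Square-integrable functions on the plane and the polynomials Re z^k, Im z^k *)

Section plane_L2.
Context {R : realType}.
Local Notation leb := (@lebesgue_measure R).
Local Notation RT := (measurableTypeR R).
Local Notation leb2 := (@lebesgue_measure R \x @lebesgue_measure R)%E.
Local Notation RT2 := (RT * RT)%type.
Implicit Types (X Y : R * R -> R).

Definition L2p X : Prop := measurable_fun (setT : set RT2) X /\ L1 leb2 setT (fun x => X x ^+ 2).

Definition box (N : R) : set (R * R) := `[- N, N] `*` `[- N, N].

Lemma compact_box N : compact (box N).
Proof. by apply: compact_setX; exact: segment_compact. Qed.

Lemma box_nsq N (x : R * R) : 0 <= N -> nsq x <= N ^+ 2 -> box N x.
Proof.
move=> N0 h; split; rewrite /= in_itv/= -ler_norml -(ler_pXn2r (n := 2)) ?nnegrE// real_normK ?num_real//;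
  apply: le_trans h; rewrite /nsq ?lerDl ?lerDr; exact: sqr_ge0.
Qed.

Lemma measurable_box N : measurable (box N : set RT2).
Proof. by apply: measurableX; exact: measurable_itv. Qed.

Lemma L1_box N : L1 leb2 setT (\1_(box N) : R * R -> R).
Proof.
apply/integrableP; split; first by apply/measurable_EFinP; apply: measurable_indic; exact: measurable_box.
rewrite (@eq_integral _ RT2 R leb2 setT (fun x => (\1_(box N : set RT2) x)%:E)); last first.
  by move=> x _; rewrite /= ger0_norm// indicE.
rewrite integral_indic ?setIT//; last exact: measurable_box.
pose A : set RT := [set` Interval (BLeft (- N)%R) (BRight N)].
have mA : measurable A by exact: measurable_itv.
have e : leb2 (box N) = (leb A * leb A)%E by exact: (product_measure1E leb leb mA mA).
suff H : (leb A * leb A < +oo)%E by move: H; rewrite -e; exact.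
rewrite /A lebesgue_measure_itv /=; by case: ifP => _; rewrite ?mule0 ?ltry//.
Qed.

Lemma L1_adm X (g : R * R -> R) (N : R) : L2p X -> continuous g -> 0 <= N ->
  (forall x, N ^+ 2 < nsq x -> g x = 0) -> L1 leb2 setT (fun x => X x * g x).
Proof.
move=> [mX LX] cg N0 g0.
have cn : {within (box N), continuous (fun x => `|g x|)}.
  apply: continuous_subspaceT => x.
  exact: (continuous_comp (cg x) (@norm_continuous _ _ _)).
have b0 : box N !=set0 by exists (0, 0); split; rewrite /= in_itv/= oppr_le0 N0.
have [m _ mM] := compact_EVT_max b0 (@compact_box N) cn.
pose M := `|g m|; have M0 : 0 <= M by exact: normr_ge0.
have mg : measurable_fun (setT : set RT2) g by exact: continuous_measurable_fun2.
have LL : L1 leb2 setT (fun x => M * (X x ^+ 2 + \1_(box N) x)).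
  by apply: (@L1Z _ RT2 R leb2 setT measurableT); apply: (@L1D _ RT2 R leb2 setT measurableT) => //; exact: L1_box.
apply: (@L1_le _ RT2 R leb2 setT measurableT _ _ (measurable_funM mX mg) _ LL).
move=> x _; rewrite /=; have [xN|xN] := ltP (N ^+ 2) (nsq x).
  by rewrite (g0 x xN) mulr0 normr0 mulr_ge0// addr_ge0 ?sqr_ge0.
have bx : box N x by exact: box_nsq.
rewrite indicE mem_set//= normrM mulrC.
apply: ler_pM => //; first by apply: mM; rewrite inE.
have : 0 <= (`|X x| - 1) ^+ 2 by exact: sqr_ge0.
have : 0 <= `|X x| by [].
by rewrite -(real_normK (num_real (X x))); set y := `|_|; nra.
Qed.

Lemma L2pN X : L2p X -> L2p (fun x => - X x).
Proof.
move=> [mX LX]; split; first exact: measurableT_comp.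
by apply: (@L1_eq _ RT2 R leb2 setT measurableT _ _ _ LX) => x _; rewrite sqrrN.
Qed.

Lemma L2p_arc X : L2p X -> {ae leb, forall r, 0 < r -> L2c (arc X r)}.
Proof.
move=> [mX LX]; apply: ae_imp (polar_arc_Lc LX) => r H r0; split; last exact: H.
exact: measurable_arc1.
Qed.

(* Real and imaginary parts of [(x1 + i x2)^k]. *)
Fixpoint hcs (k : nat) (x : R * R) : R * R :=
  if k is k'.+1 then (x.1 * (hcs k' x).1 - x.2 * (hcs k' x).2, x.1 * (hcs k' x).2 + x.2 * (hcs k' x).1)
  else (1, 0).
Definition hc k x := (hcs k x).1.
Definition hs k x := (hcs k x).2.

Lemma C2_ext (f g : R * R -> R) : f = g -> C2 f -> C2 g. Proof. by move=> ->. Qed.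

Lemma C2_hcs k : C2 (hc k) /\ C2 (hs k).
Proof.
elim: k => [|k [IC IS]]; first by split; exact: C2_cst.
split.
  apply: (@C2_ext (fun x => x.1 * hc k x + (-1) * (x.2 * hs k x))).
    by apply/funext => x; rewrite /hc /= mulN1r.
  apply: C2_add; first by apply: C2_mul => //; exact: C2_fst.
  by apply: C2_mul; [exact: C2_cst|apply: C2_mul => //; exact: C2_snd].
apply: (@C2_ext (fun x => x.1 * hs k x + x.2 * hc k x)) => //.
by apply: C2_add; apply: C2_mul => //; [exact: C2_fst|exact: C2_snd].
Qed.

(** The derivatives of z^k are k z^(k-1) and i k z^(k-1). For k = 0 the truncated predecessor is
    harmless because of the factor k. *)
Lemma D12_hcs k : D12 (hc k) (fun x => k%:R * hc k.-1 x) (fun x => - k%:R * hs k.-1 x) /\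
  D12 (hs k) (fun x => k%:R * hs k.-1 x) (fun x => k%:R * hc k.-1 x).
Proof.
elim: k => [|k [IC IS]].
  split; [apply: (D12_ext (D12_cst 1))|apply: (D12_ext (D12_cst 0))] => x; ring.
have E : forall x, (hc k x = x.1 * hc k.-1 x - x.2 * hs k.-1 x /\ hs k x = x.1 * hs k.-1 x + x.2 * hc k.-1 x) \/ k = 0%N.
  by move=> x; case: k {IC IS} => [|k]; [right|left].
have m1 (f f1 f2 : R * R -> R) : D12 f f1 f2 -> D12 (fun x => (-1) * f x) (fun x => 0 * f x + (-1) * f1 x) (fun x => 0 * f x + (-1) * f2 x).
  by move=> H; exact: (D12_mul (D12_cst _) H).
split.
  have -> : hc k.+1 = (fun x => x.1 * hc k x + (-1) * (x.2 * hs k x)).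
    by apply/funext => x; rewrite /hc /= mulN1r.
  apply: (D12_ext (D12_add (D12_mul D12_fst IC) (m1 _ _ _ (D12_mul D12_snd IS)))) => x /=.
    by rewrite -natr1; case: (E x) => [[-> _]|->]; ring.
  by rewrite -natr1; case: (E x) => [[_ ->]|->]; ring.
have -> : hs k.+1 = (fun x => x.1 * hs k x + x.2 * hc k x) by [].
apply: (D12_ext (D12_add (D12_mul D12_fst IS) (D12_mul D12_snd IC))) => x /=.
  by rewrite -natr1; case: (E x) => [[_ ->]|->]; ring.
by rewrite -natr1; case: (E x) => [[-> _]|->]; ring.
Qed.

Lemma hcs_polar k (r t : R) : hc k (polar (r, t)) = r ^+ k * cos (k%:R * t) /\
  hs k (polar (r, t)) = r ^+ k * sin (k%:R * t).
Proof.
elim: k => [|k [IC IS]]; first by rewrite !mul0r cos0 sin0 expr0 mul1r mulr0.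
have -> : hc k.+1 (polar (r, t)) = (polar (r, t)).1 * hc k (polar (r, t)) - (polar (r, t)).2 * hs k (polar (r, t)) by [].
have -> : hs k.+1 (polar (r, t)) = (polar (r, t)).1 * hs k (polar (r, t)) + (polar (r, t)).2 * hc k (polar (r, t)) by [].
rewrite IC IS /polar /= -natr1 mulrDl mul1r cosD sinD exprS; split; ring.
Qed.

Lemma hcs_rec k x : hc k.+1 x = x.1 * hc k x - x.2 * hs k x /\ hs k.+1 x = x.1 * hs k x + x.2 * hc k x.
Proof. by []. Qed.

(** Euler's relation for a homogeneous polynomial of degree k. *)
Lemma hcs_euler k x : x.1 * (k%:R * hc k.-1 x) + x.2 * (- k%:R * hs k.-1 x) = k%:R * hc k x /\
  x.1 * (k%:R * hs k.-1 x) + x.2 * (k%:R * hc k.-1 x) = k%:R * hs k x.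
Proof. case: k => [|k]; first by split; ring. by have [-> ->] := hcs_rec k x; split => /=; ring. Qed.

(** The angular derivative of z^k is i k z^k. *)
Lemma hcs_rot k x : - x.2 * (k%:R * hc k.-1 x) + x.1 * (- k%:R * hs k.-1 x) = - k%:R * hs k x /\
  - x.2 * (k%:R * hs k.-1 x) + x.1 * (k%:R * hc k.-1 x) = k%:R * hc k x.
Proof. case: k => [|k]; first by split; ring. by have [-> ->] := hcs_rec k x; split => /=; ring. Qed.

Lemma nsq_polar (r t : R) : nsq (polar (r, t)) = r ^+ 2.
Proof. by rewrite /nsq /polar /= !exprMn -mulrDr cos2Dsin2 mulr1. Qed.
End plane_L2.

Section weak.
Context {R : realType}.
Local Notation leb := (@lebesgue_measure R).
Local Notation RT := (measurableTypeR R).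
Local Notation leb2 := (@lebesgue_measure R \x @lebesgue_measure R)%E.
Local Notation RT2 := (RT * RT)%type.

(** The support lies in an annulus strictly outside the circle of radius [r0], so these are test
    functions of the exterior of the disk. *)
Definition admissible (r0 : R) (phi : R * R -> R) := C2 phi /\
  exists c d, r0 ^+ 2 < c /\ forall x, ~~ (c < nsq x < d) -> phi x = 0.

(* [u = U1 + i U2] and [v_j = Vj1 + i Vj2], extended by zero to the disk of
   radius [r0]; [wgrad] is the real form of [v = (-i grad - b A) u]. *)
Record weakfield (r0 b : R) (U1 U2 V11 V12 V21 V22 : R * R -> R) : Prop := Weakfield {
  wU1 : L2p U1; wU2 : L2p U2; wV11 : L2p V11; wV12 : L2p V12; wV21 : L2p V21; wV22 : L2p V22;
  w0 : forall x, nsq x <= r0 ^+ 2 -> [/\ U1 x = 0, U2 x = 0, V11 x = 0 & V12 x = 0] /\ (V21 x = 0 /\ V22 x = 0);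
  wgrad : forall phi, admissible r0 phi ->
    [/\ \int[leb2]_x (U1 x * pd1 phi x) = \int[leb2]_x ((V12 x + b * A1 x * U2 x) * phi x),
        \int[leb2]_x (U1 x * pd2 phi x) = \int[leb2]_x ((V22 x + b * A2 x * U2 x) * phi x),
        \int[leb2]_x (U2 x * pd1 phi x) = - \int[leb2]_x ((V11 x + b * A1 x * U1 x) * phi x) &
        \int[leb2]_x (U2 x * pd2 phi x) = - \int[leb2]_x ((V21 x + b * A2 x * U1 x) * phi x)] }.

(* Multiplication by [-i]; it exchanges the real and imaginary parts of the
   Fourier coefficients, so that only real parts need be treated. *)
Lemma rotate r0 b U1 U2 V11 V12 V21 V22 : weakfield r0 b U1 U2 V11 V12 V21 V22 ->
  weakfield r0 b U2 (fun x => - U1 x) V12 (fun x => - V11 x) V22 (fun x => - V21 x).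
Proof.
case=> LU1 LU2 L11 L12 L21 L22 W0 W; split=> //; try exact: L2pN.
  by move=> x /W0[[-> -> -> ->] [-> ->]]; rewrite oppr0.
(* Oddness of the integral without integrability: [fine] sends both infinities to 0. *)
have N (f g : R * R -> R) : \int[leb2]_x (- f x * g x) = - \int[leb2]_x (f x * g x).
  rewrite /Rintegral.
  have -> : (fun x => (- f x * g x)%:E) = (\- (fun x => (f x * g x)%:E))%E.
    by apply/funext => x; rewrite -EFinN mulNr.
  rewrite [in LHS]integralE [in RHS]integralE funeposN funenegN.
  set A := integral _ _ _; set B := integral _ _ _.
  have : (0 <= A)%E by apply: integral_ge0 => x _; exact: funeneg_ge0.
  have : (0 <= B)%E by apply: integral_ge0 => x _; exact: funepos_ge0.
  move: A B => [a| |] [c| |]//= _ _; rewrite ?oppr0//.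
  by rewrite opprB.
move=> phi /W[h1 h2 h3 h4]; split.
- rewrite h3 -N; congr (Rintegral _ _ _); apply/funext => x; ring.
- rewrite h4 -N; congr (Rintegral _ _ _); apply/funext => x; ring.
- by rewrite N h1.
- by rewrite N h2.
Qed.

Variables (r0 b : R) (U1 U2 V11 V12 V21 V22 : R * R -> R).
Hypothesis r00 : 0 < r0.
Hypothesis WF : weakfield r0 b U1 U2 V11 V12 V21 V22.

Lemma adm_pd phi : admissible r0 phi -> exists2 N, 0 <= N & [/\ continuous phi, continuous (pd1 phi), continuous (pd2 phi) &
  forall x, N ^+ 2 < nsq x -> [/\ phi x = 0, pd1 phi x = 0 & pd2 phi x = 0]].
Proof.
move=> [S [c [d [rc H]]]].
have [f1 [f2 [S1 S2 D]]] := C2_D12 S.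
have [e1 e2] := D12_pd D.
exists (`|d| + 1); first by rewrite addr_ge0.
rewrite e1 e2; split; [exact: C2_cont|exact: C2_cont|exact: C2_cont|].
move=> x xN.
have dx : d < nsq x.
  apply: lt_trans xN; have := ler_norm d; set y := `|d| => dy.
  have y0 : 0 <= y by exact: normr_ge0.
  by nra.
split; first by apply: H; rewrite negb_and -!leNgt (ltW dx) orbT.
  have [D1 _] := D x.
  have e : {near x.1, cst 0 =1 (fun t => phi (t, x.2))}.
    have : \forall t \near x.1, d < nsq (t, x.2).
      have c1 : {for x.1, continuous (fun t => nsq (t, x.2))}.
        rewrite /nsq /=; apply: (is_derive_continuous1 (is_deriveD1 (is_derive_idX1 x.1 2) (is_derive_cst (x.2 ^+ 2 : R) x.1 1))).
      by apply: cvgr_gt c1 _ _; rewrite /= -surjective_pairing.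
    by apply: filterS => t dt; rewrite H// negb_and -!leNgt (ltW dt) orbT.
  have d0 := near_eq_is_derive e (is_derive_cst (0 : R) x.1 (1 : R)).
  by case: D1 => _ <-; case: d0.
have [_ D2] := D x.
have e : {near x.2, cst 0 =1 (fun t => phi (x.1, t))}.
  have : \forall t \near x.2, d < nsq (x.1, t).
    have c1 : {for x.2, continuous (fun t => nsq (x.1, t))}.
      rewrite /nsq /=; apply: (is_derive_continuous1 (is_deriveD1 (is_derive_cst (x.1 ^+ 2 : R) x.2 1) (is_derive_idX1 x.2 2))).
    by apply: cvgr_gt c1 _ _; rewrite /= -surjective_pairing.
  by apply: filterS => t dt; rewrite H// negb_and -!leNgt (ltW dt) orbT.
have d0 := near_eq_is_derive e (is_derive_cst (0 : R) x.2 (1 : R)).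
by case: D2 => _ <-; case: d0.
Qed.

Lemma L1_adm1 X phi : L2p X -> admissible r0 phi ->
  [/\ L1 leb2 setT (fun x => X x * phi x), L1 leb2 setT (fun x => X x * pd1 phi x),
      L1 leb2 setT (fun x => X x * pd2 phi x), L1 leb2 setT (fun x => X x * (A1 x * phi x)) &
      L1 leb2 setT (fun x => X x * (A2 x * phi x))].
Proof.
move=> LX /adm_pd[N N0 [c0 c1 c2 H]].
have cA1 : continuous (fun x => A1 x * phi x).
  move=> x; apply: cvgM; last exact: c0.
  by apply: cvgM; [apply: cvgN; exact: cvg_snd|exact: cvg_cst].
have cA2 : continuous (fun x => A2 x * phi x).
  move=> x; apply: cvgM; last exact: c0.
  by apply: cvgM; [exact: cvg_fst|exact: cvg_cst].
split.
- by apply: (L1_adm LX c0 N0) => x /H[].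
- by apply: (L1_adm LX c1 N0) => x /H[].
- by apply: (L1_adm LX c2 N0) => x /H[].
- by apply: (L1_adm LX cA1 N0) => x /H[-> _ _]; rewrite mulr0.
- by apply: (L1_adm LX cA2 N0) => x /H[-> _ _]; rewrite mulr0.
Qed.

Let L2D f g := @L1D _ RT2 R leb2 setT measurableT f g.
Let L2B f g := @L1B _ RT2 R leb2 setT measurableT f g.
Let L2Z c f := @L1Z _ RT2 R leb2 setT measurableT c f.

(** The four identities of [wgrad] added up, so that the real and imaginary parts of u are paired
    with divergences of two vector fields. Taking these fields radial or tangential isolates the
    corresponding component of the magnetic gradient. *)
Lemma divergence f1 f2 g1 g2 : admissible r0 f1 -> admissible r0 f2 -> admissible r0 g1 -> admissible r0 g2 ->
  [/\ L1 leb2 setT (fun x => U1 x * (pd1 f1 x + pd2 f2 x) + U2 x * (pd1 g1 x + pd2 g2 x)),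
      L1 leb2 setT (fun x => (V12 x + b * A1 x * U2 x) * f1 x + (V22 x + b * A2 x * U2 x) * f2 x
         - ((V11 x + b * A1 x * U1 x) * g1 x + (V21 x + b * A2 x * U1 x) * g2 x)) &
      \int[leb2]_x (U1 x * (pd1 f1 x + pd2 f2 x) + U2 x * (pd1 g1 x + pd2 g2 x)) =
      \int[leb2]_x ((V12 x + b * A1 x * U2 x) * f1 x + (V22 x + b * A2 x * U2 x) * f2 x
         - ((V11 x + b * A1 x * U1 x) * g1 x + (V21 x + b * A2 x * U1 x) * g2 x))].
Proof.
case: WF => LU1 LU2 L11 L12 L21 L22 _ W a1 a2 a3 a4.
have [_ l1 _ _ _] := L1_adm1 LU1 a1; have [_ _ l2 _ _] := L1_adm1 LU1 a2.
have [_ l3 _ _ _] := L1_adm1 LU2 a3; have [_ _ l4 _ _] := L1_adm1 LU2 a4.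
have [k1 _ _ _ _] := L1_adm1 L12 a1; have [_ _ _ k1' _] := L1_adm1 LU2 a1.
have [k2 _ _ _ _] := L1_adm1 L22 a2; have [_ _ _ _ k2'] := L1_adm1 LU2 a2.
have [k3 _ _ _ _] := L1_adm1 L11 a3; have [_ _ _ k3' _] := L1_adm1 LU1 a3.
have [k4 _ _ _ _] := L1_adm1 L21 a4; have [_ _ _ _ k4'] := L1_adm1 LU1 a4.
have ex (X A U f : R * R -> R) : L1 leb2 setT (fun x => X x * f x) -> L1 leb2 setT (fun x => U x * (A x * f x)) ->
    L1 leb2 setT (fun x => (X x + b * A x * U x) * f x).
  move=> h1 h2; apply: (@L1_eq _ RT2 R leb2 setT measurableT _ _ _ (L2D h1 (L2Z b h2))) => x _; ring.
have j1 := ex _ _ _ _ k1 k1'; have j2 := ex _ _ _ _ k2 k2'.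
have j3 := ex _ _ _ _ k3 k3'; have j4 := ex _ _ _ _ k4 k4'.
have E1 : (fun x => U1 x * (pd1 f1 x + pd2 f2 x) + U2 x * (pd1 g1 x + pd2 g2 x)) =
   (fun x => (U1 x * pd1 f1 x + U1 x * pd2 f2 x) + (U2 x * pd1 g1 x + U2 x * pd2 g2 x)).
  by apply/funext => x; ring.
rewrite E1; split.
- exact: (L2D (L2D l1 l2) (L2D l3 l4)).
- exact: (L2B (L2D j1 j2) (L2D j3 j4)).
have iD f g := @RintegralD _ RT2 R leb2 setT f g measurableT.
rewrite (iD _ _ (L2D l1 l2) (L2D l3 l4)) (@RintegralB _ RT2 R leb2 setT _ _ measurableT (L2D j1 j2) (L2D j3 j4)).
rewrite (iD _ _ l1 l2) (iD _ _ l3 l4) (iD _ _ j1 j2) (iD _ _ j3 j4).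
have [w1 _ _ _] := W _ a1; have [_ w2 _ _] := W _ a2.
have [_ _ w3 _] := W _ a3; have [_ _ _ w4] := W _ a4.
by rewrite opprD; congr ((_ + _) + (_ + _)).
Qed.

Section modes.
Variable m : int.
(** The mode m is tested with z^|m|, conjugated when m < 0; the sign [eps] in front of the imaginary
    part performs the conjugation. *)
Let k := `|m|%N.
Let eps : R := if m < 0 then -1 else 1.

Let eps_k : eps * k%:R = m%:~R.
Proof.
rewrite /eps /k; case: m => n /=; first by rewrite mul1r -pmulrn.
by rewrite NegzE mulrNz -pmulrn mulN1r.
Qed.

Let eps2 : eps * eps = 1.
Proof. by rewrite /eps; case: ifP; rewrite ?mulrNN mulr1. Qed.

Let cos_k (t : R) : cos (k%:R * t) = cos (m%:~R * t).
Proof.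
rewrite -eps_k /eps; case: ifP => _; last by rewrite mul1r.
by rewrite mulN1r mulNr cosN.
Qed.

Let sin_k (t : R) : eps * sin (k%:R * t) = sin (m%:~R * t).
Proof.
rewrite -eps_k /eps; case: ifP => _; last by rewrite !mul1r.
by rewrite !mulN1r mulNr sinN.
Qed.

Definition vrad (X Y : R * R -> R) (r t : R) : R := cos t * arc X r t + sin t * arc Y r t.
Definition vang (X Y : R * R -> R) (r t : R) : R := cos t * arc Y r t - sin t * arc X r t.

(* Real parts of the Fourier coefficients of [u], [i v_r] and [v_theta]; by
   [radial_identity] and [angular_identity], [mpi] is the weak derivative of
   [malpha], and [mtau] is [(m / r - b r / 2) malpha]. *)
Definition malpha (r : R) := fc m (arc U1 r) (arc U2 r).
Definition mpi (r : R) := fc m (fun t => - vrad V12 V22 r t) (vrad V11 V21 r).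
Definition mtau (r : R) := fc m (vang V11 V21 r) (vang V12 V22 r).

Lemma measurable_fc (A B : R * R -> R) : measurable_fun (setT : set RT2) A -> measurable_fun (setT : set RT2) B ->
  measurable_fun (setT : set RT) (fun r => fc m (fun t => A (r, t)) (fun t => B (r, t))).
Proof.
move=> mA mB.
have mc (h : R -> R) : continuous h -> measurable_fun (setT : set RT2) (fun z : RT2 => h z.2).
  move=> ch; have mh : measurable_fun (setT : set RT) h by exact: continuous_measurable_fun.
  exact: (measurableT_comp mh measurable_snd).
apply: (measurable_slice (F := fun z => cos (m%:~R * z.2) * A z + sin (m%:~R * z.2) * B z)).
apply: measurable_funD; apply: measurable_funM => //.
  by apply: (mc (fun t => cos (m%:~R * t))); exact: cont_cosm.
by apply: (mc (fun t => sin (m%:~R * t))); exact: cont_sinm.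
Qed.

Let mvec X Y (h1 h2 : R -> R) : L2p X -> L2p Y -> continuous h1 -> continuous h2 ->
  measurable_fun (setT : set RT2) (fun z => h1 z.2 * X (polar z) + h2 z.2 * Y (polar z)).
Proof.
move=> [mX _] [mY _] c1 c2.
have mc (h : R -> R) : continuous h -> measurable_fun (setT : set RT2) (fun z : RT2 => h z.2).
  move=> ch; have mh : measurable_fun (setT : set RT) h by exact: continuous_measurable_fun.
  exact: (measurableT_comp mh measurable_snd).
by apply: measurable_funD; apply: measurable_funM; try exact: mc; exact: measurable_arc.
Qed.

Let csin : continuous (@sin R). Proof. exact: continuous_sin. Qed.
Let ccos : continuous (@cos R). Proof. exact: continuous_cos. Qed.
Let cNsin : continuous (fun t : R => - sin t). Proof. by move=> t; apply: cvgN; exact: csin. Qed.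

Lemma measurable_malpha : measurable_fun (setT : set RT) malpha.
Proof.
by apply: (@measurable_fc (fun z => U1 (polar z)) (fun z => U2 (polar z))); apply: measurable_arc;
  [exact: (wU1 WF).1|exact: (wU2 WF).1].
Qed.

Lemma measurable_mpi : measurable_fun (setT : set RT) mpi.
Proof.
apply: (@measurable_fc (fun z => - (cos z.2 * V12 (polar z) + sin z.2 * V22 (polar z)))
  (fun z => cos z.2 * V11 (polar z) + sin z.2 * V21 (polar z))).
  by apply: measurableT_comp => //; exact: (mvec (wV12 WF) (wV22 WF) ccos csin).
exact: (mvec (wV11 WF) (wV21 WF) ccos csin).
Qed.

Lemma measurable_mtau : measurable_fun (setT : set RT) mtau.
Proof.
apply: (@measurable_fc (fun z => cos z.2 * V21 (polar z) - sin z.2 * V11 (polar z))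
  (fun z => cos z.2 * V22 (polar z) - sin z.2 * V12 (polar z))).
  have -> : (fun z : R * R => cos z.2 * V21 (polar z) - sin z.2 * V11 (polar z)) =
     (fun z => cos z.2 * V21 (polar z) + - sin z.2 * V11 (polar z)).
    by apply/funext => z; rewrite mulNr.
  exact: (mvec (wV21 WF) (wV11 WF) ccos cNsin).
have -> : (fun z : R * R => cos z.2 * V22 (polar z) - sin z.2 * V12 (polar z)) =
   (fun z => cos z.2 * V22 (polar z) + - sin z.2 * V12 (polar z)).
  by apply/funext => z; rewrite mulNr.
exact: (mvec (wV22 WF) (wV12 WF) ccos cNsin).
Qed.

Lemma L2c_bndM (h w : R -> R) : continuous h -> (forall t, `|h t| <= 1) -> L2c w -> L2c (fun t => h t * w t).
Proof.
move=> ch hb [mw Lw]; have mh := cont_meas_circle ch.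
split; first exact: measurable_funM.
apply: (@Lc_le _ (fun t => (h t * w t) ^+ 2) (fun t => w t ^+ 2) _ _ Lw).
  by apply: measurable_funX; exact: measurable_funM.
move=> t _; rewrite ger0_norm ?sqr_ge0// exprMn ler_piMl ?sqr_ge0//.
by rewrite -(real_normK (num_real (h t))) expr_le1.
Qed.

Lemma L2c_vrad X Y r : L2c (arc X r) -> L2c (arc Y r) -> L2c (vrad X Y r).
Proof.
by move=> hX hY; apply: L2cD; apply: L2c_bndM => //; move=> t; [exact: abs_cos_le1|exact: abs_sin_le1].
Qed.

Lemma L2c_vang X Y r : L2c (arc X r) -> L2c (arc Y r) -> L2c (vang X Y r).
Proof.
by move=> hX hY; apply: L2cB; apply: L2c_bndM => //; move=> t; [exact: abs_cos_le1|exact: abs_sin_le1].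
Qed.

Lemma weak_good : {ae leb, forall r, 0 < r -> [/\ L2c (arc U1 r), L2c (arc U2 r) & L2c (arc V11 r)] /\
  [/\ L2c (arc V12 r), L2c (arc V21 r) & L2c (arc V22 r)]}.
Proof.
have g1 := L2p_arc (wU1 WF); have g2 := L2p_arc (wU2 WF); have g3 := L2p_arc (wV11 WF).
have g4 := L2p_arc (wV12 WF); have g5 := L2p_arc (wV21 WF); have g6 := L2p_arc (wV22 WF).
apply: ae_imp (ae_and g1 (ae_and g2 (ae_and g3 (ae_and g4 (ae_and g5 g6))))) => r [h1 [h2 [h3 [h4 [h5 h6]]]]] r0'.
by split; split; [exact: h1|exact: h2|exact: h3|exact: h4|exact: h5|exact: h6].
Qed.

(* Tested with [phi_j = x_j f(|x|^2) Re z^k] and [x_j f(|x|^2) Im z^k]. *)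
Lemma radial_identity c d (f g : R -> R) : r0 ^+ 2 < c -> SM f -> SM g -> supp_in c d f -> supp_in c d g ->
  (forall s : R, is_derive s 1 f (g s)) ->
  \int[leb]_(r in `]0, +oo[) (r * (((k + 2)%:R * f (r ^+ 2) + 2 * r ^+ 2 * g (r ^+ 2)) * r ^+ k * malpha r))
  = \int[leb]_(r in `]0, +oo[) (r * (- (f (r ^+ 2) * r ^+ k.+1 * mpi r))).
Proof.
move=> rc Sf Sg sf sg Df.
have [Sc Ss] := C2_hcs (R := R) k.
have Cf := C2_rad Sf.
pose P := hc (R := R) k; pose Q x := eps * hs (R := R) k x.
have SQ : C2 Q by apply: C2_mul => //; exact: C2_cst.
pose p1 x := x.1 * (f (nsq x) * P x); pose p2 x := x.2 * (f (nsq x) * P x).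
pose q1 x := x.1 * (f (nsq x) * Q x); pose q2 x := x.2 * (f (nsq x) * Q x).
have adm (z : R * R -> R) (T : R * R -> R) : C2 z -> C2 T -> admissible r0 (fun x => z x * (f (nsq x) * T x)).
  move=> Sz ST; split; first by do 2 apply: C2_mul => //.
  by exists c, d; split => // x h; rewrite sf// mul0r mulr0.
have a1 : admissible r0 p1 by apply: adm => //; exact: C2_fst.
have a2 : admissible r0 p2 by apply: adm => //; exact: C2_snd.
have a3 : admissible r0 q1 by apply: adm => //; exact: C2_fst.
have a4 : admissible r0 q2 by apply: adm => //; exact: C2_snd.
have [L1l L1r E] := divergence a1 a2 a3 a4.
have [DP DQ] := D12_hcs (R := R) k.
have DQ' := D12_mul (D12_cst eps) DQ.
have DR := D12_rad Df.
have [ep1 _] := D12_pd (D12_mul D12_fst (D12_mul DR DP)).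
have [_ ep2] := D12_pd (D12_mul D12_snd (D12_mul DR DP)).
have [eq1 _] := D12_pd (D12_mul D12_fst (D12_mul DR DQ')).
have [_ eq2] := D12_pd (D12_mul D12_snd (D12_mul DR DQ')).
pose F1 x := ((k + 2)%:R * f (nsq x) + 2 * nsq x * g (nsq x)) * (P x * U1 x + Q x * U2 x).
pose F2 x := f (nsq x) * (P x * (x.1 * V12 x + x.2 * V22 x) - Q x * (x.1 * V11 x + x.2 * V21 x)).
have eF1 : (fun x => U1 x * (pd1 p1 x + pd2 p2 x) + U2 x * (pd1 q1 x + pd2 q2 x)) = F1.
  apply/funext => x; rewrite ep1 ep2 eq1 eq2 /F1 /Q /P natrD.
  have [e1 e2] := hcs_euler (R := R) k x.
  rewrite /nsq; move: e1 e2; set h1 := hc k.-1 x; set h2 := hs k.-1 x; set h3 := hc k x; set h4 := hs k x.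
  move=> e1 e2.
  transitivity ((2 * f (nsq x) + 2 * nsq x * g (nsq x)) * (h3 * U1 x + eps * h4 * U2 x)
    + f (nsq x) * ((x.1 * (k%:R * h1) + x.2 * (- k%:R * h2)) * U1 x + eps * (x.1 * (k%:R * h2) + x.2 * (k%:R * h1)) * U2 x)).
    by rewrite /nsq; ring.
  by rewrite e1 e2 /nsq; ring.
(* The vector potential is orthogonal to x, so it drops out. *)
have eF2 : (fun x => (V12 x + b * A1 x * U2 x) * p1 x + (V22 x + b * A2 x * U2 x) * p2 x
         - ((V11 x + b * A1 x * U1 x) * q1 x + (V21 x + b * A2 x * U1 x) * q2 x)) = F2.
  by apply/funext => x; rewrite /p1 /p2 /q1 /q2 /F2 /A1 /A2; field.
rewrite eF1 in L1l E; rewrite eF2 in L1r E.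
move: E; rewrite (Rpolar L1l) (Rpolar L1r).
have good := weak_good.
have cfs (h : R -> R) : continuous h -> continuous (fun r : R => h (r ^+ 2)).
  move=> ch r; apply: (@continuous_comp _ _ _ (fun r : R => r ^+ 2) h); last exact: ch.
  exact: (is_derive_continuous1 (is_derive_idX1 r 2)).
have cX (j : nat) : continuous (fun r : R => r ^+ j).
  by move=> r; exact: (is_derive_continuous1 (is_derive_idX1 r j)).
have mc (h : R -> R) : continuous h -> measurable_fun (setT : set RT) h.
  by move=> ch; exact: continuous_measurable_fun.
have cK : continuous (fun r : R => ((k + 2)%:R * f (r ^+ 2) + 2 * r ^+ 2 * g (r ^+ 2)) * r ^+ k).
  move=> r; apply: cvgM; last exact: cX.
  apply: cvgD; first by apply: cvgM; [exact: cvg_cst|exact: cfs (SM_cont Sf) r].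
  apply: cvgM; last exact: cfs (SM_cont Sg) r.
  by apply: cvgM; [exact: cvg_cst|exact: cX].
have cJ : continuous (fun r : R => f (r ^+ 2) * r ^+ k.+1).
  by move=> r; apply: cvgM; [exact: cfs (SM_cont Sf) r|exact: cX].
have mF (F : R * R -> R) : L1 leb2 setT F -> measurable_fun (`]0, +oo[%classic : set RT) (fun r => r * ic (arc F r)).
  by move=> LF; exact: (measurable_ic_arc (L1_meas LF)).
have mS (h : R -> R) : measurable_fun (setT : set RT) h -> measurable_fun (`]0, +oo[%classic : set RT) (fun r => r * h r).
  move=> mh; apply: (measurable_funS measurableT (@subsetT _ _)); apply: measurable_funM => //.
have mI : measurable (`]0, +oo[%classic : set RT) by exact: measurable_itv.
rewrite (Rint_ae mI (mF _ L1l) (mS _ (measurable_funM (mc _ cK) measurable_malpha))); last first.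
  apply: ae_imp good => r H; rewrite /= in_itv/= andbT => r0'; congr (_ * _).
  have [[h1 h2 _] _] := H r0'.
  rewrite /malpha /fc -icZ; last by apply: Lc_fc; exact: L2c_Lc.
  apply: ic_eq => t _; rewrite /arc /F1 /P /Q nsq_polar.
  have [-> ->] := hcs_polar k r t.
  by rewrite -cos_k -sin_k; ring.
rewrite (Rint_ae mI (mF _ L1r) (mS _ (measurable_funM (mc _ (fun r => cvgN (cJ r))) measurable_mpi))); last first.
  apply: ae_imp good => r H; rewrite /= in_itv/= andbT => r0'; congr (_ * _).
  have [[_ _ h1] [h2 h3 h4]] := H r0'.
  rewrite /mpi /fc -icZ; last first.
    by apply: Lc_fc; [apply: LcN|]; apply: L2c_Lc; exact: L2c_vrad.
  apply: ic_eq => t _; rewrite /vrad /arc /F2 /P /Q nsq_polar.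
  have [-> ->] := hcs_polar k r t.
  by rewrite opprfctE -cos_k -sin_k [r ^+ k.+1]exprS /polar /=; ring.
move=> E; rewrite [LHS]E; apply: Rint_eq => r _; transitivity (r * (- (f (r ^+ 2) * r ^+ k.+1) * mpi r)); [by []|by rewrite mulNr].
Qed.

(* Tested with [(- x_2, x_1) f(|x|^2)] times [Re z^k] and [Im z^k]. *)
Lemma angular_identity c d (f : R -> R) : r0 ^+ 2 < c -> SM f -> supp_in c d f ->
  \int[leb]_(r in `]0, +oo[) (r * (m%:~R * (f (r ^+ 2) * r ^+ k) * malpha r))
  = \int[leb]_(r in `]0, +oo[) (r * (f (r ^+ 2) * r ^+ k.+1 * mtau r + b / 2 * r ^+ 2 * (f (r ^+ 2) * r ^+ k) * malpha r)).
Proof.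
move=> rc Sf sf.
have [Sc Ss] := C2_hcs (R := R) k.
have [g Sg Df] := SM_derive Sf.
have Cf := C2_rad Sf.
pose P x := (-1) * hc (R := R) k x; pose Q x := eps * hs (R := R) k x.
have SP : C2 P by apply: C2_mul => //; exact: C2_cst.
have SQ : C2 Q by apply: C2_mul => //; exact: C2_cst.
pose y2 (x : R * R) := (-1) * x.2.
have Sy : C2 y2 by apply: C2_mul; [exact: C2_cst|exact: C2_snd].
pose p1 x := y2 x * (f (nsq x) * Q x); pose p2 x := x.1 * (f (nsq x) * Q x).
pose q1 x := y2 x * (f (nsq x) * P x); pose q2 x := x.1 * (f (nsq x) * P x).
have adm (z : R * R -> R) (T : R * R -> R) : C2 z -> C2 T -> admissible r0 (fun x => z x * (f (nsq x) * T x)).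
  move=> Sz ST; split; first by do 2 apply: C2_mul => //.
  by exists c, d; split => // x h; rewrite sf// mul0r mulr0.
have a1 : admissible r0 p1 by exact: adm.
have a2 : admissible r0 p2 by apply: adm => //; exact: C2_fst.
have a3 : admissible r0 q1 by exact: adm.
have a4 : admissible r0 q2 by apply: adm => //; exact: C2_fst.
have [L1l L1r E] := divergence a1 a2 a3 a4.
have [DP DQ] := D12_hcs (R := R) k.
have DP' := D12_mul (D12_cst (-1)) DP.
have DQ' := D12_mul (D12_cst eps) DQ.
have Dy := D12_mul (D12_cst (-1)) (@D12_snd R).
have DR := D12_rad Df.
have [ep1 _] := D12_pd (D12_mul Dy (D12_mul DR DQ')).
have [_ ep2] := D12_pd (D12_mul D12_fst (D12_mul DR DQ')).
have [eq1 _] := D12_pd (D12_mul Dy (D12_mul DR DP')).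
have [_ eq2] := D12_pd (D12_mul D12_fst (D12_mul DR DP')).
pose F1 x := m%:~R * f (nsq x) * (hc k x * U1 x + Q x * U2 x).
pose F2 x := f (nsq x) * (hc k x * (x.1 * V21 x - x.2 * V11 x) + Q x * (x.1 * V22 x - x.2 * V12 x)
  + b * nsq x / 2 * (hc k x * U1 x + Q x * U2 x)).
(* The test field is tangential to circles, so the derivative of [f] disappears and only the angular
   derivative of z^|m| remains. *)
have eF1 : (fun x => U1 x * (pd1 p1 x + pd2 p2 x) + U2 x * (pd1 q1 x + pd2 q2 x)) = F1.
  apply/funext => x; rewrite ep1 ep2 eq1 eq2 /F1 /Q /y2.
  have [e1 e2] := hcs_rot (R := R) k x.
  move: e1 e2; set h1 := hc k.-1 x; set h2 := hs k.-1 x; set h3 := hc k x; set h4 := hs k x.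
  move=> e1 e2.
  transitivity (f (nsq x) * (eps * (- x.2 * (k%:R * h2) + x.1 * (k%:R * h1)) * U1 x
     - (- x.2 * (k%:R * h1) + x.1 * (- k%:R * h2)) * U2 x)); first by ring.
  rewrite e1 e2 -eps_k.
  transitivity (f (nsq x) * k%:R * (eps * h3 * U1 x + (eps * eps) * h4 * U2 x)); last by ring.
  by rewrite eps2; ring.
(* The vector potential pairs with the rotation field to |x|^2/2, the origin of the shift b r/2 in
   the angular momentum. *)
have eF2 : (fun x => (V12 x + b * A1 x * U2 x) * p1 x + (V22 x + b * A2 x * U2 x) * p2 x
         - ((V11 x + b * A1 x * U1 x) * q1 x + (V21 x + b * A2 x * U1 x) * q2 x)) = F2.
  by apply/funext => x; rewrite /p1 /p2 /q1 /q2 /F2 /A1 /A2 /y2 /P /nsq; field.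
rewrite eF1 in L1l E; rewrite eF2 in L1r E.
move: E; rewrite (Rpolar L1l) (Rpolar L1r).
have good := weak_good.
have cfs (h : R -> R) : continuous h -> continuous (fun r : R => h (r ^+ 2)).
  move=> ch r; apply: (@continuous_comp _ _ _ (fun r : R => r ^+ 2) h); last exact: ch.
  exact: (is_derive_continuous1 (is_derive_idX1 r 2)).
have cX (j : nat) : continuous (fun r : R => r ^+ j).
  by move=> r; exact: (is_derive_continuous1 (is_derive_idX1 r j)).
have mc (h : R -> R) : continuous h -> measurable_fun (setT : set RT) h.
  by move=> ch; exact: continuous_measurable_fun.
have cK : continuous (fun r : R => m%:~R * (f (r ^+ 2) * r ^+ k)).
  by move=> r; apply: cvgM; [exact: cvg_cst|apply: cvgM; [exact: cfs (SM_cont Sf) r|exact: cX]].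
have cJ : continuous (fun r : R => f (r ^+ 2) * r ^+ k.+1).
  by move=> r; apply: cvgM; [exact: cfs (SM_cont Sf) r|exact: cX].
have cL : continuous (fun r : R => b / 2 * r ^+ 2 * (f (r ^+ 2) * r ^+ k)).
  move=> r; apply: cvgM; first by apply: cvgM; [exact: cvg_cst|exact: cX].
  by apply: cvgM; [exact: cfs (SM_cont Sf) r|exact: cX].
have mF (F : R * R -> R) : L1 leb2 setT F -> measurable_fun (`]0, +oo[%classic : set RT) (fun r => r * ic (arc F r)).
  by move=> LF; exact: (measurable_ic_arc (L1_meas LF)).
have mS (h : R -> R) : measurable_fun (setT : set RT) h -> measurable_fun (`]0, +oo[%classic : set RT) (fun r => r * h r).
  move=> mh; apply: (measurable_funS measurableT (@subsetT _ _)); apply: measurable_funM => //.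
have mI : measurable (`]0, +oo[%classic : set RT) by exact: measurable_itv.
pose X r := m%:~R * (f (r ^+ 2) * r ^+ k) * malpha r.
pose Y r := f (r ^+ 2) * r ^+ k.+1 * mtau r + b / 2 * r ^+ 2 * (f (r ^+ 2) * r ^+ k) * malpha r.
have mX : measurable_fun (setT : set RT) X by exact: measurable_funM (mc _ cK) measurable_malpha.
have mY : measurable_fun (setT : set RT) Y.
  by apply: measurable_funD; apply: measurable_funM; [exact: mc|exact: measurable_mtau|exact: mc|exact: measurable_malpha].
have aX : {ae leb, forall r, (`]0, +oo[%classic : set RT) r -> r * ic (arc F1 r) = r * X r}.
  apply: ae_imp good => r H; rewrite /= in_itv/= andbT => r0'; congr (_ * _).
  have [[h1 h2 _] _] := H r0'.
  rewrite /X /malpha /fc -icZ; last by apply: Lc_fc; exact: L2c_Lc.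
  apply: ic_eq => t _; rewrite /arc /F1 /Q nsq_polar.
  have [-> ->] := hcs_polar k r t.
  by rewrite -cos_k -sin_k; ring.
have aY : {ae leb, forall r, (`]0, +oo[%classic : set RT) r -> r * ic (arc F2 r) = r * Y r}.
  apply: ae_imp good => r H; rewrite /= in_itv/= andbT => r0'; congr (_ * _).
  have [[u1 u2 h1] [h2 h3 h4]] := H r0'.
  have La := Lc_fc m (L2c_Lc u1) (L2c_Lc u2).
  have Lt := Lc_fc m (L2c_Lc (L2c_vang h1 h3)) (L2c_Lc (L2c_vang h2 h4)).
  rewrite /Y /malpha /mtau /fc -icZ// -[X in _ + X]icZ// -icD; [|exact: LcZ|exact: LcZ].
  apply: ic_eq => t _; rewrite /vang /arc /F2 /Q nsq_polar.
  have [-> ->] := hcs_polar k r t.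
  by rewrite -cos_k -sin_k [r ^+ k.+1]exprS /polar /=; field.
by rewrite (Rint_ae mI (mF _ L1l) (mS _ mX) aX) (Rint_ae mI (mF _ L1r) (mS _ mY) aY).
Qed.

Definition rball : set RT := `[r0, +oo[%classic.

Lemma measurable_rball : measurable rball. Proof. exact: measurable_itv. Qed.

Lemma rball_gt0 r : rball r -> 0 < r.
Proof. by rewrite /rball /= in_itv/= andbT; exact: lt_le_trans. Qed.

Lemma L1_sq_rball X : L2p X -> L1 leb rball (fun r => r * ic (fun t => arc X r t ^+ 2)).
Proof.
move=> [mX LX]; have := polar_L1r LX; apply: L1S; [exact: measurable_itv|exact: measurable_rball|].
by move=> r /rball_gt0 r0'; rewrite /= in_itv/= r0'.
Qed.

Let LrD f g := @L1D _ RT R leb rball measurable_rball f g.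
Let LrZ c f := @L1Z _ RT R leb rball measurable_rball c f.

Lemma fc_le (w1 w2 : R -> R) : L2c w1 -> L2c w2 -> fc m w1 w2 ^+ 2 <= 2 * pi * ic (fun t => w1 t ^+ 2 + w2 t ^+ 2).
Proof.
move=> h1 h2; have := @bessel R [:: m] w1 w2 isT h1 h2; rewrite big_seq1; apply: le_trans.
by rewrite /fc2 lerDl sqr_ge0.
Qed.

Let mfcr (h : R -> R) : measurable_fun (setT : set RT) h -> measurable_fun rball (fun r => r * h r ^+ 2).
Proof.
move=> mh; apply: (measurable_funS measurableT (@subsetT _ _)).
by apply: measurable_funM => //; exact: measurable_funX.
Qed.

Lemma vrad_vang X Y (r t : R) :
  vrad X Y r t ^+ 2 + vang X Y r t ^+ 2 = arc X r t ^+ 2 + arc Y r t ^+ 2.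
Proof.
have e := cos2Dsin2 t; rewrite /vrad /vang.
transitivity ((cos t ^+ 2 + sin t ^+ 2) * (arc X r t ^+ 2 + arc Y r t ^+ 2)); first by ring.
by rewrite e mul1r.
Qed.

(** Bessel's inequality for a single frequency on almost every circle, with [vrad_vang] to return
    from the polar components to the Cartesian ones. *)
Lemma L1_modes : [/\ L1 leb rball (fun r => r * malpha r ^+ 2), L1 leb rball (fun r => r * mpi r ^+ 2) &
  L1 leb rball (fun r => r * mtau r ^+ 2)].
Proof.
have lU1 := L1_sq_rball (wU1 WF); have lU2 := L1_sq_rball (wU2 WF).
have l11 := L1_sq_rball (wV11 WF); have l12 := L1_sq_rball (wV12 WF).
have l21 := L1_sq_rball (wV21 WF); have l22 := L1_sq_rball (wV22 WF).
have LV := LrZ (2 * pi) (LrD (LrD l11 l21) (LrD l12 l22)).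
have p2 : 0 < 2 * pi :> R by rewrite mulr_gt0// pi_gt0.
have bndV r : 0 < r -> L2c (arc V11 r) -> L2c (arc V12 r) -> L2c (arc V21 r) -> L2c (arc V22 r) ->
  ic (fun t => vrad V11 V21 r t ^+ 2 + vrad V12 V22 r t ^+ 2) + ic (fun t => vang V11 V21 r t ^+ 2 + vang V12 V22 r t ^+ 2)
  = ic (fun t => arc V11 r t ^+ 2) + ic (fun t => arc V21 r t ^+ 2) + (ic (fun t => arc V12 r t ^+ 2) + ic (fun t => arc V22 r t ^+ 2)).
  move=> r0' h1 h2 h3 h4.
  have q1 := L2c_vrad h1 h3; have q2 := L2c_vrad h2 h4; have q3 := L2c_vang h1 h3; have q4 := L2c_vang h2 h4.
  have D (f g : R -> R) : L2c f -> L2c g -> Lc (fun t => f t ^+ 2 + g t ^+ 2) by move=> hf hg; apply: LcD; [exact: hf.2|exact: hg.2].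
  have S (f : R -> R) : L2c f -> Lc (fun t => f t ^+ 2) by case.
  rewrite -!icD; [|by [apply: S|apply: D|apply: LcD; apply: D]..].
  apply: ic_eq => t _.
  have e1 := vrad_vang V11 V21 r t; have e2 := vrad_vang V12 V22 r t.
  by move: e1 e2; lra.
split.
- apply: (L1_le_ae measurable_rball (mfcr measurable_malpha) _ (LrZ (2 * pi) (LrD lU1 lU2))).
  apply: ae_imp weak_good => r H /rball_gt0 r0'; have [[h1 h2 _] _] := H r0'.
  rewrite ger0_norm; last by rewrite mulr_ge0 ?sqr_ge0// ltW.
  rewrite -mulrDr [leRHS]mulrCA; apply: ler_wpM2l; first exact: ltW.
  by rewrite -icD; [exact: fc_le|exact: h1.2|exact: h2.2].
- apply: (L1_le_ae measurable_rball (mfcr measurable_mpi) _ LV).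
  apply: ae_imp weak_good => r H /rball_gt0 r0'; have [[_ _ h1] [h2 h3 h4]] := H r0'.
  rewrite ger0_norm; last by rewrite mulr_ge0 ?sqr_ge0// ltW.
  rewrite -!mulrDr [leRHS]mulrCA; apply: ler_wpM2l; first exact: ltW.
  rewrite -(bndV r)//.
  have q1 := L2c_vrad h1 h3; have q2 := L2c_vrad h2 h4.
  apply: (le_trans (fc_le (L2cN q2) q1)); apply: ler_wpM2l; first exact: ltW.
  rewrite (@ic_eq _ (fun t => (- vrad V12 V22 r t) ^+ 2 + vrad V11 V21 r t ^+ 2) (fun t => vrad V11 V21 r t ^+ 2 + vrad V12 V22 r t ^+ 2)).
    by rewrite lerDl; apply: ic_ge0 => t _; exact: sqD_ge0.
  by move=> t _; rewrite sqrrN addrC.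
- apply: (L1_le_ae measurable_rball (mfcr measurable_mtau) _ LV).
  apply: ae_imp weak_good => r H /rball_gt0 r0'; have [[_ _ h1] [h2 h3 h4]] := H r0'.
  rewrite ger0_norm; last by rewrite mulr_ge0 ?sqr_ge0// ltW.
  rewrite -!mulrDr [leRHS]mulrCA; apply: ler_wpM2l; first exact: ltW.
  rewrite -(bndV r)//.
  have q1 := L2c_vang h1 h3; have q2 := L2c_vang h2 h4.
  apply: (le_trans (fc_le q1 q2)); apply: ler_wpM2l; first exact: ltW.
  by rewrite lerDr; apply: ic_ge0 => t _; exact: sqD_ge0.
Qed.

Let mI T : measurable (`[r0, T]%classic : set RT). Proof. exact: measurable_itv. Qed.

Lemma L1_loc (h : R -> R) T : measurable_fun (setT : set RT) h -> L1 leb rball (fun r => r * h r ^+ 2) ->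
  L1 leb `[r0, T] h.
Proof.
move=> mh Lh.
have sub : `[r0, T]%classic `<=` rball by move=> r; rewrite /rball /= !in_itv/= => /andP[-> _].
have L1' := @L1S _ RT R leb rball _ _ measurable_rball (mI T) sub Lh.
have L2' : L1 leb `[r0, T] (fun=> 1 : R).
  by apply: L1_continuous; apply: continuous_subspaceT => r; exact: cvg_cst.
apply: (@L1_le _ RT R leb _ (mI T) _ (fun r => 1 + r0^-1 * (r * h r ^+ 2))).
- exact: (measurable_funS measurableT (@subsetT _ _) mh).
- move=> r /sub rr; have r0' := rball_gt0 rr.
  have r1 : 1 <= r0^-1 * r.
    by rewrite mulrC ler_pdivlMr// mul1r; move: rr; rewrite /rball/= in_itv/= andbT.
  have : h r ^+ 2 <= r0^-1 * (r * h r ^+ 2) by rewrite mulrA ler_peMl// sqr_ge0.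
  rewrite -(real_normK (num_real (h r))).
  have : 0 <= (`|h r| - 1) ^+ 2 by exact: sqr_ge0.
  have : 0 <= `|h r| by [].
  by set y := `|h r|; set z := r0^-1 * _; nra.
- apply: (@L1D _ RT R leb _ (mI T)) => //; exact: (@L1Z _ RT R leb _ (mI T)).
Qed.
End modes.
End weak.

(** * The energy inequality for a single angular mode *)

Section mode.
Context {R : realType}.
Local Notation leb := (@lebesgue_measure R).
Local Notation RT := (measurableTypeR R).

Lemma Rint_supp (d : measure_display) (T : measurableType d) (mu : {measure set T -> \bar R})
  (A B : set T) (f : T -> R) : A `<=` B -> (forall x, B x -> ~ A x -> f x = 0) ->
  \int[mu]_(x in A) f x = \int[mu]_(x in B) f x.
Proof.
move=> AB H; rewrite [LHS]Rintegral_mkcond [RHS]Rintegral_mkcond.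
congr (Rintegral _ _ _); apply/funext => x; rewrite !patchE.
have [xA|xA] := boolP (x \in A); first by rewrite (mem_set (AB _ (set_mem xA))).
case: ifPn => // xB; rewrite H//; first exact: set_mem.
by move=> /mem_set h; rewrite h in xA.
Qed.

Lemma cont_sq (h : R -> R) : continuous h -> continuous (fun r : R => h (r ^+ 2)).
Proof.
move=> ch r; apply: (@continuous_comp _ _ _ (fun r : R => r ^+ 2) h); last exact: ch.
exact: (is_derive_continuous1 (is_derive_idX1 r 2)).
Qed.

Lemma cont_exp (j : nat) : continuous (fun r : R => r ^+ j).
Proof. by move=> r; exact: (is_derive_continuous1 (is_derive_idX1 r j)). Qed.

Lemma le_archi (x y : R) : x <= y -> y <= x + (Num.bound (y - x))%:R.
Proof. by move=> xy; rewrite -lerBlDl ltW// archi_boundP// subr_ge0. Qed.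

Variables (r0 b lam : R) (m : int) (alpha pi_ tau h h' : R -> R).
Let k := `|m|%N.
Let K := (k + 2)%N.
Hypothesis r00 : 0 < r0.
Hypothesis b0 : 0 < b.
Hypothesis ma : measurable_fun (setT : set RT) alpha.
Hypothesis mp : measurable_fun (setT : set RT) pi_.
Hypothesis mt : measurable_fun (setT : set RT) tau.
Hypothesis La : L1 leb (rball r0) (fun r => r * alpha r ^+ 2).
Hypothesis Lp : L1 leb (rball r0) (fun r => r * pi_ r ^+ 2).
Hypothesis Lt : L1 leb (rball r0) (fun r => r * tau r ^+ 2).
Hypothesis radial : forall (c d : R) (f g : R -> R), r0 ^+ 2 < c -> SM f -> SM g -> supp_in c d f -> supp_in c d g ->
  (forall s : R, is_derive s 1 f (g s)) ->
  \int[leb]_(r in `]0, +oo[) (r * ((K%:R * f (r ^+ 2) + 2 * r ^+ 2 * g (r ^+ 2)) * r ^+ k * alpha r))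
  = \int[leb]_(r in `]0, +oo[) (r * (- (f (r ^+ 2) * r ^+ k.+1 * pi_ r))).
Hypothesis angular : forall (c d : R) (f : R -> R), r0 ^+ 2 < c -> SM f -> supp_in c d f ->
  \int[leb]_(r in `]0, +oo[) (r * (m%:~R * (f (r ^+ 2) * r ^+ k) * alpha r))
  = \int[leb]_(r in `]0, +oo[) (r * (f (r ^+ 2) * r ^+ k.+1 * tau r + b / 2 * r ^+ 2 * (f (r ^+ 2) * r ^+ k) * alpha r)).
Hypothesis sup : supersolution m b lam r0 h h'.

Let mS T : measurable (`[r0, T]%classic : set RT). Proof. exact: measurable_itv. Qed.
Let mB : measurable (rball r0) := measurable_rball r0.
Let itv_sub T : (`[r0, T]%classic : set RT) `<=` `]0, +oo[%classic.
Proof. by move=> r; rewrite /= !in_itv/= andbT => /andP[h1 _]; exact: lt_le_trans h1. Qed.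

Let off (f : R -> R) c d T r : r0 ^+ 2 < c -> 0 <= T -> d < T ^+ 2 -> supp_in c d f ->
  (`]0, +oo[%classic : set RT) r -> ~ (`[r0, T]%classic : set RT) r -> f (r ^+ 2) = 0.
Proof.
move=> rc T0 dT sf; rewrite /= !in_itv/= andbT => r0' nr; apply: sf.
apply/negP => /andP[h1 h2]; apply: nr.
have e1 := ler_pXn2r (ltn0Sn 1) (ltW r00 : r0 \is Num.nneg) (ltW r0' : r \is Num.nneg).
have e2 := ler_pXn2r (ltn0Sn 1) (ltW r0' : r \is Num.nneg) (T0 : T \is Num.nneg).
by rewrite -e1 -e2 (ltW (lt_trans rc h1)) (ltW (lt_trans h2 dT)).
Qed.

Let la T : L1 leb `[r0, T] alpha := L1_loc r00 T ma La.
Let lp T : L1 leb `[r0, T] pi_ := L1_loc r00 T mp Lp.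
Let lt' T : L1 leb `[r0, T] tau := L1_loc r00 T mt Lt.
Let LIZ T c f := @L1Z _ RT R leb _ (mS T) c f.
Let LID T f g := @L1D _ RT R leb _ (mS T) f g.
Let LIB T f g := @L1B _ RT R leb _ (mS T) f g.

(** In these terms the radial identity says that [gamma0] is the weak derivative of [beta0]. The
    exponent is |m| + 2 because the test field carries r^|m| and one factor x, and the area element
    another factor r. *)
Let beta0 r := r ^+ K * alpha r.
Let gamma0 r := r ^+ K * pi_ r + K%:R * (r ^+ k.+1 * alpha r).

Let L1_beta0 T : L1 leb `[r0, T] beta0.
Proof. by apply: L1_contM => //; exact: cont_exp. Qed.
Let L1_gamma0 T : L1 leb `[r0, T] gamma0.
Proof. by apply: LID; [|apply: LIZ]; apply: L1_contM => //; exact: cont_exp. Qed.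

Let prim0 r := \int[leb]_(s in `[r0, r]) gamma0 s.

Let AC_prim T : AC r0 T prim0 gamma0.
Proof.
split; first exact: L1_gamma0.
move=> x xT; rewrite {2}/prim0 set_itv1 Rintegral_set1 add0r//.
Qed.

(* du Bois-Reymond: [r^K alpha] agrees almost everywhere with a primitive of its
   weak derivative. *)
Lemma mode_const : exists C : R, forall T : R, r0 <= T -> {ae leb, forall r, r0 <= r <= T -> beta0 r - prim0 r = C}.
Proof.
apply: weak_const => //.
  by move=> T rT; apply: LIB => //; apply: L1_continuous; exact: (AC_continuous rT (AC_prim T)).
move=> c d f g T rc cd rT dT Sf Sg sf sg Df.
have T0 : 0 <= T by rewrite (le_trans (ltW r00)).
have cf := SM_cont Sf; have cg := SM_cont Sg.
have c2rg : continuous (fun r : R => 2 * r * g (r ^+ 2)).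
  by move=> r; apply: cvgM; [apply: cvgM; [exact: cvg_cst|exact: cvg_id]|exact: (cont_sq cg)].
have ACf : AC r0 T (fun r => f (r ^+ 2)) (fun r => 2 * r * g (r ^+ 2)).
  apply: AC_derive; last by apply: continuous_subspaceT.
  move=> r _; have h1 := is_derive_comp1 (is_derive_idX1 r 2) (Df (r ^+ 2)).
  by apply: is_derive_eq h1 _; rewrite /= ; ring.
have I0 := AC_end rT (AC_mul rT (AC_prim T) ACf).
have fT : f (T ^+ 2) = 0 by apply: sf; rewrite negb_and -!leNgt (ltW dT) orbT.
have fr : f (r0 ^+ 2) = 0 by apply: sf; rewrite negb_and -!leNgt (ltW rc).
rewrite fT fr !mulr0 subrr in I0.
have E := radial rc Sf Sg sf sg Df.
have l1 : L1 leb `[r0, T] (fun r => f (r ^+ 2) * gamma0 r) by apply: L1_contM => //; exact: cont_sq.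
have l2 : L1 leb `[r0, T] (fun r => 2 * r * g (r ^+ 2) * beta0 r) by exact: L1_contM.
have l3 : L1 leb `[r0, T] (fun r => 2 * r * g (r ^+ 2) * prim0 r).
  by apply: L1_contM => //; apply: L1_continuous; exact: (AC_continuous rT (AC_prim T)).
have l4 : L1 leb `[r0, T] (fun r => f (r ^+ 2) * (r ^+ k.+1 * alpha r)).
  by apply: L1_contM; [exact: cont_sq|apply: L1_contM => //; exact: cont_exp].
have l5 : L1 leb `[r0, T] (fun r => f (r ^+ 2) * (r ^+ K * pi_ r)).
  by apply: L1_contM; [exact: cont_sq|apply: L1_contM => //; exact: cont_exp].
have E1 : \int[leb]_(r in `[r0, T]) (K%:R * (f (r ^+ 2) * (r ^+ k.+1 * alpha r)) + 2 * r * g (r ^+ 2) * beta0 r)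
   = \int[leb]_(r in `[r0, T]) ((- 1) * (f (r ^+ 2) * (r ^+ K * pi_ r))).
  transitivity (\int[leb]_(r in `[r0, T]) (r * ((K%:R * f (r ^+ 2) + 2 * r ^+ 2 * g (r ^+ 2)) * r ^+ k * alpha r))).
    by apply: Rint_eq => r _; rewrite /beta0 /K addn2 !exprS; ring.
  rewrite (@Rint_supp _ RT leb _ _ _ (@itv_sub T)); last first.
    by move=> r r1 r2; rewrite (off rc T0 dT sf r1 r2) (off rc T0 dT sg r1 r2); ring.
  rewrite E -(@Rint_supp _ RT leb _ _ _ (@itv_sub T)); last first.
    by move=> r r1 r2; rewrite (off rc T0 dT sf r1 r2); ring.
  by apply: Rint_eq => r _; rewrite /K addn2 !exprS; ring.
rewrite RintegralD ?RintegralZl// in E1; [|exact: LIZ].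
transitivity (\int[leb]_(r in `[r0, T]) (2 * r * g (r ^+ 2) * beta0 r - 2 * r * g (r ^+ 2) * prim0 r)).
  by apply: Rint_eq => r _; ring.
rewrite RintegralB//.
have I1 : \int[leb]_(r in `[r0, T]) (f (r ^+ 2) * gamma0 r + 2 * r * g (r ^+ 2) * prim0 r) = 0.
  by rewrite -I0; apply: Rint_eq => r _; ring.
rewrite RintegralD// in I1.
have I2 : \int[leb]_(r in `[r0, T]) (f (r ^+ 2) * gamma0 r) =
  \int[leb]_(r in `[r0, T]) (f (r ^+ 2) * (r ^+ K * pi_ r)) + K%:R * \int[leb]_(r in `[r0, T]) (f (r ^+ 2) * (r ^+ k.+1 * alpha r)).
  rewrite -RintegralZl// -RintegralD//; last exact: LIZ.
  by apply: Rint_eq => r _; rewrite /gamma0; ring.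
move: E1 I1; rewrite I2; lra.
Qed.

(** On a Fourier mode the angular derivative acts as multiplication, so [weak_zero] turns the weak
    identity into a pointwise one, at first on bounded intervals and then on their countable
    union. *)
Lemma mode_angular : {ae leb, forall r, rball r0 r -> (m%:~R / r - b * r / 2) * alpha r = tau r}.
Proof.
have H T : r0 <= T -> {ae leb, forall r, r0 <= r <= T -> r ^+ k.+1 * ((m%:~R - b * r ^+ 2 / 2) * alpha r - r * tau r) = 0}.
  move=> rT; have T0 : 0 <= T by rewrite (le_trans (ltW r00)).
  have cm : continuous (fun r : R => m%:~R - b * r ^+ 2 / 2).
    move=> r; apply: cvgB; first exact: cvg_cst.
    by apply: cvgM; [apply: cvgM; [exact: cvg_cst|exact: cont_exp]|exact: cvg_cst].
  have cid : continuous (fun r : R => r) by move=> r; exact: cvg_id.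
  have l1 : L1 leb `[r0, T] (fun r => (m%:~R - b * r ^+ 2 / 2) * alpha r) by exact: L1_contM.
  have l2 : L1 leb `[r0, T] (fun r => r * tau r) by exact: L1_contM.
  apply: weak_zero => //; first by apply: L1_contM; [exact: cont_exp|exact: LIB].
  move=> c d f rc cd dT Sf sf.
  have cf := SM_cont Sf.
  have E := angular rc Sf sf.
  have j1 : L1 leb `[r0, T] (fun r => f (r ^+ 2) * (r ^+ k.+1 * alpha r)).
    by apply: L1_contM; [exact: cont_sq|apply: L1_contM => //; exact: cont_exp].
  have j2 : L1 leb `[r0, T] (fun r => f (r ^+ 2) * (r ^+ k.+1 * (r * tau r + b / 2 * (r ^+ 2 * alpha r)))).
    apply: L1_contM; [exact: cont_sq|apply: L1_contM; [exact: cont_exp|]].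
    by apply: LID => //; apply: LIZ; apply: L1_contM => //; exact: cont_exp.
  transitivity (\int[leb]_(r in `[r0, T]) (m%:~R * (f (r ^+ 2) * (r ^+ k.+1 * alpha r))
     - f (r ^+ 2) * (r ^+ k.+1 * (r * tau r + b / 2 * (r ^+ 2 * alpha r))))).
    by apply: Rint_eq => r _; rewrite !exprS; field.
  rewrite RintegralB//; last exact: LIZ.
  apply/eqP; rewrite subr_eq0; apply/eqP.
  transitivity (\int[leb]_(r in `[r0, T]) (r * (m%:~R * (f (r ^+ 2) * r ^+ k) * alpha r))).
    by apply: Rint_eq => r _; rewrite !exprS; ring.
  rewrite (@Rint_supp _ RT leb _ _ _ (@itv_sub T)); last first.
    by move=> r r1 r2; rewrite (off rc T0 dT sf r1 r2); ring.
  rewrite E -(@Rint_supp _ RT leb _ _ _ (@itv_sub T)); last first.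
    by move=> r r1 r2; rewrite (off rc T0 dT sf r1 r2); ring.
  by apply: Rint_eq => r _; rewrite !exprS; ring.
have HH : {ae leb, forall r, forall n : nat, r0 <= r <= r0 + n%:R -> r ^+ k.+1 * ((m%:~R - b * r ^+ 2 / 2) * alpha r - r * tau r) = 0}.
  by apply: ae_foralln => n; apply: H; rewrite lerDl.
apply: ae_imp HH => r Hr rr.
have r0' := rball_gt0 r00 rr.
have /(Hr (Num.bound (r - r0))) /eqP : r0 <= r <= r0 + (Num.bound (r - r0))%:R.
  move: rr; rewrite /rball /= in_itv/= andbT => rr; rewrite rr /=.
  exact: le_archi.
rewrite mulf_eq0 expf_eq0/= (gt_eqF r0')/= subr_eq0 => /eqP E.
apply: (mulfI (lt0r_neq0 r0')); rewrite -E; field; exact: lt0r_neq0.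
Qed.

(** The integrability at infinity that [weighted_energy_ge0] asks for comes from the growth of the
    potential. With x = m/r and y = b r, one has y^2/8 <= (x - y/2)^2 + x^2, the difference being
    (4x - y)^2/8; the first square times alpha^2 is tau^2. *)
Lemma L1_weight : L1 leb (rball r0) (fun r => r ^+ 3 * alpha r ^+ 2).
Proof.
have LL := @L1Z _ RT R leb _ mB (8 / b ^+ 2) _ (@L1D _ RT R leb _ mB _ _ Lt (@L1Z _ RT R leb _ mB (m%:~R ^+ 2 / r0 ^+ 2) _ La)).
apply: (L1_le_ae mB _ _ LL).
  apply: (measurable_funS measurableT (@subsetT _ _)); apply: measurable_funM.
    exact: continuous_measurable_fun (@cont_exp 3).
  exact: measurable_funX.
apply: ae_imp mode_angular => r E rr; have r0' := rball_gt0 r00 rr.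
have rr0 : r0 <= r by move: rr; rewrite /rball /= in_itv/= andbT.
rewrite ger0_norm; last by rewrite mulr_ge0 ?sqr_ge0// exprn_ge0// ltW.
rewrite -(E rr) mulrC -ler_pdivrMl ?divr_gt0 ?exprn_gt0//.
have -> : r * ((m%:~R / r - b * r / 2) * alpha r) ^+ 2 + m%:~R ^+ 2 / r0 ^+ 2 * (r * alpha r ^+ 2)
  = (alpha r ^+ 2 * r) * ((m%:~R / r - b * r / 2) ^+ 2 + m%:~R ^+ 2 / r0 ^+ 2) by ring.
have -> : (8 / b ^+ 2)^-1 * (alpha r ^+ 2 * r ^+ 3) = (alpha r ^+ 2 * r) * (b ^+ 2 * r ^+ 2 / 8).
  by field; rewrite lt0r_neq0.
apply: ler_wpM2l; first by rewrite mulr_ge0 ?sqr_ge0// ltW.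
have h1 : m%:~R ^+ 2 / r ^+ 2 <= m%:~R ^+ 2 / r0 ^+ 2.
  apply: ler_wpM2l; first exact: sqr_ge0.
  by rewrite lef_pV2 ?posrE ?exprn_gt0//; apply: lerXn2r; rewrite ?nnegrE// ltW.
have h2 : m%:~R ^+ 2 / r ^+ 2 = (m%:~R / r) ^+ 2 by rewrite expr_div_n.
move: h1; rewrite h2; set x := m%:~R / r => h1.
have -> : b ^+ 2 * r ^+ 2 = (b * r) ^+ 2 by rewrite exprMn.
set y := b * r.
have : 0 <= (4 * x - y) ^+ 2 by exact: sqr_ge0.
by move: h1; nra.
Qed.

(** The angular component is replaced by the potential term through [mode_angular], and r^K alpha by
    its absolutely continuous representative; both changes affect null sets only. The supersolution
    then enters through [weighted_energy_ge0]. *)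
Lemma mode_energy : 0 <= \int[leb]_(r in rball r0) (r * (pi_ r ^+ 2 + tau r ^+ 2 - lam * alpha r ^+ 2)).
Proof.
have [C HC] := mode_const.
have [Hd Hc Hr Hh [D D0 HD]] := sup.
(* The absolutely continuous representative of [beta0]; its derivative [gamma0] agrees almost
   everywhere with [gamma], which is expressed through [beta] itself. *)
pose beta r := C + prim0 r.
pose gamma r := r ^+ K * pi_ r + K%:R * beta r / r.
have ACb T : AC r0 T beta gamma0.
  have [l0 l1] := AC_prim T; split => // x xT; rewrite /beta l1// addrA.
  by congr (_ + _ + _); rewrite /prim0 set_itv1 Rintegral_set1.
have mbT T : r0 <= T -> measurable_fun (`[r0, T]%classic : set RT) beta by move=> rT; exact: (AC_meas rT (ACb T)).
have mb : measurable_fun (rball r0) beta.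
  have -> : rball r0 = \bigcup_(n : nat) (`[r0, r0 + n%:R]%classic : set RT).
    apply/seteqP; split => r; rewrite /rball /= in_itv/= andbT.
      move=> rr; exists (Num.bound (r - r0)) => //=; rewrite in_itv/= rr/=.
      exact: le_archi.
    by move=> [n _]; rewrite /= in_itv/= => /andP[].
  apply/measurable_fun_bigcup => [n|n]; first exact: mS.
  by apply: mbT; rewrite lerDl.
have Eb : {ae leb, forall r, rball r0 r -> beta r = beta0 r}.
  have HH : {ae leb, forall r, forall n : nat, r0 <= r <= r0 + n%:R -> beta0 r - prim0 r = C}.
    by apply: ae_foralln => n; apply: HC; rewrite lerDl.
  apply: ae_imp HH => r H rr.
  have /(H (Num.bound (r - r0))) e : r0 <= r <= r0 + (Num.bound (r - r0))%:R.
    move: rr; rewrite /rball /= in_itv/= andbT => rr; rewrite rr /=.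
    exact: le_archi.
  by rewrite /beta -e subrK.
have minv (S : set RT) : (forall r, S r -> r != 0) -> measurable S -> measurable_fun S (fun r : R => r^-1).
  move=> S0 mSS; apply: subspace_continuous_measurable_fun => //.
  apply: continuous_in_subspaceT => x; rewrite inE => /S0 x0; exact: inv_continuous.
have ACg T : r0 <= T -> AC r0 T beta gamma.
  move=> rT; apply: AC_ae (ACb T).
    have sub : (`[r0, T]%classic : set RT) `<=` setT by exact: subsetT.
    apply: measurable_funD.
      apply: measurable_funM; last exact: (measurable_funS measurableT sub mp).
      by apply: (measurable_funS measurableT sub); exact: continuous_measurable_fun (@cont_exp K).
    apply: measurable_funM; first by apply: measurable_funM => //; exact: mbT.
    apply: minv => // r; rewrite /= in_itv/= => /andP[h1 _].
    by rewrite gt_eqF// (lt_le_trans r00).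
  apply: ae_imp Eb => r H rr.
  have rb : rball r0 r by move: rr; rewrite /rball /= !in_itv/= andbT => /andP[].
  have r0' := rball_gt0 r00 rb.
  rewrite /gamma (H rb) /beta0 /gamma0 /K addn2 [r ^+ k.+2]exprS; field; exact: lt0r_neq0.
pose e r := (pi_ r ^+ 2 + (pot m b r - lam) * (beta r / r ^+ K) ^+ 2) * r.
have mbK : measurable_fun (rball r0) (fun r => beta r / r ^+ K).
  apply: measurable_funM => //.
  apply: subspace_continuous_measurable_fun => //; apply: continuous_in_subspaceT => x; rewrite inE => /(rball_gt0 r00) x0.
  have e' : (fun r : R => (r ^+ K)^-1) = (fun r : R => (r^-1) ^+ K) by apply/funext => r; rewrite exprVn.
  rewrite e'; apply: (@continuous_comp _ _ _ (fun r : R => r^-1) (fun r : R => r ^+ K)); last exact: cont_exp.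
  by apply: inv_continuous; rewrite gt_eqF.
have EbK : {ae leb, forall r, rball r0 r -> alpha r = beta r / r ^+ K}.
  apply: ae_imp Eb => r H rr; rewrite H//; have r0' := rball_gt0 r00 rr.
  by rewrite /beta0 mulrAC mulfV ?mul1r// expf_neq0// gt_eqF.
have subB : rball r0 `<=` setT by exact: subsetT.
have mBf (f : R -> R) : measurable_fun (setT : set RT) f -> measurable_fun (rball r0) f.
  exact: (measurable_funS measurableT subB).
have mpot : measurable_fun (rball r0) (pot m b).
  apply: subspace_continuous_measurable_fun => //; apply: continuous_in_subspaceT => x; rewrite inE => /(rball_gt0 r00) x0.
  rewrite /pot; apply: (@continuous_comp _ _ _ (fun r : R => m%:~R / r - b * r / 2) (fun r : R => r ^+ 2)); last exact: cont_exp.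
  apply: cvgB; apply: cvgM; [exact: cvg_cst|by apply: inv_continuous; rewrite gt_eqF| |exact: cvg_cst].
  by apply: cvgM; [exact: cvg_cst|exact: cvg_id].
have me : measurable_fun (rball r0) e.
  apply: measurable_funM; last by apply: mBf.
  apply: measurable_funD; first by apply: measurable_funX; exact: mBf.
  by apply: measurable_funM; [exact: measurable_funB|exact: measurable_funX].
pose q r := r * (pi_ r ^+ 2 + tau r ^+ 2 - lam * alpha r ^+ 2).
have Lq : L1 leb (rball r0) q.
  have LL := @L1B _ RT R leb _ mB _ _ (@L1D _ RT R leb _ mB _ _ Lp Lt) (@L1Z _ RT R leb _ mB lam _ La).
  by apply: (@L1_eq _ RT R leb _ mB _ _ _ LL) => r _; rewrite /q; ring.
have qe : {ae leb, forall r, rball r0 r -> q r = e r}.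
  apply: ae_imp (ae_and mode_angular EbK) => r [H1 H2] rr.
  by rewrite /q /e -H1// -H2// /pot; ring.
have Le : L1 leb (rball r0) e by exact: (L1_ae mB me qe Lq).
have mq := L1_meas Lq.
rewrite -/q (Rint_ae mB mq me qe).
apply: (@weighted_energy_ge0 R r0 D K e h h' (fun r => pot m b r - lam) pi_ beta gamma) => //.
apply: (@L1_ae R (rball r0) (fun r => r ^+ 3 * alpha r ^+ 2)) => //.
- apply: measurable_funM; first by apply: mBf; exact: continuous_measurable_fun (@cont_exp 3).
  exact: measurable_funX.
- by apply: ae_imp EbK => r H rr; rewrite H.
- exact: L1_weight.
Qed.
End mode.

(** * Summation over the angular modes *)

Section lower.
Context {R : realType}.
Local Notation leb := (@lebesgue_measure R).
Local Notation RT := (measurableTypeR R).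
Local Notation leb2 := (@lebesgue_measure R \x @lebesgue_measure R)%E.
Local Notation RT2 := (RT * RT)%type.
Variables (r0 b lam : R).
Hypothesis r00 : 0 < r0.
Hypothesis b0 : 0 < b.
Hypothesis sup : forall n : int, exists h h' : R -> R, supersolution n b lam r0 h h'.

Let mB : measurable (rball r0) := measurable_rball r0.
Let LrD f g := @L1D _ RT R leb _ mB f g.
Let LrB f g := @L1B _ RT R leb _ mB f g.
Let LrZ c f := @L1Z _ RT R leb _ mB c f.

Let RiD (f g : R -> R) : L1 leb (rball r0) f -> L1 leb (rball r0) g ->
  \int[leb]_(r in rball r0) (f r + g r) = \int[leb]_(r in rball r0) f r + \int[leb]_(r in rball r0) g r.
Proof. by move=> hf hg; apply: RintegralD; [exact: mB|exact: hf|exact: hg]. Qed.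

Let RiB (f g : R -> R) : L1 leb (rball r0) f -> L1 leb (rball r0) g ->
  \int[leb]_(r in rball r0) (f r - g r) = \int[leb]_(r in rball r0) f r - \int[leb]_(r in rball r0) g r.
Proof. by move=> hf hg; apply: RintegralB; [exact: mB|exact: hf|exact: hg]. Qed.

Let RiZ c (f : R -> R) : L1 leb (rball r0) f ->
  \int[leb]_(r in rball r0) (c * f r) = c * \int[leb]_(r in rball r0) f r.
Proof. by move=> hf; apply: RintegralZl; [exact: mB|exact: hf]. Qed.

Lemma Rint_sq_rball (X : R * R -> R) : L2p X -> (forall x, nsq x <= r0 ^+ 2 -> X x = 0) ->
  \int[leb2]_x (X x ^+ 2) = \int[leb]_(r in rball r0) (r * ic (fun t => arc X r t ^+ 2)).
Proof.
move=> [mX LX] X0; rewrite (Rpolar LX).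
have sub : (rball r0 : set RT) `<=` `]0, +oo[%classic.
  by move=> r /(rball_gt0 r00) r0'; rewrite /= in_itv/= r0'.
rewrite -(@Rint_supp _ _ RT leb _ _ _ sub) //.
move=> r; rewrite /rball /= !in_itv/= !andbT => r0' /negP; rewrite -ltNge => rr0.
rewrite (@ic_eq _ _ (fun=> 0 * 0)); last first.
  move=> t _; rewrite /arc X0 ?expr2 ?mulr0// nsq_polar; apply: lerXn2r; rewrite ?nnegrE; exact: ltW.
have -> : ic (fun=> 0 * 0 : R) = 0 * ic (fun=> 0 : R) by apply: icZ; apply: Lc_cont => t; exact: cvg_cst.
by rewrite mul0r mulr0.
Qed.

Section field.
Variables (U1 U2 V11 V12 V21 V22 : R * R -> R).
Hypothesis WF : weakfield r0 b U1 U2 V11 V12 V21 V22.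

Definition mode2 (m : int) (r : R) : R := r * (fc2 m (fun t => - vrad V12 V22 r t) (vrad V11 V21 r)
  + fc2 m (vang V11 V21 r) (vang V12 V22 r) - lam * fc2 m (arc U1 r) (arc U2 r)).

(** The real parts of the coefficients are handled by the given field, the imaginary parts by the
    field rotated with [rotate]. *)
Lemma mode2_ge0 m : L1 leb (rball r0) (mode2 m) /\ 0 <= \int[leb]_(r in rball r0) mode2 m r.
Proof.
have key (u1 u2 v11 v12 v21 v22 : R * R -> R) : weakfield r0 b u1 u2 v11 v12 v21 v22 ->
  let q r := r * (mpi v11 v12 v21 v22 m r ^+ 2 + mtau v11 v12 v21 v22 m r ^+ 2 - lam * malpha u1 u2 m r ^+ 2) in
  L1 leb (rball r0) q /\ 0 <= \int[leb]_(r in rball r0) q r.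
  move=> wf q; have [h [h' S]] := sup m.
  have [La Lp Lt] := L1_modes r00 wf m; split.
    by apply: (@L1_eq _ RT R leb _ mB _ _ _ (LrB (LrD Lp Lt) (LrZ lam La))) => r _; rewrite /q; ring.
  apply: (mode_energy r00 b0 (measurable_malpha wf m) (measurable_mpi wf m) (measurable_mtau wf m) La Lp Lt _ _ S).
  - by move=> c d f g; exact: radial_identity wf m c d f g.
  - by move=> c d f; exact: angular_identity wf m c d f.
have [l1 i1] := key _ _ _ _ _ _ WF.
have [l2 i2] := key _ _ _ _ _ _ (rotate WF).
have E r : mode2 m r = r * (mpi V11 V12 V21 V22 m r ^+ 2 + mtau V11 V12 V21 V22 m r ^+ 2 - lam * malpha U1 U2 m r ^+ 2)
  + r * (mpi V12 (fun x => - V11 x) V22 (fun x => - V21 x) m r ^+ 2 +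
     mtau V12 (fun x => - V11 x) V22 (fun x => - V21 x) m r ^+ 2 - lam * malpha U2 (fun x => - U1 x) m r ^+ 2).
  have e1 : mpi V12 (fun x => - V11 x) V22 (fun x => - V21 x) m r = fc m (vrad V11 V21 r) (fun t => - - vrad V12 V22 r t).
    by congr ic; apply/funext => t; rewrite /vrad /arc; ring.
  have e2 : mtau V12 (fun x => - V11 x) V22 (fun x => - V21 x) m r = fc m (vang V12 V22 r) (fun t => - vang V11 V21 r t).
    by congr ic; apply/funext => t; rewrite /vang /arc; ring.
  by rewrite e1 e2 /mode2 /fc2 /mpi /mtau /malpha -mulrDr; congr (_ * _); rewrite /arc; ring.
have -> : mode2 m = (fun r => r * (mpi V11 V12 V21 V22 m r ^+ 2 + mtau V11 V12 V21 V22 m r ^+ 2 - lam * malpha U1 U2 m r ^+ 2)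
  + r * (mpi V12 (fun x => - V11 x) V22 (fun x => - V21 x) m r ^+ 2 +
     mtau V12 (fun x => - V11 x) V22 (fun x => - V21 x) m r ^+ 2 - lam * malpha U2 (fun x => - U1 x) m r ^+ 2)).
  by apply/funext.
split; first exact: LrD.
rewrite (RiD l1 l2); exact: addr_ge0 i1 i2.
Qed.

Let Usum n r := r * \sum_(m <- freqs n) fc2 m (arc U1 r) (arc U2 r).

Let measurable_Usum n : measurable_fun (setT : set RT) (Usum n).
Proof.
apply: measurable_funM => //.
have -> : (fun r => \sum_(m <- freqs n) fc2 m (arc U1 r) (arc U2 r)) =
  (fun r => \sum_(m <- freqs n) (malpha U1 U2 m r ^+ 2 + malpha U2 (fun x => - U1 x) m r ^+ 2)) by [].
apply: measurable_sum => m; apply: measurable_funD; apply: measurable_funX.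
  exact: measurable_malpha WF m.
exact: measurable_malpha (rotate WF) m.
Qed.

Let EU r := r * ic (fun t => arc U1 r t ^+ 2) + r * ic (fun t => arc U2 r t ^+ 2).

Let LEU : L1 leb (rball r0) EU.
Proof. by apply: LrD; apply: L1_sq_rball => //; [exact: wU1 WF|exact: wU2 WF]. Qed.

Let Usum_le n : {ae leb, forall r, rball r0 r -> `|Usum n r| <= 2 * pi * EU r}.
Proof.
apply: ae_imp (weak_good WF) => r H rr; have r0' := rball_gt0 r00 rr; have [[h1 h2 _] _] := H r0'.
rewrite ger0_norm; last first.
  rewrite mulr_ge0 ?(ltW r0')//; apply: sumr_ge0 => m _; rewrite /fc2 addr_ge0 ?sqr_ge0//.
rewrite /EU -mulrDr [leRHS]mulrCA; apply: ler_wpM2l; first exact: ltW.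
rewrite -icD; [|exact: h1.2|exact: h2.2].
exact: bessel (freqs_uniq n) h1 h2.
Qed.

Let L1_Usum n : L1 leb (rball r0) (Usum n).
Proof.
apply: (L1_le_ae mB _ (Usum_le n)); last exact: LrZ.
exact: (measurable_funS measurableT (@subsetT _ _) (measurable_Usum n)).
Qed.

(** Parseval on almost every circle, integrated in r by dominated convergence with the Bessel bound
    as majorant. *)
Let Usum_cvg : \int[leb]_(r in rball r0) Usum n r @[n --> \oo] --> \int[leb]_(r in rball r0) (2 * pi * EU r).
Proof.
have LG := LrZ (2 * pi) LEU.
have H1 n : measurable_fun (rball r0) (EFin \o Usum n).
  by apply/measurable_EFinP; exact: (measurable_funS measurableT (@subsetT _ _) (measurable_Usum n)).
have H2 : measurable_fun (rball r0) (EFin \o (fun r => 2 * pi * EU r)).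
  by apply/measurable_EFinP; exact: L1_meas LG.
have H3 : {ae leb, forall r, rball r0 r -> (EFin \o Usum n) r @[n --> \oo] --> (EFin \o (fun r => 2 * pi * EU r)) r}.
  apply: ae_imp (weak_good WF) => r H rr; have r0' := rball_gt0 r00 rr; have [[h1 h2 _] _] := H r0'.
  apply: cvg_EFin; first exact: nearW.
  have -> : (fun r => 2 * pi * EU r) r = r * (2 * pi * energy (arc U1 r) (arc U2 r)).
    by rewrite /EU -mulrDr mulrCA /energy icD//; [exact: h1.2|exact: h2.2].
  have h : (fun n => \sum_(m <- freqs n) fc2 m (arc U1 r) (arc U2 r)) @ \oo --> 2 * pi * energy (arc U1 r) (arc U2 r).
    exact: parseval_freqs.
  exact: (cvgM (cvg_cst r) h).
have H4 : {ae leb, forall r n, rball r0 r -> (`|(EFin \o Usum n) r| <= (2 * pi * EU r)%R%:E)%E}.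
  have HH := @ae_foralln _ _ R leb _ (fun n => Usum_le n).
  by apply: ae_imp HH => r H n rr; rewrite /= lee_fin; exact: H.
have [_ _ H] := @dominated_convergence _ RT R leb _ mB _ _ _ H1 H2 H3 LG H4.
have e2 : (\int[leb]_(x in rball r0) (2 * pi * EU x)%R%:E)%E = (\int[leb]_(r in rball r0) (2 * pi * EU r))%:E.
  by rewrite EFin_Rint.
rewrite [X in _ --> X]e2 in H.
exact: (fine_cvg H).
Qed.

Let EV r := r * ic (fun t => arc V11 r t ^+ 2) + r * ic (fun t => arc V21 r t ^+ 2)
  + (r * ic (fun t => arc V12 r t ^+ 2) + r * ic (fun t => arc V22 r t ^+ 2)).

Let LEV : L1 leb (rball r0) EV.
Proof.
apply: LrD; apply: LrD; apply: L1_sq_rball => //.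
- exact: wV11 WF.
- exact: wV21 WF.
- exact: wV12 WF.
- exact: wV22 WF.
Qed.

(** Finitely many modes are summed. On the energy side Bessel's inequality is enough; equality, that
    is Parseval, is called for only on the mass side, in the limit. *)
Let Usum_bound n : lam * \int[leb]_(r in rball r0) Usum n r <= \int[leb]_(r in rball r0) (2 * pi * EV r).
Proof.
pose S r := \sum_(m <- freqs n) mode2 m r.
have [LS IS] : L1 leb (rball r0) S /\ 0 <= \int[leb]_(r in rball r0) S r.
  rewrite /S; elim: (freqs n) => [|m s [IL II]].
    have e : (fun r : R => \sum_(m <- [::]) mode2 m r) = (fun=> 0) by apply/funext => r; rewrite big_nil.
    rewrite e; split; first by apply: (@L1_eq _ RT R leb _ mB _ _ _ (LrZ 0 LEV)) => r _; rewrite mul0r.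
    by rewrite /Rintegral integral0.
  have e : (fun r : R => \sum_(m <- m :: s) mode2 m r) = (fun r => mode2 m r + \sum_(m <- s) mode2 m r).
    by apply/funext => r; rewrite big_cons.
  have [l i] := mode2_ge0 m; rewrite e; split; first exact: LrD.
  by rewrite (RiD l IL); exact: addr_ge0 i II.
have L3 := LrB (LrZ (2 * pi) LEV) (LrZ lam (L1_Usum n)).
have L5 := LrZ lam (L1_Usum n); have L6 := LrZ (2 * pi) LEV.
rewrite -subr_ge0 -(RiZ lam (L1_Usum n)) -(RiB L6 L5).
apply: (le_trans IS).
have [m1 m2] := (L1_meas LS, L1_meas L3).
(* The bound on [S] holds almost everywhere, while the monotonicity of the integral is applied to an
   everywhere inequality: [G] dominates [S] everywhere and has the integral of the bound. *)
pose G r := Num.max (S r) (2 * pi * EV r - lam * Usum n r).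
have mG : measurable_fun (rball r0) G by exact: measurable_maxr.
have SG : {ae leb, forall r, rball r0 r -> S r <= 2 * pi * EV r - lam * Usum n r}.
  apply: ae_imp (weak_good WF) => r H rr; have r0' := rball_gt0 r00 rr; have [[u1 u2 h1] [h2 h3 h4]] := H r0'.
  have q1 := L2c_vrad h1 h3; have q2 := L2c_vrad h2 h4.
  have q3 := L2c_vang h1 h3; have q4 := L2c_vang h2 h4.
  have B1 := bessel (freqs_uniq n) (L2cN q2) q1.
  have B2 := bessel (freqs_uniq n) q3 q4.
  have -> : S r = r * (\sum_(m <- freqs n) fc2 m (fun t => - vrad V12 V22 r t) (vrad V11 V21 r)
     + \sum_(m <- freqs n) fc2 m (vang V11 V21 r) (vang V12 V22 r)) - lam * Usum n r.
    rewrite /S /mode2 /Usum -mulr_sumr [lam * _]mulrCA -mulrBr; congr (_ * _).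
    by rewrite big_split/= big_split/= sumrN mulr_sumr.
  rewrite lerD2r; apply: (@le_trans _ _ (r * (2 * pi * ic (fun t => (- vrad V12 V22 r t) ^+ 2 + vrad V11 V21 r t ^+ 2)
      + 2 * pi * ic (fun t => vang V11 V21 r t ^+ 2 + vang V12 V22 r t ^+ 2)))).
    by apply: ler_wpM2l; [exact: ltW|exact: lerD].
  rewrite -mulrDr mulrCA /EV -!mulrDr.
  apply: ler_wpM2l; first by rewrite mulr_ge0// pi_ge0.
  apply: ler_wpM2l; first exact: ltW.
  rewrite -icD; [|by apply: LcD; [exact: (L2cN q2).2|exact: q1.2]|by apply: LcD; [exact: q3.2|exact: q4.2]].
  rewrite -(icD h1.2 h3.2) -(icD h2.2 h4.2) -(icD (LcD h1.2 h3.2) (LcD h2.2 h4.2)).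
  rewrite le_eqVlt; apply/orP; left; apply/eqP; apply: ic_eq => t _.
  by move: (vrad_vang V11 V21 r t) (vrad_vang V12 V22 r t); rewrite sqrrN; lra.
have -> : \int[leb]_(r in rball r0) (2 * pi * EV r - lam * Usum n r) = \int[leb]_(r in rball r0) G r.
  apply: Rint_ae => //; apply: ae_imp SG => r H rr; by rewrite /G (max_idPr (H rr)).
have LG : L1 leb (rball r0) G.
  apply: (L1_ae mB mG _ L3); apply: ae_imp SG => r H rr; by rewrite /G (max_idPr (H rr)).
apply: le_Rintegral => //.
by move=> r _; rewrite /G le_max lexx.
Qed.

Lemma energy_lower : lam * (\int[leb2]_x (U1 x ^+ 2) + \int[leb2]_x (U2 x ^+ 2)) <=
  \int[leb2]_x (V11 x ^+ 2) + \int[leb2]_x (V21 x ^+ 2) + (\int[leb2]_x (V12 x ^+ 2) + \int[leb2]_x (V22 x ^+ 2)).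
Proof.
have W0 := w0 WF.
rewrite (Rint_sq_rball (wU1 WF)); last by move=> x /W0[[]].
rewrite (Rint_sq_rball (wU2 WF)); last by move=> x /W0[[]].
rewrite (Rint_sq_rball (wV11 WF)); last by move=> x /W0[[]].
rewrite (Rint_sq_rball (wV12 WF)); last by move=> x /W0[[]].
rewrite (Rint_sq_rball (wV21 WF)); last by move=> x /W0[_ []].
rewrite (Rint_sq_rball (wV22 WF)); last by move=> x /W0[_ []].
have lU1 := L1_sq_rball r00 (wU1 WF); have lU2 := L1_sq_rball r00 (wU2 WF).
have l11 := L1_sq_rball r00 (wV11 WF); have l12 := L1_sq_rball r00 (wV12 WF).
have l21 := L1_sq_rball r00 (wV21 WF); have l22 := L1_sq_rball r00 (wV22 WF).
have eU : \int[leb]_(r in rball r0) (2 * pi * EU r) = 2 * pi *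
  (\int[leb]_(r in rball r0) (r * ic (fun t => arc U1 r t ^+ 2)) + \int[leb]_(r in rball r0) (r * ic (fun t => arc U2 r t ^+ 2))).
  by rewrite (RiZ _ LEU) (RiD lU1 lU2).
have eV : \int[leb]_(r in rball r0) (2 * pi * EV r) = 2 * pi *
  (\int[leb]_(r in rball r0) (r * ic (fun t => arc V11 r t ^+ 2)) + \int[leb]_(r in rball r0) (r * ic (fun t => arc V21 r t ^+ 2))
  + (\int[leb]_(r in rball r0) (r * ic (fun t => arc V12 r t ^+ 2)) + \int[leb]_(r in rball r0) (r * ic (fun t => arc V22 r t ^+ 2)))).
  by rewrite (RiZ _ LEV) (RiD (LrD l11 l21) (LrD l12 l22)) (RiD l11 l21) (RiD l12 l22).
have p2 : 0 < 2 * pi :> R by rewrite mulr_gt0// pi_gt0.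
rewrite -(ler_pM2l p2) [leLHS]mulrCA -eU -eV.
have H : (fun n => lam * \int[leb]_(r in rball r0) Usum n r) @ \oo --> lam * \int[leb]_(r in rball r0) (2 * pi * EU r).
  exact: (cvgM (cvg_cst lam) Usum_cvg).
have <- := cvg_lim (@Rhausdorff R) H.
apply: limr_le; first by apply/cvg_ex; exists (lam * \int[leb]_(r in rball r0) (2 * pi * EU r)).
by apply: nearW => n; exact: Usum_bound.
Qed.
End field.
End lower.

(** * The lower bound on the exterior of a disk *)

Section link.
Context {R : realType}.
Local Open Scope complex_scope.
Local Notation leb := (@lebesgue_measure R).
Local Notation RT := (measurableTypeR R).
Local Notation leb2 := (@lebesgue_measure R \x @lebesgue_measure R)%E.
Local Notation RT2 := (RT * RT)%type.
Implicit Types (u v : R * R -> R[i]).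

Lemma Re_test (z : R[i]) (p q : R) : complex.Re (z * ('i%C * p%:C - q%:C)) = - (complex.Im z * p) - complex.Re z * q.
Proof. by case: z => a c /=; ring. Qed.

Lemma Im_test (z : R[i]) (p q : R) : complex.Im (z * ('i%C * p%:C - q%:C)) = complex.Re z * p - complex.Im z * q.
Proof. by case: z => a c /=; ring. Qed.

Lemma Re_mulC (z : R[i]) (p : R) : complex.Re (z * p%:C) = complex.Re z * p.
Proof. by case: z => a c /=; ring. Qed.

Lemma Im_mulC (z : R[i]) (p : R) : complex.Im (z * p%:C) = complex.Im z * p.
Proof. by case: z => a c /=; ring. Qed.

Lemma closure_min (T : topologicalType) (A C : set T) : closed C -> A `<=` C -> closure A `<=` C.
Proof. by move=> cC AC x; rewrite closureEbigcap => H; apply: H. Qed.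

Lemma open_exterior (Om : set (R * R)) : open (exterior Om).
Proof. by rewrite /exterior openC; exact: closed_closure. Qed.

Lemma nsq_ge0 (x : R * R) : 0 <= nsq x. Proof. by rewrite addr_ge0// sqr_ge0. Qed.

Lemma enormE (x : R * R) : enorm x ^+ 2 = nsq x.
Proof. by rewrite /enorm sqr_sqrtr// nsq_ge0. Qed.

Lemma enorm_ge0 (x : R * R) : 0 <= enorm x. Proof. exact: sqrtr_ge0. Qed.

Lemma enorm_lt (x : R * R) r : 0 < r -> (enorm x < r) = (nsq x < r ^+ 2).
Proof. by move=> r0; rewrite -enormE ltr_pXn2r// nnegrE ?enorm_ge0// ltW. Qed.

Lemma closed_nsq_le c : closed [set x : R * R | nsq x <= c].
Proof.
have -> : [set x : R * R | nsq x <= c] = nsq @^-1` [set y | y <= c] by [].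
by apply: preimage_closed; [move=> x _; exact: continuous_nsq|exact: closed_le].
Qed.

Lemma closed_nsq_ge c : closed [set x : R * R | c <= nsq x].
Proof.
have -> : [set x : R * R | c <= nsq x] = nsq @^-1` [set y | c <= y] by [].
by apply: preimage_closed; [move=> x _; exact: continuous_nsq|exact: closed_ge].
Qed.

Lemma closure_scale (A : set (R * R)) (x : R * R) :
  (forall t, 0 < t -> t < 1 -> A (t * x.1, t * x.2)) -> closure A x.
Proof.
move=> H B nB.
have c : (fun t : R => (t * x.1, t * x.2)) t @[t --> (1 : R)] --> x.
  rewrite [X in _ --> X](_ : x = (1 * x.1, 1 * x.2)); last by rewrite !mul1r -surjective_pairing.
  have cs (z : R) : t * z @[t --> (1 : R)] --> 1 * z by apply: cvgM; [exact: cvg_id|exact: cvg_cst].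
  exact: (cvg_pair (cs x.1) (cs x.2)).
have n1 : \forall t \near (1 : R)^'-, B (t * x.1, t * x.2) by exact: (cvg_at_left_filter c nB).
have n2 := nbhs_left_lt (1 : R); have n3 := nbhs_left_gt (@ltr01 R).
have [t [[h1 h2] h3]] := filter_ex (filterI (filterI n1 n2) n3).
by exists (t * x.1, t * x.2); split => //; exact: H.
Qed.

Lemma exterior_disk r : 0 < r -> exterior (disk r) = [set x : R * R | r ^+ 2 < nsq x].
Proof.
move=> r0; apply/seteqP; split => x; rewrite /exterior /=.
  move=> nc; rewrite ltNge; apply/negP => h; apply: nc; apply: closure_scale => t t0 t1.
  rewrite /disk /= enorm_lt// /nsq /= !exprMn -mulrDr.
  have r2 : 0 < r ^+ 2 by exact: exprn_gt0.
  have t2 : t ^+ 2 < 1 by rewrite expr_lt1// ltW.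
  have := nsq_ge0 x; rewrite -/(nsq x); move: h; set y := nsq x; set s := t ^+ 2 in t2 *; set q := r ^+ 2 in r2 *.
  move=> h y0; apply: (@le_lt_trans _ _ (s * q)); last by rewrite gtr_pMl.
  by apply: ler_wpM2l => //; rewrite /s sqr_ge0.
move=> h c.
have sub : closure (disk r) `<=` [set y : R * R | nsq y <= r ^+ 2].
  by apply: closure_min; [exact: closed_nsq_le|move=> y; rewrite /disk /= enorm_lt// => /ltW].
by have := sub _ c; rewrite /= leNgt h.
Qed.

Lemma admissible_test r0 phi (U : set (R * R)) : 0 < r0 -> [set x : R * R | r0 ^+ 2 < nsq x] `<=` U ->
  admissible r0 phi -> test_function U phi.
Proof.
move=> r00 sU [S [c [d [rc H]]]].
have cl : closed ([set x : R * R | c <= nsq x] `&` [set x | nsq x <= d]).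
  by apply: closedI; [exact: closed_nsq_ge|exact: closed_nsq_le].
have sub : closure [set x | phi x != 0] `<=` [set x : R * R | c <= nsq x] `&` [set x | nsq x <= d].
  apply: closure_min => // x; rewrite /= => px.
  have : c < nsq x < d by apply/negPn/negP => h; move: px; rewrite H// eqxx.
  by move=> /andP[/ltW h1 /ltW h2].
split; first exact: C2_smooth2.
  apply: (@subclosed_compact _ _ (box (`|d| + 1))); [exact: closed_closure|exact: compact_box|].
  move=> x /sub[_ /= xd]; apply: box_nsq; first by rewrite addr_ge0.
  apply: (le_trans xd); have := ler_norm d; have := normr_ge0 d; set y := `|d|; nra.
by move=> x /sub[/= cx _]; apply: sU; exact: lt_le_trans cx.
Qed.

Definition zext (D : set (R * R)) (X : R * R -> R) : R * R -> R := X \_ D.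

Lemma zext_in D X x : D x -> zext D X x = X x.
Proof. by move=> Dx; rewrite /zext patchE mem_set. Qed.

Lemma zext_out D X x : ~ D x -> zext D X x = 0.
Proof. by move=> Dx; rewrite /zext patchE; case: ifPn => // /set_mem. Qed.

Lemma normsq_ge0 (z : R[i]) : 0 <= normsq z. Proof. by rewrite addr_ge0// sqr_ge0. Qed.

Lemma L2_L1 (D : set (R * R)) u : L2 D u -> L1 leb2 D (fun x => normsq (u x)).
Proof.
move=> [mr mi H]; apply/L1_ge0P => //; last by move=> x _; exact: normsq_ge0.
by apply: measurable_funD; exact: measurable_funX.
Qed.

Lemma L2_zext (D : set (R * R)) u : measurable (D : set RT2) -> L2 D u ->
  [/\ L2p (zext D (fun x => complex.Re (u x))), L2p (zext D (fun x => complex.Im (u x))) &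
    \int[leb2]_(x in D) normsq (u x) =
    \int[leb2]_x (zext D (fun x => complex.Re (u x)) x ^+ 2) + \int[leb2]_x (zext D (fun x => complex.Im (u x)) x ^+ 2)].
Proof.
move=> mD L; have LN := L2_L1 L; case: L => mr mi _.
have part (X : R * R -> R) : measurable_fun (D : set RT2) X -> (forall x, X x ^+ 2 <= normsq (u x)) ->
    L2p (zext D X) /\ \int[leb2]_x (zext D X x ^+ 2) = \int[leb2]_(x in D) (X x ^+ 2) /\ L1 leb2 D (fun x => X x ^+ 2).
  move=> mX XN.
  have e : (fun x => zext D X x ^+ 2) = (fun x => X x ^+ 2) \_ D.
    by apply/funext => x; rewrite /zext !patchE; case: ifP => // _; rewrite expr0n.
  have LD : L1 leb2 D (fun x => X x ^+ 2).
    apply: (@L1_le _ RT2 R leb2 D mD _ _ (measurable_funX _ mX) _ LN).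
    by move=> x _; rewrite ger0_norm// sqr_ge0.
  have mz : measurable_fun (setT : set RT2) (zext D X) by exact/(measurable_restrictT X mD).
  split; [split=> //|split=> //].
    apply/L1_ge0P => //; [exact: measurable_funX|by move=> x _; exact: sqr_ge0|].
    have /L1_ge0P := LD; move=> /(_ (measurable_funX _ mX)) HH.
    have /HH h : forall x, D x -> 0 <= X x ^+ 2 by move=> x _; exact: sqr_ge0.
    rewrite integral_mkcond in h; move: h; congr (_ < _)%E; apply: eq_integral => x _.
    by rewrite /zext !patchE; case: ifP => // _; rewrite expr0n.
  by rewrite [RHS]Rintegral_mkcond -e.
have nr x : complex.Re (u x) ^+ 2 <= normsq (u x) by rewrite lerDl sqr_ge0.
have ni x : complex.Im (u x) ^+ 2 <= normsq (u x) by rewrite lerDr sqr_ge0.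
have [P1 [E1 L1r]] := part _ mr nr.
have [P2 [E2 L1i]] := part _ mi ni.
split=> //; rewrite E1 E2; apply: RintegralD => //.
Qed.

(** Each of the two complex identities splits into two real ones, and test functions supported
    outside the disk allow the integrals to be taken over the plane after extension by zero. *)
Lemma disk_weakfield r0 b (u v1 v2 : R * R -> R[i]) : 0 < r0 ->
  let D := exterior (disk r0) in
  H1A b D u v1 v2 -> weakfield r0 b (zext D (fun x => complex.Re (u x))) (zext D (fun x => complex.Im (u x)))
    (zext D (fun x => complex.Re (v1 x))) (zext D (fun x => complex.Im (v1 x)))
    (zext D (fun x => complex.Re (v2 x))) (zext D (fun x => complex.Im (v2 x))).
Proof.
move=> r00 D [Lu Lv1 Lv2 MG].
have mD : measurable (D : set RT2) by apply: open_measurable2; exact: open_exterior.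
have [u1 u2 _] := L2_zext mD Lu; have [v11 v12 _] := L2_zext mD Lv1; have [v21 v22 _] := L2_zext mD Lv2.
have DE := exterior_disk r00.
split=> //.
  move=> x xr; have nD : ~ D x by rewrite /D DE /= ltNge xr.
  by split; [split|split]; exact: zext_out.
move=> phi ap.
have sD : [set x : R * R | r0 ^+ 2 < nsq x] `<=` D by rewrite /D DE.
have [m1 m2] := MG phi (admissible_test r00 sD ap).
have ZI (F G : R * R -> R) : (forall x, D x -> F x = G x) -> (forall x, ~ D x -> G x = 0) ->
    \int[leb2]_(x in D) F x = \int[leb2]_x G x.
  move=> h1 h2; transitivity (\int[leb2]_(x in D) G x); first exact: Rint_eq.
  apply: Rint_supp => [x _ //|x _]; exact: h2.
have [a1 a2 a3 a4 a5] := L1_adm1 u1 ap; have [b1 b2 b3 b4 b5] := L1_adm1 u2 ap.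
have [c11 _ _ _ _] := L1_adm1 v11 ap; have [c12 _ _ _ _] := L1_adm1 v12 ap.
have [c21 _ _ _ _] := L1_adm1 v21 ap; have [c22 _ _ _ _] := L1_adm1 v22 ap.
have L2Z c f := @L1Z _ RT2 R leb2 setT measurableT c f.
have iD (f g : R * R -> R) : L1 leb2 setT f -> L1 leb2 setT g ->
  \int[leb2]_x (f x + g x) = \int[leb2]_x f x + \int[leb2]_x g x.
  by move=> h1 h2; exact: (@RintegralD _ RT2 R leb2 setT f g measurableT h1 h2).
have gen (A dphi : R * R -> R) (v : R * R -> R[i]) :
  let U1 := zext D (fun x => complex.Re (u x)) in let U2 := zext D (fun x => complex.Im (u x)) in
  let V1 := zext D (fun x => complex.Re (v x)) in let V2 := zext D (fun x => complex.Im (v x)) in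
  L1 leb2 setT (fun x => U1 x * dphi x) -> L1 leb2 setT (fun x => U2 x * dphi x) ->
  L1 leb2 setT (fun x => U1 x * (A x * phi x)) -> L1 leb2 setT (fun x => U2 x * (A x * phi x)) ->
  L1 leb2 setT (fun x => V1 x * phi x) -> L1 leb2 setT (fun x => V2 x * phi x) ->
  cintegral D (fun x => u x * ('i%C * (dphi x)%:C - (b * A x * phi x)%:C)) = cintegral D (fun x => v x * (phi x)%:C) ->
  \int[leb2]_x (U1 x * dphi x) = \int[leb2]_x ((V2 x + b * A x * U2 x) * phi x) /\
  \int[leb2]_x (U2 x * dphi x) = - \int[leb2]_x ((V1 x + b * A x * U1 x) * phi x).
  move=> U1 U2 V1 V2 l1 l2 l3 l4 l5 l6 [].
  rewrite (ZI _ (fun x => (- 1) * (U2 x * dphi x) + (- b) * (U1 x * (A x * phi x)))); last 2 first.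
  - by move=> x Dx; rewrite Re_test /U1 /U2 !zext_in//; ring.
  - by move=> x Dx; rewrite /U1 /U2 !zext_out//; ring.
  rewrite (ZI _ (fun x => V1 x * phi x)); last 2 first.
  - by move=> x Dx; rewrite Re_mulC /V1 !zext_in//.
  - by move=> x Dx; rewrite /V1 !zext_out//; ring.
  rewrite (ZI (fun x => complex.Im (u x * _)) (fun x => U1 x * dphi x + (- b) * (U2 x * (A x * phi x)))); last 2 first.
  - by move=> x Dx; rewrite Im_test /U1 /U2 !zext_in//; ring.
  - by move=> x Dx; rewrite /U1 /U2 !zext_out//; ring.
  rewrite (ZI _ (fun x => V2 x * phi x)); last 2 first.
  - by move=> x Dx; rewrite Im_mulC /V2 !zext_in//.
  - by move=> x Dx; rewrite /V2 !zext_out//; ring.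
  have iZ c (f : R * R -> R) : L1 leb2 setT f -> \int[leb2]_x (c * f x) = c * \int[leb2]_x f x.
    by move=> h; apply: RintegralZl; [exact: measurableT|exact: h].
  have e1 : \int[leb2]_x ((V2 x + b * A x * U2 x) * phi x) = \int[leb2]_x (V2 x * phi x) + b * \int[leb2]_x (U2 x * (A x * phi x)).
    by rewrite -(iZ _ _ l4) -(iD _ _ l6 (L2Z _ _ l4)); congr (Rintegral _ _ _); apply/funext => x; ring.
  have e2 : \int[leb2]_x ((V1 x + b * A x * U1 x) * phi x) = \int[leb2]_x (V1 x * phi x) + b * \int[leb2]_x (U1 x * (A x * phi x)).
    by rewrite -(iZ _ _ l3) -(iD _ _ l5 (L2Z _ _ l3)); congr (Rintegral _ _ _); apply/funext => x; ring.
  rewrite (iD _ _ (L2Z _ _ l2) (L2Z _ _ l3)) (iD _ _ l1 (L2Z _ _ l4)) (iZ _ _ l2) (iZ _ _ l3) (iZ _ _ l4) e1 e2.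
  by move=> <- <-; split; ring.
have [g1 g3] := gen _ _ _ a2 b2 a4 b4 c11 c12 m1.
have [g2 g4] := gen _ _ _ a3 b3 a5 b5 c21 c22 m2.
by split.
Qed.

Lemma integral_normsq_gt0 (D : set (R * R)) u : measurable (D : set RT2) -> L2 D u -> nonzero_on D u ->
  0 < \int[leb2]_(x in D) normsq (u x).
Proof.
move=> mD Lu nz; have LN := L2_L1 Lu.
rewrite lt_neqAle; apply/andP; split; last by apply: Rintegral_ge0 => x _; exact: normsq_ge0.
rewrite eq_sym; apply/eqP => i0; apply: nz.
have : (\int[leb2]_(x in D) `|(normsq (u x))%:E|)%E = 0.
  rewrite (@eq_integral _ RT2 R leb2 D (fun x => (normsq (u x))%:E)).
    by rewrite -EFin_Rint// i0.
  by move=> x _; rewrite /= ger0_norm// normsq_ge0.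
move/(ae_eq_integral_abs leb2 mD (measurable_int _ LN)).
move=> [N [mN N0 NS]]; exists N; split=> //; move=> x /= h; apply: NS => /= h'; apply: h => Dx.
have := h' Dx => -[]/eqP; rewrite /normsq paddr_eq0 ?sqr_ge0// !sqrf_eq0 => /andP[/eqP h1 /eqP h2].
by apply/eqP; rewrite eq_complex h1 h2 !eqxx.
Qed.

Lemma lambda1_lower r0 b lam : 0 < r0 -> 0 < b -> (forall n : int, exists h h' : R -> R, supersolution n b lam r0 h h') ->
  (lam%:E <= lambda1 b (exterior (disk r0)))%E.
Proof.
move=> r00 b0 S; apply: le_ereal_inf_tmp => _ [u [v1 [v2 [H nz ->]]]].
have mD : measurable (exterior (disk r0) : set RT2) by apply: open_measurable2; exact: open_exterior.
have WF := disk_weakfield r00 H.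
case: H => Lu Lv1 Lv2 _.
have [_ _ eu] := L2_zext mD Lu; have [_ _ e1] := L2_zext mD Lv1; have [_ _ e2] := L2_zext mD Lv2.
have E := energy_lower r00 b0 S WF.
rewrite lee_fin.
have iN := integral_normsq_gt0 mD Lu nz.
rewrite ler_pdivlMr// eu (@RintegralD _ RT2 R leb2 _ _ _ mD (L2_L1 Lv1) (L2_L1 Lv2)) e1 e2.
by move: E; lra.
Qed.
End link.

(** * The trial function *)

Section plane_calculus.
Context {R : realType}.
Local Notation leb := (@lebesgue_measure R).
Local Notation RT := (measurableTypeR R).
Local Notation leb2 := (@lebesgue_measure R \x @lebesgue_measure R)%E.
Local Notation RT2 := (RT * RT)%type.

Lemma continuous_pairl (y : R) : continuous (fun t : R => (t, y)).
Proof. by move=> t; exact: (cvg_pair (@cvg_id _ _) (cvg_cst y)). Qed.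

Lemma continuous_pairr (y : R) : continuous (fun t : R => (y, t)).
Proof. by move=> t; exact: (cvg_pair (cvg_cst y) (@cvg_id _ _)). Qed.

(** The function is continued to the left of [s0] along its tangent, which keeps the derivative
    continuous. *)
Lemma C1_extend (F G : R -> R) (s0 : R) : (forall s : R, s0 <= s -> is_derive s 1 F (G s)) ->
  (forall s, s0 <= s -> {for s, continuous G}) ->
  exists F1 G1 : R -> R, [/\ forall s : R, is_derive s 1 F1 (G1 s), continuous G1,
    forall s, s0 <= s -> F1 s = F s & forall s, s0 <= s -> G1 s = G s].
Proof.
move=> dF cG.
pose F1 s := if s0 <= s then F s else F s0 + G s0 * (s - s0).
pose G1 s := G (Num.max s0 s).
have dL (s : R) : is_derive s 1 (fun s => F s0 + G s0 * (s - s0)) (G s0).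
  have h := is_deriveD1 (is_derive_cst (F s0 : R) s 1) (is_deriveM1 (is_derive_cst (G s0 : R) s 1) (is_deriveB1 (is_derive_id s (1 : R)) (is_derive_cst (s0 : R) s 1))).
  by apply: (is_derive_eq h); rewrite /= /cst; ring.
exists F1, G1; split.
- move=> s; rewrite /G1; have [ss|ss|<-] := ltrgtP s0 s.
  + have e : {near s, F =1 F1}.
      have : \forall t \near s, s0 < t by exact: (open_nbhs_nbhs (conj (@open_gt _ s0) ss)).
      by apply: filterS => t /ltW h; rewrite /F1 h.
    exact: (near_eq_is_derive e (dF s (ltW ss))).
  + have e : {near s, (fun s => F s0 + G s0 * (s - s0)) =1 F1}.
      have : \forall t \near s, t < s0 by exact: (open_nbhs_nbhs (conj (@open_lt _ s0) ss)).
      by apply: filterS => t h; rewrite /F1 leNgt h.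
    exact: (near_eq_is_derive e (dL s)).
  have [d1 e1] := dF s0 (lexx _).
  have c1 : h^-1 *: (F (h *: (1 : R) + s0) - F s0) @[h --> (0 : R)^'] --> G s0.
    by rewrite -e1; exact: d1.
  have c2 : h^-1 *: (F1 (h *: (1 : R) + s0) - F1 s0) @[h --> (0 : R)^'] --> G s0.
    apply/cvgrPdist_le => e e0; have /cvgrPdist_le/(_ e e0) := c1.
    have n0 : \forall h \near (0 : R)^', h != 0 by exact: nbhs_dnbhs_neq.
    apply: filterS2 n0 => h h0; rewrite /F1 lexx.
    case: ifPn => //; rewrite -ltNge => hlt _.
    have -> : h^-1 *: (F s0 + G s0 * (h *: (1 : R) + s0 - s0) - F s0) = G s0.
      by rewrite addrK addrAC subrr add0r /GRing.scale /= mulr1; field.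
    by rewrite subrr normr0 ltW.
  apply: DeriveDef; first by apply/cvg_ex; exists (G s0).
  exact: (cvg_lim (@Rhausdorff R) c2).
- move=> s; apply: (@continuous_comp _ _ _ (fun s => Num.max s0 s) G); last by apply: cG; rewrite le_max lexx.
  by apply: continuous_max => //; first [exact: cvg_id|exact: cvg_cst].
- by move=> s h; rewrite /F1 h.
- by move=> s h; rewrite /G1 (max_idPr h).
Qed.

Lemma L1_cbox (g : R * R -> R) N : continuous g -> 0 <= N -> (forall x, ~ box N x -> g x = 0) ->
  L1 leb2 setT g.
Proof.
move=> cg N0 g0.
have cn : {within (box N), continuous (fun x => `|g x|)}.
  apply: continuous_subspaceT => x.
  exact: (continuous_comp (cg x) (@norm_continuous _ _ _)).
have b0 : box N !=set0 by exists (0, 0); split; rewrite /= in_itv/= oppr_le0 N0.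
have [m _ mM] := compact_EVT_max b0 (@compact_box R N) cn.
have mg : measurable_fun (setT : set RT2) g by exact: continuous_measurable_fun2.
apply: (@L1_le _ RT2 R leb2 setT measurableT _ _ mg _ (@L1Z _ RT2 R leb2 setT measurableT `|g m| _ (L1_box N))).
move=> x _; rewrite /= indicE; have [bx|bx] := boolP (x \in box N).
  by rewrite mulr1; apply: mM.
by rewrite mulr0 g0 ?normr0// => /mem_set h; rewrite h in bx.
Qed.

(** Fubini in the appropriate order, and the fundamental theorem on each line, where the compact
    support removes the boundary values. *)
Lemma int_partial (w d1 d2 : R * R -> R) N : D12 w d1 d2 -> continuous d1 -> continuous d2 -> 0 <= N ->
  (forall x, ~ box N x -> [/\ w x = 0, d1 x = 0 & d2 x = 0]) ->
  \int[leb2]_x d1 x = 0 /\ \int[leb2]_x d2 x = 0.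
Proof.
move=> D c1 c2 N0 H.
have L1d : L1 leb2 setT d1 by apply: (L1_cbox c1 N0) => x /H[].
have L2d : L1 leb2 setT d2 by apply: (L1_cbox c2 N0) => x /H[].
have out (t : R) : N < `|t| -> ~ (`[- N, N]%classic : set R) t.
  by move=> tN; rewrite /= in_itv/= -ler_norml leNgt tN.
have line (F f : R -> R) : (forall x : R, is_derive x 1 F (f x)) -> continuous f ->
    (forall t, N < `|t| -> F t = 0 /\ f t = 0) -> \int[leb]_t f t = 0.
  move=> dF cf F0; apply: (FTC2_real dF cf).
  - have Li : L1 leb `[- N, N] f by apply: L1_continuous; exact: continuous_subspaceT.
    have mI : measurable (`[- N, N]%classic : set RT) by exact: measurable_itv.
    have [h _] := @L1_restrict R (`[- N, N]) f mI; have := h Li.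
    congr (is_true (L1 _ _ _)); apply/funext => t; rewrite patchE; case: ifPn => // tn.
    apply/esym; apply: (F0 t _).2; rewrite ltNge; apply/negP => h'.
    by move/negP: tn; apply; apply/mem_set; rewrite /= in_itv/= -ler_norml.
  - apply: cvg_near_cst; near=> n; apply: (F0 _ _).1; rewrite ger0_norm//.
    by near: n; exact: nbhs_infty_gtr.
  - apply: cvg_near_cst; near=> n; apply: (F0 _ _).1; rewrite normrN ger0_norm//.
    by near: n; exact: nbhs_infty_gtr.
split.
  have [-> _] := Rfubini_sym L1d.
  rewrite (@Rint_eq _ RT R leb _ _ (fun=> 0)); first by rewrite /Rintegral integral0.
  move=> y _; apply: (line (fun t => w (t, y))).
  - by move=> t; have [] := D (t, y).
  - by move=> t; apply: (@continuous_comp _ _ _ (fun t => (t, y)) d1); [exact: continuous_pairl|exact: c1].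
  - by move=> t /out tn; have [] := H (t, y) (fun bx => tn bx.1).
have [-> _] := Rfubini L2d.
rewrite (@Rint_eq _ RT R leb _ _ (fun=> 0)); first by rewrite /Rintegral integral0.
move=> y _; apply: (line (fun t => w (y, t))).
- by move=> t; have [] := D (y, t).
- by move=> t; apply: (@continuous_comp _ _ _ (fun t => (y, t)) d2); [exact: continuous_pairr|exact: c2].
- by move=> t /out tn; have [] := H (y, t) (fun bx => tn bx.2).
Unshelve. all: end_near. Qed.

Lemma test_D12 (U : set (R * R)) (phi : R * R -> R) : test_function U phi ->
  [/\ D12 phi (pd1 phi) (pd2 phi), continuous phi, continuous (pd1 phi) & continuous (pd2 phi)] /\
  (forall x, ~ U x -> [/\ phi x = 0, pd1 phi x = 0 & pd2 phi x = 0]) /\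
  exists2 N, 0 <= N & forall x, ~ box N x -> [/\ phi x = 0, pd1 phi x = 0 & pd2 phi x = 0].
Proof.
move=> [S cK sU]; have D : D12 phi (pd1 phi) (pd2 phi).
  by apply: pd_D12 => x; case: (S [::] x) => _ h1 h2; [exact: h1|exact: h2].
have c0 : continuous phi by move=> x; case: (S [::] x) => h _ _; exact: h.
have c1 : continuous (pd1 phi) by move=> x; case: (S [:: false] x) => h _ _; exact: h.
have c2 : continuous (pd2 phi) by move=> x; case: (S [:: true] x) => h _ _; exact: h.
have Z x : ~ closure [set x | phi x != 0] x -> [/\ phi x = 0, pd1 phi x = 0 & pd2 phi x = 0].
  move=> nc; have oc : open (~` closure [set x | phi x != 0]) by rewrite openC; exact: closed_closure.
  have nx : \forall y \near x, phi y = 0.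
    have := open_nbhs_nbhs (conj oc nc : open_nbhs _ _); apply: filterS => y ny.
    by apply/eqP/negPn/negP => py; apply: ny; exact: subset_closure.
  split; first exact: nbhs_singleton nx.
    have e : {near x.1, cst 0 =1 (fun t => phi (t, x.2))}.
      have ct : (fun t : R => (t, x.2)) t @[t --> x.1] --> x.
        by rewrite [X in _ --> X]surjective_pairing; exact: continuous_pairl.
      have h : \forall t \near x.1, phi (t, x.2) = 0 by exact: ct _ nx.
      by apply: filterS h => t ->.
    have [_ d0] := near_eq_is_derive e (is_derive_cst (0 : R) x.1 (1 : R)).
    by have [[_ d1] _] := D x; rewrite -d1.
  have e : {near x.2, cst 0 =1 (fun t => phi (x.1, t))}.
    have ct : (fun t : R => (x.1, t)) t @[t --> x.2] --> x.
      by rewrite [X in _ --> X]surjective_pairing; exact: continuous_pairr.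
    have h : \forall t \near x.2, phi (x.1, t) = 0 by exact: ct _ nx.
    by apply: filterS h => t ->.
  have [_ d0] := near_eq_is_derive e (is_derive_cst (0 : R) x.2 (1 : R)).
  by have [_ [_ d2]] := D x; rewrite -d2.
split; first by [].
split; first by move=> x nU; apply: Z => h; apply: nU; exact: sU.
have [M [Mr HM]] := compact_bounded cK.
pose N := `|M| + 1.
have N0 : 0 <= N by rewrite addr_ge0.
exists N => // x nb; apply: Z => cx; apply: nb.
have MN : M < N by rewrite (le_lt_trans (ler_norm _))// ltrDl.
have h : Num.max `|x.1| `|x.2| <= N by exact: (HM N MN x cx).
by split; rewrite /= in_itv/= -ler_norml; apply: le_trans h; rewrite le_max lexx ?orbT.
Qed.

Lemma cont_enorm : continuous (@enorm R).
Proof.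
move=> x; apply: (@continuous_comp _ _ _ nsq Num.sqrt); first exact: continuous_nsq.
exact: sqrt_continuous.
Qed.

Lemma enorm_polar (r t : R) : 0 <= r -> enorm (polar (r, t)) = r.
Proof. by move=> r0; rewrite /enorm -/(nsq _) nsq_polar sqrtr_sqr ger0_norm. Qed.

Definition radx (S : set R) (q : R -> R) (x : R * R) : R := (q \_ S) (enorm x).

Lemma radx_in S q x : S (enorm x) -> radx S q x = q (enorm x).
Proof. by move=> h; rewrite /radx patchE mem_set. Qed.

Lemma radx_out S q x : ~ S (enorm x) -> radx S q x = 0.
Proof. by move=> h; rewrite /radx patchE; case: ifPn => // /set_mem. Qed.

Lemma radx_int (S : set R) (q : R -> R) : measurable (S : set RT) -> S `<=` `]0, +oo[%classic ->
  measurable_fun (S : set RT) q -> L1 leb S (fun r => r * q r) ->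
  L1 leb2 setT (radx S q) /\ \int[leb2]_x radx S q x = 2 * pi * \int[leb]_(r in S) (r * q r).
Proof.
move=> mS S0 mq Lq.
have mqS : measurable_fun (setT : set RT) (q \_ S) by exact/(measurable_restrictT q mS).
have me : measurable_fun (setT : set RT2) (@enorm R) by exact: continuous_measurable_fun2 cont_enorm.
have mr : measurable_fun (setT : set RT2) (radx S q) by exact: (measurableT_comp mqS me).
have p2 : 0 <= 2 * pi :> R by rewrite mulr_ge0// pi_ge0.
have mI : measurable (`]0, +oo[%classic : set RT) by exact: measurable_itv.
have LT : L1 leb2 setT (radx S q).
  apply/integrableP; split; first exact/measurable_EFinP.
  have ma : measurable_fun (setT : set RT2) (fun x => `|radx S q x|%:E).
    by apply/measurable_EFinP; exact: measurableT_comp.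
  rewrite (@eq_integral _ RT2 R leb2 setT (fun x => `|radx S q x|%:E))//.
  rewrite (ge0_integral_polar ma); last by move=> x; rewrite lee_fin.
  pose w r := (2 * pi) * (r * (q \_ S) r).
  have Lw : L1 leb `]0, +oo[ w.
    apply: (@L1Z _ RT R leb _ mI).
    have [h _] := @L1_restrict R S (fun r => r * q r) mS.
    have := L1T_restrict mI (h Lq).
    have [_ h2] := @L1_restrict R (`]0, +oo[) (fun r => r * (q \_ S) r) mI.
    move=> h3; apply: h2; move: h3; congr (is_true (L1 _ _ _)).
    apply/funext => r; rewrite !patchE; case: ifP => // _; case: ifP => // _; by rewrite mulr0.
  have /integrableP[_] := Lw; apply: le_lt_trans.
  rewrite le_eqVlt; apply/orP; left; apply/eqP; apply: eq_integral => r; rewrite inE/= in_itv/= andbT => r0.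
  rewrite (@eq_integral _ RT R leb circle (fun=> `|(q \_ S) r|%:E)); last first.
    by move=> t _; rewrite /radx enorm_polar// ltW.
  have -> : (\int[leb]_(x in circle) `|(q \_ S) r|%:E)%E = (2 * pi * `|(q \_ S) r|)%:E.
    rewrite -(ic1 `|(q \_ S) r|) /ic EFin_Rint//; first exact: measurable_circle.
    by apply: Lc_cont => t; exact: cvg_cst.
  by rewrite -EFinM /w [`|_ * (r * _)|]normrM [`|r * _|]normrM (ger0_norm p2) (ger0_norm (ltW r0)) mulrCA.
split=> //; rewrite (Rpolar LT).
transitivity (\int[leb]_(r in `]0, +oo[) (2 * pi * (r * (q \_ S) r))).
  apply: Rint_eq => r; rewrite /= in_itv/= andbT => r0.
  rewrite mulrCA; congr (_ * _); rewrite -ic1; apply: ic_eq => t _.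
  by rewrite /arc /radx enorm_polar// ltW.
rewrite -(@Rint_supp _ _ RT leb _ _ _ S0); last first.
  by move=> r _ nS; rewrite patchE memNset// !mulr0.
rewrite -RintegralZl//; apply: Rint_eq => r Sr; by rewrite patchE mem_set.
Qed.

(** With q = 2 - p < 0 the integrand is r^(q-1), so p > 2 is what makes planar moments finite away
    from the origin. *)
Lemma L1_powR p r1 : 2 < p -> 0 < r1 -> L1 leb `[r1, +oo[ (fun r => r * r `^ (- p)).
Proof.
move=> p2 r10.
have rp r : r1 <= r -> 0 < r by exact: lt_le_trans.
have dp (e x : R) : 0 < x -> is_derive x 1 (fun r : R => r `^ e) (e * x `^ (e - 1)) by exact: is_derive1_powR.
pose q := 2 - p; have q0 : q < 0 by rewrite subr_lt0.
have qE x : 0 < x -> x * x `^ (- p) = x `^ (q - 1).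
  move=> x0; rewrite -[X in X * _](powRr1 (ltW x0)) -powRD; last by rewrite (gt_eqF x0) /= ?implybT.
  by congr (_ `^ _); rewrite /q; ring.
apply: (@L1_eq _ RT R leb _ _ (fun r => r `^ (q - 1))).
- exact: measurable_itv.
- by move=> r; rewrite /= in_itv/= andbT => /rp/qE ->.
have cf : {within `[r1, +oo[, continuous (fun r : R => r `^ (q - 1))}.
  by apply: within_rightray => r /rp rp'; exact: (is_derive_continuous1 (dp (q - 1) _ rp')).
have mf : measurable_fun (`[r1, +oo[ : set R) (fun r : R => r `^ (q - 1)).
  by apply: subspace_continuous_measurable_fun.
have f0 r : `[r1, +oo[%classic r -> 0 <= r `^ (q - 1) by move=> _; exact: powR_ge0.
have [_ H] := L1_ge0P leb mf f0; apply: H => {mf}.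
pose F (r : R) : R := q^-1 * r `^ q.
have dF (r : R) : 0 < r -> is_derive r 1 F (r `^ (q - 1)).
  move=> rp'; apply: (is_derive_eq (is_deriveM1 (is_derive_cst (q^-1 : R) r 1) (dp q r rp'))).
  by rewrite /cst; field; rewrite lt_eqF.
have Fl : F x @[x --> +oo] --> (0 : R).
  rewrite /F -(mulr0 q^-1); apply: cvgM; first exact: cvg_cst.
  have cV : x^-1 @[x --> +oo] --> (0 : R)^'+.
    have c0 : x^-1 @[x --> +oo] --> (0 : R) by apply/gtr0_cvgV0; [exact: nbhs_pinfty_gt|exact: cvg_id].
    move=> A; rewrite /at_right => nA; have := c0 _ nA.
    have := nbhs_pinfty_gt (num_real (0 : R)); apply: filterS2 => x x0 /= h.
    by apply: h; rewrite invr_gt0.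
  have cN : a `^ (- q) @[a --> (0 : R)^'+] --> (0 : R) by apply: powR_cvg0; rewrite oppr_gt0.
  have := cvg_comp _ _ cV cN; apply: cvg_trans; apply: near_eq_cvg.
  have := nbhs_pinfty_gt (num_real (0 : R)); apply: filterS => x x0 /=.
  by rewrite -powR_inv1 ?ltW// -powRrM mulN1r opprK.
rewrite (@ge0_continuous_FTC2y _ _ F r1 0 (fun r _ => powR_ge0 _ _) cf Fl).
- by rewrite -EFinB ltry.
- by move=> x /ltW/rp/dF[].
- by apply: cvg_at_right_filter; exact: (is_derive_continuous1 (dF _ r10)).
- move=> x; rewrite in_itv/= andbT => /ltW/rp/dF[_].
  by rewrite derive1E.
Qed.

Lemma exists_polar (x : R * R) : exists r t, [/\ 0 <= r, r ^+ 2 = nsq x & x = (r * cos t, r * sin t)].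
Proof.
have [e0|e0] := eqVneq (enorm x) 0.
  exists 0, 0; rewrite !mul0r; split=> //.
    by rewrite -enormE e0.
  move: (enormE x); rewrite e0 expr0n/= => /esym/eqP; rewrite /nsq paddr_eq0 ?sqr_ge0// !sqrf_eq0 => /andP[/eqP h1 /eqP h2].
  by rewrite [LHS]surjective_pairing h1 h2.
have ep : 0 < enorm x by rewrite lt_neqAle eq_sym e0 enorm_ge0.
pose c := x.1 / enorm x; pose s := x.2 / enorm x.
have cs : c ^+ 2 + s ^+ 2 = 1.
  by rewrite /c /s !expr_div_n -mulrDl -/(nsq x) -enormE mulfV// expf_neq0.
have c1 : -1 <= c <= 1.
  rewrite -ler_norml -(expr_le1 (n := 2))// real_normK ?num_real// -cs lerDl; exact: sqr_ge0.
have cA : cos (acos c) = c by apply: acosK; rewrite in_itv.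
have sA : sin (acos c) ^+ 2 = s ^+ 2.
  have := cos2Dsin2 (acos c); rewrite cA -cs => /addrI ->//.
exists (enorm x).
have xE : x = (enorm x * c, enorm x * s).
  by rewrite [LHS]surjective_pairing /c /s; congr pair; field.
move/eqP: sA; rewrite eqf_sqr => /orP[/eqP sA|/eqP sA].
  by exists (acos c); rewrite enormE cA sA; split=> //; exact: ltW.
exists (- acos c); rewrite enormE cosN sinN cA sA opprK; split=> //; exact: ltW.
Qed.
End plane_calculus.

Section upper.
Context {R : realType}.
Local Open Scope complex_scope.
Local Notation leb := (@lebesgue_measure R).
Local Notation RT := (measurableTypeR R).
Local Notation leb2 := (@lebesgue_measure R \x @lebesgue_measure R)%E.
Local Notation RT2 := (RT * RT)%type.

Lemma continuous_A1 : continuous (@A1 R).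
Proof.
move=> x; rewrite /A1; apply: (@cvgM _ _ _ _ (fun x : R * R => - x.2) (fun=> 2^-1)); last exact: cvg_cst.
by apply: cvgN; exact: cvg_snd.
Qed.

Lemma continuous_A2 : continuous (@A2 R).
Proof.
move=> x; rewrite /A2; apply: (@cvgM _ _ _ _ (fun x : R * R => x.1) (fun=> 2^-1)); last exact: cvg_cst.
exact: cvg_fst.
Qed.

(** No boundary term arises: a test function vanishes outside [D], so each integral is one over the
    plane, where the derivative of a compactly supported product integrates to zero. *)
Lemma mag_grad_C1 b (D : set (R * R)) (U1 U2 d11 d12 d21 d22 : R * R -> R) :
  D12 U1 d11 d12 -> D12 U2 d21 d22 -> continuous U1 -> continuous U2 ->
  continuous d11 -> continuous d12 -> continuous d21 -> continuous d22 ->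
  mag_grad b D (fun x => U1 x +i* U2 x)
    (fun x => (d21 x - b * A1 x * U1 x) +i* (- d11 x - b * A1 x * U2 x))
    (fun x => (d22 x - b * A2 x * U1 x) +i* (- d12 x - b * A2 x * U2 x)).
Proof.
move=> D1 D2 c1 c2 c11 c12 c21 c22 phi /test_D12[[Dp cp cp1 cp2] [outD [N N0 outN]]].
have ZI (F : R * R -> R) : (forall x, ~ D x -> F x = 0) -> \int[leb2]_(x in D) F x = \int[leb2]_x F x.
  by move=> h; apply: Rint_supp => [x _ //|x _]; exact: h.
have CM (f g : R * R -> R) : continuous f -> continuous g -> continuous (fun x => f x * g x).
  by move=> cf cg x; apply: cvgM; [exact: cf|exact: cg].
have CD (f g : R * R -> R) : continuous f -> continuous g -> continuous (fun x => f x + g x).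
  by move=> cf cg x; apply: cvgD; [exact: cf|exact: cg].
have CN (f : R * R -> R) : continuous f -> continuous (fun x => - f x).
  by move=> cf x; apply: cvgN; exact: cf.
have cc (c : R) : continuous (fun _ : R * R => c) by move=> x; exact: cvg_cst.
have CB (f g : R * R -> R) : continuous f -> continuous g -> continuous (fun x => f x - g x).
  by move=> cf cg x; apply: cvgB; [exact: cf|exact: cg].
have IM (U e1 e2 : R * R -> R) : D12 U e1 e2 -> continuous U -> continuous e1 -> continuous e2 ->
    \int[leb2]_x (e1 x * phi x + U x * pd1 phi x) = 0 /\ \int[leb2]_x (e2 x * phi x + U x * pd2 phi x) = 0.
  move=> DU cU ce1 ce2; apply: (int_partial (D12_mul DU Dp) _ _ N0).
  - by apply: CD; exact: CM.
  - by apply: CD; exact: CM.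
  - by move=> x /outN[-> -> ->]; rewrite !mulr0 addr0.
have [i11 i12] := IM _ _ _ D1 c1 c11 c12; have [i21 i22] := IM _ _ _ D2 c2 c21 c22.
have eqI (f g z : R * R -> R) : continuous f -> continuous z -> (forall x, ~ box N x -> f x = 0 /\ z x = 0) ->
    (forall x, g x = f x + z x) -> \int[leb2]_x z x = 0 -> \int[leb2]_x f x = \int[leb2]_x g x.
  move=> cf cz fz E Z.
  have Lf : L1 leb2 setT f by apply: (L1_cbox cf N0) => x /fz[].
  have Lz : L1 leb2 setT z by apply: (L1_cbox cz N0) => x /fz[].
  have -> : g = (fun x => f x + z x) by apply/funext.
  by rewrite (@RintegralD _ RT2 R leb2 setT f z measurableT Lf Lz) Z addr0.
have cA := continuous_A1; have cA' := continuous_A2.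
have gen (A dphi U e V e' : R * R -> R) (s : R) : continuous A -> continuous dphi -> continuous U -> continuous e -> continuous V ->
  (forall x, ~ D x -> phi x = 0 /\ dphi x = 0) -> (forall x, ~ box N x -> phi x = 0 /\ dphi x = 0) ->
  \int[leb2]_x (e x * phi x + U x * dphi x) = 0 ->
  \int[leb2]_(x in D) (s * (U x * dphi x) - V x * (b * A x * phi x)) =
  \int[leb2]_(x in D) ((- s * e x - b * A x * V x) * phi x).
  move=> hA hd hU he hV oD oN I0.
  rewrite !ZI; [|by move=> x /oD[z1 z2]; rewrite ?z1 ?z2; ring|by move=> x /oD[z1 z2]; rewrite ?z1 ?z2; ring].
  apply: (eqI _ _ (fun x => - s * (e x * phi x + U x * dphi x))).
  - apply: CB; first by apply: (CM _ _) => //; exact: CM.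
    by apply: (CM _ _) => //; apply: (CM _ _) => //; exact: CM.
  - by apply: (CM _ _) => //; apply: CD; exact: CM.
  - by move=> x /oN[-> ->]; rewrite !mulr0 subr0 addr0 mulr0.
  - by move=> x; ring.
  have Lz : L1 leb2 setT (fun x => e x * phi x + U x * dphi x).
    apply: (@L1_cbox R _ N _ N0); first by apply: CD; exact: CM.
    by move=> x /oN[-> ->]; rewrite !mulr0 addr0.
  have -> : \int[leb2]_x (- s * (e x * phi x + U x * dphi x)) = - s * \int[leb2]_x (e x * phi x + U x * dphi x).
    by apply: RintegralZl; [exact: measurableT|exact: Lz].
  by rewrite I0 mulr0.
have o1 x : ~ D x -> phi x = 0 /\ pd1 phi x = 0 by move=> /outD[].
have o2 x : ~ D x -> phi x = 0 /\ pd2 phi x = 0 by move=> /outD[].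
have n1 x : ~ box N x -> phi x = 0 /\ pd1 phi x = 0 by move=> /outN[].
have n2 x : ~ box N x -> phi x = 0 /\ pd2 phi x = 0 by move=> /outN[].
have j1 := gen _ _ _ _ _ d11 (- 1) cA cp1 c2 c21 c1 o1 n1 i21.
have j2 := gen _ _ _ _ _ d11 1 cA cp1 c1 c11 c2 o1 n1 i11.
have j3 := gen _ _ _ _ _ d11 (- 1) cA' cp2 c2 c22 c1 o2 n2 i22.
have j4 := gen _ _ _ _ _ d11 1 cA' cp2 c1 c12 c2 o2 n2 i12.
have ext (f g : R * R -> R) : (forall x, f x = g x) -> \int[leb2]_(x in D) f x = \int[leb2]_(x in D) g x.
  by move=> h; apply: Rint_eq => x _.
split; congr (_ +i* _).
- rewrite [LHS](ext _ _ (fun x => Re_test _ _ _)) [RHS](ext _ _ (fun x => Re_mulC _ _)) /=.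
  rewrite [LHS](ext _ (fun x => - 1 * (U2 x * pd1 phi x) - U1 x * (b * A1 x * phi x))); last by move=> x; ring.
  by rewrite j1; apply: ext => x; ring.
- rewrite [LHS](ext _ _ (fun x => Im_test _ _ _)) [RHS](ext _ _ (fun x => Im_mulC _ _)) /=.
  rewrite [LHS](ext _ (fun x => 1 * (U1 x * pd1 phi x) - U2 x * (b * A1 x * phi x))); last by move=> x; ring.
  by rewrite j2; apply: ext => x; ring.
- rewrite [LHS](ext _ _ (fun x => Re_test _ _ _)) [RHS](ext _ _ (fun x => Re_mulC _ _)) /=.
  rewrite [LHS](ext _ (fun x => - 1 * (U2 x * pd2 phi x) - U1 x * (b * A2 x * phi x))); last by move=> x; ring.
  by rewrite j3; apply: ext => x; ring.
- rewrite [LHS](ext _ _ (fun x => Im_test _ _ _)) [RHS](ext _ _ (fun x => Im_mulC _ _)) /=.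
  rewrite [LHS](ext _ (fun x => 1 * (U1 x * pd2 phi x) - U2 x * (b * A2 x * phi x))); last by move=> x; ring.
  by rewrite j4; apply: ext => x; ring.
Qed.

Section trial.
Variables (m : nat) (a b r0 : R).
Hypotheses (a0 : 0 < a) (am : a <= m%:R + 1) (b0 : 0 < b) (r00 : 0 < r0).
Let r1 := r0 / 2.
Let r10 : 0 < r1. Proof. by rewrite divr_gt0. Qed.

(** The profile divided by r^m, as a function of s = r^2: the trial function is [amp] of |x|^2 times
    z^m. *)
Let amp (s : R) : R := expR (- (b * s / 4)) * kint m 0 a (b * s / 2).
Let amp' (s : R) : R := - (b / 4) * amp s - b / 2 * (expR (- (b * s / 4)) * kint m 1 a (b * s / 2)).

Let dexp (s : R) : is_derive s 1 (fun s => expR (- (b * s / 4))) (- (b / 4) * expR (- (b * s / 4))).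
Proof.
have -> : (fun s => expR (- (b * s / 4))) = (fun s : R => expR (- (b / 4) * s)).
  by apply/funext => t; congr expR; field.
apply: (is_derive_eq (is_derive_comp1 (is_deriveM1 (is_derive_cst (- (b / 4) : R) s 1) (is_derive_id s (1 : R))) (is_derive_expR _))).
rewrite /= /cst mulr1 mul0r add0r mulrC; congr (_ * expR _); by field.
Qed.

Let dk j (s : R) : 0 < s -> is_derive s 1 (fun s => kint m j a (b * s / 2)) (- (b / 2 * kint m j.+1 a (b * s / 2))).
Proof.
move=> s0; have z0 : 0 < b * s / 2 by rewrite divr_gt0// mulr_gt0.
have h1 := is_deriveM1 (is_deriveM1 (is_derive_cst (b : R) s 1) (is_derive_id s (1 : R))) (is_derive_cst (2^-1 : R) s 1).
have h := is_derive_comp1 h1 (is_derive_kint j a0 am z0).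
by apply: (is_derive_eq h); rewrite /= /cst; ring.
Qed.

Let damp (s : R) : 0 < s -> is_derive s 1 amp (amp' s).
Proof.
move=> s0; apply: (is_derive_eq (is_deriveM1 (dexp s) (dk 0 s0))).
by rewrite /amp' /amp /=; ring.
Qed.

Let camp' (s : R) : 0 < s -> {for s, continuous amp'}.
Proof.
move=> s0; have h1 := is_deriveM1 (is_derive_cst (- (b / 4) : R) s 1) (damp s0).
have h2 := is_deriveM1 (is_derive_cst (b / 2 : R) s 1) (is_deriveM1 (dexp s) (dk 1 s0)).
exact: (is_derive_continuous1 (is_deriveB1 h1 h2)).
Qed.

Let rad0_amp r : rad0 m a b r = r ^+ m * amp (r ^+ 2).
Proof. by rewrite /rad0 /amp mulrA. Qed.

Let radh_amp r : 0 < r -> 2 * r ^+ 2 * amp' (r ^+ 2) = amp (r ^+ 2) * (r * radh m a b r - m%:R).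
Proof.
move=> rp; have k0 := kint_gt0 0 a0 am (divr_gt0 (mulr_gt0 b0 (exprn_gt0 2 rp)) (ltr0n _ 2)).
by rewrite /amp' /amp /radh; field; rewrite !gt_eqF.
Qed.

(* The radial factor is singular at the origin, so it is extended across the
   disk of radius [r0 / 2] by [C1_extend], which makes the trial field [C^1] on
   the whole plane. *)
Lemma trial_fields : exists u v1 v2 : R * R -> R[i],
  [/\ forall D, mag_grad b D u v1 v2,
    measurable_fun (setT : set RT2) (fun x => complex.Re (u x)) /\ measurable_fun (setT : set RT2) (fun x => complex.Im (u x)),
    measurable_fun (setT : set RT2) (fun x => complex.Re (v1 x)) /\ measurable_fun (setT : set RT2) (fun x => complex.Im (v1 x)),
    measurable_fun (setT : set RT2) (fun x => complex.Re (v2 x)) /\ measurable_fun (setT : set RT2) (fun x => complex.Im (v2 x)) &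
    forall x, r1 <= enorm x -> normsq (u x) = rad0 m a b (enorm x) ^+ 2 /\
      normsq (v1 x) + normsq (v2 x) = rad0 m a b (enorm x) ^+ 2 * (radh m a b (enorm x) ^+ 2 + pot m b (enorm x))].
Proof.
have s00 : 0 < r1 ^+ 2 by rewrite exprn_gt0.
have [F [G [dF cG FE GE]]] := @C1_extend R amp amp' (r1 ^+ 2) (fun s h => damp (lt_le_trans s00 h)) (fun s h => camp' (lt_le_trans s00 h)).
have cF : continuous F by move=> s; exact: (is_derive_continuous1 (dF s)).
have [DC DS] := D12_hcs (R := R) m.
have [SC SS] := C2_hcs (R := R) m.
have [SC1 SS1] := C2_hcs (R := R) m.-1.
have cC := C2_cont SC; have cS := C2_cont SS; have cC1 := C2_cont SC1; have cS1 := C2_cont SS1.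
have D1 := D12_mul (D12_rad dF) DC; have D2 := D12_mul (D12_rad dF) DS.
have CM (f g : R * R -> R) : continuous f -> continuous g -> continuous (fun x => f x * g x).
  by move=> cf cg x; apply: cvgM; [exact: cf|exact: cg].
have CD (f g : R * R -> R) : continuous f -> continuous g -> continuous (fun x => f x + g x).
  by move=> cf cg x; apply: cvgD; [exact: cf|exact: cg].
have cc (c : R) : continuous (fun _ : R * R => c) by move=> x; exact: cvg_cst.
have Cn (f : R -> R) : continuous f -> continuous (fun x : R * R => f (nsq x)).
  by move=> cf x; apply: (@continuous_comp _ _ _ (@nsq R) f); [exact: continuous_nsq|exact: cf].
have cx1 : continuous (fun x : R * R => x.1) by move=> x; exact: cvg_fst.
have cx2 : continuous (fun x : R * R => x.2) by move=> x; exact: cvg_snd.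
have cU1 := CM _ _ (Cn _ cF) cC; have cU2 := CM _ _ (Cn _ cF) cS.
have cr1 : continuous (fun x : R * R => 2 * x.1 * G (nsq x)) by apply: (CM _ _); [exact: CM|exact: Cn].
have cr2 : continuous (fun x : R * R => 2 * x.2 * G (nsq x)) by apply: (CM _ _); [exact: CM|exact: Cn].
have cd11 := CD _ _ (CM _ _ cr1 cC) (CM _ _ (Cn _ cF) (CM _ _ (cc m%:R) cC1)).
have cd12 := CD _ _ (CM _ _ cr2 cC) (CM _ _ (Cn _ cF) (CM _ _ (cc (- m%:R)) cS1)).
have cd21 := CD _ _ (CM _ _ cr1 cS) (CM _ _ (Cn _ cF) (CM _ _ (cc m%:R) cS1)).
have cd22 := CD _ _ (CM _ _ cr2 cS) (CM _ _ (Cn _ cF) (CM _ _ (cc m%:R) cC1)).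
have MG := fun D => mag_grad_C1 b (D := D) D1 D2 cU1 cU2 cd11 cd12 cd21 cd22.
have mc (f : R * R -> R) : continuous f -> measurable_fun (setT : set RT2) f by move=> cf; exact: continuous_measurable_fun2.
have cA := @continuous_A1; have cA' := @continuous_A2.
have CB (f g : R * R -> R) : continuous f -> continuous g -> continuous (fun x => f x - g x).
  by move=> cf cg x; apply: cvgB; [exact: cf|exact: cg].
have CN (f : R * R -> R) : continuous f -> continuous (fun x => - f x).
  by move=> cf x; apply: cvgN; exact: cf.
have cbA1 := CM _ _ (cc b) cA; have cbA2 := CM _ _ (cc b) cA'.
do 3 eexists; split; first exact: MG.
- by split; apply: mc; [exact: cU1|exact: cU2].
- split; apply: mc; [exact: (CB _ _ cd21 (CM _ _ cbA1 cU1))|exact: (CB _ _ (CN _ cd11) (CM _ _ cbA1 cU2))].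
- split; apply: mc; [exact: (CB _ _ cd22 (CM _ _ cbA2 cU1))|exact: (CB _ _ (CN _ cd12) (CM _ _ cbA2 cU2))].
move=> x xr; have ep : 0 < enorm x by exact: lt_le_trans xr.
have nr : r1 ^+ 2 <= nsq x by rewrite -enormE lerXn2r// nnegrE ltW.
rewrite /normsq /= (FE _ nr) (GE _ nr).
have H := radh_amp ep; move: H; rewrite enormE => H.
have hcs2 k : hc k x ^+ 2 + hs k x ^+ 2 = nsq x ^+ k.
  elim: k => [|k IH]; first by rewrite /hc /hs /= expr1n expr0n addr0.
  by have [-> ->] := hcs_rec k x; rewrite [nsq x ^+ k.+1]exprS -IH /nsq; ring.
have E2 : rad0 m a b (enorm x) ^+ 2 = nsq x ^+ m * amp (nsq x) ^+ 2.
  by rewrite rad0_amp exprMn -exprM mulnC exprM enormE.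
split; first by rewrite E2 -hcs2; ring.
rewrite E2 /A1 /A2.
set f := amp (nsq x) in H *; set g := amp' (nsq x) in H *; set h := radh m a b (enorm x) in H *.
have [e1 e2] := hcs_euler m x; have [e3 e4] := hcs_rot m x.
move: e1 e2 e3 e4 (hcs2 m) (hcs2 m.-1).
set p := hc m.-1 x; set q := hs m.-1 x; set P := hc m x; set Q := hs m x; set k : R := m%:R => e1 e2 e3 e4 q1 q2.
(* The factor k^2 covers m = 0, where the truncated predecessor would break |z^(m-1)|^2 |z|^2 =
   |z^m|^2. *)
have q3 : k ^+ 2 * (p ^+ 2 + q ^+ 2) * nsq x = k ^+ 2 * nsq x ^+ m.
  rewrite q2 /k; case: (m) => [|j]; first by rewrite expr0n /= !mul0r.
  by rewrite /= [nsq x ^+ j.+1]exprS; ring.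
pose n := nsq x; have n0 : n != 0 by rewrite gt_eqF// (lt_le_trans _ nr).
have E : enorm x ^+ 2 = n by rewrite enormE.
(* The energy density is grouped so that Euler's relation and the angular derivative of z^m evaluate
   the mixed terms. *)
transitivity (4 * g ^+ 2 * n * (P ^+ 2 + Q ^+ 2)
  + 4 * g * f * (P * (x.1 * (k * p) + x.2 * (- k * q)) + Q * (x.1 * (k * q) + x.2 * (k * p)))
  + 2 * f ^+ 2 * (k ^+ 2 * (p ^+ 2 + q ^+ 2))
  + b ^+ 2 / 4 * n * (f ^+ 2 * (P ^+ 2 + Q ^+ 2))
  + b * f ^+ 2 * (Q * (- x.2 * (k * p) + x.1 * (- k * q)) - P * (- x.2 * (k * q) + x.1 * (k * p)))).
  by rewrite /n /nsq; field.
have q4 : k ^+ 2 * (p ^+ 2 + q ^+ 2) = k ^+ 2 * n ^+ m / n by apply: (mulIf n0); rewrite q3 mulfVK.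
rewrite e1 e2 e3 e4 q4.
have -> : P * (k * P) + Q * (k * Q) = k * (P ^+ 2 + Q ^+ 2) by ring.
have -> : Q * (- k * Q) - P * (k * P) = - k * (P ^+ 2 + Q ^+ 2) by ring.
rewrite q1 -/n.
(* The derivative in s is traded for the logarithmic derivative in r by [radh_amp]. *)
have G1 : g = f * (enorm x * h - k) / (2 * n).
  have e5 : n * g = f * (enorm x * h - k) / 2 by move: H; rewrite -/n -/k; lra.
  by apply: (mulfI n0); rewrite e5; field.
rewrite G1 /pot -E; field; exact: lt0r_neq0.
Qed.
End trial.
End upper.

(** * Comparison of the domains *)

Section final.
Context {R : realType}.
Local Notation leb := (@lebesgue_measure R).
Local Notation RT := (measurableTypeR R).
Local Notation leb2 := (@lebesgue_measure R \x @lebesgue_measure R)%E.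
Local Notation RT2 := (RT * RT)%type.

Lemma enorm_gtE (x : R * R) r : 0 < r -> (r ^+ 2 < nsq x) = (r < enorm x).
Proof. by move=> r0; rewrite -enormE ltr_pXn2r// nnegrE ?enorm_ge0// ltW. Qed.

Lemma L2_intro (D : set (R * R)) (u : R * R -> R[i]) (g : R * R -> R) : measurable (D : set RT2) ->
  measurable_fun (setT : set RT2) (fun x => complex.Re (u x)) -> measurable_fun (setT : set RT2) (fun x => complex.Im (u x)) ->
  L1 leb2 D g -> (forall x, D x -> normsq (u x) <= g x) -> L2 D u.
Proof.
move=> mD mr mi Lg ug.
have mr' := measurable_funS measurableT (@subsetT _ D) mr.
have mi' := measurable_funS measurableT (@subsetT _ D) mi.
have mn : measurable_fun (D : set RT2) (fun x => normsq (u x)) by apply: measurable_funD; exact: measurable_funX.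
split=> //.
have LN : L1 leb2 D (fun x => normsq (u x)).
  apply: (@L1_le _ RT2 R leb2 D mD _ _ mn _ Lg) => x Dx.
  by rewrite ger0_norm ?normsq_ge0//; exact: ug.
have [h _] := L1_ge0P leb2 mn (fun x _ => normsq_ge0 (u x)).
exact: h.
Qed.

Section bound.
Variables (m : nat) (a b r0 e p d : R) (D : set (R * R)).
Hypotheses (a0 : 0 < a) (am : a <= m%:R + 1) (b0 : 0 < b) (r00 : 0 < r0) (h0 : radh m a b r0 = 0).
Hypothesis p2 : 2 < p.
Hypothesis bath : forall y, 0 < y -> `|y - r0| < d ->
  (y <= r0 -> excess m a b y <= excess m a b r0 * r0 `^ p * y `^ (- p)) /\
  (r0 <= y -> excess m a b r0 * r0 `^ p * y `^ (- p) <= excess m a b y).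
Hypotheses (e0 : 0 < e) (er : e <= r0 / 2) (ed : e < d).
Hypothesis oD : open D.
Hypothesis Dlo : forall x, D x -> r0 - e <= enorm x.
Hypothesis Dhi : forall x, r0 + e < enorm x -> D x.
Hypothesis momE : moment p D = moment p (exterior (disk r0)).

Let r1 := r0 / 2.
Let r10 : 0 < r1. Proof. by rewrite divr_gt0. Qed.
Let mD : measurable (D : set RT2). Proof. exact: open_measurable2. Qed.
Let B : set (R * R) := exterior (disk r0).
Let mB : measurable (B : set RT2). Proof. by apply: open_measurable2; exact: open_exterior. Qed.
Let BE x : B x <-> r0 < enorm x.
Proof. by rewrite /B exterior_disk//= enorm_gtE. Qed.
Let Dr x : D x -> r1 <= enorm x.
Proof. by move=> /Dlo; move: er; rewrite /r1; lra. Qed.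

Let S : set R := `[r1, +oo[%classic.
Let mS : measurable (S : set RT). Proof. exact: measurable_itv. Qed.
Let S0 : S `<=` `]0, +oo[%classic.
Proof. by move=> r; rewrite /S /= !in_itv/= !andbT; exact: lt_le_trans. Qed.
Let Spos r : S r -> 0 < r.
Proof. by move=> /S0; rewrite /= in_itv/= andbT. Qed.
Let DS x : D x -> S (enorm x).
Proof. by move=> /Dr h; rewrite /S /= in_itv/= h. Qed.
Let BS x : B x -> S (enorm x).
Proof. by move=> /BE h; rewrite /S /= in_itv/= andbT /r1; move: h r00; lra. Qed.

Let meas_cont (q : R -> R) : (forall r, 0 < r -> {for r, continuous q}) -> measurable_fun (S : set RT) q.
Proof.
move=> cq; apply: subspace_continuous_measurable_fun => //; apply: continuous_in_subspaceT => x.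
by rewrite inE => /Spos; exact: cq.
Qed.

Let q1 r : R := rad0 m a b r ^+ 2.
Let q2 r : R := rad0 m a b r ^+ 2 * (radh m a b r ^+ 2 + pot m b r).
Let w r : R := r `^ (- p).

Let cq1 r : 0 < r -> {for r, continuous q1}.
Proof. by move=> rp; exact: (is_derive_continuous1 (is_deriveX1 2 (is_derive_rad0 a0 am b0 rp))). Qed.

Let cex r : 0 < r -> {for r, continuous (excess m a b)}.
Proof. exact: continuous_excess. Qed.

Let q2E : q2 = (fun r => excess m a b r + b * (1 - 2 * a) * q1 r).
Proof. by apply/funext => r; rewrite /q2 /q1 /excess; ring. Qed.

Let cq2 r : 0 < r -> {for r, continuous q2}.
Proof.
move=> rp; rewrite q2E; apply: (@cvgD _ _ _ _ _ (excess m a b) (fun r => b * (1 - 2 * a) * q1 r)); first exact: cex.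
by apply: (@cvgM _ _ _ _ (fun=> b * (1 - 2 * a)) q1); [exact: cvg_cst|exact: cq1].
Qed.

Let cw r : 0 < r -> {for r, continuous w}.
Proof. by move=> rp; exact: (is_derive_continuous1 (is_derive1_powR (- p) rp)). Qed.

Let L_decay (q : R -> R) : (forall r, 0 < r -> {for r, continuous q}) -> (forall r, 0 < r -> 0 <= q r) ->
  (forall r, 0 < r -> q r <= rad0 m a b r ^+ 2 * (1 + r ^+ 2 + radh m a b r ^+ 2 + pot m b r)) -> L1 leb S (fun r => r * q r).
Proof.
move=> cq q0 qle; have [K K0 HK] := excess_decay a0 am b0 r10.
have mrq : measurable_fun (S : set RT) (fun r => r * q r).
  by apply: measurable_funM; [exact: measurable_id|exact: meas_cont].
apply: (@L1_le _ RT R leb S mS _ _ mrq _ (L1_inv_exp3 K r10)) => r Sr.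
have rp := Spos Sr; rewrite ger0_norm; last by rewrite mulr_ge0 ?q0// ltW.
rewrite ler_pdivlMr ?exprn_gt0//.
have -> : r * q r * r ^+ 3 = q r * r ^+ 4 by ring.
apply: le_trans (HK r _); last by move: Sr; rewrite /S /= in_itv/= andbT.
by apply: ler_wpM2r; [rewrite exprn_ge0// ltW|exact: qle].
Qed.

Let Lq1 : L1 leb S (fun r => r * q1 r).
Proof.
apply: (L_decay cq1) => r rp; first exact: sqr_ge0.
rewrite /q1 ler_peMr ?sqr_ge0// -!addrA lerDl !addr_ge0 ?sqr_ge0//.
Qed.

Let Lq2 : L1 leb S (fun r => r * q2 r).
Proof.
apply: (L_decay cq2) => r rp; first by rewrite mulr_ge0 ?addr_ge0 ?sqr_ge0.
rewrite /q2 ler_wpM2l ?sqr_ge0// -[leRHS]addrA lerDr addr_ge0 ?sqr_ge0//.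
Qed.

Let Lw : L1 leb S (fun r => r * w r). Proof. exact: L1_powR. Qed.
Let Lex : L1 leb S (fun r => r * excess m a b r). Proof. exact: L1_excess. Qed.

Let radx_on (q : R -> R) (E : set (R * R)) : measurable (E : set RT2) -> (forall x, E x -> S (enorm x)) ->
  (forall r, 0 < r -> {for r, continuous q}) -> L1 leb S (fun r => r * q r) -> L1 leb2 E (fun x => q (enorm x)).
Proof.
move=> mE ES cq Lq; have [L _] := radx_int mS S0 (meas_cont cq) Lq.
have LE := @L1S _ RT2 R leb2 setT E _ measurableT mE (@subsetT _ _) L.
by apply: (@L1_eq _ RT2 R leb2 E mE _ _ _ LE) => x /ES h; rewrite radx_in.
Qed.

Let moment_fin (E : set (R * R)) : measurable (E : set RT2) -> (forall x, E x -> S (enorm x)) ->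
  moment p E = (\int[leb2]_(x in E) w (enorm x))%:E.
Proof.
by move=> mE ES; rewrite EFin_Rint//; exact: radx_on.
Qed.

Let excess_B : \int[leb2]_(x in B) excess m a b (enorm x) = 0.
Proof.
pose S' : set R := `]r0, +oo[%classic.
have mS' : measurable (S' : set RT) by exact: measurable_itv.
have S'S : S' `<=` S.
  by move=> r; rewrite /S' /S /= !in_itv/= !andbT /r1; move: r00; lra.
have S'0 : S' `<=` `]0, +oo[%classic by move=> r /S'S/S0.
have mq : measurable_fun (S' : set RT) (excess m a b) by apply: (measurable_funS mS S'S); exact: meas_cont.
have Lq := @L1S _ RT R leb _ _ _ mS mS' S'S Lex.
have [_ E] := radx_int mS' S'0 mq Lq.
transitivity (\int[leb2]_x radx S' (excess m a b) x).
  rewrite [LHS]Rintegral_mkcond; congr (Rintegral _ _ _); apply/funext => x; rewrite patchE.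
  have [xB|xB] := boolP (x \in B).
    by rewrite radx_in// /S' /= in_itv/= andbT; apply/BE; exact: set_mem.
  rewrite radx_out// /S' /= in_itv/= andbT => /BE/mem_set h; by rewrite h in xB.
rewrite E /S' Rintegral_itv_obnd_cbnd//.
by rewrite (integral_excess a0 am b0 r00 h0) mulr0.
Qed.

(* Bathtub argument: [excess - kap r^-p] changes sign from minus to plus at
   [r0], and [r^-p] has the same integral over both domains. *)
Let excess_D : \int[leb2]_(x in D) excess m a b (enorm x) <= 0.
Proof.
pose kap := excess m a b r0 * r0 `^ p.
have LD := radx_on mD DS cex Lex; have LB := radx_on mB BS cex Lex.
have WD := radx_on mD DS cw Lw; have WB := radx_on mB BS cw Lw.
have KD := @L1Z _ RT2 R leb2 D mD kap _ WD; have KB := @L1Z _ RT2 R leb2 B mB kap _ WB.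
have ZD := @L1B _ RT2 R leb2 D mD _ _ LD KD; have ZB := @L1B _ RT2 R leb2 B mB _ _ LB KB.
pose z x := excess m a b (enorm x) - kap * w (enorm x).
have split_z (E : set (R * R)) : measurable (E : set RT2) -> L1 leb2 E (fun x => excess m a b (enorm x)) ->
    L1 leb2 E (fun x => w (enorm x)) -> \int[leb2]_(x in E) z x =
    \int[leb2]_(x in E) excess m a b (enorm x) - kap * \int[leb2]_(x in E) w (enorm x).
  move=> mE h1 h2; have h3 := @L1Z _ RT2 R leb2 E mE kap _ h2.
  rewrite (@RintegralB _ RT2 R leb2 E _ _ mE h1 h3); congr (_ - _).
  by apply: RintegralZl; [exact: mE|exact: h2].
have mom : \int[leb2]_(x in D) w (enorm x) = \int[leb2]_(x in B) w (enorm x).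
  by have := momE; rewrite (moment_fin mD DS) (moment_fin mB BS) => -[].
have zle : \int[leb2]_(x in D) z x <= \int[leb2]_(x in B) z x.
  rewrite [leLHS]Rintegral_mkcond [leRHS]Rintegral_mkcond.
  have Lr (E : set (R * R)) : measurable (E : set RT2) -> L1 leb2 E z -> L1 leb2 setT (z \_ E).
    move=> mE h; rewrite /L1 -restrict_EFin.
    by apply/integrable_restrict => //; rewrite setTI.
  apply: le_Rintegral; [exact: measurableT|exact: Lr|exact: Lr|].
  move=> x _; rewrite !patchE.
  have [xD|xD] := boolP (x \in D); have [xB|xB] := boolP (x \in B) => //.
  - have Dx := set_mem xD; have ex : enorm x <= r0.
      by rewrite leNgt; apply/negP => /BE/mem_set h; rewrite h in xB.
    have ep : 0 < enorm x by exact: Spos (DS Dx).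
    have near_r : `|enorm x - r0| < d.
      by rewrite ler0_norm ?subr_le0// opprB (le_lt_trans _ ed)// lerBlDl -lerBlDr; exact: Dlo.
    by have [h _] := bath ep near_r; rewrite /z subr_le0; exact: h.
  - have xr := (BE x).1 (set_mem xB).
    have ex : enorm x <= r0 + e.
      by rewrite leNgt; apply/negP => /Dhi/mem_set h; rewrite h in xD.
    have ep : 0 < enorm x by exact: lt_trans xr.
    have near_r : `|enorm x - r0| < d.
      by rewrite gtr0_norm ?subr_gt0// ltrBlDl (le_lt_trans ex)// ltrD2l.
    by have [_ h] := bath ep near_r; rewrite /z subr_ge0; apply: h; exact: ltW.
move: zle; rewrite (split_z _ mD LD WD) (split_z _ mB LB WB) mom excess_B; lra.
Qed.

(** The square with sides [2 r0, 3 r0] and [0, r0] lies beyond radius r0 + e, hence in [D], and has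
    area r0^2. Without a set of positive measure the trial function would be null. *)
Let nonneg : ~ leb2.-negligible D.
Proof.
move=> [N [mN N0 DN]].
pose I1 : set RT := `[2 * r0, 3 * r0]%classic; pose I2 : set RT := `[0, r0]%classic.
have mI1 : measurable I1 by exact: measurable_itv.
have mI2 : measurable I2 by exact: measurable_itv.
have sub : I1 `*` I2 `<=` N.
  move=> x [] ; rewrite /I1 /I2 /= !in_itv/= => /andP[h1 _] _; apply: DN; apply: Dhi.
  rewrite -enorm_gtE; last by rewrite addr_gt0.
  apply: (@lt_le_trans _ _ ((2 * r0) ^+ 2)).
    by rewrite ltr_pXn2r// ?nnegrE; move: r00 er e0; lra.
  apply: (@le_trans _ _ (x.1 ^+ 2)); last by rewrite lerDl sqr_ge0.
  by rewrite lerXn2r// nnegrE; move: r00 h1; lra.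
have m12 : measurable (I1 `*` I2 : set RT2) by exact: measurableX.
have le0 : (leb2 (I1 `*` I2) <= 0)%E.
  by rewrite -N0; apply: le_measure; [exact: mem_set|exact: mem_set|exact: sub].
have eM : leb2 (I1 `*` I2) = (leb I1 * leb I2)%E by exact: (product_measure1E leb leb mI1 mI2).
have l1 : leb I1 = r0%:E.
  rewrite /I1 lebesgue_measure_itv /= lte_fin ifT; last by move: r00; lra.
  by rewrite -EFinB; congr (_%:E); ring.
have l2 : leb I2 = r0%:E.
  by rewrite /I2 lebesgue_measure_itv /= lte_fin r00 -EFinB subr0.
have gt0 : (0 < leb2 (I1 `*` I2))%E.
  suff : (0 < leb I1 * leb I2)%E by rewrite -eM; exact.
  by rewrite l1 l2 -EFinM lte_fin mulr_gt0.
by move: (lt_le_trans gt0 le0); rewrite ltxx.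
Qed.

Lemma lambda1_upper : (lambda1 b D <= (b * (1 - 2 * a))%:E)%E.
Proof.
have [u [v1 [v2 [MG [mu1 mu2] [m11 m12] [m21 m22] H]]]] := trial_fields a0 am b0 r00.
have Hu x : D x -> normsq (u x) = q1 (enorm x) by move=> /Dr/H[].
have Hv x : D x -> normsq (v1 x) + normsq (v2 x) = q2 (enorm x) by move=> /Dr/H[].
have L1D := radx_on mD DS cq1 Lq1; have L2D := radx_on mD DS cq2 Lq2.
have Lu : L2 D u by apply: (L2_intro mD mu1 mu2 L1D) => x /Hu ->.
have Lv1 : L2 D v1.
  by apply: (L2_intro mD m11 m12 L2D) => x /Hv <-; rewrite lerDl; exact: normsq_ge0.
have Lv2 : L2 D v2.
  by apply: (L2_intro mD m21 m22 L2D) => x /Hv <-; rewrite lerDr; exact: normsq_ge0.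
have nz : nonzero_on D u.
  move=> [N [mN N0 NS]]; apply: nonneg; exists N; split=> // x Dx; apply: NS => /= h.
  have := Hu x Dx; rewrite (h Dx) /normsq /= expr0n /= addr0 => /esym/eqP.
  by rewrite sqrf_eq0 gt_eqF// rad0_gt0//; exact: Spos (DS Dx).
have N0 := integral_normsq_gt0 mD Lu nz.
apply: (@le_trans _ _ (((\int[leb2]_(x in D) (normsq (v1 x) + normsq (v2 x))) / (\int[leb2]_(x in D) normsq (u x)))%:E)).
  by apply: ereal_inf_lbound; exists u, v1, v2.
rewrite lee_fin ler_pdivrMr//.
have EX := radx_on mD DS cex Lex.
have -> : \int[leb2]_(x in D) (normsq (v1 x) + normsq (v2 x)) =
  \int[leb2]_(x in D) excess m a b (enorm x) + b * (1 - 2 * a) * \int[leb2]_(x in D) normsq (u x).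
  have Z : L1 leb2 D (fun x => b * (1 - 2 * a) * q1 (enorm x)) by exact: (@L1Z _ RT2 R leb2 D mD).
  transitivity (\int[leb2]_(x in D) (excess m a b (enorm x) + b * (1 - 2 * a) * q1 (enorm x))).
    by apply: Rint_eq => x Dx; rewrite Hv// q2E.
  rewrite (@RintegralD _ RT2 R leb2 D _ _ mD EX Z); congr (_ + _).
  transitivity (b * (1 - 2 * a) * \int[leb2]_(x in D) q1 (enorm x)).
    by apply: RintegralZl; [exact: mD|exact: L1D].
  by congr (_ * _); apply: Rint_eq => x Dx; rewrite Hu.
by rewrite gerDr; exact: excess_D.
Qed.
End bound.

Lemma polar_region_lo (rho : R -> R) c : 0 < c -> (forall t, c <= rho t) -> disk c `<=` polar_region rho.
Proof.
move=> c0 h x; rewrite /disk /= => xc; have [r [t [rp r2 xE]]] := exists_polar x.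
exists r, t; split=> //; apply: lt_le_trans (h t).
by move: xc; rewrite enorm_lt// -r2 ltr_pXn2r// nnegrE// ltW.
Qed.

Lemma polar_region_hi (rho : R -> R) c : 0 < c -> (forall t, rho t <= c) ->
  closure (polar_region rho) `<=` [set x | nsq x <= c ^+ 2].
Proof.
move=> c0 h; apply: closure_min; first exact: closed_nsq_le.
move=> _ [r [t [rp rt ->]]] /=; have := nsq_polar r t; rewrite /polar /= => ->.
by rewrite lerXn2r ?nnegrE// ?ltW// (lt_le_trans rt).
Qed.
End final.

Theorem theorem1p5 (R : realType) (rad b p : R)
  (rad_gt0 : 0 < rad)
  (b_range : 0 < b * rad ^+ 2 < 4 - 2 * Num.sqrt 3)
  (p_gt : pstar (b * rad ^+ 2) < p) :
  exists2 rstar : R, 0 < rstar < rad &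
    forall (Omega : set (R * R)) (rho : R -> R),
      domain Omega ->
      bounded_set Omega ->
      smooth_boundary Omega ->
      star_shaped0 Omega ->
      smooth1 rho ->
      (forall t, rho (t + 2 * pi) = rho t) ->
      (forall t, 0 < rho t) ->
      Omega = polar_region rho ->
      moment p (exterior Omega) = moment p (exterior (disk rad)) ->
      (forall t, rad - rstar <= rho t <= rad + rstar) ->
      (lambda1 b (exterior Omega) <= lambda1 b (exterior (disk rad)))%E.
Proof.
move: b_range => /andP[B0 B4].
have r2 : 0 < rad ^+ 2 by exact: exprn_gt0.
have b0 : 0 < b by rewrite -(pmulr_lgt0 b r2).
have s0 : 0 <= Num.sqrt 3 :> R by exact: sqrtr_ge0.
have s2 : Num.sqrt 3 ^+ 2 = 3 :> R by rewrite sqr_sqrtr.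
have s1 : 3 / 2 < Num.sqrt 3 :> R.
  by rewrite ltNge; apply/negP => h; move: s2 h s0; set s := Num.sqrt 3; nra.
have B1 : b * rad ^+ 2 < 1 by move: B4 s1; lra.
(* The number 4 - 2 sqrt 3 is the smaller root of 4 - 8 B + B^2. *)
have Bq : 0 < 4 - 8 * (b * rad ^+ 2) + (b * rad ^+ 2) ^+ 2.
  by move: B4 s2 s0 s1; set s := Num.sqrt 3; set B := b * rad ^+ 2; nra.
have [m [a [m0 a0 am h0 sup]]] := spectral_gap b0 rad_gt0 (lt_trans B1 (ltr1n R 2)).
have M1 : 1 <= m%:R :> R by rewrite ler1n.
(* The gap 2 a b rad^2 is positive because a > 0: the ground state energy lies strictly below the
   Landau level [b]. *)
have lamB : b * (1 - 2 * a) * rad ^+ 2 < b * rad ^+ 2.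
  by have := mulr_gt0 a0 B0; lra.
have [p2 slope] := pstar_slope B0 B1 Bq p_gt M1 lamB.
have [d d0 bath] := bathtub_sign a0 am b0 rad_gt0 h0 slope.
(* Half of [d] stays strictly within the range of the sign change, and half of [rad] keeps the
   domain away from the origin, beyond radius rad/2, where the trial fields have the prescribed
   profile. Both are fixed before [Omega] is introduced. *)
exists (Num.min (d / 2) (rad / 2)).
  by rewrite lt_min !divr_gt0//= gt_min; apply/orP; right; move: rad_gt0; lra.
set e := Num.min _ _ => Omega rho _ _ _ _ _ _ _ OE mom hrho.
have e0 : 0 < e by rewrite lt_min !divr_gt0.
have er : e <= rad / 2 by rewrite ge_min lexx orbT.
have ed : e < d by rewrite gt_min; apply/orP; left; move: d0; lra.
have lo0 : 0 < rad - e by move: er rad_gt0; lra.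
have hi0 : 0 < rad + e by rewrite addr_gt0.
apply: le_trans (lambda1_lower rad_gt0 b0 sup).
apply: (lambda1_upper a0 am b0 rad_gt0 h0 p2 bath e0 er ed) => //.
- exact: open_exterior.
- move=> x xD; rewrite leNgt; apply/negP => xl; apply: xD; apply: subset_closure.
  rewrite OE; apply: (polar_region_lo lo0) => // t.
  by have /andP[] := hrho t.
- move=> x xh; rewrite /exterior /= OE => xc.
  have hr t : rho t <= rad + e by have /andP[] := hrho t.
  have := polar_region_hi hi0 hr xc.
  by rewrite /= leNgt enorm_gtE// xh.
Qed.
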